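(* Let $a<b$, $\alpha\in(\frac12,1)$, $\sigma>0$, let $L:\mathbb{R}\times\mathbb{R}\times[a,b]\to\mathbb{R}$, $(x,y,t)\mapsto L(x,y,t)$, be of class $C^1$, let $S'\subseteq\mathbb{R}$ be open, let $X'\subseteq[a,b]$ be open, and let $\xi$ be a one-parameter group of diffeomorphisms of $S'$. Suppose that the functional $\mathcal{J}$ is invariant under the action of $\xi$. For $u\in C^2([a,b],S')$ write $[u]_t=\big(u(t),{}^{C}\mathbb{D}_{a^+}^{\alpha,\sigma}u(t),t\big)$. Then for every weak extremal $u\in C^2([a,b],S')$ of $\mathcal{J}$ the quantity $C[u]_t$ defined for $t\in X'$ by $$C[u]_t=\frac{\partial L}{\partial y}[u]_t\;\mathbb{I}_{a^+}^{1-\alpha,\sigma}\frac{\partial\xi}{\partial s}(0,u(t),t)+\frac{\partial\xi}{\partial s}(0,u(t),t)\;\mathbb{I}_{b^-}^{1-\alpha,\sigma}\frac{\partial L}{\partial y}[u]_t$$ satisfies $$C[u]_t=\lim_{t\to b^-}\left(\frac{\partial L}{\partial y}[u]_t\;\mathbb{I}_{a^+}^{1-\alpha,\sigma}\frac{\partial\xi}{\partial s}(0,u(t),t)\right)-\lim_{t\to a^+}\left(\frac{\partial\xi}{\partial s}(0,u(t),t)\;\mathbb{I}_{b^-}^{1-\alpha,\sigma}\frac{\partial L}{\partial y}[u]_t\right)$$ and is a constant of motion on $X'$ and $S'$, i.e. $\frac{d}{dt}C[u]_t=0$ for all $t\in X'$ along all weak extremals $u\in C^2([a,b],S')$.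
   Context: Tempered operators ($\beta\in(0,1)$): $\mathbb{I}_{a^+}^{\beta,\sigma}w(t)=\frac1{\Gamma(\beta)}\int_a^t(t-\theta)^{\beta-1}e^{-\sigma(t-\theta)}w(\theta)\,d\theta$, $\mathbb{I}_{b^-}^{\beta,\sigma}w(t)=\frac1{\Gamma(\beta)}\int_t^b(\theta-t)^{\beta-1}e^{-\sigma(\theta-t)}w(\theta)\,d\theta$, ${}^{C}\mathbb{D}_{a^+}^{\alpha,\sigma}w(t)=\frac{e^{-\sigma t}}{\Gamma(1-\alpha)}\int_a^t(t-\theta)^{-\alpha}[e^{\sigma\theta}w(\theta)]'\,d\theta$. In expressions such as $\mathbb{I}_{a^+}^{1-\alpha,\sigma}\frac{\partial\xi}{\partial s}(0,u(t),t)$ the operator is applied to the function $t\mapsto\frac{\partial\xi}{\partial s}(0,u(t),t)$ and evaluated at $t$; likewise $\mathbb{I}_{b^-}^{1-\alpha,\sigma}\frac{\partial L}{\partial y}[u]_t$ is the operator applied to $t\mapsto\frac{\partial L}{\partial y}[u]_t$. Functional: $\mathcal{J}(u)=\int_a^bL\big(u(t),{}^{C}\mathbb{D}_{a^+}^{\alpha,\sigma}u(t),t\big)\,dt$. Weak extremal: the Gâteaux differential is $D\mathcal{J}(u)v=\lim_{h\to0}\frac{\mathcal{J}(u+hv)-\mathcal{J}(u)}{h}$, for $v\in AC([a,b],\mathbb{R})$ such that $\mathcal{J}(u+hv)$ is well defined and finite for $h$ near $0$, provided that the limit exists; $u$ is a weak extremal if $D\mathcal{J}(u)v=0$ for all such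 $v\in AC([a,b],\mathbb{R})$. One-parameter group of diffeomorphisms of $S'$: a $C^2$ map $\xi:\mathbb{R}\times S'\times[a,b]\to S'$, $(s,x,t)\mapsto\xi(s,x,t)$, such that for each $t$: each map $\xi(s,\cdot,t):S'\to S'$ is invertible with $C^2$ inverse, $\xi(0,\cdot,t)=\mathrm{Id}_{S'}$, and $\xi(s,\cdot,t)\circ\xi(s',\cdot,t)=\xi(s+s',\cdot,t)$ for all $s,s'\in\mathbb{R}$. Invariance: $\mathcal{J}$ is invariant under the action of $\xi$ if for every weak extremal $u\in C^2([a,b],S')$, all $s\in\mathbb{R}$ and all subintervals $[t_a,t_b]\subseteq[a,b]$, $$\int_{t_a}^{t_b}L\big(u(t),{}^{C}\mathbb{D}_{a^+}^{\alpha,\sigma}u(t),t\big)dt=\int_{t_a}^{t_b}L\big(\xi(s,u(t),t),{}^{C}\mathbb{D}_{a^+}^{\alpha,\sigma}\xi(s,u(t),t),t\big)dt,$$ where ${}^{C}\mathbb{D}_{a^+}^{\alpha,\sigma}\xi(s,u(t),t)$ means the derivative applied to $t\mapsto\xi(s,u(t),t)$. *)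

(* Defs.v *)
From HB Require Import structures.
From mathcomp Require Import all_boot all_order all_algebra.
From mathcomp Require Import all_classical all_reals all_analysis.

Set Implicit Arguments.
Unset Strict Implicit.
Unset Printing Implicit Defensive.

Import Order.TTheory GRing.Theory Num.Theory.
Import numFieldNormedType.Exports.

Local Open Scope classical_set_scope.
Local Open Scope ring_scope.

Local Notation leb R := (@lebesgue_measure R).

Section Smoothness.
Context {R : realType} {V : normedModType R}.

(* [l] is the derivative of [f] at [x] in the direction [e], computed with
   increments that stay in [D]: one-sided at boundary points such as t = a. *)
Definition is_derive_in (D : set V) (f : V -> R) (x e : V) (l : R) : Prop :=
  (fun h : R => h^-1 * (f (x + h *: e) - f x))
    @ within [set h | D (x + h *: e)] (0 : R)^' --> l.

(* [f] is of class C^k on [D]: its iterated partial derivatives (within [D])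
   in the directions of the basis [B], up to order [k], exist and are
   continuous on [D]. *)
Fixpoint class_C (k : nat) (B : seq V) (D : set V) (f : V -> R) : Prop :=
  {within D, continuous f} /\
  if k is k'.+1 then
    forall e, e \in B -> exists g : V -> R,
      (forall x, D x -> is_derive_in D f x e (g x)) /\ class_C k' B D g
  else True.

End Smoothness.

Section Spaces.
Context {R : realType}.

Definition class_C1var (k : nat) (D : set R) (f : R -> R) : Prop :=
  @class_C R R^o k [:: 1] D f.

Definition class_C3var (k : nat) (D1 D2 D3 : set R) (f : R -> R -> R -> R) :
    Prop :=
  @class_C R (R^o * R^o * R^o)%type k
    [:: (1, 0, 0); (0, 1, 0); (0, 0, 1)]
    (D1 `*` D2 `*` D3)
    (fun p => f p.1.1 p.1.2 p.2).

(* u \in C^2([a, b], S) *)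
Definition C2_curve (a b : R) (S : set R) (u : R -> R) : Prop :=
  class_C1var 2 `[a, b] u /\ forall t, a <= t <= b -> S (u t).

(* w \in AC([a, b], R) *)
Definition abs_continuous (a b : R) (w : R -> R) : Prop :=
  forall eps : R, 0 < eps -> exists2 delta : R, 0 < delta &
    forall (n : nat) (x y : 'I_n -> R),
      (forall i, [/\ a <= x i, x i <= y i & y i <= b]) ->
      trivIset setT (fun i : 'I_n => `]x i, y i[%classic) ->
      \sum_(i < n) (y i - x i) < delta ->
      \sum_(i < n) `|w (y i) - w (x i)| < eps.

End Spaces.

Section TemperedCalculus.
Context {R : realType}.

Definition Gamma (z : R) : R :=
  \int[leb R]_(x in `]0, +oo[) (x `^ (z - 1) * expR (- x)).

Definition tempered_int_left (a beta sigma : R) (w : R -> R) (t : R) : R :=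
  (Gamma beta)^-1 * \int[leb R]_(theta in `[a, t])
    ((t - theta) `^ (beta - 1) * expR (- (sigma * (t - theta))) * w theta).

Definition tempered_int_right (b beta sigma : R) (w : R -> R) (t : R) : R :=
  (Gamma beta)^-1 * \int[leb R]_(theta in `[t, b])
    ((theta - t) `^ (beta - 1) * expR (- (sigma * (theta - t))) * w theta).

(* For absolutely continuous [w] the derivative under the integral exists
   almost everywhere and the integral converges for almost every [t]. *)
Definition tempered_caputo (a alpha sigma : R) (w : R -> R) (t : R) : R :=
  expR (- (sigma * t)) / Gamma (1 - alpha) * \int[leb R]_(theta in `[a, t])
    ((t - theta) `^ (- alpha)
     * derive1 (fun theta' : R => expR (sigma * theta') * w theta') theta).

End TemperedCalculus.

Section Variational.
Context {R : realType}.
Variables (a b alpha sigma : R) (L : R -> R -> R -> R).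

(* t |-> L [u]_t, with [u]_t = (u t, D u t, t) *)
Definition lagr (u : R -> R) (t : R) : R :=
  L (u t) (tempered_caputo a alpha sigma u t) t.

(* t |-> (dL/dy) [u]_t *)
Definition lagr_dy (u : R -> R) (t : R) : R :=
  derive1 (fun y : R => L (u t) y t) (tempered_caputo a alpha sigma u t).

Definition action (u : R -> R) : R := \int[leb R]_(t in `[a, b]) lagr u t.

Definition action_finite (u : R -> R) : Prop :=
  (leb R).-integrable `[a, b] (EFin \o lagr u).

Definition admissible_variation (u v : R -> R) : Prop :=
  abs_continuous a b v /\
  \forall h \near (0 : R), action_finite (fun t => u t + h * v t).

Definition is_gateaux (u v : R -> R) (l : R) : Prop :=
  (fun h : R => (action (fun t => u t + h * v t) - action u) / h)
    @ (0 : R)^' --> l.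

Definition weak_extremal (u : R -> R) : Prop :=
  forall (v : R -> R) (l : R),
    admissible_variation u v -> is_gateaux u v l -> l = 0.

End Variational.

Section Symmetry.
Context {R : realType}.
Variables (a b alpha sigma : R) (L : R -> R -> R -> R).
Variables (S : set R) (xi : R -> R -> R -> R).

(* arguments of [xi] in the order s, x, t *)
Definition one_param_group : Prop :=
  [/\ class_C3var 2 setT S `[a, b] xi,
      forall s x t, S x -> a <= t <= b -> S (xi s x t),
      forall s t, a <= t <= b -> exists zeta : R -> R,
        [/\ forall x, S x -> S (zeta x),
            forall x, S x -> zeta (xi s x t) = x,
            forall x, S x -> xi s (zeta x) t = x
          & class_C1var 2 S zeta],
      forall x t, S x -> a <= t <= b -> xi 0 x t = x
    & forall s s' x t, S x -> a <= t <= b ->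
        xi s (xi s' x t) t = xi (s + s') x t].

Definition invariant_action : Prop :=
  forall u : R -> R, C2_curve a b S u -> weak_extremal a b alpha sigma L u ->
  forall s ta tb : R, a <= ta -> ta <= tb -> tb <= b ->
    \int[leb R]_(t in `[ta, tb]) lagr a alpha sigma L u t =
    \int[leb R]_(t in `[ta, tb])
      lagr a alpha sigma L (fun t' => xi s (u t') t') t.

(* t |-> (dxi/ds) (0, u t, t) *)
Definition generator (u : R -> R) (t : R) : R :=
  derive1 (fun s : R => xi s (u t) t) 0.

Definition noether_left (u : R -> R) (t : R) : R :=
  lagr_dy a alpha sigma L u t
  * tempered_int_left a (1 - alpha) sigma (generator u) t.

Definition noether_right (u : R -> R) (t : R) : R :=
  generator u t
  * tempered_int_right b (1 - alpha) sigma (lagr_dy a alpha sigma L u) t.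

Definition noether (u : R -> R) (t : R) : R :=
  noether_left u t + noether_right u t.

End Symmetry.

(* Main.v *)
(* The hypotheses force both factors of the conserved quantity to vanish on ]a, b[,
   which contains the open set X'; this gives all the conclusions.

   Put G(t) = e^(sigma t) (d xi / d s)(0, u(t), t), extended to the left of a by G(a), and
   q(t) = e^(- sigma t) (d L / d y)[u]_t / Gamma(1 - alpha), extended by 0 outside [a, b].
   Differentiating the invariance in s at 0 and testing the extremality with the
   variations e^(- sigma t) G chi gives, for every C^1 function chi,
     int_a^b q (I((G chi)') - chi I(G')) = 0,   I w(t) = int_a^t (t - x)^(- alpha) w(x) dx.
   When chi tends to the indicator of ]-oo, tau[ this becomes, with s = 1 + alpha,
     int_(y > tau) q(y) int_(x < tau) (y - x)^(-s) G(x) dx dy = 0   for all tau in ]a, b[.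
   Let U(t, z) = int_(x < t) (t - x)^(-s) e^(- z / (t - x)) G(x) dx, and let V be the same
   potential of q with time reversed. They solve U_t = z U_zz + s U_z and
   V_t = - (z V_zz + s V_z), and Psi(t, z) = - int_z^oo x^(s - 1) U V dx satisfies
   Psi_t = z^s (U_z V - U V_z). The identity above says that Psi(t, 0+) = 0, and a
   maximum principle applied to Psi and - Psi gives Psi = 0, i.e. U V = 0. Both factors
   being analytic in z, for each t either U(t, .) = 0, whence G(t) = 0 and I G(t) = 0,
   or V(t, .) = 0, whence the same for q and the right-sided integral. *)

Require Import Defs.
From HB Require Import structures.
From mathcomp Require Import all_boot all_order all_algebra.
From mathcomp Require Import all_classical all_reals all_analysis.
From mathcomp Require Import measurable_realfun ring lra.
Import Order.TTheory GRing.Theory Num.Theory.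
Import numFieldNormedType.Exports.
Local Open Scope classical_set_scope.
Local Open Scope ring_scope.

Set Implicit Arguments.
Unset Strict Implicit.
Unset Printing Implicit Defensive.

(** * Real functions of one and two variables *)

Section Elementary.
Context {R : realType}.
Implicit Types (f : R -> R) (x l : R).

(** Invariance holds on all subintervals, hence pointwise, while extremality is one integral
    identity with a free test function. Eliminating L_x between the two leaves the failure of the
    Leibniz rule for the fractional derivative, which is nonlocal: its limit couples the past of G
    with the future of q across tau. The variable z undoes this coupling, since (A + B)^(- s), with
    A = tau - x and B = y - tau, is up to Gamma(s) the integral over z > 0 of z^(s - 1) times a
    function of A and the same function of B; U and V are the corresponding superpositions. The
    maximum principle is not a standard one. Where V does not vanish, Psi_t = z Psi_zz - (s - 1 + 2
    z V_z / V) Psi_z is parabolic forward in time; where U does not vanish, Psi solves a backward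
    equation. A positive maximum therefore moves to earlier or to later times, according to the
    factor that keeps its sign. Psi vanishes at time b, but no value is prescribed at time a: the
    constant extension of G takes its place by giving U(a, .) a sign, and it also absorbs the
    boundary term at a of an integration by parts. *)

Lemma cvg_is_derive f x l :
  h^-1 * (f (x + h) - f x) @[h --> 0^'] --> l -> is_derive x 1 f l.
Proof.
move=> fl.
have e : (fun h : R => h^-1 * (f (x + h) - f x)) = (fun h : R => h^-1 *: (f (h *: 1 + x) - f x)).
  by apply/funext => h; rewrite [h *: 1]mulr1 [h + x]addrC.
rewrite e in fl.
by apply: DeriveDef; [apply/cvg_ex; exists l|exact: (cvg_lim _ fl)].
Qed.

Lemma is_derive_cvg f x l : is_derive x 1 f l ->
  h^-1 * (f (x + h) - f x) @[h --> 0^'] --> l.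
Proof.
move=> [fx fl].
have e : (fun h : R => h^-1 *: (f (h *: 1 + x) - f x)) = (fun h : R => h^-1 * (f (x + h) - f x)).
  by apply/funext => h; rewrite [h *: 1]mulr1 [h + x]addrC.
have /cvg_ex[/= l' hl'] := fx.
by move: fl hl'; rewrite /derive e => <- hl'; rewrite (cvg_lim _ hl').
Qed.

(** Serves for the kernel at elapsed time 0, where its formula changes and the increment is
    controlled only through a bound by h^2. *)
Lemma is_derive_quadratic f x l (c : R) :
  (forall h, `|f (x + h) - f x - l * h| <= c * h ^+ 2) -> is_derive x 1 f l.
Proof.
move=> fc; apply: cvg_is_derive; apply/cvgrPdist_le => e e0.
have c0 : 0 < `|c| + 1 by rewrite ltr_wpDl.
near=> h; have h0 : h != 0 by near: h; exact: nbhs_dnbhs_neq.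
have -> : l - h^-1 * (f (x + h) - f x) = - (h^-1 * (f (x + h) - f x - l * h)).
  by field.
rewrite normrN normrM normfV ler_pdivrMl ?normr_gt0//.
apply: (le_trans (fc h)).
have he : `|h| <= e / (`|c| + 1).
  by near: h; apply: dnbhs0_le; rewrite divr_gt0.
have hc : (`|c| + 1) * `|h| <= e by rewrite mulrC -ler_pdivlMr.
have e1 : h ^+ 2 = `|h| * `|h| by rewrite -expr2 real_normK// num_real.
rewrite e1 mulrA [c * _]mulrC -mulrA ler_wpM2l//; apply: le_trans hc.
by rewrite ler_wpM2r// (le_trans (ler_norm c))// lerDl.
Unshelve. all: by end_near. Qed.

Lemma is_derive_gt0_right f x l : is_derive x 1 f l -> 0 < l ->
  exists2 d : R, 0 < d & forall h, 0 < h < d -> f x < f (x + h).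
Proof.
move=> [fx fl] l0.
have : h^-1 *: (f (h + x) - f x) @[h --> 0^'] --> l.
  have /cvg_ex[/= l' hl'] := fx.
  rewrite -fl /derive.
  have e : (fun h : R => h^-1 *: (f (h *: 1 + x) - f x)) = (fun h : R => h^-1 *: (f (h + x) - f x)).
    by apply/funext => h; rewrite [h *: 1]mulr1.
  by rewrite /= e in hl' *; rewrite (cvg_lim _ hl').
move=> /cvgrPdist_lt /(_ _ l0)[d /= d0 H].
exists d => // h /andP[h0 hd].
have := H h; rewrite /ball_ /= sub0r normrN gtr0_norm// hd gt_eqF// => /(_ isT isT).
rewrite ltr_norml => /andP[_]; rewrite ltrBlDr -ltrBlDl subrr.
by rewrite pmulr_rgt0 ?invr_gt0// subr_gt0 addrC.
Qed.

Lemma is_derive_gt0_left f x l : is_derive x 1 f l -> 0 < l ->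
  exists2 d : R, 0 < d & forall h, 0 < h < d -> f (x - h) < f x.
Proof.
move=> fl l0.
have fl' : is_derive (- x) 1 (fun y => - f (- y)) l.
  have h1 : is_derive (- x) 1 (fun y => - y) (-1) by exact: is_deriveN.
  have h2 : is_derive (- - x) 1 f l by rewrite opprK.
  have h3 := @is_derive1_comp _ f -%R (- x) l (-1) h2 h1.
  have h4 := is_deriveN h3.
  by apply: (is_derive_eq h4); rewrite mulrN1 opprK.
have [d d0 H] := is_derive_gt0_right fl' l0.
exists d => // h hd; have := H _ hd.
by rewrite opprK opprD opprK ltrN2.
Qed.

Lemma half_lt x : 0 < x -> x / 2 < x.
Proof. by move=> x0; rewrite ltr_pdivrMr// ltr_pMr// ltr1n. Qed.

Lemma min_half_lt x y : 0 < x -> Num.min (x / 2) y < x.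
Proof. by move=> x0; rewrite gt_min half_lt. Qed.

Lemma MVT_derive f (df : R -> R) (x y : R) : x < y ->
  (forall t, x <= t <= y -> is_derive t 1 f (df t)) ->
  exists2 c, x < c < y & f y - f x = df c * (y - x).
Proof.
move=> xy fdf.
have [|t /[!in_itv]/= /andP[xt ty]||c /[!in_itv]/= cxy ->] := @MVT _ f df x y.
- exact: xy.
- by apply: fdf; rewrite !ltW.
- apply: derivable_within_continuous => t /[!in_itv]/= txy.
  by have [] := fdf t txy.
- by exists c.
Qed.

Lemma derive_gt0_lt f (df : R -> R) (x y : R) : x < y ->
  (forall t, x <= t <= y -> is_derive t 1 f (df t)) ->
  (forall t, x < t < y -> 0 < df t) -> f x < f y.
Proof.
move=> xy fdf df0; have [c cxy fc] := MVT_derive xy fdf.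
by rewrite -subr_gt0 fc mulr_gt0 ?subr_gt0// df0.
Qed.

Lemma derive_lt0_lt f (df : R -> R) (x y : R) : x < y ->
  (forall t, x <= t <= y -> is_derive t 1 f (df t)) ->
  (forall t, x < t < y -> df t < 0) -> f y < f x.
Proof.
move=> xy fdf df0; have [c cxy fc] := MVT_derive xy fdf.
by rewrite -subr_lt0 fc pmulr_llt0 ?subr_gt0// df0.
Qed.

Lemma is_derive_unique f x l l' : is_derive x 1 f l -> is_derive x 1 f l' -> l = l'.
Proof. by move=> [_ <-] [_ <-]. Qed.

Lemma is_derive_continuous f x l : is_derive x 1 f l -> {for x, continuous f}.
Proof. by move=> [fx _]; apply/differentiable_continuous/derivable1_diffP. Qed.

Lemma interior_min_derive f (df : R -> R) (x y c : R) : x < c < y ->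
  (forall t, x < t < y -> is_derive t 1 f (df t)) ->
  (forall t, x < t < y -> f c <= f t) -> df c = 0.
Proof.
move=> cxy fdf fc; apply: (@is_derive_unique f c); first exact: fdf.
have xy : x <= y by case/andP: cxy => /lt_trans h /h /ltW.
have H1 t : t \in `]x, y[ -> derivable f t 1 by rewrite in_itv/= => /fdf[].
have H2 t : t \in `]x, y[ -> f c <= f t by rewrite in_itv/=; exact: fc.
by apply: (derive1_at_min xy H1 _ H2); rewrite in_itv.
Qed.

Lemma interior_max_derive f (df : R -> R) (x y c : R) : x < c < y ->
  (forall t, x < t < y -> is_derive t 1 f (df t)) ->
  (forall t, x < t < y -> f t <= f c) -> df c = 0.
Proof.
move=> cxy fdf fc; apply: (@is_derive_unique f c); first exact: fdf.
have xy : x <= y by case/andP: cxy => /lt_trans h /h /ltW.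
have H1 t : t \in `]x, y[ -> derivable f t 1 by rewrite in_itv/= => /fdf[].
have H2 t : t \in `]x, y[ -> f t <= f c by rewrite in_itv/=; exact: fc.
by apply: (derive1_at_max xy H1 _ H2); rewrite in_itv.
Qed.

Lemma EVT_max_rect (f : R -> R -> R) (t1 t0 z1 z2 : R) : t1 <= t0 -> z1 <= z2 ->
  (forall t z, t1 <= t <= t0 -> z1 <= z <= z2 ->
     {for (t, z), continuous (fun p : R * R => f p.1 p.2)}) ->
  exists t z, [/\ t1 <= t <= t0, z1 <= z <= z2 &
    forall t' z', t1 <= t' <= t0 -> z1 <= z' <= z2 -> f t' z' <= f t z].
Proof.
move=> t10 z12 cf; pose K : set (R * R) := `[t1, t0] `*` `[z1, z2].
have K0 : K !=set0 by exists (t1, z1); split; rewrite /= in_itv/= lexx ?t10 ?z12.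
have cK : compact K by apply: compact_setX; exact: segment_compact.
have [|[t z] /set_mem[/= tt zz] h] := @compact_EVT_max _ R (fun p => f p.1 p.2) K K0 cK.
  apply: continuous_in_subspaceT => -[t z] /set_mem[/= tt zz].
  by apply: cf; rewrite ?(itvP tt) ?(itvP zz).
exists t, z; split; rewrite ?(itvP tt) ?(itvP zz)// => t' z' h1 h2.
by apply: (h (t', z')); apply/mem_set; split; rewrite /= in_itv.
Qed.

Lemma EVT_min_rect (f : R -> R -> R) (t1 t0 z1 z2 : R) : t1 <= t0 -> z1 <= z2 ->
  (forall t z, t1 <= t <= t0 -> z1 <= z <= z2 ->
     {for (t, z), continuous (fun p : R * R => f p.1 p.2)}) ->
  exists t z, [/\ t1 <= t <= t0, z1 <= z <= z2 &
    forall t' z', t1 <= t' <= t0 -> z1 <= z' <= z2 -> f t z <= f t' z'].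
Proof.
move=> t10 z12 cf.
have [|t [z [h1 h2 h3]]] := @EVT_max_rect (fun t z => - f t z) _ _ _ _ t10 z12.
  by move=> t z ht hz; apply: continuousN; exact: cf.
by exists t, z; split => // t' z' h4 h5; rewrite -lerN2 h3.
Qed.

(** Tube lemma: compactness of [[z1, z2]] turns radii that depend on z into one time radius. At the
    extremal times of the maximum principle it yields a whole strip of times from local information
    at each height. *)
Lemma near_cover_rect (P : R -> R -> Prop) (t0 z1 z2 : R) :
  (forall z, z1 <= z <= z2 -> exists2 e : R, 0 < e &
     forall t z', `|t - t0| < e -> `|z' - z| < e -> P t z') ->
  exists2 e : R, 0 < e & forall t z, `|t - t0| < e -> z1 <= z <= z2 -> P t z.
Proof.
move=> H; have /compact_near_coveringP/(_ R (nbhs t0) P) := @segment_compact R z1 z2.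
case=> [z /= /[!in_itv]/= zz|e /= e0 he].
  have [e e0 he] := H z zz.
  exists (ball z e, ball t0 e).
    by split; apply/nbhs_ballP; exists e.
  by move=> [z' t] [/= h1 h2]; apply: he; rewrite distrC.
exists e => // t z ht hz; apply: (he t); last by rewrite /= in_itv.
by rewrite /ball_/= distrC.
Qed.

Lemma continuous2_lt (f : R -> R -> R) (t z M : R) :
  {for (t, z), continuous (fun p : R * R => f p.1 p.2)} -> f t z < M ->
  exists2 e : R, 0 < e & forall u v, `|u - t| < e -> `|v - z| < e -> f u v < M.
Proof.
move=> cf fM.
have : \forall p \near (t, z), f p.1 p.2 < M by exact: (cvgr_lt (f t z) cf).
move/nbhs_ballP => [e /= e0 he].
by exists e => // u v hu hv; apply: (he (u, v)); split; rewrite /ball/= distrC.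
Qed.

Lemma constant_sign (F : R -> R) (x y : R) :
  (forall z, x < z < y -> {for z, continuous F}) ->
  (forall z, x < z < y -> F z != 0) ->
  (forall z, x < z < y -> 0 < F z) \/ (forall z, x < z < y -> F z < 0).
Proof.
move=> cF F0.
have [h|/existsNP[u /not_implyP[uxy /negP]]] := pselect (forall z, x < z < y -> 0 < F z).
  by left.
rewrite -leNgt le_eqVlt (negbTE (F0 u uxy))/= => Fu; right => v vxy.
rewrite ltNge le_eqVlt eq_sym (negbTE (F0 v vxy))/=; apply/negP => Fv.
have cs p q : x < p -> q < y -> {within `[p, q], continuous F}.
  move=> xp qy; apply: continuous_in_subspaceT => z /set_mem /= /[!in_itv]/= /andP[pz zq].
  by apply: cF; rewrite (lt_le_trans xp pz) (le_lt_trans zq qy).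
have [uv|vu] := leP u v.
  have [| |c /[!in_itv]/= /andP[uc cv] c0] := @IVT _ F u v 0 uv.
  - by apply: cs; [case/andP: uxy|case/andP: vxy].
  - by rewrite ge_min le_max !(ltW Fu) !(ltW Fv) orbT.
  - suff : F c != 0 by rewrite c0 eqxx.
    case/andP: uxy => xu _; case/andP: vxy => _ vy.
    by apply: F0; rewrite (lt_le_trans xu uc) (le_lt_trans cv vy).
have [| |c /[!in_itv]/= /andP[uc cv] c0] := @IVT _ F v u 0 (ltW vu).
- by apply: cs; [case/andP: vxy|case/andP: uxy].
- by rewrite ge_min le_max !(ltW Fu) !(ltW Fv) orbT.
- suff : F c != 0 by rewrite c0 eqxx.
  case/andP: vxy => xu _; case/andP: uxy => _ vy.
  by apply: F0; rewrite (lt_le_trans xu uc) (le_lt_trans cv vy).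
Qed.

End Elementary.

(** * A maximum principle for pairs of forward and backward solutions *)

Section MaxPrinciple.
Context {R : realType}.

(* U solves U_t = z U_zz + s U_z and V the backward equation; with k z = z^(s-1)
   the two formulas for the gradient of Psi are compatible. *)
Record caloric_pair (s : R) (k : R -> R) (U U1 U2 V V1 V2 Psi : R -> R -> R) : Prop := {
  cp_weight : forall z : R, 0 < z -> 0 < k z;
  cp_U : forall t z : R, 0 < z -> is_derive z 1 (U t) (U1 t z);
  cp_U1 : forall t z : R, 0 < z -> is_derive z 1 (U1 t) (U2 t z);
  cp_Ut : forall t z : R, 0 < z -> is_derive t 1 (U ^~ z) (z * U2 t z + s * U1 t z);
  cp_Uc : forall t z : R, 0 < z -> {for (t, z), continuous (fun p => U p.1 p.2)};
  cp_V : forall t z : R, 0 < z -> is_derive z 1 (V t) (V1 t z);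
  cp_V1 : forall t z : R, 0 < z -> is_derive z 1 (V1 t) (V2 t z);
  cp_Vt : forall t z : R, 0 < z -> is_derive t 1 (V ^~ z) (- (z * V2 t z + s * V1 t z));
  cp_Vc : forall t z : R, 0 < z -> {for (t, z), continuous (fun p => V p.1 p.2)};
  cp_Psi : forall t z : R, 0 < z -> is_derive z 1 (Psi t) (k z * (U t z * V t z));
  cp_Psit : forall t z : R, 0 < z ->
    is_derive t 1 (Psi ^~ z) (z * k z * (U1 t z * V t z - U t z * V1 t z));
  cp_Psic : forall t z : R, 0 < z -> {for (t, z), continuous (fun p => Psi p.1 p.2)} }.

(** The formula for Psi_t is antisymmetric in U and V, so reversing time and exchanging the two
    functions is consistent with the same Psi. Every statement about earlier times thus has a
    counterpart about later times. *)
Lemma caloric_pair_rev s k U U1 U2 V V1 V2 Psi :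
  caloric_pair s k U U1 U2 V V1 V2 Psi ->
  caloric_pair s k (fun t => V (- t)) (fun t => V1 (- t)) (fun t => V2 (- t))
    (fun t => U (- t)) (fun t => U1 (- t)) (fun t => U2 (- t)) (fun t => Psi (- t)).
Proof.
have rev (f : R -> R) (t l : R) : is_derive (- t) 1 f l ->
    is_derive t 1 (fun t => f (- t)) (- l).
  move=> fl; have h1 : is_derive t 1 (fun y : R => - y) (-1) by exact: is_deriveN.
  by apply: (is_derive_eq (@is_derive1_comp _ f -%R t l (-1) fl h1)); rewrite mulrN1.
have revc (f : R -> R -> R) t z : {for (- t, z), continuous (fun p => f p.1 p.2)} ->
    {for (t, z), continuous (fun p => f (- p.1) p.2)}.
  move=> fc; apply: (@continuous_comp _ _ _ (fun p : R * R => (- p.1, p.2)) (fun p => f p.1 p.2)) => //.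
  have h1 : (- p.1) @[p --> (t, z)] --> - t by apply: cvgN; exact: cvg_fst.
  have h2 : p.2 @[p --> (t, z)] --> z by exact: cvg_snd.
  exact: (cvg_pair h1 h2).
move=> [k0 dU dU1 dUt cU dV dV1 dVt cV dP dPt cP]; constructor.
- exact: k0.
- by move=> t z z0; exact: dV.
- by move=> t z z0; exact: dV1.
- move=> t z z0; apply: (is_derive_eq (rev (V ^~ z) _ _ (dVt _ _ z0))).
  by rewrite opprK.
- by move=> t z z0; apply: (revc V); exact: cV.
- by move=> t z z0; exact: dU.
- by move=> t z z0; exact: dU1.
- by move=> t z z0; exact: (rev (U ^~ z) _ _ (dUt _ _ z0)).
- by move=> t z z0; apply: (revc U); exact: cU.
- by move=> t z z0; apply: (is_derive_eq (dP _ _ z0)); rewrite [in RHS]mulrC [in RHS]mulrC [X in _ * X]mulrC.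
- move=> t z z0; apply: (is_derive_eq (rev (Psi ^~ z) _ _ (dPt _ _ z0))).
  by ring.
- by move=> t z z0; apply: (revc Psi); exact: cP.
Qed.

(** Psi depends on the pair only through U V and U_z V - U V_z, which do not change; hence V may be
    assumed nonnegative where it keeps a sign. *)
Lemma caloric_pair_opp s k U U1 U2 V V1 V2 Psi :
  caloric_pair s k U U1 U2 V V1 V2 Psi ->
  caloric_pair s k (fun t z => - U t z) (fun t z => - U1 t z) (fun t z => - U2 t z)
    (fun t z => - V t z) (fun t z => - V1 t z) (fun t z => - V2 t z) Psi.
Proof.
move=> [k0 dU dU1 dUt cU dV dV1 dVt cV dP dPt cP]; constructor.
- exact: k0.
- by move=> t z z0; exact: is_deriveN (dU _ _ z0).
- by move=> t z z0; exact: is_deriveN (dU1 _ _ z0).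
- by move=> t z z0; apply: (is_derive_eq (is_deriveN (dUt _ _ z0))); ring.
- by move=> t z z0; apply: continuousN; exact: cU.
- by move=> t z z0; exact: is_deriveN (dV _ _ z0).
- by move=> t z z0; exact: is_deriveN (dV1 _ _ z0).
- by move=> t z z0; apply: (is_derive_eq (is_deriveN (dVt _ _ z0))); ring.
- by move=> t z z0; apply: continuousN; exact: cV.
- by move=> t z z0; apply: (is_derive_eq (dP _ _ z0)); ring.
- by move=> t z z0; apply: (is_derive_eq (dPt _ _ z0)); ring.
- exact: cP.
Qed.

Section Fixed.
Variables (s : R) (k : R -> R) (U U1 U2 V V1 V2 Psi : R -> R -> R).
Hypothesis H : caloric_pair s k U U1 U2 V V1 V2 Psi.

(** Adding e (t0 - t) to V keeps a negative minimum away from the sides and from the final time. At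
    that minimum V_z = 0 and V_zz >= 0, so V_t = - z V_zz <= 0 and the perturbed function decreases
    strictly in t, which a minimum before t0 forbids. *)
Lemma backward_caloric_ge0 (t1 t0 z1 z2 : R) : 0 < z1 -> z1 <= z2 -> t1 <= t0 ->
  (forall z, z1 <= z <= z2 -> 0 <= V t0 z) ->
  (forall t, t1 <= t <= t0 -> 0 <= V t z1) ->
  (forall t, t1 <= t <= t0 -> 0 <= V t z2) ->
  forall t z, t1 <= t <= t0 -> z1 <= z <= z2 -> 0 <= V t z.
Proof.
move=> z10 z12 t10 V0 Vz1 Vz2 t z ht hz; rewrite leNgt; apply/negP => Vtz.
have c_gt0 x : z1 <= x <= z2 -> 0 < x by move=> /andP[/(lt_le_trans z10)].
(* This choice gives e (t0 - t) < e D = - V t z, even at t = t0, so the perturbed function is still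
   negative at (t, z). *)
pose D := 2 * (t0 - t + 1); have D0 : 0 < D by rewrite /D; case/andP: ht => _; lra.
pose e := - V t z / D; have e0 : 0 < e by rewrite divr_gt0// oppr_gt0.
pose W t z := V t z + e * (t0 - t).
have cW t' z' : t1 <= t' <= t0 -> z1 <= z' <= z2 ->
    {for (t', z'), continuous (fun p : R * R => W p.1 p.2)}.
  move=> _ /c_gt0 hz'; apply: (@cvgD _ _ _ _ _ (fun p : R * R => V p.1 p.2) (fun p => e * (t0 - p.1))).
    exact: (cp_Vc H).
  by apply: cvgMr; apply: cvgB; [exact: cvg_cst|exact: cvg_fst].
have [tc [zc [htc hzc Wmin]]] := EVT_min_rect t10 z12 cW.
have Wc : W tc zc < 0.
  apply: (le_lt_trans (Wmin t z ht hz)); rewrite /W.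
  have -> : V t z = - (e * D) by rewrite /e divfK ?gt_eqF// opprK.
  rewrite /D; case/andP: ht => _ ht; nra.
have zc0 := c_gt0 _ hzc.
have etc : 0 <= e * (t0 - tc) by apply: mulr_ge0; [exact: ltW|rewrite subr_ge0; case/andP: htc].
have tct0 : tc < t0.
  rewrite lt_neqAle; case/andP: (htc) => _ ->; rewrite andbT; apply/eqP => tct0.
  by have := V0 _ hzc; move: Wc etc; rewrite /W tct0; clear - H; lra.
have z1c : z1 < zc.
  rewrite lt_neqAle; case/andP: (hzc) => -> _; rewrite andbT; apply/eqP => ez.
  by have := Vz1 _ htc; move: Wc etc; rewrite /W ez; clear - H; lra.
have z2c : zc < z2.
  rewrite lt_neqAle; case/andP: (hzc) => _ ->; rewrite andbT; apply/eqP => ez.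
  by have := Vz2 _ htc; move: Wc etc; rewrite /W ez; clear - H; lra.
have hc : z1 < zc < z2 by rewrite z1c.
have Vmin x : z1 <= x <= z2 -> V tc zc <= V tc x.
  by move=> hx; have := Wmin tc x htc hx; rewrite /W lerD2r.
have V1c : V1 tc zc = 0.
  apply: (interior_min_derive hc (f := V tc)) => x /andP[/ltW h1 /ltW h2].
    by apply: (cp_V H); apply: c_gt0; rewrite h1.
  by apply: Vmin; rewrite h1.
(* Second-order condition: were V_zz negative, V_z would be negative just to the right of [zc], and
   V would drop below its minimum there. *)
have V2c : 0 <= V2 tc zc.
  rewrite leNgt; apply/negP => V2lt0.
  have [d d0 hd] := @is_derive_gt0_right _ (- V1 tc) zc (- V2 tc zc)
     (is_deriveN (cp_V1 H tc zc0)) (eqbRL (oppr_gt0 _) V2lt0).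
  pose h := Num.min (d / 2) (z2 - zc).
  have h0 : 0 < h by rewrite lt_min divr_gt0//= subr_gt0.
  have hz2 : zc + h <= z2 by rewrite -lerBrDl ge_min lexx orbT.
  have hdd : h < d by exact: min_half_lt.
  have : V tc (zc + h) < V tc zc.
    apply: (@derive_lt0_lt _ _ (V1 tc)); first by rewrite ltrDl.
      by move=> x /andP[h1 h2]; apply: (cp_V H); rewrite (lt_le_trans zc0).
    move=> x /andP[h1 h2]; have := hd (x - zc).
    rewrite !fctE subrKC V1c oppr0 oppr_gt0; apply.
    by rewrite subr_gt0 h1/= (le_lt_trans _ hdd)// lerBlDr addrC ltW.
  by apply/negP; rewrite -leNgt Vmin// hz2 (le_trans (ltW z1c))// lerDl ltW.
have Vtc := cp_Vt H tc zc0; rewrite V1c mulr0 addr0 in Vtc.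
have dg : is_derive tc 1 (fun t => e * t - V t zc) (e * 1 - - (zc * V2 tc zc)).
  by apply: is_deriveB.
have dg0 : 0 < e * 1 - - (zc * V2 tc zc).
  by rewrite opprK mulr1 ltr_wpDr// mulr_ge0// ltW.
have [d d0 hd] := is_derive_gt0_right dg dg0.
pose h := Num.min (d / 2) (t0 - tc).
have h0 : 0 < h by rewrite lt_min divr_gt0//= subr_gt0.
have ht0 : tc + h <= t0 by rewrite -lerBrDl ge_min lexx orbT.
have hdd : h < d by exact: min_half_lt.
have := hd h; rewrite h0 hdd => /(_ isT).
have := Wmin (tc + h) zc.
rewrite ht0 hzc (le_trans _ (_ : tc <= tc + h)) ?lerDl ?(ltW h0)//; last by case/andP: htc.
move=> /(_ isT isT); rewrite /W; clear - H; lra.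
Qed.

(** For V > 0 the equation of Psi is parabolic forward in time, but division by V is avoided, so V
    may have zeros. At a maximum of Psi - e (t - t1) away from the sides and from time t1, U V = 0
    and Psi_t >= e > 0. If V = 0 there, then V_z = 0 because V >= 0, and Psi_t = 0. If V > 0, then U
    = 0 and U_z > 0, so Psi still increases to the right of its maximum. *)
Lemma max_propagates_back (M t1 t0 z1 z2 : R) : 0 < z1 -> z1 <= z2 -> t1 <= t0 ->
  (forall t z, t1 <= t <= t0 -> z1 <= z <= z2 -> 0 <= V t z) ->
  (forall t, t1 <= t <= t0 -> Psi t z1 < M) ->
  (forall t, t1 <= t <= t0 -> Psi t z2 < M) ->
  (forall t z, t1 <= t <= t0 -> z1 <= z <= z2 -> Psi t z <= M) ->
  (exists2 z, z1 <= z <= z2 & Psi t0 z = M) ->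
  exists2 z, z1 < z < z2 & Psi t1 z = M.
Proof.
move=> z10 z12 t10 V0 Pz1 Pz2 PM [z0 hz0 Pz0]; apply: contrapT => noM.
have c_gt0 x : z1 <= x <= z2 -> 0 < x by move=> /andP[/(lt_le_trans z10)].
have ht1 : t1 <= t1 <= t0 by rewrite lexx.
have Pt1 z : z1 <= z <= z2 -> Psi t1 z < M.
  move=> hz; rewrite lt_neqAle PM// andbT; apply/eqP => Pt1z; apply: noM; exists z => //.
  case/andP: hz => hz1 hz2; rewrite !lt_neqAle hz1 hz2 !andbT.
  apply/andP; split; apply/eqP => ez.
    by have := Pz1 t1 ht1; rewrite ez Pt1z ltxx.
  by have := Pz2 t1 ht1; rewrite -ez Pt1z ltxx.
have ctime z : 0 < z -> {within `[t1, t0], continuous (Psi ^~ z)}.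
  move=> hz; apply: derivable_within_continuous => t _.
  by have [] := cp_Psit H t hz.
have h1 : z1 <= z1 <= z2 by rewrite lexx.
have h2 : z1 <= z2 <= z2 by rewrite lexx z12.
have [u1 /[!in_itv]/= hu1 mu1] := EVT_max t10 (ctime z1 (c_gt0 _ h1)).
have [u2 /[!in_itv]/= hu2 mu2] := EVT_max t10 (ctime z2 (c_gt0 _ h2)).
have cspace : {within `[z1, z2], continuous (Psi t1)}.
  apply: derivable_within_continuous => z /[!in_itv]/= hz.
  by have [] := cp_Psi H t1 (c_gt0 _ hz).
have [u3 /[!in_itv]/= hu3 mu3] := EVT_max z12 cspace.
(* Smallest gap between M and the values of Psi on the two sides and at time t1. The total
   perturbation e (t0 - t1) stays below it, so the perturbed maximum cannot lie there. *)
pose eta := Num.min (M - Psi u1 z1) (Num.min (M - Psi u2 z2) (M - Psi t1 u3)).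
have eta0 : 0 < eta by rewrite !lt_min !subr_gt0 Pz1// Pz2// Pt1.
have eta1 : eta <= M - Psi u1 z1 by rewrite ge_min lexx.
have eta2 : eta <= M - Psi u2 z2 by rewrite !ge_min lexx orbT.
have eta3 : eta <= M - Psi t1 u3 by rewrite !ge_min lexx !orbT.
pose D := t0 - t1 + 1; have D0 : 0 < D by rewrite /D; lra.
pose e := eta / D; have e0 : 0 < e by rewrite divr_gt0.
have eD : e * (t0 - t1) < eta.
  have -> : eta = e * D by rewrite /e divfK ?gt_eqF.
  by rewrite /D; nra.
pose W t z := Psi t z - e * (t - t1).
have cW t' z' : t1 <= t' <= t0 -> z1 <= z' <= z2 ->
    {for (t', z'), continuous (fun p : R * R => W p.1 p.2)}.
  move=> _ /c_gt0 hz'; apply: (@cvgB _ _ _ _ _ (fun p : R * R => Psi p.1 p.2) (fun p => e * (p.1 - t1))).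
    exact: (cp_Psic H).
  by apply: cvgMr; apply: cvgB; [exact: cvg_fst|exact: cvg_cst].
have [tc [zc [htc hzc Wmax]]] := EVT_max_rect t10 z12 cW.
have ht0 : t1 <= t0 <= t0 by rewrite lexx t10.
have Wc : M - eta < W tc zc.
  apply: (lt_le_trans _ (Wmax t0 z0 ht0 hz0)); rewrite /W Pz0; move: eD; clear - H; lra.
have zc0 := c_gt0 _ hzc.
have etc : 0 <= e * (tc - t1) by apply: mulr_ge0; [exact: ltW|rewrite subr_ge0; case/andP: htc].
have tct1 : t1 < tc.
  rewrite lt_neqAle; case/andP: (htc) => -> _; rewrite andbT; apply/eqP => tct1.
  by have := mu3 zc; rewrite in_itv/= hzc => /(_ isT); move: Wc etc eta3; rewrite /W -tct1; clear - H; lra.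
have z1c : z1 < zc.
  rewrite lt_neqAle; case/andP: (hzc) => -> _; rewrite andbT; apply/eqP => ez.
  by have := mu1 tc; rewrite in_itv/= htc => /(_ isT); move: Wc etc eta1; rewrite /W -ez; clear - H; lra.
have z2c : zc < z2.
  rewrite lt_neqAle; case/andP: (hzc) => _ ->; rewrite andbT; apply/eqP => ez.
  by have := mu2 tc; rewrite in_itv/= htc => /(_ isT); move: Wc etc eta2; rewrite /W ez; clear - H; lra.
have hc : z1 < zc < z2 by rewrite z1c.
have Pmax x : z1 <= x <= z2 -> Psi tc x <= Psi tc zc.
  by move=> hx; have := Wmax tc x htc hx; rewrite /W lerD2r.
have kc := cp_weight H zc0.
have UV0 : U tc zc * V tc zc = 0.
  have : k zc * (U tc zc * V tc zc) = 0.
    apply: (interior_max_derive hc (f := Psi tc) (df := fun z => k z * (U tc z * V tc z))) => x /andP[/ltW h3 /ltW h4].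
      by apply: (cp_Psi H); apply: c_gt0; rewrite h3.
    by apply: Pmax; rewrite h3.
  by move/eqP; rewrite mulf_eq0 (gt_eqF kc)/= => /eqP.
have Ptc := cp_Psit H tc zc0.
set P' := zc * k zc * _ in Ptc.
have eP' : e <= P'.
  rewrite leNgt; apply/negP => P'e.
  have dg : is_derive tc 1 (fun t => e * t - Psi t zc) (e * 1 - P') by apply: is_deriveB.
  have dg0 : 0 < e * 1 - P' by rewrite mulr1 subr_gt0.
  have [d d0 hd] := is_derive_gt0_left dg dg0.
  pose h := Num.min (d / 2) (tc - t1).
  have h0 : 0 < h by rewrite lt_min divr_gt0//= subr_gt0.
  have ht : t1 <= tc - h by rewrite lerBrDr -lerBrDl ge_min lexx orbT.
  have hdd : h < d by exact: min_half_lt.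
  have := hd h; rewrite h0 hdd => /(_ isT).
  have := Wmax (tc - h) zc.
  rewrite ht hzc (le_trans (_ : tc - h <= tc)) ?gerBl ?(ltW h0)//; last by case/andP: htc.
  move=> /(_ isT isT); rewrite /W; clear - H; lra.
have [Vc|Vc] := eqVneq (V tc zc) 0.
  suff V1c : V1 tc zc = 0 by move: eP'; rewrite /P' Vc V1c !mulr0 subrr mulr0 leNgt e0.
  apply: (interior_min_derive hc (f := V tc)) => x /andP[/ltW h3 /ltW h4].
    by apply: (cp_V H); apply: c_gt0; rewrite h3.
  by rewrite Vc V0// h3.
have Vpos : 0 < V tc zc by rewrite lt_neqAle eq_sym Vc V0.
have Uc : U tc zc = 0 by move/eqP: UV0; rewrite mulf_eq0 (negbTE Vc) orbF => /eqP.
have U1pos : 0 < U1 tc zc.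
  have : 0 < P' by exact: lt_le_trans eP'.
  by rewrite /P' Uc mul0r subr0 pmulr_rgt0; [rewrite pmulr_lgt0|exact: mulr_gt0].
have [d d0 hd] := is_derive_gt0_right (cp_U H tc zc0) U1pos.
have : \forall x \near zc, 0 < V tc x.
  exact: (cvgr_gt _ (is_derive_continuous (cp_V H tc zc0)) _ Vpos).
move=> /nbhs_ballP[d' /= d'0 hd'].
pose h := Num.min (Num.min (d / 2) (d' / 2)) (z2 - zc).
have h0 : 0 < h by rewrite !lt_min !divr_gt0//= subr_gt0.
have hz2 : zc + h <= z2 by rewrite -lerBrDl ge_min lexx orbT.
have hdd : h < d by rewrite !gt_min half_lt.
have hdd' : h < d' by rewrite !gt_min (half_lt d'0) orbT.
have : Psi tc zc < Psi tc (zc + h).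
  apply: (@derive_gt0_lt _ _ (fun z => k z * (U tc z * V tc z))); first by rewrite ltrDl.
    by move=> x /andP[h3 h4]; apply: (cp_Psi H); rewrite (lt_le_trans zc0).
  move=> x /andP[h3 h4].
  have x0 : 0 < x := lt_trans zc0 h3.
  have xh : x - zc < h by rewrite ltrBlDl.
  rewrite mulr_gt0 ?(cp_weight H)// mulr_gt0//.
    have := hd (x - zc); rewrite subrKC.
    by rewrite Uc; apply; rewrite subr_gt0 h3 (lt_trans xh).
  by apply: hd'; rewrite /ball/= distrC gtr0_norm ?subr_gt0// (lt_trans xh).
by apply/negP; rewrite -leNgt Pmax// hz2 (le_trans (ltW z1c))// lerDl ltW.
Qed.

End Fixed.
End MaxPrinciple.

(** * Sign changes at isolated zeros *)

Section SignChange.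
Context {R : realType}.
Implicit Types (F : R -> R) (z r : R).

Definition keeps_sign F z := exists2 r : R, 0 < r &
  (forall z', `|z' - z| < r -> 0 <= F z') \/ (forall z', `|z' - z| < r -> F z' <= 0).

(** The centre is excluded: the function may vanish there without changing sign, and this is the
    form that an isolated zero provides. *)
Definition strictly_keeps_sign F z := exists2 r : R, 0 < r &
  (forall z', 0 < `|z' - z| < r -> 0 < F z') \/ (forall z', 0 < `|z' - z| < r -> F z' < 0).

Definition isolated_zero F z := exists2 r : R, 0 < r &
  forall z', 0 < `|z' - z| < r -> F z' != 0.

Lemma punctured_signs F z : 0 < z ->
  (forall z', 0 < z' -> {for z', continuous F}) -> isolated_zero F z ->
  exists r, [/\ 0 < r, r < z,
    (forall h, 0 < h < r -> 0 < F (z - h)) \/ (forall h, 0 < h < r -> F (z - h) < 0) &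
    (forall h, 0 < h < r -> 0 < F (z + h)) \/ (forall h, 0 < h < r -> F (z + h) < 0)].
Proof.
move=> z0 cF [r r0 Fr]; pose r' := Num.min r (z / 2).
have r'0 : 0 < r' by rewrite lt_min r0 divr_gt0.
have r'r : r' <= r by rewrite ge_min lexx.
have r'z : r' < z by rewrite gt_min; apply/orP; right; lra.
exists r'; split => //.
- have := @constant_sign R F (z - r') z; case.
  + by move=> x /andP[h1 h2]; apply: cF; rewrite (lt_trans _ h1)// subr_gt0.
  + move=> x /andP[h1 h2]; apply: Fr; rewrite distrC gtr0_norm ?subr_gt0// h2/=.
    by rewrite (lt_le_trans _ r'r)// ltrBlDr -ltrBlDl.
  + by move=> hs; left => h /andP[h1 h2]; apply: hs; rewrite ltrD2l ltrN2 h2 gtrBl.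
  + by move=> hs; right => h /andP[h1 h2]; apply: hs; rewrite ltrD2l ltrN2 h2 gtrBl.
- have := @constant_sign R F z (z + r'); case.
  + by move=> x /andP[h1 h2]; apply: cF; rewrite (lt_trans _ h1).
  + move=> x /andP[h1 h2]; apply: Fr; rewrite gtr0_norm ?subr_gt0// h1/=.
    by rewrite (lt_le_trans _ r'r)// ltrBlDl.
  + by move=> hs; left => h /andP[h1 h2]; apply: hs; rewrite ltrD2l h2 ltrDl h1.
  + by move=> hs; right => h /andP[h1 h2]; apply: hs; rewrite ltrD2l h2 ltrDl h1.
Qed.

Lemma punctured_cases (P : R -> Prop) z r :
  (forall h, 0 < h < r -> P (z - h)) -> (forall h, 0 < h < r -> P (z + h)) ->
  forall z', 0 < `|z' - z| < r -> P z'.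
Proof.
move=> Pl Pr z' /andP[h1 h2]; have [zz'|z'z] := leP z z'.
  rewrite ger0_norm ?subr_ge0// in h1 h2.
  have -> : z' = z + (z' - z) by lra.
  by apply: Pr; rewrite h1.
rewrite distrC gtr0_norm ?subr_gt0// in h1 h2.
have -> : z' = z - (z - z') by lra.
by apply: Pl; rewrite subr_gt0 z'z.
Qed.

Lemma not_keeps_signP F z r : 0 < r ->
  ((forall h, 0 < h < r -> 0 < F (z - h)) /\ (forall h, 0 < h < r -> F (z + h) < 0)) \/
  ((forall h, 0 < h < r -> F (z - h) < 0) /\ (forall h, 0 < h < r -> 0 < F (z + h))) ->
  ~ keeps_sign F z.
Proof.
move=> r0 hF [r' r'0 hr']; pose h := Num.min r r' / 2.
have m0 : 0 < Num.min r r' by rewrite lt_min r0.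
have h0 : 0 < h by rewrite divr_gt0.
have m1 : Num.min r r' <= r by rewrite ge_min lexx.
have m2 : Num.min r r' <= r' by rewrite ge_min lexx orbT.
have hr : 0 < h < r by rewrite h0/= /h; lra.
have e1 : `|z + h - z| < r' by rewrite [z + h]addrC addrK gtr0_norm// /h; lra.
have e2 : `|z - h - z| < r' by rewrite [z - h]addrC addrK normrN gtr0_norm// /h; lra.
by case: hF => -[/(_ _ hr) + /(_ _ hr)]; case: hr' => hr'; have := hr' _ e1; have := hr' _ e2; lra.
Qed.

End SignChange.

Section Extremum.
Context {R : realType}.

Section Fixed.
Variables (s : R) (k : R -> R) (U U1 U2 V V1 V2 Psi : R -> R -> R).
Hypothesis H : caloric_pair s k U U1 U2 V V1 V2 Psi.

(* At a maximum point of Psi the product U V changes sign from + to - in z, so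
   exactly one of the factors changes sign. *)
Lemma max_sign_dichotomy (M t z : R) : 0 < z ->
  (forall z', 0 < z' -> Psi t z' <= M) -> Psi t z = M ->
  isolated_zero (U t) z -> isolated_zero (V t) z ->
  (exists2 r, 0 < r & forall z', 0 < `|z' - z| < r -> Psi t z' < M) /\
  ((strictly_keeps_sign (V t) z /\ ~ keeps_sign (U t) z) \/
   (strictly_keeps_sign (U t) z /\ ~ keeps_sign (V t) z)).
Proof.
move=> z0 PM Pz iU iV.
have cU z' : 0 < z' -> {for z', continuous (U t)}.
  by move=> z'0; exact: is_derive_continuous (cp_U H t z'0).
have cV z' : 0 < z' -> {for z', continuous (V t)}.
  by move=> z'0; exact: is_derive_continuous (cp_V H t z'0).
have [r1 [r10 r1z Ul Ur]] := punctured_signs z0 cU iU.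
have [r2 [r20 r2z Vl Vr]] := punctured_signs z0 cV iV.
pose r := Num.min r1 r2.
have r0 : 0 < r by rewrite lt_min r10.
have rr1 : r <= r1 by rewrite ge_min lexx.
have rr2 : r <= r2 by rewrite ge_min lexx orbT.
have rz : r < z by exact: le_lt_trans rr1 r1z.
have sub1 h : 0 < h < r -> 0 < h < r1 by move=> /andP[-> /lt_le_trans->].
have sub2 h : 0 < h < r -> 0 < h < r2 by move=> /andP[-> /lt_le_trans->].
have dP (z' : R) : 0 < z' -> is_derive z' 1 (Psi t) (k z' * (U t z' * V t z')) by exact: (cp_Psi H).
have k0 z' : 0 < z' -> 0 < k z' by exact: (cp_weight H).
have right_neg h : 0 < h < r -> (forall h', 0 < h' < r -> U t (z + h') * V t (z + h') < 0) ->
    Psi t (z + h) < M.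
  move=> /andP[h0 hr] neg; rewrite -Pz.
  apply: (derive_lt0_lt (df := fun x => k x * (U t x * V t x))); first by rewrite ltrDl.
    by move=> x /andP[zx _]; apply: dP; exact: lt_le_trans zx.
  move=> x /andP[zx xh]; rewrite pmulr_rlt0 ?k0//; last exact: lt_trans zx.
  by have := neg (x - z); rewrite subrKC; apply; apply/andP; split; lra.
have right_pos : (forall h', 0 < h' < r -> 0 < U t (z + h') * V t (z + h')) -> False.
  move=> pos; have h0 : 0 < r / 2 by rewrite divr_gt0.
  have : Psi t z < Psi t (z + r / 2).
    apply: (derive_gt0_lt (df := fun x => k x * (U t x * V t x))); first by rewrite ltrDl.
      by move=> x /andP[zx _]; apply: dP; exact: lt_le_trans zx.
    move=> x /andP[zx xh]; rewrite mulr_gt0 ?k0//; first exact: lt_trans zx.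
    by have := pos (x - z); rewrite subrKC; apply; apply/andP; split; lra.
  by apply/negP; rewrite -leNgt Pz PM// addr_gt0.
have left_pos h : 0 < h < r -> (forall h', 0 < h' < r -> 0 < U t (z - h') * V t (z - h')) ->
    Psi t (z - h) < M.
  move=> /andP[h0 hr] pos; rewrite -Pz.
  apply: (derive_gt0_lt (df := fun x => k x * (U t x * V t x))); first by rewrite gtrBl.
    by move=> x /andP[zx _]; apply: dP; apply: lt_le_trans zx; lra.
  move=> x /andP[zx xh]; rewrite mulr_gt0 ?k0//; first by apply: lt_trans zx; lra.
  by have := pos (z - x); rewrite subKr; apply; apply/andP; split; lra.
have left_neg : (forall h', 0 < h' < r -> U t (z - h') * V t (z - h') < 0) -> False.
  move=> neg; have h0 : 0 < r / 2 by rewrite divr_gt0.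
  have zr : 0 < z - r / 2 by lra.
  have : Psi t z < Psi t (z - r / 2).
    apply: (derive_lt0_lt (df := fun x => k x * (U t x * V t x))); first by rewrite gtrBl.
      by move=> x /andP[zx _]; apply: dP; apply: lt_le_trans zx.
    move=> x /andP[zx xh]; rewrite pmulr_rlt0 ?k0//; last by apply: lt_trans zx.
    by have := neg (z - x); rewrite subKr; apply; apply/andP; split; lra.
  by apply/negP; rewrite -leNgt Pz PM.
have Psilt : (forall h', 0 < h' < r -> 0 < U t (z - h') * V t (z - h')) ->
    (forall h', 0 < h' < r -> U t (z + h') * V t (z + h') < 0) ->
    exists2 r, 0 < r & forall z', 0 < `|z' - z| < r -> Psi t z' < M.
  move=> hl hr; exists r => //.
  by apply: (punctured_cases (P := fun z' => Psi t z' < M)) => h hh; [exact: left_pos|exact: right_neg].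
case: Ul => Ul; case: Vl => Vl.
- have LP h : 0 < h < r -> 0 < U t (z - h) * V t (z - h).
    by move=> hh; rewrite mulr_gt0 ?Ul ?Vl ?sub1 ?sub2.
  case: Ur => Ur; case: Vr => Vr.
  + by exfalso; apply: right_pos => h hh; rewrite mulr_gt0 ?Ur ?Vr ?sub1 ?sub2.
  + split; first by apply: Psilt => // h hh; rewrite nmulr_llt0 ?Ur ?Vr ?sub1 ?sub2.
    right; split.
      exists r => //; left; apply: (punctured_cases (P := fun x => 0 < U t x)) => h hh.
        by apply: Ul; exact: sub1.
      by apply: Ur; exact: sub1.
    by apply: (not_keeps_signP r20); left.
  + split; first by apply: Psilt => // h hh; rewrite pmulr_llt0 ?Ur ?Vr ?sub1 ?sub2.
    left; split.
      exists r => //; left; apply: (punctured_cases (P := fun x => 0 < V t x)) => h hh.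
        by apply: Vl; exact: sub2.
      by apply: Vr; exact: sub2.
    by apply: (not_keeps_signP r10); left.
  + by exfalso; apply: right_pos => h hh; rewrite nmulr_lgt0 ?Ur ?Vr ?sub1 ?sub2.
- by exfalso; apply: left_neg => h hh; rewrite nmulr_llt0 ?Ul ?Vl ?sub1 ?sub2.
- by exfalso; apply: left_neg => h hh; rewrite pmulr_llt0 ?Ul ?Vl ?sub1 ?sub2.
- have LP h : 0 < h < r -> 0 < U t (z - h) * V t (z - h).
    by move=> hh; rewrite nmulr_lgt0 ?Ul ?Vl ?sub1 ?sub2.
  case: Ur => Ur; case: Vr => Vr.
  + by exfalso; apply: right_pos => h hh; rewrite mulr_gt0 ?Ur ?Vr ?sub1 ?sub2.
  + split; first by apply: Psilt => // h hh; rewrite nmulr_llt0 ?Ur ?Vr ?sub1 ?sub2.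
    left; split.
      exists r => //; right; apply: (punctured_cases (P := fun x => V t x < 0)) => h hh.
        by apply: Vl; exact: sub2.
      by apply: Vr; exact: sub2.
    by apply: (not_keeps_signP r10); right.
  + split; first by apply: Psilt => // h hh; rewrite pmulr_llt0 ?Ur ?Vr ?sub1 ?sub2.
    right; split.
      exists r => //; right; apply: (punctured_cases (P := fun x => U t x < 0)) => h hh.
        by apply: Ul; exact: sub1.
      by apply: Ur; exact: sub1.
    by apply: (not_keeps_signP r20); right.
  + by exfalso; apply: right_pos => h hh; rewrite nmulr_lgt0 ?Ur ?Vr ?sub1 ?sub2.
Qed.

End Fixed.
End Extremum.

Section Extremum.
Context {R : realType}.

Section Fixed.
Variables (s : R) (k : R -> R) (U U1 U2 V V1 V2 Psi : R -> R -> R).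
Hypothesis H : caloric_pair s k U U1 U2 V V1 V2 Psi.

(** On the two sides z - r and z + r, the strict inequalities V > 0 and Psi < M persist for slightly
    earlier times. The minimum principle then spreads V >= 0 over the rectangle, in which the
    maximum propagates backwards. The number [d0] delimits the times at which [M] is known to be a
    bound. *)
Lemma extend_back_pos (M t z d0 : R) : 0 < z -> 0 < d0 ->
  (forall t' z', t - d0 <= t' <= t -> 0 < z' -> Psi t' z' <= M) -> Psi t z = M ->
  (exists2 r, 0 < r & forall z', 0 < `|z' - z| < r -> Psi t z' < M) ->
  (exists2 r, 0 < r & forall z', 0 < `|z' - z| < r -> 0 < V t z') ->
  exists d r, [/\ 0 < d, 0 < r,
    forall t' z', t - d <= t' <= t -> `|z' - z| < r -> 0 <= V t' z' &
    forall t', t - d <= t' <= t -> exists z', [/\ 0 < z', `|z' - z| < r & Psi t' z' = M]].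
Proof.
move=> z0 d00 PM Pz [r1 r10 hr1] [r2 r20 hr2].
pose r := Num.min (Num.min r1 r2) z / 2.
have m0 : 0 < Num.min (Num.min r1 r2) z by rewrite !lt_min r10 r20.
have r0 : 0 < r by rewrite divr_gt0.
have m1 : Num.min (Num.min r1 r2) z <= r1 by rewrite !ge_min lexx.
have m2 : Num.min (Num.min r1 r2) z <= r2 by rewrite !ge_min lexx orbT.
have m3 : Num.min (Num.min r1 r2) z <= z by rewrite ge_min lexx orbT.
have rr1 : r < r1 by exact: lt_le_trans (half_lt m0) m1.
have rr2 : r < r2 by exact: lt_le_trans (half_lt m0) m2.
have zr : 0 < z - r by rewrite subr_gt0 (lt_le_trans (half_lt m0) m3).
have zr' : 0 < z + r by rewrite addr_gt0.
have el : `|z - r - z| = r by rewrite [z - r]addrC addrK normrN gtr0_norm.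
have er : `|z + r - z| = r by rewrite [z + r]addrC addrK gtr0_norm.
have timegt x : 0 < x -> 0 < V t x -> exists2 d, 0 < d & forall t', `|t' - t| < d -> 0 < V t' x.
  move=> x0 Vx.
  have /cvgr_gt/(_ _ Vx)/nbhs_ballP[d /= dd hd] : {for t, continuous (V ^~ x)}.
    exact: is_derive_continuous (cp_Vt H t x0).
  by exists d => // t' ht'; apply: hd; rewrite /ball/= distrC.
have timelt x : 0 < x -> Psi t x < M -> exists2 d, 0 < d & forall t', `|t' - t| < d -> Psi t' x < M.
  move=> x0 Vx.
  have /cvgr_lt/(_ _ Vx)/nbhs_ballP[d /= dd hd] : {for t, continuous (Psi ^~ x)}.
    exact: is_derive_continuous (cp_Psit H t x0).
  by exists d => // t' ht'; apply: hd; rewrite /ball/= distrC.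
have hl2 : 0 < `|z - r - z| < r2 by rewrite el r0.
have hl1 : 0 < `|z - r - z| < r1 by rewrite el r0.
have hr2' : 0 < `|z + r - z| < r2 by rewrite er r0.
have hr1' : 0 < `|z + r - z| < r1 by rewrite er r0.
have [e1 e10 he1] := timegt _ zr (hr2 _ hl2).
have [e2 e20 he2] := timegt _ zr' (hr2 _ hr2').
have [e3 e30 he3] := timelt _ zr (hr1 _ hl1).
have [e4 e40 he4] := timelt _ zr' (hr1 _ hr1').
pose d := Num.min (Num.min (Num.min e1 e2) (Num.min e3 e4)) d0 / 2.
have n0 : 0 < Num.min (Num.min (Num.min e1 e2) (Num.min e3 e4)) d0 by rewrite !lt_min e10 e20 e30 e40.
have d1 : 0 < d by rewrite divr_gt0.
have n1 : Num.min (Num.min (Num.min e1 e2) (Num.min e3 e4)) d0 <= e1 by rewrite !ge_min lexx.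
have n2 : Num.min (Num.min (Num.min e1 e2) (Num.min e3 e4)) d0 <= e2 by rewrite !ge_min lexx !orbT.
have n3 : Num.min (Num.min (Num.min e1 e2) (Num.min e3 e4)) d0 <= e3 by rewrite !ge_min lexx !orbT.
have n4 : Num.min (Num.min (Num.min e1 e2) (Num.min e3 e4)) d0 <= e4 by rewrite !ge_min lexx !orbT.
have n5 : Num.min (Num.min (Num.min e1 e2) (Num.min e3 e4)) d0 <= d0 by rewrite !ge_min lexx !orbT.
have de1 : d < e1 by exact: lt_le_trans (half_lt n0) n1.
have de2 : d < e2 by exact: lt_le_trans (half_lt n0) n2.
have de3 : d < e3 by exact: lt_le_trans (half_lt n0) n3.
have de4 : d < e4 by exact: lt_le_trans (half_lt n0) n4.
have dd0 : d <= d0 by exact: le_trans (ltW (half_lt n0)) n5.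
have near_t e t' : d < e -> t - d <= t' <= t -> `|t' - t| < e.
  by move=> de /andP[h1 h2]; rewrite ler0_norm ?subr_le0// opprB ltrBlDr -ltrBlDl (lt_le_trans _ h1)// ltrD2l ltrN2.
have zrzr : z - r <= z + r by rewrite (@le_trans _ _ z)// ?gerBl ?lerDl ltW.
have tdt : t - d <= t by rewrite gerBl ltW.
have V0 t' z' : t - d <= t' <= t -> z - r <= z' <= z + r -> 0 <= V t' z'.
  apply: (backward_caloric_ge0 H zr zrzr tdt).
  (* At the centre, which the strict positivity leaves out, V t z >= 0 follows by continuity. *)
  - move=> x /andP[h1 h2]; have [->|xz] := eqVneq x z; last first.
      apply/ltW/hr2; rewrite normr_gt0 subr_eq0 xz/= (le_lt_trans _ rr2)//.
      by rewrite ler_distl h1.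
    rewrite leNgt; apply/negP => Vz.
    have /cvgr_lt/(_ _ Vz)/nbhs_ballP[e /= ee he] : {for z, continuous (V t)}.
      exact: is_derive_continuous (cp_V H t z0).
    pose h := Num.min e r2 / 2.
    have m4 : 0 < Num.min e r2 by rewrite lt_min ee.
    have m5 : Num.min e r2 <= e by rewrite ge_min lexx.
    have m6 : Num.min e r2 <= r2 by rewrite ge_min lexx orbT.
    have h0 : 0 < h by rewrite divr_gt0.
    have eh : `|z + h - z| = h by rewrite [z + h]addrC addrK gtr0_norm.
    have : 0 < V t (z + h) by apply: hr2; rewrite eh h0/= (lt_le_trans (half_lt m4)).
    apply/negP; rewrite -leNgt ltW//; apply: he.
    by rewrite /ball/= distrC eh (lt_le_trans (half_lt m4)).
  - by move=> t'' ht''; apply/ltW/he1/near_t.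
  - by move=> t'' ht''; apply/ltW/he2/near_t.
exists d, r; split => //.
- move=> t' z' ht' hz'; apply: V0 => //.
  by move: hz'; rewrite ltr_distl => /andP[/ltW-> /ltW->].
- move=> t' /andP[ht'1 ht'2].
  have sub t'' : t' <= t'' <= t -> t - d <= t'' <= t by move=> /andP[h1 ->]; rewrite (le_trans ht'1).
  have sub0 t'' : t' <= t'' <= t -> t - d0 <= t'' <= t.
    by move=> /sub/andP[h1 ->]; rewrite andbT (le_trans _ h1)// lerD2l lerN2.
  have [|||||z' /andP[h1 h2] Pz'] := max_propagates_back H (M := M) zr zrzr ht'2.
  - by move=> t'' x /sub; exact: V0.
  - by move=> t'' /sub ht''; apply/he3/near_t.
  - by move=> t'' /sub ht''; apply/he4/near_t.
  - by move=> t'' x /sub0 ht'' /andP[hx _]; apply: PM => //; exact: lt_le_trans hx.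
  - by exists z => //; rewrite gerBl lerDl ltW.
  - exists z'; split => //; first exact: lt_trans h1.
    by rewrite ltr_distl h1.
Qed.

End Fixed.

Lemma keeps_sign_opp (F : R -> R) z : keeps_sign (fun x => - F x) z -> keeps_sign F z.
Proof.
move=> [r r0 [h|h]]; exists r => //; [right|left] => x /h.
  by rewrite oppr_ge0.
by rewrite oppr_le0.
Qed.

Lemma extend_back s k U U1 U2 V V1 V2 Psi (M t z d0 : R) :
  caloric_pair s k U U1 U2 V V1 V2 Psi -> 0 < z -> 0 < d0 ->
  (forall t' z', t - d0 <= t' <= t -> 0 < z' -> Psi t' z' <= M) -> Psi t z = M ->
  (exists2 r, 0 < r & forall z', 0 < `|z' - z| < r -> Psi t z' < M) ->
  strictly_keeps_sign (V t) z ->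
  exists d r, [/\ 0 < d, 0 < r,
    forall t' z', t - d <= t' <= t -> `|z' - z| < r -> keeps_sign (V t') z' &
    forall t', t - d <= t' <= t -> exists z', [/\ 0 < z', `|z' - z| < r & Psi t' z' = M]].
Proof.
move=> H z0 d00 PM Pz Plt [r r0 Vs].
have keep (F : R -> R -> R) d' r' : (forall t' z', t - d' <= t' <= t -> `|z' - z| < r' -> 0 <= F t' z') ->
    forall t' z', t - d' <= t' <= t -> `|z' - z| < r' -> keeps_sign (F t') z'.
  move=> F0 t' z' ht' hz'; exists (r' - `|z' - z|); first by rewrite subr_gt0.
  left => x hx; apply: F0 => //.
  by rewrite -(subrK z' x) -addrA (le_lt_trans (ler_normD _ _))// -ltrBrDr.
case: Vs => Vs.
- have [|d [r' [d1 r'0 h1 h2]]] := extend_back_pos H z0 d00 PM Pz Plt; first by exists r.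
  by exists d, r'; split => //; exact: keep.
- have [|d [r' [d1 r'0 h1 h2]]] := extend_back_pos (caloric_pair_opp H) z0 d00 PM Pz Plt.
    by exists r => // x /Vs; rewrite oppr_gt0.
  exists d, r'; split => // t' z' ht' hz'; apply: keeps_sign_opp.
  exact: (keep (fun t x => - V t x) _ _ h1).
Qed.

(** Time reversal exchanges U and V: this is [extend_back] for the reversed pair at time - t. *)
Lemma extend_forth s k U U1 U2 V V1 V2 Psi (M t z d0 : R) :
  caloric_pair s k U U1 U2 V V1 V2 Psi -> 0 < z -> 0 < d0 ->
  (forall t' z', t <= t' <= t + d0 -> 0 < z' -> Psi t' z' <= M) -> Psi t z = M ->
  (exists2 r, 0 < r & forall z', 0 < `|z' - z| < r -> Psi t z' < M) ->
  strictly_keeps_sign (U t) z ->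
  exists d r, [/\ 0 < d, 0 < r,
    forall t' z', t <= t' <= t + d -> `|z' - z| < r -> keeps_sign (U t') z' &
    forall t', t <= t' <= t + d -> exists z', [/\ 0 < z', `|z' - z| < r & Psi t' z' = M]].
Proof.
move=> H z0 d00 PM Pz Plt Us.
have [||||d [r [d1 r0 h1 h2]]] := @extend_back _ _ _ _ _ _ _ _ _ M (- t) z d0 (caloric_pair_rev H) z0 d00.
- move=> t' z' ht' z'0; apply: PM => //; lra.
- by rewrite opprK.
- by rewrite opprK.
- by rewrite opprK.
exists d, r; split => //.
- move=> t' z' ht'; have := h1 (- t') z'; rewrite opprK; apply; lra.
- move=> t' ht'; have := h2 (- t'); rewrite opprK; apply; lra.
Qed.

(* If V keeps its sign at a maximum point, the maximum is attained at all slightly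
   earlier times, and at all slightly later ones if U keeps its sign. Hence U keeps
   its sign at the first maximizing time (at time a this is a hypothesis), and the
   supremum of the maximizing times at which U keeps its sign gives a contradiction. *)
Theorem caloric_pair_le0 s k U U1 U2 V V1 V2 Psi (a b : R) :
  caloric_pair s k U U1 U2 V V1 V2 Psi -> a < b ->
  (forall e, 0 < e -> exists z1 z2, [/\ 0 < z1, z1 <= z2 &
     forall t z, a <= t <= b -> 0 < z -> (z < z1) || (z2 < z) -> Psi t z < e]) ->
  (forall z, 0 < z -> Psi b z = 0) ->
  (forall t z, 0 < z -> (forall z', 0 < z' -> U t z' = 0) \/ isolated_zero (U t) z) ->
  (forall t z, 0 < z -> (forall z', 0 < z' -> V t z' = 0) \/ isolated_zero (V t) z) ->
  (forall z, 0 < z -> keeps_sign (U a) z) ->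
  forall t z, a <= t <= b -> 0 < z -> Psi t z <= 0.
Proof.
move=> H ab decay Pb isoU isoV Ua t1 z1 ht1 z10; rewrite leNgt; apply/negP => P1.
have [zl [zh [zl0 zlh out]]] := decay _ P1.
have in_zlh t z : a <= t <= b -> 0 < z -> Psi t1 z1 <= Psi t z -> zl <= z <= zh.
  move=> ht z0 Ptz; rewrite !leNgt -negb_or; apply/negP => /(out t z ht z0).
  by rewrite ltNge Ptz.
have [|t [z [ht hz Pmax]]] := @EVT_max_rect _ Psi a b zl zh (ltW ab) zlh.
  by move=> t z _ /andP[hz _]; apply: (cp_Psic H); exact: lt_le_trans hz.
pose M := Psi t z; have M0 : 0 < M.
  by apply: (lt_le_trans P1); apply: Pmax => //; apply: (in_zlh t1).
have PM t' z' : a <= t' <= b -> 0 < z' -> Psi t' z' <= M.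
  move=> ht' z'0; have [h|h] := leP (Psi t1 z1) (Psi t' z').
    by apply: Pmax => //; apply: (in_zlh t').
  by apply: (le_trans (ltW h)); apply: Pmax => //; apply: (in_zlh t1).
have M_in t' z' : a <= t' <= b -> 0 < z' -> Psi t' z' = M -> zl <= z' <= zh.
  by move=> ht' z'0 Pz'; apply: (in_zlh t') => //; rewrite Pz' PM.
(* Neither factor vanishes identically at a maximizing time: Psi would be constant in z there, equal
   to M > 0, against its decay at 0. *)
have iso t' z' : a <= t' <= b -> 0 < z' -> Psi t' z' = M ->
    isolated_zero (U t') z' /\ isolated_zero (V t') z'.
  move=> ht' z'0 Pz'.
  have nz : ~ (forall x, 0 < x -> U t' x * V t' x = 0).
    move=> UV0; have [zl' [zh' [zl'0 zlh' out']]] := decay _ M0.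
    pose x := Num.min z' zl' / 2.
    have m0 : 0 < Num.min z' zl' by rewrite lt_min z'0.
    have m1 : Num.min z' zl' <= z' by rewrite ge_min lexx.
    have m2 : Num.min z' zl' <= zl' by rewrite ge_min lexx orbT.
    have x0 : 0 < x by rewrite divr_gt0.
    have xz' : x < z' by rewrite /x; lra.
    have [|c /andP[xc _]] := @MVT_derive _ (Psi t') (fun z => k z * (U t' z * V t' z)) x z' xz'.
      by move=> y /andP[xy _]; apply: (cp_Psi H); exact: lt_le_trans xy.
    rewrite UV0; last exact: lt_trans xc.
    rewrite mulr0 mul0r Pz' => /eqP; rewrite subr_eq0 => /eqP Mx.
    have xl : (x < zl') || (zh' < x) by apply/orP; left; rewrite /x; lra.
    by have := out' t' x ht' x0 xl; rewrite -Mx ltxx.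
  by case: (isoU t' z' z'0) => [U0|?]; case: (isoV t' z' z'0) => [V0|?] //;
    exfalso; apply: nz => x x0; rewrite ?U0 ?V0// ?mul0r ?mulr0.
have dich t' z' (ht' : a <= t' <= b) (z'0 : 0 < z') (Pz' : Psi t' z' = M) :=
  max_sign_dichotomy H z'0 (fun x => PM t' x ht') Pz'
    (proj1 (iso t' z' ht' z'0 Pz')) (proj2 (iso t' z' ht' z'0 Pz')).
have strict_keeps (F : R -> R -> R) t' z' : {for z', continuous (F t')} ->
    strictly_keeps_sign (F t') z' -> keeps_sign (F t') z'.
  move=> cF [r r0 hF]; exists r => //.
  have z'z z'' : `|z'' - z'| < r -> z'' != z' -> 0 < `|z'' - z'| < r.
    by move=> -> zz; rewrite normr_gt0 subr_eq0 zz.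
  pose h := fun e => Num.min e r / 2.
  have hh e : 0 < e -> [/\ 0 < h e < e & 0 < h e < r].
    move=> e0; have m0 : 0 < Num.min e r by rewrite lt_min e0.
    have m1 : Num.min e r <= e by rewrite ge_min lexx.
    have m2 : Num.min e r <= r by rewrite ge_min lexx orbT.
    by split; rewrite /h; lra.
  have eh e : 0 < e -> `|z' + h e - z'| = h e.
    by case/hh => /andP[he0 _] _; rewrite [z' + _]addrC addrK gtr0_norm.
  case: hF => hF; [left|right] => x xr; have [xz|xz] := eqVneq x z'.
  - rewrite xz leNgt; apply/negP => Fz.
    have /cvgr_lt/(_ _ Fz)/nbhs_ballP[e /= e0 he] := cF.
    have [/andP[h1 h2] h3] := hh e e0.
    have : 0 < F t' (z' + h e) by apply: hF; rewrite eh.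
    by apply/negP; rewrite -leNgt ltW//; apply: he; rewrite /ball/= distrC eh.
  - by apply/ltW/hF/z'z.
  - rewrite xz leNgt; apply/negP => Fz.
    have /cvgr_gt/(_ _ Fz)/nbhs_ballP[e /= e0 he] := cF.
    have [/andP[h1 h2] h3] := hh e e0.
    have : F t' (z' + h e) < 0 by apply: hF; rewrite eh.
    by apply/negP; rewrite -leNgt ltW//; apply: he; rewrite /ball/= distrC eh.
  - by apply/ltW/hF/z'z.
have ltM_near t' z' : 0 < z' -> Psi t' z' < M -> exists2 e, 0 < e &
    forall u v, `|u - t'| < e -> `|v - z'| < e -> Psi u v < M.
  move=> z'0 PzM.
  exact: continuous2_lt (cp_Psic H z'0) PzM.
pose E := [set t' | a <= t' <= b /\ exists z', 0 < z' /\ Psi t' z' = M].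
have Et : E t by split => //; exists z; split => //; case/andP: hz => /(lt_le_trans zl0).
have lbE : lbound E a by move=> x [/andP[]].
have infE : has_inf E by split; [exists t|exists a].
pose t0 := inf E.
have at0 : a <= t0 by apply: lb_le_inf lbE; exists t.
have t0b : t0 <= b by case/andP: ht => _; apply: le_trans; apply: ge_inf Et; exists a.
(* The infimum is attained: otherwise Psi < M for all heights in [zl, zh] on a whole strip of times
   around [t0]. *)
have [z0 [z00 Pt0]] : exists z0, 0 < z0 /\ Psi t0 z0 = M.
  apply: contrapT => noM.
  have [y hy|e e0 he] := @near_cover_rect R (fun t z => Psi t z < M) t0 zl zh.
    have y0 : 0 < y by case/andP: hy => /(lt_le_trans zl0).
    apply: ltM_near => //; rewrite lt_neqAle PM ?at0 ?t0b// andbT.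
    by apply/eqP => Py; apply: noM; exists y.
  have [x [hx [y [y0 Pxy]]] xe] := inf_adherent e0 infE.
  have := he x y; rewrite Pxy ltxx (M_in x y hx y0 Pxy) => h.
  suff : false by []; apply: h => //; rewrite ger0_norm ?subr_ge0; last first.
    by apply: ge_inf; [exists a|split => //; exists y].
  by rewrite ltrBlDl.
have ht0 : a <= t0 <= b by rewrite at0.
have keepU0 : keeps_sign (U t0) z0.
  have [Plt [[Vs nU]|[Us _]]] := dich t0 z0 ht0 z00 Pt0.
    have at0' : a < t0.
      rewrite lt_neqAle at0 andbT; apply/eqP => at0e; apply: nU; rewrite -at0e; exact: Ua.
    have d00 : 0 < t0 - a by rewrite subr_gt0.
    have PM0 t' z' : t0 - (t0 - a) <= t' <= t0 -> 0 < z' -> Psi t' z' <= M.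
      by move=> h; apply: PM; lra.
    have [d [r [d0 r0 _ h2]]] := extend_back H z00 d00 PM0 Pt0 Plt Vs.
    pose t' := Num.max a (t0 - d).
    have ht' : t0 - d <= t' <= t0 by rewrite le_max lexx orbT ge_max at0 gerBl ltW.
    have [z' [z'0 _ Pz']] := h2 t' ht'.
    have t't0 : t' < t0 by rewrite gt_max at0' ltrBlDr ltrDl.
    have : t0 <= t'.
      apply: ge_inf; first by exists a.
      by split; [rewrite le_max lexx (le_trans (ltW t't0))|exists z'].
    by rewrite leNgt t't0.
  apply: strict_keeps => //; exact: is_derive_continuous (cp_U H t0 z00).
pose T := [set t' | a <= t' <= b /\ exists z', [/\ 0 < z', Psi t' z' = M & keeps_sign (U t') z']].
have Tt0 : T t0 by split => //; exists z0.
have ubT : ubound T b by move=> x [/andP[]].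
have supT : has_sup T by split; [exists t0|exists b].
pose ts := sup T.
have ats : a <= ts by apply: (le_trans at0); apply: ub_le_sup Tt0; exists b.
have tsb : ts <= b by apply: ge_sup ubT; exists t0.
have hts : a <= ts <= b by rewrite ats.
(* Each height has a neighbourhood in which no point at a time up to [ts] is counted in [T]; by
   compactness this contradicts the choice of [ts] as the supremum of [T]. *)
have [y hy|e e0 he] := @near_cover_rect R
    (fun t z => t <= ts -> ~ [/\ a <= t <= b, 0 < z, Psi t z = M & keeps_sign (U t) z]) ts zl zh.
  have y0 : 0 < y by case/andP: hy => /(lt_le_trans zl0).
  have [Py|Py] := eqVneq (Psi ts y) M; last first.
    have [|e e0 he] := ltM_near ts y y0; first by rewrite lt_neqAle Py PM.
    exists e => // u v hu hv _ [_ _ Puv _].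
    by have := he u v hu hv; rewrite Puv ltxx.
  have [Plt [[Vs nU]|[Us nV]]] := dich ts y hts y0 Py.
    have ats' : a < ts.
      rewrite lt_neqAle ats andbT; apply/eqP => ae; apply: nU; rewrite -ae; exact: Ua.
    have d00 : 0 < ts - a by rewrite subr_gt0.
    have PM0 t' z' : ts - (ts - a) <= t' <= ts -> 0 < z' -> Psi t' z' <= M.
      by move=> h; apply: PM; lra.
    have [d [r [d0 r0 h1 _]]] := extend_back H y0 d00 PM0 Py Plt Vs.
    exists (Num.min d r); first by rewrite lt_min d0.
    move=> u v; rewrite !lt_min => /andP[ud _] /andP[_ vr] uts [hu v0 Puv kU].
    (* At such a point both factors would keep their signs, whereas the dichotomy makes one of them
       change sign. *)
    have kV : keeps_sign (V u) v.
      by apply: h1 => //; rewrite uts andbT; move: ud; rewrite ltr_norml; lra.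
    by have [_ [[_ nU']|[_ nV']]] := dich u v hu v0 Puv; [exact: nU'|exact: nV'].
  (* Here U keeps its sign, so the maximum persists at later times with U still keeping its sign,
     and [ts] would not be an upper bound of [T]. There is room after [ts] because Psi vanishes at
     time b. *)
  exfalso.
  have tsb' : ts < b.
    rewrite lt_neqAle tsb andbT; apply/eqP => eb.
    by move: M0; rewrite -Py eb Pb// ltxx.
  have d00 : 0 < b - ts by rewrite subr_gt0.
  have PM0 t' z' : ts <= t' <= ts + (b - ts) -> 0 < z' -> Psi t' z' <= M.
    by move=> h; apply: PM; lra.
  have [d [r [d0 r0 h1 h2]]] := extend_forth H y0 d00 PM0 Py Plt Us.
  pose t' := Num.min b (ts + d).
  have ht' : ts <= t' <= ts + d by rewrite le_min tsb lerDl (ltW d0) ge_min lexx orbT.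
  have tst' : ts < t' by rewrite lt_min tsb' ltrDl.
  have [z' [z'0 z'r Pz']] := h2 t' ht'.
  have : t' <= ts.
    apply: ub_le_sup; first by exists b.
    split; first by rewrite ge_min lexx andbT (le_trans ats (ltW tst')).
    by exists z'; split => //; exact: h1.
  by rewrite leNgt tst'.
have [x [hx [y [y0 Pxy kU]]] xe] := sup_adherent e0 supT.
have xts : x <= ts by apply: ub_le_sup; [exists b|split => //; exists y].
apply: (he x y _ (M_in x y hx y0 Pxy) xts); last by split.
by rewrite distrC ger0_norm ?subr_ge0// ltrBlDl -ltrBlDr.
Qed.

End Extremum.

(** * Potentials of bounded densities *)

Section PowerWeight.
Context {R : realType}.
Notation mu := (@lebesgue_measure R).
Variable s : R.
Hypothesis s1 : 1 < s.

(** Common integrable majorant of the kernels below; its integral over the line is of order z^(1 -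
    s), whence the rates in z of the later estimates. *)
Definition pweight (z x : R) : R := (z + `|x|) `^ (- s).

Lemma pweight_gt0 z x : 0 < z -> 0 < pweight z x.
Proof. by move=> z0; rewrite powR_gt0// ltr_wpDr. Qed.

Lemma pweight_continuous z : 0 < z -> continuous (pweight z).
Proof.
move=> z0 x; have zx : 0 < z + `|x| by rewrite ltr_wpDr.
apply: (@continuous_comp _ _ _ (fun x => z + `|x|) (fun y => y `^ (- s))).
  by apply: cvgD; [exact: cvg_cst|exact: norm_continuous].
exact: is_derive_continuous (is_derive1_powR (- s) zx).
Qed.

Lemma powR_cvg_pinfty0 (z p : R) : 0 < p -> (z + x) `^ (- p) @[x --> +oo] --> (0 : R).
Proof.
move=> p0; apply/cvgrPdist_le => e e0.
pose M := e `^ (- p^-1).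
have M0 : 0 < M by rewrite powR_gt0.
near=> x; have Mx : M <= z + x by rewrite -lerBlDl; near: x; apply: nbhs_pinfty_ge; exact: num_real.
have zx0 : 0 < z + x by exact: lt_le_trans Mx.
rewrite sub0r normrN ger0_norm ?powR_ge0// powRN -[leRHS]invrK lef_pV2 ?posrE ?powR_gt0 ?invr_gt0//.
have -> : e^-1 = M `^ p.
  by rewrite /M -powRrM mulNr mulVf ?gt_eqF// powR_inv1 ?ltW.
by apply: ge0_ler_powR => //; rewrite ?nnegrE; exact: ltW.
Unshelve. all: by end_near. Qed.

Lemma integral_pweight z : 0 < z ->
  (\int[mu]_x (pweight z x)%:E = (2 * (z `^ (1 - s) / (s - 1)))%:E)%E.
Proof.
move=> z0; have s10 : 0 < s - 1 by rewrite subr_gt0.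
rewrite ge0_symfun_integralT.
- rewrite -set_itvcy EFinM; congr (_ * _)%E.
  pose f x := (z + x) `^ (- s); pose F x := - ((z + x) `^ (1 - s) / (s - 1)).
  have df (x : R) : 0 <= x -> is_derive x 1 F (f x).
    move=> x0; have zx : 0 < z + x by rewrite ltr_wpDr.
    have h1 : is_derive x 1 (fun y => z + y) (1 : R).
      by apply: (is_derive_eq (is_deriveD (is_derive_cst z x 1) (is_derive_id x 1))); rewrite add0r.
    have h2 := @is_derive1_comp _ (fun y => y `^ (1 - s)) (fun y => z + y) x _ _ (is_derive1_powR (1 - s) zx) h1.
    have h3 := is_deriveZ (- (s - 1)^-1) h2.
    have -> : F = (- (s - 1)^-1 \*: ((fun y => y `^ (1 - s)) \o (fun y => z + y))).
      by apply/funext => y; rewrite /F /= mulrC -mulNr.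
    apply: (is_derive_eq h3); rewrite mulr1 /f.
    have -> : 1 - s - 1 = - s by ring.
    rewrite [LHS]mulrA -[RHS]mul1r; congr (_ * _).
    by rewrite -(opprB s 1) mulrNN mulVf ?gt_eqF.
  transitivity (\int[mu]_(x in `[0%R, +oo[) (f x)%:E)%E.
    by apply: eq_integral => x /set_mem/=; rewrite in_itv/= andbT /pweight => x0; rewrite ger0_norm.
  rewrite (@ge0_continuous_FTC2y _ f F 0 0).
  + by rewrite -EFinB sub0r /F addr0 opprK.
  + by move=> x x0; exact: powR_ge0.
  + apply: continuous_in_subspaceT => x /set_mem/=; rewrite in_itv/= andbT => x0.
    have zx : 0 < z + x by rewrite ltr_wpDr.
    apply: (@continuous_comp _ _ _ (fun x => z + x) (fun y => y `^ (- s))).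
      by apply: cvgD; [exact: cvg_cst|exact: cvg_id].
    exact: is_derive_continuous (is_derive1_powR (- s) zx).
  + rewrite /F -oppr0 -[in X in _ --> X](mul0r (s - 1)^-1); apply: cvgN; apply: cvgMl.
    have -> : 1 - s = - (s - 1) by ring.
    exact: powR_cvg_pinfty0.
  + by move=> x x0; have [] := df x (ltW x0).
  + apply: cvg_at_right_filter; exact: is_derive_continuous (df 0 (lexx _)).
  + move=> x; rewrite in_itv/= andbT => x0.
    by rewrite derive1E; have [_ ->] := df x (ltW x0).
- by move=> x; exact/ltW/pweight_gt0.
- exact: pweight_continuous.
- by move=> x; rewrite /pweight /= normrN.
Qed.

Lemma integral_pweight_translate z t : 0 < z ->
  (\int[mu]_x (pweight z (t - x))%:E = (2 * (z `^ (1 - s) / (s - 1)))%:E)%E.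
Proof.
move=> z0; rewrite -(integral_pweight z0).
have d (x : R) : is_derive x 1 (fun y => y - t) (1 : R).
  by apply: (is_derive_eq (is_deriveB (is_derive_id x 1) (is_derive_cst t x 1))); rewrite subr0.
have d1 : derive1 (fun y : R => y - t) = cst 1.
  by apply/funext => x; rewrite derive1E; have [_ ->] := d x.
rewrite [RHS](@increasing_ge0_integration_by_substitutionT _ (fun y => y - t)).
- apply: eq_integral => x _; rewrite !fctE d1 /= mulr1 /pweight.
  by rewrite distrC.
- by move=> x y xy; rewrite ltrD2r.
- by rewrite d1; exact: cst_continuous.
- by rewrite d1; exact: is_cvg_cst.
- by rewrite d1; exact: is_cvg_cst.
- by move=> x; have [] := d x.
- exact: cvg_addrr_Ny.
- exact: cvg_addrr.
- exact: pweight_continuous.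
- by move=> x; exact/ltW/pweight_gt0.
Qed.

Lemma integrable_pweight z t : 0 < z ->
  mu.-integrable setT (EFin \o (fun x => pweight z (t - x))).
Proof.
move=> z0; have mf : measurable_fun [set: R] (fun x => pweight z (t - x)).
  apply: continuous_measurable_fun => x.
  apply: (@continuous_comp _ _ _ (fun x => t - x) (pweight z)); last exact: pweight_continuous.
  by apply: cvgB; [exact: cvg_cst|exact: cvg_id].
apply/integrableP; split; first exact/measurable_EFinP.
under eq_integral => x _ do rewrite /= ger0_norm ?(ltW (pweight_gt0 _ z0))//.
by rewrite integral_pweight_translate// ltry.
Qed.

End PowerWeight.

(** * The kernel and its derivatives *)

Section Kernel.
Context {R : realType}.
Notation mu := (@lebesgue_measure R).
Variable s : R.
Hypothesis s1 : 1 < s.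
Hypothesis s2 : s <= 2.

(* With A the elapsed time, pot 0 t z below solves U_t = z U_zz + s U_z; the index
   n counts the derivatives -d/dz. *)
Definition hk (n : nat) (z A : R) : R :=
  if 0 < A then A `^ (- (s + n%:R)) * expR (- (z / A)) else 0.

Lemma hk_ge0 n z A : 0 <= hk n z A.
Proof. by rewrite /hk; case: ifPn => // A0; rewrite mulr_ge0 ?powR_ge0 ?expR_ge0. Qed.

Lemma hk0 n z A : A <= 0 -> hk n z A = 0.
Proof. by move=> A0; rewrite /hk ltNge A0. Qed.

Lemma hkS n z A : 0 < A -> hk n.+1 z A = hk n z A / A.
Proof.
move=> A0; rewrite /hk A0 -natr1.
have -> : - (s + (n%:R + 1)) = - (s + n%:R) + (- 1) :> R by ring.
rewrite powRD; last by rewrite (gt_eqF A0) implybT.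
by rewrite powR_inv1 ?ltW// mulrAC.
Qed.

Lemma hkE n z A : 0 < A -> hk n z A = hk 0 z A * A^-1 ^+ n.
Proof.
move=> A0; elim: n => [|n IH]; first by rewrite expr0 mulr1.
by rewrite hkS// IH exprSr mulrA.
Qed.

(** With x = z / A, one has x^n (1 + x)^s <= (1 + x)^(n + 2), as s <= 2, and (1 + x)^(n + 2) / (n +
    2)! <= e^(1 + x). Both factors of the constant come from there. *)
Definition hkC (n : nat) : R := (n.+2)`!%:R * expR 1.

Lemma hkC_gt0 n : 0 < hkC n.
Proof. by rewrite mulr_gt0 ?expR_gt0// ltr0n fact_gt0. Qed.

Lemma hk_le n z A : 0 < z -> hk n z A <= hkC n * z^-1 ^+ n * pweight s z A.
Proof.
move=> z0; have [A0|A0] := leP A 0.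
  by rewrite hk0// mulr_ge0 ?mulr_ge0 ?(ltW (hkC_gt0 _)) ?(ltW (pweight_gt0 _ _ z0))// exprn_ge0// invr_ge0 ltW.
pose x := z / A; have x0 : 0 < x by rewrite divr_gt0.
have x1 : 0 < 1 + x by rewrite addr_gt0.
have key : x ^+ n * expR (- x) <= hkC n * (1 + x) `^ (- s).
  have h1 : (1 + x) `^ s * x ^+ n <= (1 + x) ^+ n.+2.
    rewrite -addn2 exprD mulrC; apply: ler_pM.
    - by rewrite exprn_ge0// ltW.
    - exact: powR_ge0.
    - by apply: lerXn2r; rewrite ?nnegrE ?(ltW x0) ?(ltW x1)// lerDr.
    - rewrite -powR_mulrn ?(ltW x1)//; apply: ler_powR => //; rewrite lerDl; exact: ltW.
  have h2 : (1 + x) ^+ n.+2 <= hkC n * expR x.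
    rewrite /hkC -mulrA -expRD mulrC -ler_pdivrMr ?ltr0n ?fact_gt0//.
    by apply: le_trans (expR_ge1Dxn n.+1 (ltW x1)); rewrite lerDr.
  rewrite powRN expRN ler_pdivlMr ?powR_gt0// mulrAC ler_pdivrMr ?expR_gt0//.
  by rewrite mulrC; exact: le_trans h1 h2.
have zA : z + A = A * (1 + x) by rewrite mulrDr mulr1 /x mulrCA divff ?gt_eqF// mulr1 addrC.
have Ax : A^-1 = z^-1 * x by rewrite /x mulrA mulVf ?gt_eqF// mul1r.
rewrite hkE// /hk A0 mulr0n addr0 /pweight gtr0_norm// zA powRM ?(ltW A0) ?(ltW x1)//.
rewrite -/x Ax exprMn.
have -> : A `^ (- s) * expR (- x) * (z^-1 ^+ n * x ^+ n) =
  (z^-1 ^+ n * A `^ (- s)) * (x ^+ n * expR (- x)) by ring.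
have -> : hkC n * z^-1 ^+ n * (A `^ (- s) * (1 + x) `^ (- s)) =
  (z^-1 ^+ n * A `^ (- s)) * (hkC n * (1 + x) `^ (- s)) by ring.
by rewrite ler_wpM2l// mulr_ge0 ?powR_ge0// exprn_ge0// invr_ge0 ltW.
Qed.

Lemma is_derive_hk_z n (z A : R) : is_derive z 1 (fun z : R => hk n z A) (- hk n.+1 z A).
Proof.
have [A0|A0] := leP A 0.
  rewrite hk0// oppr0 (_ : (fun z => _) = cst 0); first exact: is_derive_cst.
  by apply/funext => y; rewrite hk0.
rewrite hkS// (_ : (fun z => _) = (A `^ (- (s + n%:R))) \*: (fun z => expR (- (z / A)))); last first.
  by apply/funext => y; rewrite /hk A0.
have h1 : is_derive z 1 (fun y => - (y / A)) (- A^-1).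
  have -> : (fun y => - (y / A)) = (- A^-1) \*: (id : R -> R).
    by apply/funext => y; rewrite /= [RHS]mulNr mulrC.
  by apply: (is_derive_eq (is_deriveZ (- A^-1) (is_derive_id z 1))); rewrite [_ *: _]mulr1.
have h2 := @is_derive1_comp _ expR (fun y => - (y / A)) z _ _ (is_derive_expR _) h1.
apply: (is_derive_eq (is_deriveZ (A `^ (- (s + n%:R))) h2)).
by rewrite /hk A0 [_ *: _]mulrA mulrN.
Qed.

(** The kernel of index n is A^2 times that of index n + 2, which is bounded in A. The quadratic
    bound makes the kernel differentiable at A = 0, where it is glued to the zero function. *)
Lemma hk_quadratic n z : 0 < z -> exists2 c, 0 < c & forall A, hk n z A <= c * A ^+ 2.
Proof.
move=> z0; pose c := hkC n.+2 * z^-1 ^+ n.+2 * z `^ (- s).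
have c0 : 0 < c.
  by apply: mulr_gt0; [apply: mulr_gt0; [exact: hkC_gt0|by rewrite exprn_gt0// invr_gt0]|exact: powR_gt0].
exists c => // A; have [A0|A0] := leP A 0.
  by rewrite hk0// mulr_ge0 ?sqr_ge0// ltW.
have : hk n.+2 z A <= c.
  apply: (le_trans (hk_le n.+2 A z0)); rewrite ler_wpM2l//.
    by rewrite mulr_ge0 ?(ltW (hkC_gt0 _))// exprn_ge0// invr_ge0 ltW.
  rewrite /pweight !powRN lef_pV2 ?posrE ?powR_gt0 ?ltr_wpDr//.
  have s0 : 0 <= s by apply: ltW; apply: lt_trans s1.
  by apply: ge0_ler_powR => //; rewrite ?nnegrE ?lerDl ?addr_ge0// ltW.
by rewrite !hkS// -mulrA -invfM ler_pdivrMr ?mulr_gt0// -expr2.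
Qed.

(** Since - d/dz raises the index by one, for n = 0 the right-hand side is s U_z + z U_zz: this is
    the equation of the forward potential, valid across A = 0. *)
Lemma is_derive_hk_A n (z A : R) : 0 < z ->
  is_derive A 1 (hk n z) (- (s + n%:R) * hk n.+1 z A + z * hk n.+2 z A).
Proof.
move=> z0; have [A0|A0|A0] := ltgtP A 0.
- rewrite !hk0 ?ltW// !mulr0 addr0.
  apply: (@near_eq_is_derive _ _ _ (cst 0) _ _ _ _ _ (is_derive_cst _ _ _)).
  near=> y; rewrite hk0// ltW//; near: y; exact: lt_nbhsl.
- pose p := - (s + n%:R).
  have h1 : is_derive A 1 (fun y => - (z / y)) (z / A ^+ 2).
    have h := is_deriveZ (- z) (@is_deriveV _ id A 1 1 (lt0r_neq0 A0) (is_derive_id A 1)).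
    have -> : (fun y => - (z / y)) = (- z) \*: (fun y => y^-1).
      by apply/funext => y; rewrite /= [RHS]mulNr.
    by apply: (is_derive_eq h); rewrite /GRing.scale/= mulr1 mulrNN.
  have h2 := @is_derive1_comp _ expR (fun y => - (z / y)) A _ _ (is_derive_expR _) h1.
  have h3 := is_deriveM (is_derive1_powR p A0) h2.
  apply: (@near_eq_is_derive _ _ _ _ _ _ _ _ _ (is_derive_eq h3 _)).
    near=> y; rewrite /hk ifT//; near: y; exact: lt_nbhsr.
  have -> : A `^ (p - 1) = A `^ p / A.
    by rewrite powRD ?powR_inv1 ?(ltW A0)// (gt_eqF A0) implybT.
  rewrite !hkS// /hk A0 -/p /=.
  rewrite /GRing.scale /=; field; exact: lt0r_neq0.
- rewrite A0 !hk0// !mulr0 addr0.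
  have [c c0 hc] := hk_quadratic n z0.
  apply: (@is_derive_quadratic _ _ _ _ c) => h.
  by rewrite add0r (hk0 _ _ (lexx _)) mul0r !subr0 ger0_norm ?hk_ge0.
Unshelve. all: by end_near. Qed.

End Kernel.

Section RintegralTools.
Context {R : realType}.
Notation mu := (@lebesgue_measure R).

Lemma integrable_le (D : set R) (f g : R -> R) : measurable D -> measurable_fun D f ->
  mu.-integrable D (EFin \o g) -> (forall x, D x -> `|f x| <= g x) ->
  mu.-integrable D (EFin \o f).
Proof.
move=> mD mf ig fg; apply: le_integrable ig => //; first exact/measurable_EFinP.
by move=> x Dx /=; rewrite lee_fin (le_trans (fg x Dx))// ler_norm.
Qed.

Lemma integrable_scale (D : set R) (f : R -> R) (k : R) : measurable D ->
  mu.-integrable D (EFin \o f) -> mu.-integrable D (EFin \o (fun x => k * f x)).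
Proof. by move=> mD fi; exact: (@integrableZl _ _ _ mu D mD k _ fi). Qed.

Lemma integrable_patch (D : set R) (f : R -> R) : measurable D ->
  mu.-integrable D (EFin \o f) -> mu.-integrable setT (EFin \o (f \_ D)).
Proof.
move=> mD fi; have [h _] := @integrable_mkcond _ _ R mu D (EFin \o f) mD.
have := h fi; congr (_.-integrable _ _); apply/funext => x /=.
by rewrite !patchE/=; case: ifP.
Qed.

Lemma integrable_norm (D : set R) (f : R -> R) :
  mu.-integrable D (EFin \o f) -> mu.-integrable D (EFin \o (fun x => `|f x|)).
Proof. by move=> /integrable_abse; congr (_.-integrable _ _); exact/funext. Qed.

Lemma is_derive_Rintegral (f df : R -> R -> R) (D : set R) (a e : R) (G : R -> R) :
  measurable D -> 0 < e ->
  (forall x, `|x - a| < e -> mu.-integrable D (EFin \o f x)) ->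
  (forall x y : R, `|x - a| < e -> D y -> is_derive x 1 (f ^~ y) (df x y)) ->
  mu.-integrable D (EFin \o G) ->
  (forall x y, `|x - a| < e -> D y -> `|df x y| <= G y) ->
  is_derive a 1 (fun x => \int[mu]_(y in D) f x y) (\int[mu]_(y in D) df a y).
Proof.
move=> mD e0 fi fd Gi dfG.
have ae x : `](a - e), (a + e)[%classic x -> `|x - a| < e.
  by rewrite /= in_itv/= ltr_distl.
have aa : `](a - e), (a + e)[%classic a by rewrite /= in_itv/= ltrBlDr !ltrDl e0.
have p1 (x y : R) : `](a - e), (a + e)[%classic x -> D y -> partial1of2 f x y = df x y.
  by move=> /ae hx hy; rewrite partial1of2E; have [_ ->] := fd x y hx hy.
have G' x y : `](a - e), (a + e)[%classic x -> D y -> `|partial1of2 f x y| <= `|G y|.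
  by move=> hx hy; rewrite p1// (le_trans (dfG _ _ (ae _ hx) hy))// ler_norm.
have Gi' : mu.-integrable D (EFin \o (fun y => `|G y|)).
  have := integrable_abse Gi; congr (_.-integrable _ _); exact/funext.
have fd' (x y : R) : `](a - e), (a + e)[%classic x -> D y -> derivable (f ^~ y) x 1.
  by move=> /ae hx hy; have [] := fd x y hx hy.
have h := @cvg_differentiation_under_integral R _ _ mu f D mD a (a - e) (a + e) aa
  (fun x hx => fi x (ae _ hx)) fd' (fun y => `|G y|) (fun y => normr_ge0 _) Gi' G'.
apply: cvg_is_derive.
have -> : \int[mu]_(y in D) df a y = \int[mu]_(y in D) partial1of2 f a y.
  by apply: eq_Rintegral => y /set_mem hy; rewrite p1.
by under eq_fun => t do rewrite (addrC a t).
Qed.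

Lemma dominated_Rintegral (D : set R) (f_ : nat -> R -> R) (f g : R -> R) :
  measurable D -> (forall n, measurable_fun D (f_ n)) -> measurable_fun D f ->
  (forall x, D x -> f_ n x @[n --> \oo] --> f x) ->
  mu.-integrable D (EFin \o g) ->
  (forall n x, D x -> `|f_ n x| <= g x) ->
  \int[mu]_(x in D) f_ n x @[n --> \oo] --> \int[mu]_(x in D) f x.
Proof.
move=> mD mf_ mf fl gi fg.
have mf_E n : measurable_fun D (EFin \o f_ n) by exact/measurable_EFinP.
have mfE : measurable_fun D (EFin \o f) by exact/measurable_EFinP.
have flE : {ae mu, forall x, D x -> (EFin \o f_ ^~ x) n @[n --> \oo] --> (f x)%:E}.
  by apply: aeW => x Dx; apply: cvg_EFin; [exact: nearW|exact: fl].
have fgE : {ae mu, forall x n, D x -> (`|(EFin \o f_ n) x| <= (EFin \o g) x)%E}.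
  by apply: aeW => x n Dx /=; rewrite lee_fin fg.
have [fi _ h] := @dominated_convergence _ _ _ mu D mD (fun n => EFin \o f_ n) (EFin \o f) (EFin \o g) mf_E mfE flE gi fgE.
have fin : (\int[mu]_(x in D) (f x)%:E)%E \is a fin_num by exact: integrable_fin_num.
apply: fine_cvg; rewrite /Rintegral fineK//.
Qed.

(** The mean value theorem controls the increments in the first variable uniformly in the second, so
    continuity in the second variable has to be known only on the line through t. *)
Lemma continuous2_of_is_derive (f ft : R -> R -> R) (t z e C : R) : 0 < e ->
  (forall u v : R, `|u - t| < e -> `|v - z| < e -> is_derive u 1 (f ^~ v) (ft u v)) ->
  (forall u v, `|u - t| < e -> `|v - z| < e -> `|ft u v| <= C) ->
  {for z, continuous (f t)} -> {for (t, z), continuous (fun p => f p.1 p.2)}.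
Proof.
move=> e0 fd fC fz; apply/cvgrPdist_lt => /= d d0.
have C0 : 0 < `|C| + 1 by rewrite ltr_wpDl.
have d20 : 0 < d / 2 by rewrite divr_gt0.
have /nbhs_ballP[r /= r0 Hr] : \forall v \near z, `|f t z - f t v| < d / 2.
  by move/cvgrPdist_lt : fz => /(_ _ d20).
pose q := Num.min (Num.min e r) (d / 2 / (`|C| + 1)).
have q0 : 0 < q by rewrite !lt_min e0 r0 divr_gt0.
exists (ball t q, ball z q) => /=; first by split; exact: nbhsx_ballx.
move=> [u v] [/= hu hv].
move: hu hv; rewrite /ball/= (distrC t) (distrC z) !lt_min => /andP[/andP[hu _] hu2] /andP[/andP[hv hv2] _].
have h1 : `|f t z - f t v| < d / 2 by apply: Hr; rewrite /ball/= distrC.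
have h2 : `|f t v - f u v| <= d / 2.
  have key x y : x < y -> `|x - t| < e -> `|y - t| < e -> `|f y v - f x v| <= `|C| * `|y - x|.
    move=> xy hx hy.
    have hxy w : x <= w <= y -> `|w - t| < e.
      move=> /andP[w1 w2]; move: hx hy; rewrite !ltr_distl => /andP[x1 x2] /andP[y1 y2].
      by rewrite (lt_le_trans x1)//= (le_lt_trans w2).
    have [|c /andP[c1 c2] ->] := @MVT_derive _ (f ^~ v) (ft ^~ v) x y xy.
      by move=> w hw; apply: fd => //; exact: hxy.
    rewrite normrM ler_wpM2r//; apply: le_trans (ler_norm _).
    by rewrite fC// hxy// !ltW.
  have : `|f t v - f u v| <= `|C| * `|u - t|.
    have [tu|tu|->] := ltgtP t u; last by rewrite subrr normr0 mulr_ge0.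
    - by rewrite distrC key// subrr normr0.
    - by rewrite (distrC u) key// subrr normr0.
  move=> /le_trans; apply; move: hu2; rewrite ltr_pdivlMr// => /ltW; apply: le_trans.
  by rewrite mulrC ler_wpM2l// lerDl.
by rewrite (splitr d) -(subrKA (f t v)) (le_lt_trans (ler_normD _ _))// ltr_leD.
Qed.
End RintegralTools.

Section Potential.
Context {R : realType}.
Notation mu := (@lebesgue_measure R).
Variables (s K : R) (g : R -> R).
Hypotheses (s1 : 1 < s) (s2 : s <= 2) (K0 : 0 <= K).
Hypotheses (mg : measurable_fun [set: R] g) (gK : forall x, `|g x| <= K).
Notation hk := (hk s).

Definition pot n (t z : R) := \int[mu]_x (hk n z (t - x) * g x).

Lemma continuous_hk n z : 0 < z -> continuous (hk n z).
Proof. by move=> z0 A; apply: is_derive_continuous (is_derive_hk_A s1 s2 n A z0). Qed.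

Lemma measurable_hk n z t : 0 < z -> measurable_fun [set: R] (fun x => hk n z (t - x)).
Proof.
move=> z0; apply: continuous_measurable_fun => x.
apply: (@continuous_comp _ _ _ (fun x => t - x) (hk n z)); last exact: continuous_hk.
by apply: cvgB; [exact: cvg_cst|exact: cvg_id].
Qed.

Lemma integrable_hk n z t : 0 < z -> mu.-integrable setT (EFin \o (fun x => hk n z (t - x))).
Proof.
move=> z0; apply: (@integrable_le _ _ _ (fun x => hkC n * z^-1 ^+ n * pweight s z (t - x))) => //.
- exact: measurable_hk.
- by apply: integrable_scale => //; exact: (integrable_pweight s1 t z0).
- by move=> x _; rewrite ger0_norm ?hk_ge0// hk_le.
Qed.

Lemma integrable_pot n z t : 0 < z ->
  mu.-integrable setT (EFin \o (fun x => hk n z (t - x) * g x)).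
Proof.
move=> z0; apply: (@integrable_le _ _ _ (fun x => K * hk n z (t - x))) => //.
- by apply: measurable_funM => //; exact: measurable_hk.
- by apply: integrable_scale => //; exact: (integrable_hk n t z0).
- by move=> x _; rewrite normrM mulrC (ger0_norm (hk_ge0 _ _ _ _)) ler_wpM2r ?hk_ge0.
Qed.

Lemma pot_le n t z : 0 < z ->
  `|pot n t z| <= K * (hkC n * z^-1 ^+ n) * (2 * (z `^ (1 - s) / (s - 1))).
Proof.
move=> z0; have c0 : 0 <= hkC n * z^-1 ^+ n.
  by rewrite mulr_ge0 ?(ltW (hkC_gt0 _))// exprn_ge0// invr_ge0 ltW.
have ip : mu.-integrable setT (EFin \o (fun x => K * (hkC n * z^-1 ^+ n) * pweight s z (t - x))).
  by apply: integrable_scale => //; exact: (integrable_pweight s1 t z0).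
apply: (le_trans (le_normr_Rintegral measurableT (integrable_pot n t z0))).
have -> : K * (hkC n * z^-1 ^+ n) * (2 * (z `^ (1 - s) / (s - 1))) =
    \int[mu]_x (K * (hkC n * z^-1 ^+ n) * pweight s z (t - x)).
  rewrite RintegralZl//; last exact: integrable_pweight.
  by rewrite /Rintegral integral_pweight_translate.
apply: le_Rintegral => //.
  have := integrable_abse (integrable_pot n t z0); congr (_.-integrable _ _); exact/funext.
move=> x _; rewrite normrM (ger0_norm (hk_ge0 _ _ _ _)) mulrC -mulrA.
by rewrite ler_pM ?hk_ge0 ?hk_le.
Qed.

Lemma pweight_le2 z z' x x' : 0 < z -> z + `|x| <= z' + `|x'| -> pweight s z' x' <= pweight s z x.
Proof.
move=> z0 zz; rewrite /pweight !powRN.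
have h0 : 0 < z + `|x| by rewrite ltr_wpDr.
have h0' : 0 < z' + `|x'| by exact: lt_le_trans zz.
rewrite lef_pV2 ?posrE ?powR_gt0//.
by apply: ge0_ler_powR => //; rewrite ?nnegrE ltW// (lt_trans _ s1).
Qed.

(** Trades nearby parameters for a smaller z, which gives one majorant on a whole neighbourhood, as
    differentiation under the integral requires. *)
Lemma hk_le_pweight n z z' A A' : 0 < z -> z <= z' -> z + `|A| <= z' + `|A'| ->
  hk n z' A' <= hkC n * z^-1 ^+ n * pweight s z A.
Proof.
move=> z0 zz' zA; have z'0 : 0 < z' by exact: lt_le_trans zz'.
apply: (le_trans (hk_le s2 n A' z'0)).
have z'V : z'^-1 <= z^-1 by rewrite lef_pV2.
apply: ler_pM; rewrite ?mulr_ge0 ?(ltW (hkC_gt0 _)) ?exprn_ge0 ?invr_ge0 ?(ltW z'0) ?powR_ge0//.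
  by rewrite ler_wpM2l ?(ltW (hkC_gt0 _))// lerXn2r ?nnegrE ?invr_ge0 ?(ltW z0) ?(ltW z'0).
exact: pweight_le2.
Qed.

Lemma half_ball (z z' : R) : 0 < z -> `|z' - z| < z / 2 -> z / 2 <= z'.
Proof. by move=> z0; rewrite ltr_distl => /andP[h _]; lra. Qed.

Lemma is_derive_pot_z n (t z : R) : 0 < z -> is_derive z 1 (pot n t) (- pot n.+1 t z).
Proof.
move=> z0; have z20 : 0 < z / 2 by rewrite divr_gt0.
have -> : - pot n.+1 t z = \int[mu]_x (- hk n.+1 z (t - x) * g x).
  rewrite -mulN1r -RintegralZl//; last exact: integrable_pot.
  by apply: eq_Rintegral => x _; rewrite mulN1r mulNr.
apply: (@is_derive_Rintegral _ (fun z x => hk n z (t - x) * g x)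
  (fun z x => - hk n.+1 z (t - x) * g x) setT z (z / 2)
  (fun x => K * (hkC n.+1 * (z / 2)^-1 ^+ n.+1) * pweight s (z / 2) (t - x))) => //.
- move=> z' hz'; apply: integrable_pot; exact: lt_le_trans (half_ball z0 hz').
- move=> z' x hz' _.
  have h := is_deriveM (is_derive_hk_z s n z' (t - x)) (is_derive_cst (g x) z' 1).
  by apply: (is_derive_eq h); rewrite scaler0 add0r /GRing.scale/= mulrC.
- by apply: integrable_scale => //; exact: (integrable_pweight s1 t z20).
- move=> z' x hz' _; rewrite normrM normrN (ger0_norm (hk_ge0 _ _ _ _)) mulrC -mulrA.
  rewrite ler_pM ?hk_ge0//; apply: hk_le_pweight => //; first exact: half_ball.
  by rewrite lerD2r half_ball.
Qed.

Lemma is_derive_pot_t n (t z : R) : 0 < z ->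
  is_derive t 1 (pot n ^~ z) (- (s + n%:R) * pot n.+1 t z + z * pot n.+2 t z).
Proof.
move=> z0; have z20 : 0 < z / 2 by rewrite divr_gt0.
have -> : - (s + n%:R) * pot n.+1 t z + z * pot n.+2 t z =
    \int[mu]_x ((- (s + n%:R) * hk n.+1 z (t - x) + z * hk n.+2 z (t - x)) * g x).
  rewrite -!RintegralZl//; try exact: integrable_pot.
  rewrite -RintegralD//.
  - by apply: eq_Rintegral => x _; rewrite !mulrDl !mulrA.
  - by apply: integrable_scale => //; exact: (integrable_pot n.+1 t z0).
  - by apply: integrable_scale => //; exact: (integrable_pot n.+2 t z0).
pose C := (s + n%:R) * (hkC n.+1 * (z / 2)^-1 ^+ n.+1) + z * (hkC n.+2 * (z / 2)^-1 ^+ n.+2).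
apply: (@is_derive_Rintegral _ (fun t x => hk n z (t - x) * g x)
  (fun t x => (- (s + n%:R) * hk n.+1 z (t - x) + z * hk n.+2 z (t - x)) * g x) setT t (z / 2)
  (fun x => K * C * pweight s (z / 2) (t - x))) => //.
- by move=> t' _; exact: integrable_pot.
- move=> t' x _ _.
  have h1 : is_derive t' 1 (fun t => t - x) (1 : R).
    by apply: (is_derive_eq (is_deriveB (is_derive_id t' 1) (is_derive_cst x t' 1))); rewrite subr0.
  have h2 := @is_derive1_comp _ (hk n z) (fun t => t - x) t' _ _ (is_derive_hk_A s1 s2 n (t' - x) z0) h1.
  have h := is_deriveM h2 (is_derive_cst (g x) t' 1).
  by apply: (is_derive_eq h); rewrite scaler0 add0r /GRing.scale/= mulr1 mulrC.
- by apply: integrable_scale => //; exact: (integrable_pweight s1 t z20).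
- move=> t' x ht' _; rewrite normrM mulrC -mulrA; apply: ler_pM => //.
  (* Moving t by less than z / 2 is paid for by lowering z to z / 2 in the weight. *)
  have hh m : hk m z (t' - x) <= hkC m * (z / 2)^-1 ^+ m * pweight s (z / 2) (t - x).
    apply: hk_le_pweight => //; first by rewrite ltW// half_lt.
    have : `|t - x| <= `|t - t'| + `|t' - x|.
      by rewrite -[t - x](subrKA t') ler_normD.
    by move: ht'; rewrite (distrC t'); lra.
  have sn : 0 <= s + n%:R by rewrite addr_ge0// ltW// (lt_trans _ s1).
  apply: (le_trans (ler_normD _ _)); rewrite mulrDl !normrM normrN.
  rewrite !(ger0_norm (hk_ge0 _ _ _ _)) (ger0_norm sn) (gtr0_norm z0).
  by apply: lerD; rewrite -[leRHS]mulrA ler_wpM2l ?(ltW z0) ?hh.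
Qed.

Lemma continuous_pot n t z : 0 < z -> {for (t, z), continuous (fun p => pot n p.1 p.2)}.
Proof.
move=> z0; have z20 : 0 < z / 2 by rewrite divr_gt0.
pose B m := K * (hkC m * (z / 2)^-1 ^+ m) * (2 * ((z / 2) `^ (1 - s) / (s - 1))).
have hB m u v : `|v - z| < z / 2 -> `|pot m u v| <= B m.
  move=> hv; have zv := half_ball z0 hv; have v0 : 0 < v by exact: lt_le_trans zv.
  apply: (le_trans (pot_le m u v0)); rewrite /B -!(mulrA K) ler_wpM2l// -!(mulrA (hkC m)).
  apply: ler_wpM2l; first exact: ltW (hkC_gt0 _).
  have vz : v^-1 <= (z / 2)^-1 by rewrite lef_pV2.
  apply: ler_pM.
  - by rewrite exprn_ge0 ?invr_ge0 ?(ltW v0).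
  - by rewrite mulr_ge0// divr_ge0 ?powR_ge0// subr_ge0 ltW.
  - by rewrite lerXn2r ?nnegrE ?invr_ge0 ?(ltW v0) ?(ltW z20).
  - rewrite ler_wpM2l// ler_wpM2r ?invr_ge0 ?subr_ge0 ?(ltW s1)//.
    have -> : 1 - s = - (s - 1) by ring.
    rewrite !powRN lef_pV2 ?posrE ?powR_gt0//; apply: ge0_ler_powR => //.
    - by rewrite subr_ge0 ltW.
    - by rewrite nnegrE ltW.
    - by rewrite nnegrE ltW.
apply: (@continuous2_of_is_derive _ (pot n) (fun t z => - (s + n%:R) * pot n.+1 t z + z * pot n.+2 t z)
   _ _ (z / 2) ((s + n%:R) * B n.+1 + (z + z / 2) * B n.+2)) => //.
- by move=> u v _ hv; apply: is_derive_pot_t; exact: lt_le_trans (half_ball z0 hv).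
- move=> u v _ hv; have zv := half_ball z0 hv; have v0 : 0 < v by exact: lt_le_trans zv.
  have sn : 0 <= s + n%:R by rewrite addr_ge0// ltW// (lt_trans _ s1).
  rewrite (le_trans (ler_normD _ _))// !normrM normrN (ger0_norm sn) (gtr0_norm v0).
  apply: lerD; first by rewrite ler_wpM2l ?hB.
  rewrite ler_pM ?hB//; first exact: ltW.
  by move: hv; rewrite ltr_distl => /andP[_ /ltW].
- exact: is_derive_continuous (is_derive_pot_z n t z0).
Qed.

End Potential.

Lemma continuous_isolated_zero {R : realType} (f : R -> R) (z : R) :
  {for z, continuous f} -> f z != 0 -> isolated_zero f z.
Proof.
move=> cf fz; have fz0 : 0 < `|f z| by rewrite normr_gt0.
have /nbhs_ballP[e /= e0 He] : \forall v \near z, `|f z - f v| < `|f z|.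
  by move/cvgrPdist_lt : cf => /(_ _ fz0).
exists e => // z' /andP[_ hz']; apply/eqP => fz'.
by have := He z'; rewrite /ball/= distrC fz' subr0 ltxx => /(_ hz').
Qed.

(** * Analyticity of the potentials in z *)

Section PotentialZeros.
Context {R : realType}.
Notation mu := (@lebesgue_measure R).
Variables (s K : R) (g : R -> R).
Hypotheses (s1 : 1 < s) (s2 : s <= 2) (K0 : 0 <= K).
Hypotheses (mg : measurable_fun [set: R] g) (gK : forall x, `|g x| <= K).
Notation hk := (hk s).
Notation pot := (pot s g).

(** Rolle: a second zero close to z would put a zero of the derivative strictly between the two,
    while the derivative has no zero near z except possibly at z. *)
Lemma isolated_zero_pot_step n t z : 0 < z ->
  isolated_zero (pot n.+1 t) z -> isolated_zero (pot n t) z.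
Proof.
move=> z0 [r r0 Hr]; have [Pz|Pz] := eqVneq (pot n t z) 0; last first.
  apply: continuous_isolated_zero Pz.
  exact: is_derive_continuous (is_derive_pot_z s1 s2 mg gK n t z0).
have [rz0 rz] : 0 < Num.min r z /\ (Num.min r z <= r) by rewrite lt_min r0 z0 ge_min lexx.
exists (Num.min r z) => // z' /andP[h0 h1].
have [hr hz] : `|z' - z| < r /\ `|z' - z| < z by move: h1; rewrite lt_min => /andP[].
have key x y : x < y -> 0 < x -> pot n t y - pot n t x = 0 ->
    exists2 c, x < c < y & pot n.+1 t c = 0.
  move=> xy x0 h.
  have [|c cxy] := @MVT_derive _ (pot n t) (fun z => - pot n.+1 t z) x y xy.
    by move=> w /andP[xw _]; apply: (is_derive_pot_z s1 s2 mg gK); exact: lt_le_trans xw.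
  rewrite h => /esym/eqP; rewrite mulf_eq0 oppr_eq0 [y - x == 0]subr_eq0 (gt_eqF xy) orbF => /eqP.
  by exists c.
apply/negP => /eqP Pz'.
have [zz|zz|zz] := ltgtP z z'; last by move: h0; rewrite zz subrr normr0 ltxx.
- have [|c /andP[c1 c2] /eqP] := key z z' zz z0; first by rewrite Pz Pz' subrr.
  apply/negP; apply: Hr; rewrite gtr0_norm ?subr_gt0// c1/=.
  by apply: lt_trans hr; rewrite gtr0_norm ?subr_gt0// ltrD2r.
- have z'0 : 0 < z' by move: hz; rewrite ltr_distl subrr => /andP[].
  have [|c /andP[c1 c2] /eqP] := key z' z zz z'0; first by rewrite Pz Pz' subrr.
  apply/negP; apply: Hr; rewrite ltr0_norm ?subr_lt0// opprB subr_gt0 c2/=.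
  by apply: lt_trans hr; rewrite ltr0_norm ?subr_lt0// opprB ltrD2l ltrN2.
Qed.

Lemma isolated_zero_pot n t z : 0 < z -> pot n t z != 0 -> isolated_zero (pot 0 t) z.
Proof.
move=> z0 Pn.
have h : isolated_zero (pot n t) z.
  apply: continuous_isolated_zero Pn.
  exact: is_derive_continuous (is_derive_pot_z s1 s2 mg gK n t z0).
elim: n h {Pn} => [|n IH] h; [exact: h|apply: IH; exact: isolated_zero_pot_step z0 h].
Qed.

Lemma series_exp_coeff_le (x y : R) N : `|x| <= y -> `|series (exp_coeff x) N| <= expR y.
Proof.
move=> xy; have y0 : 0 <= y by exact: le_trans xy.
apply: (@le_trans _ _ (series (exp_coeff y) N)).
  rewrite /series/= (le_trans (ler_norm_sum _ _ _))//; apply: ler_sum => i _.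
  rewrite /exp_coeff/= normrM normrX [`|_^-1|]ger0_norm ?invr_ge0//.
  by rewrite ler_wpM2r ?invr_ge0// lerXn2r ?nnegrE.
rewrite /expR; apply: nondecreasing_cvgn_le; last exact: is_cvg_series_exp_coeff.
by apply: nondecreasing_series => i _ _; rewrite /exp_coeff/= divr_ge0// exprn_ge0.
Qed.

(** Taylor expansion of e^((z - z') / A) under the integral: its terms are multiples of the
    potentials of all indices at z, which vanish. The partial sums are dominated by the kernel at z
    - |z - z'|, and z' < 2 z keeps this parameter positive. *)
Lemma pot_vanish_near t z z' : 0 < z -> (forall n, pot n t z = 0) ->
  0 < z' < 2 * z -> pot 0 t z' = 0.
Proof.
move=> z0 Pz /andP[z'0 z'z].
pose d := `|z - z'|.
have dz : d < z by rewrite /d ltr_norml ltrBlDr ltrDl z'0 andbT ltrBrDr addrC ltrBlDr -mulr2n -mulr_natl.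
have zd0 : 0 < z - d by rewrite subr_gt0.
pose f N x := hk 0 z (t - x) * series (exp_coeff ((z - z') / (t - x))) N * g x.
have intf N : \int[mu]_x f N x = 0 /\ mu.-integrable setT (EFin \o f N).
  elim: N => [|N [IH1 IH2]].
    have -> : f 0%N = cst 0.
      by apply/funext => x; rewrite /f /series/= big_geq// mulr0 mul0r.
    by split; [rewrite Rintegral_cst// mul0r|exact: integrable0].
  pose c := (z - z') ^+ N / N`!%:R.
  have e : f N.+1 = (fun x => f N x + c * (hk N z (t - x) * g x)).
    apply/funext => x; rewrite /f seriesSr mulrDr mulrDl; congr (_ + _).
    have [A0|A0] := leP (t - x) 0; first by rewrite !hk0// !mul0r mulr0.
    by rewrite (hkE s N z A0) /exp_coeff/= /c expr_div_n exprVn; ring.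
  have iP := integrable_pot s1 s2 mg gK N t z0.
  split.
    rewrite e RintegralD//; last exact: integrable_scale.
    by rewrite IH1 RintegralZl// -/(pot N t z) Pz mulr0 addr0.
  rewrite e; have := integrableD measurableT IH2 (integrable_scale c measurableT iP).
  by congr (_.-integrable _ _); apply/funext => x.
have lim : \int[mu]_x f N x @[N --> \oo] --> \int[mu]_x (hk 0 z' (t - x) * g x).
  apply: (@dominated_Rintegral _ _ _ _ (fun x => K * hk 0 (z - d) (t - x))) => //.
  - by move=> N; have /integrableP[/measurable_EFinP] := (intf N).2.
  - by have /integrableP[/measurable_EFinP] := integrable_pot s1 s2 mg gK 0 t z'0.
  - move=> x _; apply: cvgMl.
    have [A0|A0] := leP (t - x) 0.
      rewrite !hk0//; under eq_fun do rewrite mul0r; exact: cvg_cst.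
    have -> : hk 0 z' (t - x) = hk 0 z (t - x) * expR ((z - z') / (t - x)).
      rewrite /hk A0 -mulrA -expRD; congr (_ * expR _); ring.
    apply: cvgMr; exact: is_cvg_series_exp_coeff.
  - by apply: integrable_scale => //; exact: integrable_hk.
  - move=> N x _; rewrite /f normrM mulrC; apply: ler_pM => //.
    have [A0|A0] := leP (t - x) 0; first by rewrite !hk0// mul0r normr0.
    rewrite normrM (ger0_norm (hk_ge0 _ _ _ _)).
    have -> : hk 0 (z - d) (t - x) = hk 0 z (t - x) * expR (d / (t - x)).
      rewrite /hk A0 -mulrA -expRD; congr (_ * expR _); ring.
    rewrite ler_wpM2l ?hk_ge0// series_exp_coeff_le// normrM /d.
    by rewrite [`|_^-1|]gtr0_norm ?invr_gt0.
move: lim; under eq_fun do rewrite (intf _).1.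
by rewrite /pot => /(cvg_unique (@norm_hausdorff _ R^o) (cvg_cst 0)) <-.
Qed.

(** Continuation to the right: vanishing on (0, 2 w) kills all derivatives there, and 3 w / 2 is
    taken as the next centre; any ratio strictly between 1 and 2 would do. *)
Lemma pot_vanish t z : 0 < z -> (forall n, pot n t z = 0) ->
  forall z', 0 < z' -> pot 0 t z' = 0.
Proof.
move=> z0 Pz z' z'0.
have vanish_all w : 0 < w -> (forall v, 0 < v < 2 * w -> pot 0 t v = 0) ->
    forall n v, 0 < v < 2 * w -> pot n t v = 0.
  move=> w0 h; elim=> [|n IH] v hv; first exact: h.
  have v0 : 0 < v by case/andP: hv.
  suff : - pot n.+1 t v = 0 by move/eqP; rewrite oppr_eq0 => /eqP.
  apply: (@is_derive_unique _ (pot n t) v); first exact: is_derive_pot_z.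
  apply: (@near_eq_is_derive _ _ _ (cst 0) _ _ _ _ _ (is_derive_cst _ _ _)).
  near=> y; rewrite IH//; near: y; exact: (near_in_itvoo hv).
have step k : forall n v, 0 < v < 2 * (z * (3 / 2) ^+ k) -> pot n t v = 0.
  elim: k => [|k IH].
    by rewrite expr0 mulr1; apply: vanish_all => // v; exact: pot_vanish_near.
  have w0 : 0 < z * (3 / 2) ^+ k by rewrite mulr_gt0// exprn_gt0.
  have w'0 : 0 < z * (3 / 2) ^+ k.+1 by rewrite mulr_gt0// exprn_gt0.
  apply: (vanish_all _ w'0) => v hv; apply: (pot_vanish_near w'0 _ hv) => n; apply: IH.
  by rewrite w'0/= exprS mulrCA ltr_pM2r//; lra.
have [k zk] : exists k, z' < 2 * (z * (3 / 2) ^+ k).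
  (* Bernoulli's inequality, so that the intervals exhaust the half-line. *)
  have b k : 1 + k%:R / 2 <= (3 / 2 : R) ^+ k.
    elim: k => [|k IH]; first by rewrite expr0 mul0r addr0.
    rewrite exprS (le_trans _ (ler_wpM2l _ IH))//.
    have : 0 <= k%:R :> R by []. 
    by rewrite -natr1; lra.
  exists (Num.bound (z' / z)).
  have := archi_boundP (ltW (divr_gt0 z'0 z0)); rewrite ltr_pdivrMr// => /lt_le_trans; apply.
  rewrite mulrCA mulrC ler_wpM2l ?(ltW z0)//.
  have bk := b (Num.bound (z' / z)).
  rewrite -(ler_pM2l (ltr0Sn _ 1)) in bk; apply: le_trans bk.
  by rewrite mulrDr mulr1 mulrCA divff// mulr1 lerDr.
by apply: (step k); rewrite z'0.
Unshelve. all: by end_near. Qed.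

(* pot 0 t is a Laplace transform, hence analytic in z: if all its derivatives
   vanish at one point, it vanishes identically. *)
Lemma pot_isolated t z : 0 < z ->
  (forall z', 0 < z' -> pot 0 t z' = 0) \/ isolated_zero (pot 0 t) z.
Proof.
move=> z0; have [[n Pn]|h] := pselect (exists n, pot n t z != 0).
  by right; exact: isolated_zero_pot Pn.
left; apply: (@pot_vanish t z z0) => n; apply/eqP; apply: contra_notT h => h.
by exists n.
Qed.

End PotentialZeros.

(** * The Abel kernel *)

Section AbelKernel.
Context {R : realType}.
Notation mu := (@lebesgue_measure R).
Variable al : R.
Hypotheses (al0 : 0 < al) (al1 : al < 1).

Lemma is_derive_affine_opp (t x : R) : is_derive x 1 (fun y => t - y) (- 1 : R).
Proof. by apply: (is_derive_eq (is_deriveB (is_derive_cst t x 1) (is_derive_id x 1))); rewrite sub0r. Qed.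

Lemma is_derive_powR_sub (p t x : R) : x < t ->
  is_derive x 1 (fun y => (t - y) `^ p) (- (p * (t - x) `^ (p - 1))).
Proof.
move=> xt; have tx : 0 < t - x by rewrite subr_gt0.
apply: (is_derive_eq (@is_derive1_comp _ (fun y => y `^ p) (fun y => t - y) x _ _
  (is_derive1_powR p tx) (is_derive_affine_opp t x))).
by rewrite mulrN1.
Qed.

(** The shift d > 0 keeps the integrand continuous up to t, as the fundamental theorem requires; it
    is removed by monotone convergence in [integral_abel_kernel]. *)
Lemma integral_powR_sub (a t d : R) : a < t -> 0 < d ->
  (\int[mu]_(x in `[a, t]) ((t + d - x) `^ (- al))%:E =
   (((t + d - a) `^ (1 - al) - d `^ (1 - al)) / (1 - al))%:E)%E.
Proof.
move=> at_ d0; have p0 : 0 < 1 - al by rewrite subr_gt0.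
pose F x := - (1 - al)^-1 * (t + d - x) `^ (1 - al).
have dF (x : R) : x <= t -> is_derive x 1 F ((t + d - x) `^ (- al)).
  move=> xt; have xtd : x < t + d by rewrite (le_lt_trans xt)// ltrDl.
  apply: (is_derive_eq (is_deriveZ (- (1 - al)^-1) (is_derive_powR_sub (1 - al) xtd))).
  rewrite /GRing.scale/= mulrNN mulrA mulVf ?gt_eqF// mul1r; congr (_ `^ _); ring.
rewrite (@continuous_FTC2 _ _ F _ _ at_).
- rewrite -EFinB /F !mulNr opprK addrC -mulrBr mulrC.
  by rewrite [t + d]addrC addrK.
- apply: continuous_in_subspaceT => x /set_mem/=; rewrite in_itv/= => /andP[_ xt].
  have xtd : x < t + d by rewrite (le_lt_trans xt)// ltrDl.
  exact: is_derive_continuous (is_derive_powR_sub (- al) xtd).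
- split.
  + by move=> x; rewrite in_itv/= => /andP[_ /ltW xt]; have [] := dF x xt.
  + apply: cvg_at_right_filter; exact: is_derive_continuous (dF a (ltW at_)).
  + apply: cvg_at_left_filter; exact: is_derive_continuous (dF t (lexx _)).
- move=> x; rewrite in_itv/= => /andP[_ /ltW xt].
  by rewrite derive1E; have [_ ->] := dF x xt.
Qed.

Lemma measurable_powR_sub (p t : R) (D : set R) : measurable_fun D (fun x => (t - x) `^ p).
Proof.
apply: measurable_funTS; apply: (measurableT_comp (measurable_powR p)).
by apply: measurable_funB => //; exact: measurable_cst.
Qed.

Lemma integral_abel_kernel (a t : R) : a < t ->
  (\int[mu]_(x in `[a, t]) ((t - x) `^ (- al))%:E =
   ((t - a) `^ (1 - al) / (1 - al))%:E)%E.
Proof.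
move=> at_; have p0 : 0 < 1 - al by rewrite subr_gt0.
rewrite -integral_itv_bndo_bndc; last by apply/measurable_EFinP; exact: measurable_powR_sub.
pose f n x := ((t + n.+1%:R^-1 - x) `^ (- al))%:E.
have mf n : measurable_fun `[a, t[ (f n) by apply/measurable_EFinP; exact: measurable_powR_sub.
have f0 n x : `[a, t[%classic x -> (0 <= f n x)%E by move=> _; rewrite lee_fin powR_ge0.
have hd n : 0 < n.+1%:R^-1 :> R by rewrite invr_gt0.
have fnd x : `[a, t[%classic x -> {homo f ^~ x : n m / (n <= m)%N >-> (n <= m)%E}.
  rewrite /= in_itv/= => /andP[ax xt] n m nm; rewrite lee_fin !powRN.
  have h k : 0 < t + k.+1%:R^-1 - x by rewrite subr_gt0 (lt_trans xt)// ltrDl.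
  rewrite lef_pV2 ?posrE ?powR_gt0//; apply: ge0_ler_powR; rewrite ?nnegrE ?(ltW (h _)) ?(ltW al0)//.
  by rewrite lerD2r lerD2l lef_pV2 ?posrE// ler_nat.
have lf x : `[a, t[%classic x -> limn (f ^~ x) = ((t - x) `^ (- al))%:E.
  rewrite /= in_itv/= => /andP[ax xt]; apply/cvg_lim => //; apply: cvg_EFin; first exact: nearW.
  have tx : 0 < t - x by rewrite subr_gt0.
  have h1 : (t + n.+1%:R^-1 - x) @[n --> \oo] --> t - x.
    rewrite -[in X in _ --> X](addr0 t); apply: cvgB; last exact: cvg_cst.
    by apply: cvgD; [exact: cvg_cst|exact: cvg_harmonic].
  exact: (cvg_comp _ _ h1 (is_derive_continuous (is_derive1_powR (- al) tx))).
have h := @cvg_monotone_convergence _ _ _ mu `[a, t[%classic (measurable_itv _) f mf f0 fnd.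
rewrite (@eq_integral _ _ _ mu `[a, t[%classic (fun x => limn (f ^~ x))); last first.
  by move=> x /set_mem xI; rewrite lf.
have e n : (\int[mu]_(x in `[a, t[) f n x)%E =
    (((t + n.+1%:R^-1 - a) `^ (1 - al) - n.+1%:R^-1 `^ (1 - al)) / (1 - al))%:E.
  by rewrite integral_itv_bndo_bndc// (integral_powR_sub at_ (hd n)).
rewrite -(cvg_lim _ h)//; under eq_fun do rewrite e.
apply/cvg_lim => //; apply: cvg_EFin; first exact: nearW.
rewrite /comp/=; apply: cvgMl; rewrite -[X in _ --> X]subr0; apply: cvgB.
  have ta0 : 0 < t - a by rewrite subr_gt0.
  have h1 : (t + n.+1%:R^-1 - a) @[n --> \oo] --> t - a.
    rewrite -[in X in _ --> X](addr0 t); apply: cvgB; last exact: cvg_cst.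
    by apply: cvgD; [exact: cvg_cst|exact: cvg_harmonic].
  exact: (cvg_comp _ _ h1 (is_derive_continuous (is_derive1_powR (1 - al) ta0))).
have /cvg_at_rightP H := @powR_cvg0 R _ p0.
apply: (H (fun n => n.+1%:R^-1)); split=> //; exact: cvg_harmonic.
Qed.

Lemma integrable_abel_kernel (a t : R) :
  mu.-integrable `[a, t] (EFin \o (fun x => (t - x) `^ (- al))).
Proof.
have mf : measurable_fun `[a, t] (fun x => (t - x) `^ (- al)) by exact: measurable_powR_sub.
apply/integrableP; split; first exact/measurable_EFinP.
under eq_integral => x _ do rewrite /= ger0_norm ?powR_ge0//.
have [at_|ta|->] := ltgtP a t.
- by rewrite integral_abel_kernel// ltry.
- by rewrite set_itv_ge ?integral_set0// -leNgt bnd_simp.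
- by rewrite set_itv1 integral_set1.
Qed.

Lemma Rintegral_abel_kernel (a t : R) : a <= t ->
  \int[mu]_(x in `[a, t]) ((t - x) `^ (- al)) = (t - a) `^ (1 - al) / (1 - al).
Proof.
rewrite le_eqVlt => /predU1P[->|at_]; last by rewrite /Rintegral integral_abel_kernel.
by rewrite set_itv1 Rintegral_set1 subrr powR0 ?mul0r// subr_eq0 gt_eqF.
Qed.

End AbelKernel.

Section Reflection.
Context {R : realType}.
Notation mu := (@lebesgue_measure R).

Lemma ge0_integral_opp (f : R -> R) : measurable_fun [set: R] f -> (forall x, 0 <= f x) ->
  (\int[mu]_x (f (- x))%:E = \int[mu]_x (f x)%:E)%E.
Proof.
move=> mf f0.
have mE : measurable_fun [set: measurableTypeR R] (EFin \o f) by exact/measurable_EFinP.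
have mo : measurable_fun [set: measurableTypeR R] (-%R : measurableTypeR R -> measurableTypeR R).
  exact: oppr_measurable.
have := @ge0_integral_pushforward _ _ (measurableTypeR R) (measurableTypeR R) R -%R mo mu setT
  (EFin \o f) measurableT mE (fun x _ => f0 x).
rewrite preimage_setT => <-.
by apply: eq_measure_integral => A mA _; exact: lebesgue_measureN.
Qed.

(** Positive and negative parts are reflected separately, through the invariance of Lebesgue measure
    under x -> - x. *)
Lemma Rintegral_opp (f : R -> R) : measurable_fun [set: R] f ->
  \int[mu]_x f (- x) = \int[mu]_x f x.
Proof.
move=> mf; rewrite /Rintegral integralE [in RHS]integralE.
have mE : measurable_fun [set: R] (EFin \o f) by exact/measurable_EFinP.
have mp (h : R -> R) : measurable_fun [set: R] h -> measurable_fun [set: R] (fun x => Num.max (h x) 0).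
  by move=> mh; apply: measurable_maxr => //; exact: measurable_cst.
have p0 (h : R -> R) x : 0 <= Num.max (h x) 0 by rewrite le_max lexx orbT.
have maxE (x : R) : maxe x%:E 0%E = (Num.max x 0)%:E by rewrite EFin_max.
congr (fine (_ - _))%E.
- transitivity (\int[mu]_x (Num.max (f (- x)) 0)%:E)%E; last transitivity (\int[mu]_x (Num.max (f x) 0)%:E)%E.
  + by apply: eq_integral => x _; rewrite funeposE/= maxE.
  + by rewrite -(ge0_integral_opp (mp _ mf) (p0 f)).
  + by apply: eq_integral => x _; rewrite funeposE/= maxE.
- have mf' : measurable_fun [set: R] (fun x => - f x) by exact: measurableT_comp.
  transitivity (\int[mu]_x (Num.max (- f (- x)) 0)%:E)%E; last transitivity (\int[mu]_x (Num.max (- f x) 0)%:E)%E.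
  + by apply: eq_integral => x _; rewrite funenegE/= maxE.
  + by rewrite -(ge0_integral_opp (mp _ mf') (p0 (fun x => - f x))).
  + by apply: eq_integral => x _; rewrite funenegE/= maxE.
Qed.
End Reflection.

(** * Recovering a density from its potential *)

Section VanishingPotential.
Context {R : realType}.
Notation mu := (@lebesgue_measure R).
Variables (s K : R) (g : R -> R).
Hypotheses (s1 : 1 < s) (s2 : s < 2).
Hypotheses (mg : measurable_fun [set: R] g) (gK : forall x, `|g x| <= K).
Notation hk := (hk s).
Let s2' := ltW s2.

(** Lower bound of z^s times the kernel of index 0 on z <= A <= 2 z, a window in which the kernel
    keeps a fixed share of its mass. *)
Let m := 2 `^ (- s) * expR (- 1).

Let m0 : 0 < m. Proof. by rewrite mulr_gt0 ?powR_gt0 ?expR_gt0. Qed.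

Lemma Rintegral_indic_itv (x y c : R) : x <= y ->
  mu.-integrable setT (EFin \o (fun u => c * \1_`[x, y] u)) /\
  \int[mu]_u (c * \1_`[x, y] u) = c * (y - x).
Proof.
move=> xy; have i1 : mu.-integrable setT (EFin \o \1_`[x, y]) by exact: integrable_indic_itv.
split; first exact: integrable_scale.
rewrite RintegralZl//; congr (_ * _).
have muE : mu `[x, y] = (y - x)%:E.
  rewrite lebesgue_measure_itv/= lte_fin; case: ltP => // yx.
  by rewrite (le_anti (introT andP (conj xy yx))) subrr.
by rewrite /Rintegral integral_indic// setIT; exact: (congr1 fine muE).
Qed.

(** On the window z <= A <= 2 z, of length z, the kernel is at least m z^(- s), which produces the
    left-hand side; everything else is an error of size [C] measured by the weight at w. Small z
    with w fixed will give the value of g at t, large z with w = z its value far to the left. *)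
Lemma pot_vanish_bound (gam C z w t : R) : 0 <= gam -> 0 < z -> 0 < w -> pot s g 0 t z = 0 ->
  0 <= C ->
  (forall A, z <= A <= 2 * z -> gam * hk 0 z A - C * pweight s w A <= hk 0 z A * g (t - A)) ->
  (forall A, 0 < A -> - (C * pweight s w A) <= hk 0 z A * g (t - A)) ->
  gam * m * z `^ (1 - s) <= C * (2 * (w `^ (1 - s) / (s - 1))).
Proof.
move=> gam0 z0 w0 Pz C0 H1 H2.
have zz : t - 2 * z <= t - z by rewrite lerD2l lerN2 mulr_natl mulr2n lerDl ltW.
have [i1 e1] := Rintegral_indic_itv (gam * m * z `^ (- s)) zz.
have i2 := integrable_pweight s1 t w0.
have i2' := integrable_scale C measurableT i2.
have e2 : \int[mu]_x (C * pweight s w (t - x)) = C * (2 * (w `^ (1 - s) / (s - 1))).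
  by rewrite RintegralZl//; congr (_ * _); rewrite /Rintegral integral_pweight_translate.
have i3 := integrable_pot s1 s2' mg gK 0 t z0.
have i12 : mu.-integrable setT (EFin \o (fun x =>
    gam * m * z `^ (- s) * \1_`[(t - 2 * z), (t - z)] x - C * pweight s w (t - x))).
  by have := integrableB measurableT i1 i2'; congr (_.-integrable _ _); exact/funext.
have : \int[mu]_x (gam * m * z `^ (- s) * \1_`[(t - 2 * z), (t - z)] x - C * pweight s w (t - x))
    <= pot s g 0 t z.
  apply: le_Rintegral => // x _; rewrite indicE.
  have [xI|xI] := boolP (x \in (`[(t - 2 * z), (t - z)]%classic : set R)); last first.
    rewrite mulr0 sub0r; have [A0|A0] := ltP 0 (t - x).
      by have := H2 (t - x) A0; rewrite subKr.
    by rewrite hk0// mul0r oppr_le0 mulr_ge0// ltW// pweight_gt0.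
  move/set_mem : xI; rewrite /= in_itv/= => /andP[x1 x2].
  have hA : z <= t - x <= 2 * z by rewrite lerBrDl -lerBrDr x2/= lerBlDl -lerBlDr.
  have := H1 (t - x) hA; rewrite subKr mulr1; apply: le_trans; rewrite lerD2r -mulrA ler_wpM2l//.
  case/andP : hA => hA1 hA2.
  have A0 : 0 < t - x by exact: lt_le_trans hA1.
  rewrite /hk A0 mulr0n addr0 /m mulrAC -(powRM _ (ler0n R 2) (ltW z0)).
  apply: ler_pM; rewrite ?powR_ge0 ?expR_ge0//.
    rewrite !powRN lef_pV2 ?posrE ?powR_gt0 ?mulr_gt0//.
    apply: ge0_ler_powR; rewrite ?nnegrE ?(ltW A0) ?mulr_ge0 ?(ltW z0)//.
    by apply/ltW/(lt_trans ltr01).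
  by rewrite ler_expR lerN2 ler_pdivrMr// mul1r.
rewrite RintegralB// e1 e2 Pz subr_le0.
have -> : t - z - (t - 2 * z) = z by ring.
have -> : z `^ (1 - s) = z `^ (- s) * z.
  by rewrite addrC powRD ?(gt_eqF z0) ?implybT// powRr1// ltW.
by rewrite -(mulrA (gam * m)).
Qed.

(** As z tends to 0, the window close to t carries the unbounded mass z^(1 - s), while elapsed times
    beyond d contribute a bounded amount; hence g t > 0 is impossible. *)
Lemma pot_vanish_at (t : R) : (forall z, 0 < z -> pot s g 0 t z = 0) ->
  {for t, continuous g} -> g t <= 0.
Proof.
move=> P0 cg; rewrite leNgt; apply/negP => gt0.
have gt20 : 0 < g t / 2 by rewrite divr_gt0.
have /nbhs_ballP[d /= d0 Hd] : \forall x \near t, g t / 2 <= g x.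
  have : \forall x \near t, `|g t - g x| < g t / 2 by move/cvgrPdist_lt : cg => /(_ _ gt20).
  by apply: filterS => x; rewrite ltr_distl => /andP[_]; lra.
have K0 : 0 <= K by exact: le_trans (gK 0).
pose C := K * 2 `^ s; have C0 : 0 <= C by rewrite mulr_ge0// powR_ge0.
have key z : 0 < z -> 2 * z < d -> g t / 2 * m * z `^ (1 - s) <= C * (2 * (d `^ (1 - s) / (s - 1))).
  move=> z0 zd; apply: (@pot_vanish_bound (g t / 2) C z d t (ltW gt20) z0 d0 (P0 z z0) C0).
    move=> A /andP[A1 A2].
    have A0 : 0 < A by exact: lt_le_trans A1.
    apply: (@le_trans _ _ (g t / 2 * hk 0 z A)).
      by rewrite lerBlDr lerDl mulr_ge0// ltW// pweight_gt0.
    rewrite mulrC ler_wpM2l ?hk_ge0//; apply: Hd.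
    by rewrite /ball/= subKr gtr0_norm//; exact: le_lt_trans zd.
  move=> A A0; have [Ad|dA] := ltP A d.
    apply: (@le_trans _ _ 0); first by rewrite oppr_le0 mulr_ge0// ltW// pweight_gt0.
    rewrite mulr_ge0 ?hk_ge0//; apply: (le_trans (ltW gt20)); apply: Hd.
    by rewrite /ball/= subKr gtr0_norm.
  rewrite lerNl -mulrN (le_trans (ler_norm _))// normrM normrN mulrC (ger0_norm (hk_ge0 _ _ _ _)).
  rewrite /C -mulrA ler_pM ?hk_ge0//.
  rewrite /hk A0 mulr0n addr0 /pweight gtr0_norm//.
  have h : (2 * A) `^ (- s) <= (d + A) `^ (- s).
    have dA0 : 0 < d + A by rewrite addr_gt0.
    rewrite !powRN lef_pV2 ?posrE ?powR_gt0 ?mulr_gt0//.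
    apply: ge0_ler_powR; rewrite ?nnegrE ?(ltW dA0) ?mulr_ge0 ?(ltW A0)//.
      by apply/ltW/(lt_trans ltr01).
    by rewrite mulr_natl mulr2n lerD2r.
  apply: (@le_trans _ _ (A `^ (- s))).
    by rewrite ler_piMr ?powR_ge0// -[leRHS]expR0 ler_expR oppr_le0 divr_ge0 ?ltW.
  have -> : A `^ (- s) = 2 `^ s * (2 * A) `^ (- s).
    rewrite (powRM _ (ler0n R 2) (ltW A0)) mulrA [2 `^ (- s)]powRN mulfV ?mul1r// gt_eqF// powR_gt0.
  by rewrite ler_wpM2l ?powR_ge0.
pose M := C * (2 * (d `^ (1 - s) / (s - 1))) / (g t / 2 * m).
have gm0 : 0 < g t / 2 * m by rewrite mulr_gt0.
have M0 : 0 <= M.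
  rewrite divr_ge0 ?(ltW gm0)// !mulr_ge0// ?powR_ge0// invr_ge0 subr_ge0 ltW//.
have s10 : 0 < s - 1 by rewrite subr_gt0.
(* Ensures 2 z < d and z^(1 - s) >= M + 1, where M is the bound on z^(1 - s) imposed by [key]. *)
pose z := Num.min (d / 4) ((M + 1) `^ (- (s - 1)^-1)).
have M10 : 0 < M + 1 by rewrite ltr_wpDl.
have z0 : 0 < z by rewrite lt_min divr_gt0 ?powR_gt0.
have zd : 2 * z < d.
  have : z <= d / 4 by rewrite ge_min lexx.
  by move: (d) d0 => d' d'0; lra.
have := key z z0 zd; rewrite mulrC -ler_pdivlMr// -/M leNgt => /negP; apply.
apply: (@lt_le_trans _ _ (M + 1)); first by rewrite ltrDl.
have -> : 1 - s = - (s - 1) by ring.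
have -> : M + 1 = ((M + 1) `^ (- (s - 1)^-1)) `^ (- (s - 1)).
  by rewrite -powRrM mulrNN mulVf ?gt_eqF// powRr1// ltW.
rewrite !(powRN _ (s - 1)) lef_pV2 ?posrE ?powR_gt0//.
by apply: ge0_ler_powR; rewrite ?nnegrE ?powR_ge0 ?(ltW z0) ?(ltW s10)// ge_min lexx orbT.
Qed.

(** For large z the window lies where g = c. The source between a and t contributes less by a factor
    of order (t - a) / z, because there the kernel of index 0 is A times that of index 1, with A <=
    t - a. *)
Lemma pot_vanish_far (t a c : R) : (forall z, 0 < z -> pot s g 0 t z = 0) ->
  a < t -> (forall x, x < a -> g x = c) -> c <= 0.
Proof.
move=> P0 at_ gc; rewrite leNgt; apply/negP => c0.
have D0 : 0 < t - a by rewrite subr_gt0.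
have K0 : 0 <= K by exact: le_trans (gK 0).
pose C z := K * (t - a) * (hkC 1 * z^-1 ^+ 1).
have hC1 := @hkC_gt0 R 1.
have C0 z : 0 < z -> 0 <= C z.
  by move=> z0; rewrite /C !mulr_ge0 ?(ltW D0) ?(ltW hC1)// exprn_ge0// invr_ge0 ltW.
have key z : t - a < z -> c * m * z `^ (1 - s) <= C z * (2 * (z `^ (1 - s) / (s - 1))).
  move=> zD; have z0 : 0 < z by exact: lt_trans zD.
  apply: (@pot_vanish_bound c (C z) z z t (ltW c0) z0 z0 (P0 z z0) (C0 z z0)).
    move=> A /andP[A1 A2].
    rewrite gc; last by rewrite ltrBlDl -ltrBlDr; exact: lt_le_trans A1.
    rewrite [leRHS]mulrC lerBlDr lerDl; apply: mulr_ge0; first exact: C0.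
    exact/ltW/pweight_gt0.
  move=> A A0; have [AD|DA] := leP A (t - a); last first.
    apply: (@le_trans _ _ 0); first by rewrite oppr_le0 mulr_ge0 ?C0// ltW// pweight_gt0.
    rewrite gc ?mulr_ge0 ?hk_ge0 ?(ltW c0)//.
    by rewrite ltrBlDl -ltrBlDr.
  rewrite lerNl -mulrN (le_trans (ler_norm _))// normrM normrN mulrC (ger0_norm (hk_ge0 _ _ _ _)).
  rewrite /C -[K * _ * _]mulrA -[leRHS]mulrA ler_pM ?hk_ge0//.
  have -> : hk 0 z A = A * hk 1 z A by rewrite hkS// mulrCA mulfV ?gt_eqF// mulr1.
  by rewrite -mulrA ler_pM ?hk_ge0 ?(ltW A0)// hk_le.
have cm0 : 0 < c * m by rewrite mulr_gt0.
have s10 : 0 < s - 1 by rewrite subr_gt0.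
pose M := K * (t - a) * hkC 1 * 2 / (s - 1) / (c * m).
have M0 : 0 <= M.
  by rewrite !mulr_ge0// ?invr_ge0 ?(ltW cm0) ?(ltW s10) ?(ltW D0) ?(ltW hC1).
pose z := Num.max (t - a) M + 1.
have zD : t - a < z by rewrite /z ltr_pwDr// le_max lexx.
have zM : M < z by rewrite /z ltr_pwDr// le_max lexx orbT.
have z0 : 0 < z by exact: lt_trans zD.
have := key z zD.
have -> : C z * (2 * (z `^ (1 - s) / (s - 1))) =
    (K * (t - a) * hkC 1 * 2 / (s - 1) / z) * z `^ (1 - s) by rewrite /C expr1; ring.
rewrite ler_pM2r ?powR_gt0// ler_pdivlMr// mulrC -ler_pdivlMr// -/M.
by rewrite leNgt zM.
Qed.

Lemma pot_itv (t a z : R) : (forall x, x < a -> g x = 0) ->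
  pot s g 0 t z = \int[mu]_(x in `[a, t]) (hk 0 z (t - x) * g x).
Proof.
move=> g0; rewrite [RHS]Rintegral_mkcond; apply: eq_Rintegral => x _.
rewrite patchE; case: ifPn => // /negP xI; have [xa|ax] := ltP x a; first by rewrite g0// mulr0.
rewrite hk0 ?mul0r// subr_le0 leNgt; apply/negP => xt; apply: xI.
by rewrite inE/= in_itv/= ax ltW.
Qed.

(** A primitive in z of minus the kernel of index 0, equal to A times that kernel for A >= 0; as z
    tends to 0 it becomes the Abel kernel A^(- (s - 1)). *)
Let nk (z A : R) := A `^ (- (s - 1)) * expR (- (z / A)).

Let is_derive_nk (z A : R) : 0 <= A -> is_derive z 1 (nk ^~ A) (- hk 0 z A).
Proof.
rewrite le_eqVlt => /predU1P[<-|A0].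
  (* At A = 0 both sides vanish by convention: [powR] sends 0 to 0 for a nonzero exponent. *)
  rewrite hk0// oppr0 (_ : nk ^~ 0 = cst 0); first exact: is_derive_cst.
  by apply/funext => y; rewrite /nk powR0 ?mul0r// oppr_eq0 subr_eq0 gt_eqF.
have h1 : is_derive z 1 (fun y => - (y / A)) (- A^-1).
  have -> : (fun y => - (y / A)) = (- A^-1) \*: (id : R -> R).
    by apply/funext => y; rewrite /= [RHS]mulNr mulrC.
  by apply: (is_derive_eq (is_deriveZ (- A^-1) (is_derive_id z 1))); rewrite [_ *: _]mulr1.
have h2 := @is_derive1_comp _ expR (fun y => - (y / A)) z _ _ (is_derive_expR _) h1.
apply: (is_derive_eq (is_deriveZ (A `^ (- (s - 1))) h2)).
rewrite /hk A0 mulr0n addr0 /GRing.scale/=.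
have -> : A `^ (- s) = A `^ (- (s - 1)) / A.
  have -> : - s = - (s - 1) + - 1 by ring.
  by rewrite powRD ?(gt_eqF A0) ?implybT// powR_inv1// ltW.
by ring.
Qed.

Let nk_ge0 z A : 0 <= nk z A.
Proof. by rewrite mulr_ge0 ?powR_ge0 ?expR_ge0. Qed.

Let nk_le z A : 0 <= z -> 0 <= A -> nk z A <= A `^ (- (s - 1)).
Proof.
move=> z0 A0; rewrite /nk ler_piMr ?powR_ge0//.
by rewrite -[leRHS]expR0 ler_expR oppr_le0 divr_ge0.
Qed.

Let nkE z A : 0 <= A -> nk z A = A * hk 0 z A.
Proof.
rewrite le_eqVlt => /predU1P[<-|A0].
  by rewrite mul0r /nk powR0 ?mul0r// oppr_eq0 subr_eq0 gt_eqF.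
rewrite /nk /hk A0 mulr0n addr0 mulrA; congr (_ * _).
have -> : - (s - 1) = - s + 1 by ring.
rewrite powRD; last by rewrite (gt_eqF A0) implybT.
by rewrite (powRr1 (ltW A0)) mulrC.
Qed.

(** The integral of g against [nk z] has derivative - pot = 0, hence does not depend on z. It is
    O(z^(- (s - 1))) at infinity, hence 0, and its limit at z = 0 is the Abel integral. *)
Lemma pot_vanish_abel (t a : R) : (forall z, 0 < z -> pot s g 0 t z = 0) ->
  a < t -> (forall x, x < a -> g x = 0) ->
  \int[mu]_(x in `[a, t]) ((t - x) `^ (- (s - 1)) * g x) = 0.
Proof.
move=> P0 at_ g0.
have D0 : 0 < t - a by rewrite subr_gt0.
have K0 : 0 <= K by exact: le_trans (gK 0).
have s10 : 0 < s - 1 by rewrite subr_gt0.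
have s11 : s - 1 < 1 by rewrite ltrBlDr.
have mgI : measurable_fun `[a, t] g by exact: measurable_funTS.
have iA := integrable_abel_kernel s10 s11 a t.
have iKA := integrable_scale K (measurable_itv _) iA.
have tx x : `[a, t]%classic x -> 0 <= t - x <= t - a.
  by rewrite /= in_itv/= => /andP[ax xt]; rewrite subr_ge0 xt/= lerD2l lerN2.
have nk_dom z x : 0 <= z -> `[a, t]%classic x -> `|nk z (t - x) * g x| <= K * (t - x) `^ (- (s - 1)).
  move=> z0 /tx/andP[h _]; rewrite normrM mulrC (ger0_norm (nk_ge0 _ _)).
  by rewrite ler_pM ?nk_le.
have mnk z : 0 < z -> measurable_fun `[a, t] (fun x => nk z (t - x) * g x).
  move=> z0.
  have h : measurable_fun `[a, t] (fun x => (t - x) * hk 0 z (t - x) * g x).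
    apply: measurable_funM => //; apply: measurable_funM.
      by apply: measurable_funB => //; exact: measurable_cst.
    by apply: measurable_funTS; exact: measurable_hk.
  apply: eq_measurable_fun h => x /set_mem/tx/andP[h _]; by rewrite nkE.
have ink z : 0 < z -> mu.-integrable `[a, t] (EFin \o (fun x => nk z (t - x) * g x)).
  move=> z0; apply: (integrable_le _ (mnk z z0) iKA) => // x; exact: nk_dom (ltW z0).
pose N z := \int[mu]_(x in `[a, t]) (nk z (t - x) * g x).
have dN (z : R) : 0 < z -> is_derive z 1 N 0.
  move=> z0; have z20 : 0 < z / 2 by rewrite divr_gt0.
  have e0 : 0 = \int[mu]_(x in `[a, t]) (- hk 0 z (t - x) * g x).
    rewrite -[LHS]oppr0 -(P0 z z0) (pot_itv t z g0) -mulN1r -RintegralZl//.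
      by apply: eq_Rintegral => x _; rewrite mulN1r mulNr.
    by apply: integrableS (integrable_pot s1 s2' mg gK 0 t z0).
  rewrite e0.
  apply: (@is_derive_Rintegral _ (fun z x => nk z (t - x) * g x)
    (fun z x => - hk 0 z (t - x) * g x) _ z (z / 2)
    (fun x => K * (hkC 0 * (z / 2)^-1 ^+ 0) * pweight s (z / 2) (t - x))) => //.
  - by move=> w hw; apply: ink; exact: lt_le_trans (half_ball z0 hw).
  - move=> w x hw /tx/andP[h _].
    have h' := is_deriveM (is_derive_nk w h) (is_derive_cst (g x) w 1).
    by apply: (is_derive_eq h'); rewrite scaler0 add0r /GRing.scale/= mulrC.
  - apply: integrable_scale => //.
    by apply: integrableS (integrable_pweight s1 t z20).
  - move=> w x hw _; rewrite normrM normrN (ger0_norm (hk_ge0 _ _ _ _)) mulrC -mulrA.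
    rewrite ler_pM ?hk_ge0//; apply: hk_le_pweight => //; first exact: half_ball.
    by rewrite lerD2r half_ball.
have cN z w : 0 < z -> z < w -> N w = N z.
  move=> z0 zw; have [|c _ /eqP] := @MVT_derive _ N (cst 0) z w zw.
    by move=> y /andP[zy _]; apply: dN; exact: lt_le_trans zy.
  by rewrite mul0r subr_eq0 => /eqP.
pose C := (t - a) * K * hkC 0 * (2 / (s - 1)).
have NC z : 0 < z -> `|N z| <= C * z `^ (- (s - 1)).
  move=> z0; apply: (le_trans (le_normr_Rintegral _ (ink z z0))) => //.
  have ip : mu.-integrable setT (EFin \o (fun x => (t - a) * K * hkC 0 * pweight s z (t - x))).
    by apply: integrable_scale => //; exact: integrable_pweight.
  have -> : C * z `^ (- (s - 1)) = \int[mu]_x ((t - a) * K * hkC 0 * pweight s z (t - x)).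
    rewrite RintegralZl//; last exact: integrable_pweight.
    rewrite /Rintegral integral_pweight_translate//=.
    have -> : 1 - s = - (s - 1) by ring.
    by rewrite /C; ring.
  rewrite [leLHS]Rintegral_mkcond; apply: le_Rintegral => //.
    by apply: integrable_patch => //; apply: integrable_norm; exact: ink.
  move=> x _; rewrite patchE; case: ifPn => [/set_mem/tx/andP[h1 h2]|_]; last first.
    by rewrite !mulr_ge0 ?(ltW D0) ?(ltW (hkC_gt0 _))// ltW// pweight_gt0.
  rewrite normrM (ger0_norm (nk_ge0 _ _)) nkE// mulrC.
  have -> : (t - a) * K * hkC 0 * pweight s z (t - x) = K * ((t - a) * (hkC 0 * pweight s z (t - x))).
    by ring.
  rewrite ler_pM ?mulr_ge0 ?hk_ge0// ler_pM ?hk_ge0//.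
  by have := hk_le s2' 0 (t - x) z0; rewrite expr0 mulr1.
have N0 z : 0 < z -> N z = 0.
  move=> z0; apply/eqP; rewrite -normr_le0.
  have C0 : C * ((0 + x) `^ (- (s - 1))) @[x --> +oo] --> (0 : R).
    rewrite -(mulr0 C); apply: cvgMr; exact: powR_cvg_pinfty0.
  apply: (cvgr_to_ge C0); near=> w; rewrite add0r.
  have zw : z < w by near: w; apply: nbhs_pinfty_gt; exact: num_real.
  by rewrite -(cN z w z0 zw) NC//; exact: lt_trans zw.
have lim : N n.+1%:R^-1 @[n --> \oo] --> \int[mu]_(x in `[a, t]) ((t - x) `^ (- (s - 1)) * g x).
  apply: (@dominated_Rintegral _ _ _ _ (fun x => K * (t - x) `^ (- (s - 1)))) => //.
  - by move=> n; apply: mnk; rewrite invr_gt0.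
  - by apply: measurable_funM => //; exact: measurable_powR_sub.
  - move=> x _; apply: cvgMl; rewrite /nk -[in X in _ --> X](mulr1 (_ `^ _)); apply: cvgMr.
    have h1 : (- (n.+1%:R^-1 / (t - x))) @[n --> \oo] --> (0 : R).
      rewrite -oppr0 -[in X in _ --> X](mul0r (t - x)^-1); apply: cvgN; apply: cvgMl.
      exact: cvg_harmonic.
    by have := cvg_comp _ _ h1 (@continuous_expR R 0); rewrite expR0.
  - by move=> n x hx; apply: nk_dom; rewrite ?invr_ge0.
move: lim; under eq_fun do rewrite N0//.
by move=> /(cvg_unique (@norm_hausdorff _ R^o) (cvg_cst 0)) <-.
Unshelve. all: by end_near. Qed.

End VanishingPotential.

(** * Improper integrals and their derivatives *)

Section TailIntegrals.
Context {R : realType}.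

Lemma powR_subr1 (x p : R) : 0 < x -> x `^ p = x `^ (p - 1) * x.
Proof.
move=> x0; have e : p = (p - 1) + 1 by ring.
rewrite [in LHS]e powRD; last by rewrite (gt_eqF x0) implybT.
by rewrite (powRr1 (ltW x0)).
Qed.

Notation mu := (@lebesgue_measure R).

Lemma Rintegral_eq0 (D : set R) (f : R -> R) : measurable D ->
  (forall x, D x -> f x = 0) -> \int[mu]_(x in D) f x = 0.
Proof.
move=> mD f0; transitivity (\int[mu]_(x in D) (cst 0 x)); last by rewrite Rintegral_cst// mul0r.
by apply: eq_Rintegral => x /set_mem; exact: f0.
Qed.

Lemma is_derive_tail (h : R -> R) (w z : R) : w < z ->
  mu.-integrable `]w, +oo[ (EFin \o h) -> {for z, continuous h} ->
  is_derive z 1 (fun z => \int[mu]_(x in `]z, +oo[) h x) (- h z).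
Proof.
move=> wz hi ch.
have hi' : mu.-integrable `]w, (z + 1)] (EFin \o h).
  by apply: integrableS hi => // x /=; rewrite !in_itv/= andbT => /andP[].
have z1 : z < z + 1 by rewrite ltrDl.
have [|d1 d2] := @continuous_FTC1 _ h (BRight w) z (z + 1) z1 hi' _ ch.
  by rewrite lte_fin.
have d : is_derive z 1 (fun z => \int[mu]_(x in `]w, z]) h x) (h z).
  by apply: DeriveDef; [exact: d1|rewrite -derive1E].
have d' := is_deriveB (is_derive_cst (\int[mu]_(x in `]w, +oo[) h x) z 1) d.
apply: (@near_eq_is_derive _ _ _ _ _ _ _ _ _ (is_derive_eq d' _)); last by rewrite sub0r.
near=> y; rewrite !fctE; apply: Rintegral_itvB => //.
by rewrite bnd_simp ltW//; near: y; exact: lt_nbhsr.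
Unshelve. all: by end_near. Qed.

Lemma Rintegral_FTC2 (h F : R -> R) (x y : R) : x < y ->
  (forall t : R, x <= t <= y -> is_derive t 1 F (h t)) ->
  (forall t, x <= t <= y -> {for t, continuous h}) ->
  \int[mu]_(t in `[x, y]) h t = F y - F x.
Proof.
move=> xy dF ch; rewrite /Rintegral (@continuous_FTC2 _ h F x y xy) -?EFinB//.
- by apply: continuous_in_subspaceT => t /set_mem/=; rewrite in_itv/=; exact: ch.
- split.
  + by move=> t; rewrite in_itv/= => /andP[/ltW xt /ltW ty]; have [] := dF t (introT andP (conj xt ty)).
  + by apply: cvg_at_right_filter; apply: is_derive_continuous (dF x _); rewrite lexx ltW.
  + by apply: cvg_at_left_filter; apply: is_derive_continuous (dF y _); rewrite lexx ltW.
- move=> t; rewrite in_itv/= => /andP[/ltW xt /ltW ty].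
  by rewrite derive1E; have [_ ->] := dF t (introT andP (conj xt ty)).
Qed.

(** The integrand has no sign, so the passage from bounded intervals to the half-line is by
    dominated convergence. *)
Lemma Rintegral_FTC2y (h F : R -> R) (x : R) :
  (forall t : R, x <= t -> is_derive t 1 F (h t)) ->
  (forall t, x <= t -> {for t, continuous h}) ->
  mu.-integrable `]x, +oo[ (EFin \o h) -> F t @[t --> +oo] --> (0 : R) ->
  \int[mu]_(t in `]x, +oo[) h t = - F x.
Proof.
move=> dF ch hi F0.
have xn n : x < x + n.+1%:R by rewrite ltrDl.
pose hn (n : nat) t := h t * \1_(`]x, x + n.+1%:R]) t.
have mh : measurable_fun `]x, +oo[ h by case/integrableP: hi => /measurable_EFinP.
have lim : \int[mu]_(t in `]x, +oo[) hn n t @[n --> \oo] --> \int[mu]_(t in `]x, +oo[) h t.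
  apply: (@dominated_Rintegral _ _ _ _ (fun t => `|h t|)) => //.
  - by move=> n; apply: measurable_funM => //; apply: measurable_funTS; exact: measurable_indic.
  - move=> t; rewrite /= in_itv/= andbT => xt.
    apply: cvg_near_cst; near=> n; rewrite /hn indicE mem_set ?mulr1//=.
    rewrite in_itv/= xt/= -lerBlDl; apply: ltW; near: n.
    by apply: filterS (nbhs_infty_gtr (t - x)) => n /lt_le_trans; apply; rewrite ler_nat.
  - exact: integrable_norm.
  - move=> n t _; rewrite normrM ler_piMr// indicE; case: (_ \in _); rewrite ?normr1 ?normr0//.
have eF n : \int[mu]_(t in `]x, +oo[) hn n t = F (x + n.+1%:R) - F x.
  have dFn t : x <= t <= x + n.+1%:R -> is_derive t 1 F (h t) by move=> /andP[xt _]; exact: dF.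
  have chn t : x <= t <= x + n.+1%:R -> {for t, continuous h} by move=> /andP[xt _]; exact: ch.
  have <- := Rintegral_FTC2 (xn n) dFn chn.
  rewrite -Rintegral_itv_obnd_cbnd; last first.
    by apply: integrableS hi => // t /=; rewrite !in_itv/= andbT => /andP[].
  rewrite Rintegral_mkcond [RHS]Rintegral_mkcond; apply: eq_Rintegral => t _.
  rewrite !patchE /hn indicE; case: ifPn => [|/negP] /=.
    by move=> _; case: ifP; rewrite ?mulr1 ?mulr0.
  move=> nt; case: ifPn => //; rewrite !inE/= in nt *; rewrite in_itv/= => /andP[xt _].
  by case: nt; rewrite in_itv/= andbT.
have lim2 : F (x + n.+1%:R) - F x @[n --> \oo] --> - F x.
  rewrite -[in X in _ --> X](sub0r (F x)); apply: cvgB; last exact: cvg_cst.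
  apply: (cvg_comp (fun n => x + n.+1%:R) F _ F0); apply/cvgryPge => A; near=> n.
  rewrite -lerBlDl; apply: ltW; near: n.
  by apply: filterS (nbhs_infty_gtr (A - x)) => n /lt_le_trans; apply; rewrite ler_nat.
move: lim; under eq_fun do rewrite eF.
by move=> h1; apply: (cvg_unique (@norm_hausdorff _ R^o) h1 lim2).
Unshelve. all: by end_near. Qed.

Lemma integrable_opp (f : R -> R) : mu.-integrable setT (EFin \o f) ->
  mu.-integrable setT (EFin \o (fun x => f (- x))).
Proof.
move=> /integrableP[/measurable_EFinP mf fi].
apply/integrableP; split.
  by apply/measurable_EFinP; apply: measurableT_comp.
have := @ge0_integral_opp _ (fun x => `|f x|) _ (fun x => normr_ge0 _).
by move=> /= ->//; exact: measurableT_comp.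
Qed.

Lemma integrable_powR0 (p z : R) : 0 < p < 1 ->
  mu.-integrable `[0, z] (EFin \o (fun x => x `^ (- p))).
Proof.
move=> /andP[p0 p1].
have := integrable_opp (integrable_patch (measurable_itv _) (integrable_abel_kernel p0 p1 (- z) 0)).
move=> h.
have mf : measurable_fun `[0, z] (fun x : R => x `^ (- p)) by apply: measurable_funTS; exact: measurable_powR.
have := @integrableS _ _ _ mu setT `[0, z]%classic _ measurableT (measurable_itv _) (@subsetT _ _) h.
apply: le_integrable => //; first exact/measurable_EFinP.
move=> x hx; rewrite /= patchE mem_set.
  by rewrite /= sub0r opprK.
by move: hx; rewrite /= !in_itv/= lerN2 oppr_le0 andbC.
Qed.

End TailIntegrals.

Section PotentialSupport.
Context {R : realType}.
Notation mu := (@lebesgue_measure R).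
Variables (s K : R).
Hypotheses (s1 : 1 < s) (s2 : s <= 2).

Definition potC n : R := K * hkC n * 2 / (s - 1).

Lemma pot_le_potC (g : R -> R) n t z : measurable_fun [set: R] g -> (forall x, `|g x| <= K) ->
  0 < z -> `|pot s g n t z| <= potC n * (z `^ (1 - s) * z^-1 ^+ n).
Proof.
move=> mg gK z0; apply: (le_trans (pot_le s1 s2 mg gK n t z0)).
by rewrite le_eqVlt; apply/orP; left; apply/eqP; rewrite /potC; ring.
Qed.

Lemma potC_ge0 n : 0 <= K -> 0 <= potC n.
Proof.
by move=> K0; rewrite /potC !mulr_ge0 ?invr_ge0 ?subr_ge0 ?(ltW s1) ?(ltW (hkC_gt0 _)).
Qed.

(* If the sources lie at distance at most D, then A <= D on the support and
   A^-n <= D^2 A^-(n+2): two more powers of z are gained at infinity. *)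
Lemma pot_le_supp (g : R -> R) (a D : R) n t z : measurable_fun [set: R] g ->
  (forall x, `|g x| <= K) -> (forall x, x < a -> g x = 0) -> 0 <= D -> t - a <= D -> 0 < z ->
  `|pot s g n t z| <= D ^+ 2 * potC n.+2 * (z `^ (1 - s) * z^-1 ^+ n.+2).
Proof.
move=> mg gK ga D0 tD z0; have K0 : 0 <= K by exact: le_trans (gK 0).
pose g' x := (t - x) ^+ 2 * (g x * \1_(`]-oo, t]) x).
have mg' : measurable_fun [set: R] g'.
  apply: measurable_funM.
    by apply: measurable_funX; apply: measurable_funB => //; exact: measurable_cst.
  by apply: measurable_funM => //; exact: measurable_indic.
have g'K x : `|g' x| <= D ^+ 2 * K.
  rewrite /g' indicE; have [|_] := boolP (x \in _); last by rewrite !mulr0 normr0 mulr_ge0// sqr_ge0.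
  rewrite inE/= in_itv/= => xt; have [xa|ax] := ltP x a.
    by rewrite ga// mul0r mulr0 normr0 mulr_ge0// sqr_ge0.
  rewrite mulr1 normrM normrX ger0_norm ?subr_ge0//; apply: ler_pM => //.
    by rewrite exprn_ge0// subr_ge0.
  rewrite lerXn2r ?nnegrE ?subr_ge0//; apply: le_trans tD.
  by rewrite lerD2l lerN2.
have -> : pot s g n t z = pot s g' n.+2 t z.
  apply: eq_Rintegral => x _; rewrite /g'; have [A0|A0] := leP (t - x) 0.
    by rewrite !hk0// !mul0r.
  rewrite indicE mem_set ?mulr1/=; last by rewrite in_itv/= ltW// -subr_gt0.
  rewrite !hkS//; field; exact: lt0r_neq0.
have h := pot_le s1 s2 mg' g'K n.+2 t z0.
apply: (le_trans h); rewrite le_eqVlt; apply/orP; left; apply/eqP; rewrite /potC; ring.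
Qed.

(** Since w + z <= 2 z for z >= w, the power z^(- s) is dominated on the tail by the integrable
    weight, and the spare powers of 1 / z are frozen at w. *)
Lemma pweight_tail (w z : R) n : 0 < w -> w <= z ->
  z `^ (1 - s) * z^-1 ^+ n.+1 <= w^-1 ^+ n * 2 `^ s * pweight s w z.
Proof.
move=> w0 wz; have z0 : 0 < z by exact: lt_le_trans wz.
have wz0 : 0 < w + z by rewrite addr_gt0.
have s0 : 0 <= s by exact/ltW/(lt_trans ltr01).
have e : z `^ (1 - s) * z^-1 = z `^ (- s).
  rewrite -(powR_inv1 (ltW z0)) -powRD ?(gt_eqF z0) ?implybT//; congr (_ `^ _); ring.
rewrite exprS mulrA e mulrC -[leRHS]mulrA; apply: ler_pM.
- by rewrite exprn_ge0// invr_ge0 ltW.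
- exact: powR_ge0.
- by rewrite lerXn2r ?nnegrE ?invr_ge0 ?(ltW z0) ?(ltW w0)// lef_pV2.
- rewrite /pweight gtr0_norm//.
  have -> : z `^ (- s) = 2 `^ s * (2 * z) `^ (- s).
    by rewrite (powRM _ (ler0n R 2) (ltW z0)) mulrA [2 `^ (- s)]powRN mulfV ?mul1r// gt_eqF// powR_gt0.
  rewrite ler_wpM2l ?powR_ge0// !powRN lef_pV2 ?posrE ?powR_gt0 ?mulr_gt0//.
  apply: ge0_ler_powR => //; rewrite ?nnegrE ?(ltW wz0) ?mulr_ge0 ?(ltW z0)//.
  by rewrite mulr_natl mulr2n lerD2r.
Qed.

End PotentialSupport.

(** * The primitive Psi of the product of two potentials *)

Section Psi.
Context {R : realType}.
Notation mu := (@lebesgue_measure R).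
Variables (s K b : R) (g f : R -> R).
Hypotheses (s1 : 1 < s) (s2 : s <= 2).
Hypotheses (mg : measurable_fun [set: R] g) (gK : forall x, `|g x| <= K).
Hypotheses (mf : measurable_fun [set: R] f) (fK : forall x, `|f x| <= K).
Hypothesis fb : forall x, b < x -> f x = 0.

Let h x := f (- x).
Let mh : measurable_fun [set: R] h. Proof. exact: measurableT_comp. Qed.
Let hK x : `|h x| <= K. Proof. exact: fK. Qed.
Let hb x : x < - b -> h x = 0. Proof. by move=> xb; rewrite /h fb// ltrNr. Qed.
Let K0 : 0 <= K. Proof. exact: le_trans (gK 0). Qed.
Notation C n := (potC s K n).
Let C0 n : 0 <= C n. Proof. exact: potC_ge0. Qed.

Notation P := (pot s g).
Definition bpot n t z := pot s h n (- t) z.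
Notation Q := bpot.

Let P_le n t z : 0 < z -> `|P n t z| <= C n * (z `^ (1 - s) * z^-1 ^+ n).
Proof. exact: pot_le_potC. Qed.

Let Q_le (D : R) n t z : 0 <= D -> b - t <= D -> 0 < z ->
  `|Q n t z| <= D ^+ 2 * C n.+2 * (z `^ (1 - s) * z^-1 ^+ n.+2).
Proof.
by move=> D0 tD z0; apply: (pot_le_supp s1 s2 n mh hK hb) => //; rewrite opprK addrC.
Qed.

Lemma is_derive_bpot_z n (t z : R) : 0 < z -> is_derive z 1 (Q n t) (- Q n.+1 t z).
Proof. exact: (is_derive_pot_z s1 s2 mh hK). Qed.

Lemma is_derive_bpot_t n (t z : R) : 0 < z ->
  is_derive t 1 (Q n ^~ z) (- (- (s + n%:R) * Q n.+1 t z + z * Q n.+2 t z)).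
Proof.
move=> z0; have h1 : is_derive t 1 (fun y : R => - y) (-1) by exact: is_deriveN.
have h2 := is_derive_pot_t s1 s2 mh hK n (- t) z0.
by apply: (is_derive_eq (@is_derive1_comp _ (pot s h n ^~ z) -%R t _ (-1) h2 h1)); rewrite mulrN1.
Qed.

Lemma continuous_bpot n t z : 0 < z -> {for (t, z), continuous (fun p => Q n p.1 p.2)}.
Proof.
move=> z0; apply: (@continuous_comp _ _ _ (fun p : R * R => (- p.1, p.2)) (fun p => pot s h n p.1 p.2)).
  have h1 : (- p.1) @[p --> (t, z)] --> - t by apply: cvgN; exact: cvg_fst.
  have h2 : p.2 @[p --> (t, z)] --> z by exact: cvg_snd.
  exact: (cvg_pair h1 h2).
exact: (continuous_pot s1 s2 K0 mh hK).
Qed.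

Definition psi_density t z := z `^ (s - 1) * (P 0 t z * Q 0 t z).
Definition psi t z := - \int[mu]_(x in `]z, +oo[) psi_density t x.

Let dt_density t z := z `^ (s - 1) * ((- s * P 1 t z + z * P 2 t z) * Q 0 t z
  - P 0 t z * (- s * Q 1 t z + z * Q 2 t z)).
Let flux t z := z `^ s * (- P 1 t z * Q 0 t z + P 0 t z * Q 1 t z).

Let is_derive_density_t (t z : R) : 0 < z -> is_derive t 1 (psi_density ^~ z) (dt_density t z).
Proof.
move=> z0.
have d := is_deriveM (is_derive_pot_t s1 s2 mg gK 0 t z0) (is_derive_bpot_t 0 t z0).
apply: (is_derive_eq (is_deriveZ (z `^ (s - 1)) d)).
rewrite /dt_density /GRing.scale/= !addr0; move: (P 0 t z) (P 1 t z) (P 2 t z) (Q 0 t z) (Q 1 t z) (Q 2 t z) => p0 p1 p2 q0 q1 q2; ring.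
Qed.

Let continuous_density t z : 0 < z -> {for z, continuous (psi_density t)}.
Proof.
move=> z0.
have d := is_deriveM (is_derive_pot_z s1 s2 mg gK 0 t z0) (is_derive_bpot_z 0 t z0).
exact: is_derive_continuous (is_deriveM (is_derive1_powR (s - 1) z0) d).
Qed.

Let powR_s z := @powR_subr1 R z s.

Let powR_1s z : 0 < z -> z `^ (s - 1) * z `^ (1 - s) = 1.
Proof.
move=> z0; rewrite -powRD; last by rewrite (gt_eqF z0) implybT.
by rewrite addrC subrKA subrr powRr0.
Qed.

(** Green's identity: z U_zz + s U_z = z^(1 - s) (z^s U_z)_z is symmetric for the weight z^(s - 1),
    so the time derivative of the density is the z-derivative of z^s (U_z V - U V_z). Integration up
    to infinity then gives Psi_t in closed form. *)
Let is_derive_flux (t z : R) : 0 < z -> is_derive z 1 (flux t) (dt_density t z).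
Proof.
move=> z0.
have d1 := is_deriveM (is_deriveN (is_derive_pot_z s1 s2 mg gK 1 t z0)) (is_derive_bpot_z 0 t z0).
have d2 := is_deriveM (is_derive_pot_z s1 s2 mg gK 0 t z0) (is_derive_bpot_z 1 t z0).
have d := is_deriveM (is_derive1_powR s z0) (is_deriveD d1 d2).
apply: (is_derive_eq d).
rewrite /dt_density /GRing.scale/= !fctE powR_s//; move: (P 0 t z) (P 1 t z) (P 2 t z) (Q 0 t z) (Q 1 t z) (Q 2 t z) => p0 p1 p2 q0 q1 q2; ring.
Qed.

Let continuous_dt_density t z : 0 < z -> {for z, continuous (dt_density t)}.
Proof.
move=> z0.
have cP n : {for z, continuous (P n t)} by exact: is_derive_continuous (is_derive_pot_z s1 s2 mg gK n t z0).
have cQ n : {for z, continuous (Q n t)} by exact: is_derive_continuous (is_derive_bpot_z n t z0).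
have cz : {for z, continuous (fun z => z `^ (s - 1))} by exact: is_derive_continuous (is_derive1_powR (s - 1) z0).
apply: cvgM; first exact: cz.
apply: cvgB.
  apply: cvgM; last exact: cQ.
  apply: cvgD; first by apply: cvgM; [exact: cvg_cst|exact: cP].
  by apply: cvgM; [exact: cvg_id|exact: cP].
apply: cvgM; first exact: cP.
apply: cvgD; first by apply: cvgM; [exact: cvg_cst|exact: cQ].
by apply: cvgM; [exact: cvg_id|exact: cQ].
Qed.

(** The gain z^(- 2) at infinity comes from Q alone: f vanishes beyond b, whereas g need not vanish
    far to the left. *)
Lemma psi_density_le (D t z : R) : 0 <= D -> b - t <= D -> 0 < z ->
  `|psi_density t z| <= D ^+ 2 * (C 0 * C 2) * (z `^ (1 - s) * z^-1 ^+ 2).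
Proof.
move=> D0 tD z0; rewrite /psi_density !normrM (ger0_norm (powR_ge0 _ _)).
have h1 := P_le 0 t z0; have h2 := Q_le 0 D0 tD z0.
have h3 : `|P 0 t z| * `|Q 0 t z| <= C 0 * (z `^ (1 - s) * z^-1 ^+ 0) * (D ^+ 2 * C 2 * (z `^ (1 - s) * z^-1 ^+ 2)).
  by apply: ler_pM.
apply: (le_trans (ler_wpM2l (powR_ge0 _ _) h3)).
rewrite le_eqVlt; apply/orP; left; apply/eqP.
move: (powR_1s z0) (C 0) (C 2); move: (z `^ (1 - s)) (z `^ (s - 1)) => E p pE c0 c2.
by rewrite -[RHS]mul1r -pE; ring.
Qed.

Definition fluxC D := D ^+ 2 * (C 1 * C 2 + C 0 * C 3).

Let flux_le (D t z : R) : 0 <= D -> b - t <= D -> 0 < z ->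
  `|flux t z| <= fluxC D * (z `^ (1 - s) * z^-1 ^+ 2).
Proof.
move=> D0 tD z0; rewrite /flux normrM (ger0_norm (powR_ge0 _ _)).
have p0 := P_le 0 t z0; have p1 := P_le 1 t z0.
have q0 := Q_le 0 D0 tD z0; have q1 := Q_le 1 D0 tD z0.
have h3 : `|- P 1 t z * Q 0 t z + P 0 t z * Q 1 t z| <=
   C 1 * (z `^ (1 - s) * z^-1 ^+ 1) * (D ^+ 2 * C 2 * (z `^ (1 - s) * z^-1 ^+ 2)) +
   C 0 * (z `^ (1 - s) * z^-1 ^+ 0) * (D ^+ 2 * C 3 * (z `^ (1 - s) * z^-1 ^+ 3)).
  have /le_trans := ler_normD (- P 1 t z * Q 0 t z) (P 0 t z * Q 1 t z); apply; rewrite !normrM normrN.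
  exact: lerD (ler_pM (normr_ge0 _) (normr_ge0 _) p1 q0) (ler_pM (normr_ge0 _) (normr_ge0 _) p0 q1).
apply: (le_trans (ler_wpM2l (powR_ge0 _ _) h3)).
have zz : z * z^-1 = 1 by rewrite mulfV ?gt_eqF.
rewrite powR_s// /fluxC le_eqVlt; apply/orP; left; apply/eqP.
move: (powR_1s z0) (C 0) (C 1) (C 2) (C 3); move: (z `^ (1 - s)) (z `^ (s - 1)) => E p pE c0 c1 c2 c3.
by rewrite -[RHS]mul1r -pE -[RHS]mulr1 -zz; ring.
Qed.

Definition dtC D := D ^+ 2 * ((s * C 1 + C 2) * C 2 + C 0 * (s * C 3 + C 4)).

Let dt_density_le (D t z : R) : 0 <= D -> b - t <= D -> 0 < z ->
  `|dt_density t z| <= dtC D * (z `^ (1 - s) * z^-1 ^+ 3).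
Proof.
move=> D0 tD z0; rewrite /dt_density normrM (ger0_norm (powR_ge0 _ _)).
have p0 := P_le 0 t z0; have p1 := P_le 1 t z0; have p2 := P_le 2 t z0.
have q0 := Q_le 0 D0 tD z0; have q1 := Q_le 1 D0 tD z0; have q2 := Q_le 2 D0 tD z0.
have s0 : 0 <= s by exact/ltW/(lt_trans ltr01).
have hl (x y c d : R) : `|x| <= c -> `|y| <= d -> `|- s * x + z * y| <= s * c + z * d.
  move=> hx hy; apply: (le_trans (ler_normD _ _)); rewrite !normrM normrN (ger0_norm s0) (gtr0_norm z0).
  by rewrite lerD// ler_wpM2l// ltW.
have h3 := lerD (ler_pM (normr_ge0 _) (normr_ge0 _) (hl _ _ _ _ p1 p2) q0)
   (ler_pM (normr_ge0 _) (normr_ge0 _) p0 (hl _ _ _ _ q1 q2)).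
have h4 : `|(- s * P 1 t z + z * P 2 t z) * Q 0 t z - P 0 t z * (- s * Q 1 t z + z * Q 2 t z)| <= 
  (s * (C 1 * (z `^ (1 - s) * z^-1 ^+ 1)) + z * (C 2 * (z `^ (1 - s) * z^-1 ^+ 2))) *
      (D ^+ 2 * C 2 * (z `^ (1 - s) * z^-1 ^+ 2)) +
      C 0 * (z `^ (1 - s) * z^-1 ^+ 0) *
      (s * (D ^+ 2 * C 3 * (z `^ (1 - s) * z^-1 ^+ 3)) + z * (D ^+ 2 * C 4 * (z `^ (1 - s) * z^-1 ^+ 4))).
  by apply: le_trans h3; rewrite (le_trans (ler_normB _ _))// !normrM.
apply: (le_trans (ler_wpM2l (powR_ge0 _ _) h4)).
rewrite /dtC le_eqVlt; apply/orP; left; apply/eqP.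
move: (powR_1s z0) (C 0) (C 1) (C 2) (C 3) (C 4).
move: (z `^ (1 - s)) (z `^ (s - 1)) => E p pE c0 c1 c2 c3 c4.
by rewrite -[RHS]mul1r -pE; field; exact: lt0r_neq0.
Qed.

Let integrable_pweight_itv (c w : R) : 0 < w ->
  mu.-integrable `]w, +oo[ (EFin \o (fun x => c * pweight s w x)).
Proof.
move=> w0; have i1 : mu.-integrable setT (EFin \o (fun x => pweight s w (0 - x))) by exact: integrable_pweight.
have mp : measurable_fun [set: R] (pweight s w) by apply: continuous_measurable_fun; exact: pweight_continuous.
have i2 : mu.-integrable setT (EFin \o pweight s w).
  apply: (integrable_le measurableT mp i1) => x _; rewrite sub0r /pweight normrN.
  by rewrite ger0_norm// powR_ge0.
by apply: integrable_scale => //; apply: integrableS i2.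
Qed.

Let measurable_itv_cont (w : R) (F : R -> R) : 0 < w ->
  (forall z, 0 < z -> {for z, continuous F}) -> measurable_fun `]w, +oo[ F.
Proof.
move=> w0 cF; apply: open_continuous_measurable_fun; first exact: interval_open.
by move=> z /set_mem/=; rewrite in_itv/= andbT => wz; apply: cF; exact: lt_trans wz.
Qed.

Let in_tail (w z : R) : 0 < w -> `]w, +oo[%classic z -> w <= z /\ 0 < z.
Proof. by move=> w0 /=; rewrite in_itv/= andbT => wz; rewrite ltW// (lt_trans w0). Qed.

(** The summand 1 leaves room for the times t' with |t' - t| < 1, so that one constant serves on a
    neighbourhood of t. *)
Let Dt t : R := `|b - t| + 1.
Let Dt0 t : 0 <= Dt t. Proof. by rewrite addr_ge0. Qed.
Let Dt_le t : b - t <= Dt t. Proof. by rewrite (le_trans (ler_norm _))// lerDl. Qed.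
Let Dt_near t t' : `|t' - t| < 1 -> b - t' <= Dt t.
Proof.
move=> tt; have := ler_norm (b - t); move: tt; rewrite ltr_distl => /andP[tt _] hb1.
rewrite /Dt lerBlDr; apply: (@le_trans _ _ ((b - t) + (1 + t'))); last by rewrite addrA 2!lerD2r.
have -> : b - t + (1 + t') = b + (t' - (t - 1)) by ring.
by rewrite lerDl subr_ge0 ltW.
Qed.

Let C02 D : 0 <= D -> 0 <= D ^+ 2 * (C 0 * C 2).
Proof. by move=> D0; apply: mulr_ge0; [exact: exprn_ge0|apply: mulr_ge0]. Qed.

Lemma integrable_psi_density t w : 0 < w -> mu.-integrable `]w, +oo[ (EFin \o psi_density t).
Proof.
move=> w0.
have mm : measurable_fun `]w, +oo[ (psi_density t).
  by apply: measurable_itv_cont => // z z0; exact: continuous_density.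
apply: (integrable_le _ mm (integrable_pweight_itv (Dt t ^+ 2 * (C 0 * C 2) * (w^-1 ^+ 1 * 2 `^ s)) w0)) => // z.
move=> /(in_tail w0)[wz z0]; apply: (le_trans (psi_density_le (Dt0 t) (Dt_le t) z0)).
rewrite -[leRHS]mulrA; apply: ler_wpM2l; [exact: C02|exact: (pweight_tail s1)].
Qed.

Lemma is_derive_psi_z (t z : R) : 0 < z -> is_derive z 1 (psi t) (psi_density t z).
Proof.
move=> z0; have z2 : z / 2 < z by exact: half_lt.
have z20 : 0 < z / 2 by rewrite divr_gt0.
have := is_deriveN (is_derive_tail z2 (integrable_psi_density t z20) (@continuous_density t z z0)).
by rewrite opprK.
Qed.

Let flux_cvg0 t : flux t z @[z --> +oo] --> (0 : R).
Proof.
have p := @powR_cvg_pinfty0 R 0 s (lt_trans ltr01 s1).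
have c0 : 0 <= fluxC (Dt t).
  apply: mulr_ge0; first exact: exprn_ge0.
  by apply: addr_ge0; apply: mulr_ge0.
have hl : fluxC (Dt t) * ((0 + z) `^ (- s)) @[z --> +oo] --> (0 : R).
  by rewrite -[X in _ --> X](mulr0 (fluxC (Dt t))); apply: cvgMr.
apply/cvgr0Pnorm_le => e e0; have /cvgr0Pnorm_le/(_ _ e0) H := hl; near=> z.
have z1 : 1 <= z by near: z; apply: nbhs_pinfty_ge; exact: num_real.
have z0 : 0 < z by exact: lt_le_trans z1.
have : `|fluxC (Dt t) * (0 + z) `^ (- s)| <= e by near: z; exact: H.
apply: le_trans; rewrite add0r (ger0_norm (mulr_ge0 c0 (powR_ge0 _ _))).
apply: (le_trans (flux_le (Dt0 t) (Dt_le t) z0)); apply: ler_wpM2l => //.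
have e2 : z `^ (1 - s) * z^-1 = z `^ (- s).
  rewrite -(powR_inv1 (ltW z0)) -powRD ?(gt_eqF z0) ?implybT//; congr (_ `^ _); ring.
by rewrite expr2 mulrA e2 ler_piMr ?powR_ge0// invf_le1.
Unshelve. all: by end_near. Qed.

Let dtC_ge0 D : 0 <= D -> 0 <= dtC D.
Proof.
move=> D0; have s0 : 0 <= s by exact/ltW/(lt_trans ltr01).
by apply: mulr_ge0; [exact: exprn_ge0|]; apply: addr_ge0; apply: mulr_ge0 => //; apply: addr_ge0 => //; apply: mulr_ge0.
Qed.

Let integrable_dt_density t w : 0 < w -> mu.-integrable `]w, +oo[ (EFin \o dt_density t).
Proof.
move=> w0.
have mm : measurable_fun `]w, +oo[ (dt_density t).
  by apply: measurable_itv_cont => // z z0; exact: continuous_dt_density.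
apply: (integrable_le _ mm (integrable_pweight_itv (dtC (Dt t) * (w^-1 ^+ 2 * 2 `^ s)) w0)) => // z.
move=> /(in_tail w0)[wz z0]; apply: (le_trans (dt_density_le (Dt0 t) (Dt_le t) z0)).
rewrite -[leRHS]mulrA; apply: ler_wpM2l; [exact: dtC_ge0|exact: (pweight_tail s1)].
Qed.

Lemma is_derive_psi_t (t z : R) : 0 < z -> is_derive t 1 (psi ^~ z) (flux t z).
Proof.
move=> z0.
have e : - flux t z = \int[mu]_(x in `]z, +oo[) dt_density t x.
  apply/esym/Rintegral_FTC2y.
  - by move=> y zy; apply: is_derive_flux; exact: lt_le_trans zy.
  - by move=> y zy; apply: continuous_dt_density; exact: lt_le_trans zy.
  - exact: integrable_dt_density.
  - exact: flux_cvg0.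
rewrite -[flux t z]opprK e; apply: is_deriveN.
apply: (@is_derive_Rintegral _ psi_density dt_density _ t 1
   (fun x => dtC (Dt t) * (z^-1 ^+ 2 * 2 `^ s) * pweight s z x)) => //.
- by move=> t' _; exact: integrable_psi_density.
- by move=> t' x _ /(in_tail z0)[_ x0]; exact: is_derive_density_t.
- exact: integrable_pweight_itv.
- move=> t' x tt /(in_tail z0)[zx x0].
  apply: (le_trans (dt_density_le (Dt0 t) (Dt_near tt) x0)).
  rewrite -[leRHS]mulrA; apply: ler_wpM2l; [exact: dtC_ge0|exact: (pweight_tail s1)].
Qed.

Let fluxC_ge0 D : 0 <= D -> 0 <= fluxC D.
Proof.
by move=> D0; apply: mulr_ge0; [exact: exprn_ge0|apply: addr_ge0; apply: mulr_ge0].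
Qed.

Lemma continuous_psi t z : 0 < z -> {for (t, z), continuous (fun p => psi p.1 p.2)}.
Proof.
move=> z0; have z20 : 0 < z / 2 by rewrite divr_gt0.
pose e := Num.min 1 (z / 2); have e0 : 0 < e by rewrite lt_min ltr01.
have near_z v : `|v - z| < e -> z / 2 <= v.
  by move=> hv; apply: half_ball => //; apply: lt_le_trans hv _; rewrite ge_min lexx orbT.
apply: (@continuous2_of_is_derive _ psi flux _ _ e
   (fluxC (Dt t) * ((z / 2)^-1 ^+ 1 * 2 `^ s * (z / 2 + z / 2) `^ (- s)))) => //.
- by move=> u v _ /near_z hv; apply: is_derive_psi_t; exact: lt_le_trans hv.
- move=> u v hu /near_z hv; have v0 : 0 < v by exact: lt_le_trans hv.
  have hu1 : `|u - t| < 1 by apply: lt_le_trans hu _; rewrite ge_min lexx.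
  apply: (le_trans (flux_le (Dt0 t) (Dt_near hu1) v0)); apply: ler_wpM2l; first exact: fluxC_ge0.
  apply: (le_trans (pweight_tail s1 1 z20 hv)); rewrite ler_wpM2l//.
    by rewrite mulr_ge0 ?powR_ge0// exprn_ge0// invr_ge0 ltW.
  rewrite /pweight gtr0_norm// !powRN lef_pV2 ?posrE ?powR_gt0 ?addr_gt0//.
  apply: ge0_ler_powR; rewrite ?nnegrE ?addr_ge0 ?(ltW z20) ?(ltW v0)//; last by rewrite lerD2l.
  exact/ltW/(lt_trans ltr01).
- exact: is_derive_continuous (is_derive_psi_z t z0).
Qed.

Lemma caloric_pair_psi : caloric_pair s (fun z => z `^ (s - 1)) (P 0) (fun t z => - P 1 t z) (P 2)
  (Q 0) (fun t z => - Q 1 t z) (Q 2) psi.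
Proof.
constructor.
- by move=> z z0; exact: powR_gt0.
- by move=> t z z0; exact: (is_derive_pot_z s1 s2 mg gK 0 t z0).
- by move=> t z z0; have := is_deriveN (is_derive_pot_z s1 s2 mg gK 1 t z0); rewrite opprK.
- move=> t z z0; apply: (is_derive_eq (is_derive_pot_t s1 s2 mg gK 0 t z0)).
  by rewrite addr0 mulrN mulNr addrC.
- by move=> t z z0; exact: (continuous_pot s1 s2 K0 mg gK).
- by move=> t z z0; exact: is_derive_bpot_z.
- by move=> t z z0; have := is_deriveN (is_derive_bpot_z 1 t z0); rewrite opprK.
- move=> t z z0; apply: (is_derive_eq (is_derive_bpot_t 0 t z0)).
  by rewrite addr0 mulrN mulNr addrC.
- by move=> t z z0; exact: continuous_bpot.
- by move=> t z z0; exact: is_derive_psi_z.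
- move=> t z z0; apply: (is_derive_eq (is_derive_psi_t t z0)).
  by rewrite /flux powR_s// [_ * z]mulrC mulrN opprK.
- by move=> t z z0; exact: continuous_psi.
Qed.

(* Uniform decay: at infinity from the support of f, at 0 from the integrable
   bound z^(1-s) on the density, once psi is known to vanish at 0+. *)
Lemma psi_le_infty (D t z : R) : 0 <= D -> b - t <= D -> 0 < z ->
  `|psi t z| <= D ^+ 2 * (C 0 * C 2) * (z^-1 * 2 `^ s) * (2 * (z `^ (1 - s) / (s - 1))).
Proof.
move=> D0 tD z0; rewrite /psi normrN.
apply: (le_trans (le_normr_Rintegral _ (integrable_psi_density t z0))) => //.
pose c := D ^+ 2 * (C 0 * C 2) * (z^-1 * 2 `^ s).
have c0 : 0 <= c by apply: mulr_ge0; [exact: C02|rewrite mulr_ge0 ?powR_ge0// invr_ge0 ltW].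
have -> : c * (2 * (z `^ (1 - s) / (s - 1))) = \int[mu]_x (c * pweight s z (0 - x)).
  by rewrite RintegralZl//; [rewrite /Rintegral integral_pweight_translate|exact: integrable_pweight].
rewrite [leLHS]Rintegral_mkcond; apply: le_Rintegral => //.
- by apply: integrable_patch => //; apply: integrable_norm; exact: integrable_psi_density.
- by apply: integrable_scale => //; exact: integrable_pweight.
move=> x _; rewrite patchE; case: ifPn => [/set_mem/(in_tail z0)[zx x0]|_]; last first.
  by rewrite mulr_ge0// ltW// pweight_gt0.
apply: (le_trans (psi_density_le D0 tD x0)); rewrite /c -[leRHS]mulrA; apply: ler_wpM2l; first exact: C02.
have := pweight_tail s1 1 z0 zx; rewrite expr1; congr (_ <= _ * _).
by rewrite /pweight sub0r normrN.
Qed.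

End Psi.

(** * Boundary values of Psi *)

Section FubiniReal.
Context {R : realType}.
Notation mu := (@lebesgue_measure R).

(** The bound B on the inner norms makes F integrable on the plane, by Tonelli. The integrability of
    the swapped inner integral is recorded because a constant factor has to be taken out of it
    later. *)
Lemma Rintegral_fubini (F : R -> R -> R) (B : R -> R) :
  measurable_fun [set: R * R] (fun p => F p.1 p.2) ->
  (forall x, mu.-integrable setT (EFin \o F x)) ->
  (forall y, mu.-integrable setT (EFin \o F^~ y)) ->
  mu.-integrable setT (EFin \o B) ->
  (forall x, \int[mu]_y `|F x y| <= B x) ->
  \int[mu]_x \int[mu]_y F x y = \int[mu]_y \int[mu]_x F x y /\
  mu.-integrable setT (EFin \o (fun y => \int[mu]_x F x y)).
Proof.
move=> mF iF iF' iB FB.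
pose RR := (measurableTypeR R * measurableTypeR R)%type.
have mFE : measurable_fun [set: RR] (fun p : RR => (F p.1 p.2)%:E) by exact/measurable_EFinP.
have fin1 x : (\int[mu]_y (F x y)%:E)%E = (\int[mu]_y F x y)%:E.
  by rewrite /Rintegral fineK//; exact: (integrable_fin_num _ (iF x)).
have fin2 y : (\int[mu]_x (F x y)%:E)%E = (\int[mu]_x F x y)%:E.
  by rewrite /Rintegral fineK//; exact: (integrable_fin_num _ (iF' y)).
have iP : (mu \x mu)%E.-integrable setT (fun p : RR => (F p.1 p.2)%:E).
  apply: (integrable12ltyP mu mu mFE).2.
  have /integrableP[_] := iB; apply: le_lt_trans; apply: ge0_le_integral => //.
  - by move=> x _; exact: integral_ge0.
  - apply: (@measurable_fun_fubini_tonelli_F _ _ _ _ R mu (fun p : RR => `|(F p.1 p.2)%:E|%E)) => //.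
    exact: measurableT_comp.
  - by apply: measurableT_comp => //; case/integrableP: iB.
  - move=> x _; have : (\int[mu]_y `|F x y|%:E)%E = (\int[mu]_y `|F x y|)%:E.
      by rewrite /Rintegral fineK//; apply: (integrable_fin_num _ (integrable_norm (iF x))).
    by move=> /= ->; rewrite lee_fin (le_trans (FB x))// ler_norm.
split; last first.
  have mF' : measurable_fun [set: RR] (fun p : RR => (F p.2 p.1)%:E).
    have H := measurableT_comp mF (@measurable_swap _ _ (measurableTypeR R) (measurableTypeR R)).
    exact/measurable_EFinP.
  have iP' : (mu \x mu)%E.-integrable setT (fun p : RR => (F p.2 p.1)%:E).
    by apply: (integrable12ltyP mu mu mF').2; exact: ((integrable21ltyP mu mu mFE).1 iP).
  have := integrable_fubini_F iP'; congr (_.-integrable _ _); apply/funext => y.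
  by rewrite /fubini_F /= fin2.
have := Fubini iP; rewrite /= => h.
rewrite /Rintegral; congr fine.
transitivity (\int[mu]_x \int[mu]_y (F x y)%:E)%E.
  by apply: eq_integral => x _; rewrite fin1.
by rewrite h; apply: eq_integral => y _; rewrite fin2.
Qed.

End FubiniReal.

(** * Products of kernels and the Gamma integral *)

Section HeatKernelProducts.
Context {R : realType}.
Notation mu := (@lebesgue_measure R).
Variable s : R.
Hypotheses (s1 : 1 < s) (s2 : s <= 2).
Notation hk := (hk s).

(** The inverse is written as a power in order to use the measurability of [powR] when z and A both
    vary. *)
Lemma hk0E z A : 0 < A -> hk 0 z A = A `^ (- s) * expR (- (z * A `^ (- 1))).
Proof. by move=> A0; rewrite /hk A0 mulr0n addr0 powR_inv1 ?ltW. Qed.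

Lemma measurable_hk2 d (T : measurableType d) (z A : T -> R) :
  measurable_fun setT z -> measurable_fun setT A ->
  measurable_fun setT (fun p => hk 0 (z p) (A p)).
Proof.
move=> mz mA.
have e : (fun p => hk 0 (z p) (A p)) =
    (fun p => if 0 < A p then A p `^ (- s) * expR (- (z p * A p `^ (- 1))) else 0).
  by apply/funext => p; case: ifPn => [/hk0E//|]; rewrite -leNgt => /hk0 ->.
rewrite e; apply: measurable_fun_ifT.
- by apply: measurable_fun_ltr => //; exact: measurable_cst.
- apply: measurable_funM; first exact: (measurableT_comp (measurable_powR (- s))).
  apply: (measurableT_comp (@measurable_expR R)); apply: measurableT_comp => //.
  by apply: measurable_funM => //; exact: (measurableT_comp (measurable_powR (- 1))).
- exact: measurable_cst.
Qed.

(** The weight is symmetric in z and A: the bound that was integrable in A for fixed z becomes one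
    that is integrable in z for fixed A. *)
Lemma hk_le_swap z A : 0 < z -> 0 < A -> hk 0 z A <= hkC 0 * pweight s A z.
Proof.
move=> z0 A0; have := hk_le s2 0 A z0; rewrite expr0 mulr1.
by rewrite /pweight !gtr0_norm// addrC.
Qed.

Lemma hk_mul_le z A : 0 < z -> 0 < A -> z `^ (s - 1) * hk 0 z A <= hkC 0 / A.
Proof.
move=> z0 A0; have zA : 0 < A + z by rewrite addr_gt0.
apply: (le_trans (ler_wpM2l (powR_ge0 _ _) (hk_le_swap z0 A0))).
rewrite mulrCA ler_wpM2l ?(ltW (hkC_gt0 _))// /pweight gtr0_norm//.
have -> : - s = - (s - 1) - 1 by ring.
have -> : (A + z) `^ (- (s - 1) - 1) = (A + z) `^ (- (s - 1)) / (A + z).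
  by rewrite powRD ?(powR_inv1 (ltW zA))// (gt_eqF zA) implybT.
rewrite mulrA; apply: (@le_trans _ _ (A + z)^-1); last by rewrite lef_pV2 ?posrE// lerDl ltW.
rewrite ler_piMl ?invr_ge0 ?(ltW zA)// powRN ler_pdivrMr ?powR_gt0// mul1r.
apply: ge0_ler_powR; rewrite ?nnegrE ?(ltW z0) ?(ltW zA) ?subr_ge0 ?(ltW s1)//.
by rewrite lerDr ltW.
Qed.

Lemma integrable_hk_hk A B : 0 < A -> 0 < B ->
  mu.-integrable `]0, +oo[ (EFin \o (fun z => z `^ (s - 1) * (hk 0 z A * hk 0 z B))).
Proof.
move=> A0 B0.
have iw := integrable_pweight s1 0 B0.
have iw' : mu.-integrable `]0, +oo[ (EFin \o (fun x => hkC 0 / A * hkC 0 * pweight s B (0 - x))).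
  by apply: integrable_scale => //; apply: integrableS iw.
have mm : measurable_fun (`]0%R, +oo[%classic : set R) (fun z : R => z `^ (s - 1) * (hk 0 z A * hk 0 z B)).
  apply: measurable_funTS; apply: measurable_funM; first exact: measurable_powR.
  by apply: measurable_funM; apply: measurable_hk2 => //; exact: measurable_cst.
apply: (integrable_le _ mm iw') => // z; rewrite /= in_itv/= andbT => z0.
rewrite ger0_norm ?mulr_ge0 ?powR_ge0 ?hk_ge0// mulrA -[leRHS]mulrA.
apply: ler_pM; rewrite ?mulr_ge0 ?powR_ge0 ?hk_ge0//; first exact: hk_mul_le.
have -> : pweight s B (0 - z) = pweight s B z by rewrite /pweight sub0r normrN.
exact: hk_le_swap.
Qed.

Definition gamma_int := \int[mu]_(x in `]0, +oo[) (x `^ (s - 1) * expR (- x)).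

Lemma ge0_integral_gamma_scale (lam : R) : 0 < lam ->
  (\int[mu]_(x in `]0%R, +oo[) (x `^ (s - 1) * expR (- x))%:E =
   (lam `^ s)%:E * \int[mu]_(x in `]0%R, +oo[) (x `^ (s - 1) * expR (- (lam * x)))%:E)%E.
Proof.
move=> l0; pose G x : R := x `^ (s - 1) * expR (- x).
have s10 : 0 < s - 1 by rewrite subr_gt0.
have mG (c : R) (D : set R) : measurable_fun D (fun x : R => x `^ (s - 1) * expR (- (c * x))).
  apply: measurable_funTS; apply: measurable_funM; first exact: measurable_powR.
  apply: (measurableT_comp (@measurable_expR R)).
  have mc : measurable_fun [set: R] (fun x : R => c * x).
    by apply: measurable_funM => //; exact: measurable_cst.
  exact: measurableT_comp mc.
have mG1 (D : set R) : measurable_fun D G.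
  by have := mG 1 D; congr measurable_fun; apply/funext => x; rewrite mul1r.
have d (x : R) : is_derive x 1 (fun y => lam * y) lam.
  by apply: (is_derive_eq (is_deriveZ lam (is_derive_id x 1))); rewrite /GRing.scale/= mulr1.
have d1 : derive1 (fun y : R => lam * y) = cst lam.
  by apply/funext => x; rewrite derive1E; have [_ ->] := d x.
have cG0 : G x @[x --> 0^'+] --> G 0.
  have -> : G 0 = 0 * expR (- 0) by rewrite /G powR0 ?gt_eqF.
  apply: cvgM; first exact: powR_cvg0.
  apply: cvg_at_right_filter.
  apply: (@continuous_comp _ _ _ -%R expR); [exact: opp_continuous|exact: continuous_expR].
have cGp (x : R) : 0 < x -> {for x, continuous G}.
  move=> x0; apply: cvgM; first exact: is_derive_continuous (is_derive1_powR (s - 1) x0).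
  apply: (@continuous_comp _ _ _ -%R expR); [exact: opp_continuous|exact: continuous_expR].
have := @increasing_ge0_integration_by_substitutiony R (fun y => lam * y) G 0.
rewrite mulr0 !d1 => h.
rewrite integral_itv_obnd_cbnd ?h; first last.
- exact/measurable_EFinP.
- by move=> x _; rewrite /G mulr_ge0 ?powR_ge0 ?expR_ge0.
- apply/continuous_within_itvcyP; split => // x; rewrite in_itv/= andbT; exact: cGp.
- by apply: gt0_cvgMry => //; exact: cvg_id.
- split; first by move=> x _; have [] := d x.
  by apply: cvg_at_right_filter; exact: is_derive_continuous (d 0).
- exact: is_cvg_cst.
- exact: is_cvg_cst.
- by move=> x _; exact: cst_continuous.
- by move=> x y _ _ xy; rewrite ltr_pM2l.
rewrite -integral_itv_obnd_cbnd; last first.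
  apply/measurable_EFinP; apply: measurable_funM; last exact: measurable_cst.
  by apply: (measurableT_comp (mG1 setT)); apply: measurable_funM => //; exact: measurable_cst.
rewrite -ge0_integralZl//; last 3 first.
- by apply/measurable_EFinP; exact: mG.
- by move=> x _; rewrite lee_fin mulr_ge0 ?powR_ge0 ?expR_ge0.
- by rewrite lee_fin powR_ge0.
apply: eq_integral => x /set_mem; rewrite /= in_itv/= andbT => x0.
rewrite -EFinM; congr (_%:E); rewrite !fctE /G/= powRM ?(ltW l0) ?(ltW x0)//.
rewrite (powR_subr1 s l0).
by ring.
Qed.

(** The two exponentials multiply to e^(- lam z) with lam = 1 / A + 1 / B, and rescaling z leaves
    lam^(- s) (A B)^(- s) = (A + B)^(- s). *)
Lemma Rintegral_hk_hk A B : 0 < A -> 0 < B ->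
  \int[mu]_(z in `]0, +oo[) (z `^ (s - 1) * (hk 0 z A * hk 0 z B)) = gamma_int * (A + B) `^ (- s).
Proof.
move=> A0 B0; have AB : 0 < A * B by rewrite mulr_gt0.
have ApB : 0 < A + B by rewrite addr_gt0.
pose lam := (A + B) / (A * B); have l0 : 0 < lam by rewrite divr_gt0.
have c0 : 0 < (A * B) `^ (- s) by rewrite powR_gt0.
have e z : z `^ (s - 1) * (hk 0 z A * hk 0 z B) = (A * B) `^ (- s) * (z `^ (s - 1) * expR (- (lam * z))).
  rewrite /hk A0 B0 !mulr0n !addr0 powRM ?(ltW A0) ?(ltW B0)//.
  have -> : - (lam * z) = - (z / A) + - (z / B) by rewrite /lam; field; rewrite !gt_eqF.
  by rewrite expRD; ring.
have ii := integrable_hk_hk A0 B0.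
have i2 : mu.-integrable `]0, +oo[ (EFin \o (fun z => z `^ (s - 1) * expR (- (lam * z)))).
  have := integrable_scale ((A * B) `^ (- s))^-1 (measurable_itv _) ii.
  congr (_.-integrable _ _); apply/funext => z /=.
  by rewrite e mulrA mulVf ?mul1r// gt_eqF.
under eq_Rintegral => z _ do rewrite e.
rewrite RintegralZl//.
have := ge0_integral_gamma_scale l0.
have fi : (\int[mu]_(x in `]0%R, +oo[) (x `^ (s - 1) * expR (- (lam * x)))%:E)%E \is a fin_num.
  exact: (integrable_fin_num _ i2).
have key : (A * B) `^ (- s) = lam `^ s * (A + B) `^ (- s).
  have -> : A + B = lam * (A * B) by rewrite /lam; field; rewrite !gt_eqF.
  rewrite (powRM _ (ltW l0) (ltW AB)) mulrA [lam `^ (- s)]powRN mulfV ?mul1r//.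
  by rewrite gt_eqF// powR_gt0.
move=> h; rewrite /gamma_int /Rintegral h fineM// key.
by rewrite -!mulrA; congr (_ * _); rewrite mulrC.
Qed.

End HeatKernelProducts.

Section PsiAtZero.
Context {R : realType}.
Notation mu := (@lebesgue_measure R).
Variables (s K b : R).
Hypotheses (s1 : 1 < s) (s2 : s < 2) (K0 : 0 <= K).
Let s2' := ltW s2.
Notation C n := (potC s K n).
Let C0 n : 0 <= C n. Proof. exact: potC_ge0. Qed.
Notation hk := (hk s).

(** Near z = 0 both potentials are of order z^(1 - s), hence so is the density, and this is
    integrable since s < 2. Beyond z = 1 the second summand takes over; it is the tail bound
    [pweight_tail] with w = 1 and n = 1. *)
Definition psi_dom (t z : R) : R :=
  C 0 * C 0 * ((fun x => x `^ (- (s - 1))) \_ `[0, 1]) z +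
  (`|b - t| + 1) ^+ 2 * (C 0 * C 2) * (1^-1 ^+ 1 * 2 `^ s) * pweight s 1 (0 - z).

Lemma integrable_psi_dom t : mu.-integrable setT (EFin \o psi_dom t).
Proof.
have i1 : mu.-integrable setT (EFin \o (fun z => C 0 * C 0 * ((fun x => x `^ (- (s - 1))) \_ `[0, 1]) z)).
  apply: integrable_scale => //; apply: integrable_patch => //; apply: integrable_powR0.
  by rewrite subr_gt0 s1/= ltrBlDr.
have i2 : mu.-integrable setT (EFin \o (fun z => (`|b - t| + 1) ^+ 2 * (C 0 * C 2) * (1^-1 ^+ 1 * 2 `^ s) * pweight s 1 (0 - z))).
  by apply: integrable_scale => //; exact: integrable_pweight.
by have := integrableD measurableT i1 i2; congr (_.-integrable _ _); exact/funext.
Qed.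

Lemma psi_dom_ge0 t z : 0 <= psi_dom t z.
Proof.
apply: addr_ge0; first apply: mulr_ge0; first exact: mulr_ge0.
  by rewrite patchE; case: ifP => // _; exact: powR_ge0.
apply: mulr_ge0; last exact: powR_ge0.
apply: mulr_ge0; first by apply: mulr_ge0; [exact: sqr_ge0|exact: mulr_ge0].
by rewrite mulr_ge0 ?powR_ge0// exprn_ge0// invr_ge0.
Qed.

Lemma psi_density_le0 (g f : R -> R) t z :
  measurable_fun [set: R] g -> (forall x, `|g x| <= K) ->
  measurable_fun [set: R] f -> (forall x, `|f x| <= K) ->
  0 < z -> `|psi_density s g f t z| <= C 0 * C 0 * z `^ (- (s - 1)).
Proof.
move=> mg gK mf fK z0.
rewrite /psi_density !normrM (ger0_norm (powR_ge0 _ _)).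
have h1 := pot_le_potC s1 s2' 0 t mg gK z0.
have h2 : `|bpot s f 0 t z| <= C 0 * (z `^ (1 - s) * z^-1 ^+ 0).
  by apply: pot_le_potC => //; exact: measurableT_comp.
have := ler_wpM2l (powR_ge0 z (s - 1)) (ler_pM (normr_ge0 _) (normr_ge0 _) h1 h2).
move=> /le_trans; apply; rewrite expr0 mulr1.
have -> : - (s - 1) = 1 - s by ring.
have pE : z `^ (s - 1) * z `^ (1 - s) = 1.
  rewrite -powRD; last by rewrite (gt_eqF z0) implybT.
  by rewrite addrC subrKA subrr powRr0.
rewrite le_eqVlt; apply/orP; left; apply/eqP.
move: pE (C 0); move: (z `^ (1 - s)) (z `^ (s - 1)) => E p pE c0.
by rewrite -[RHS]mul1r -pE; ring.
Qed.

Lemma psi_density_dom (g f : R -> R) t z :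
  measurable_fun [set: R] g -> (forall x, `|g x| <= K) ->
  measurable_fun [set: R] f -> (forall x, `|f x| <= K) -> (forall x, b < x -> f x = 0) ->
  0 < z -> `|psi_density s g f t z| <= psi_dom t z.
Proof.
move=> mg gK mf fK fb z0; have [z1|z1] := ltP 1 z; last first.
  apply: (le_trans (psi_density_le0 t mg gK mf fK z0)).
  rewrite /psi_dom patchE mem_set; last by rewrite /= in_itv/= ltW.
  rewrite lerDl; apply: mulr_ge0; last exact: powR_ge0.
  apply: mulr_ge0; first by apply: mulr_ge0; [exact: sqr_ge0|exact: mulr_ge0].
  by rewrite mulr_ge0 ?powR_ge0// exprn_ge0// invr_ge0.
apply: (@le_trans _ _ ((`|b - t| + 1) ^+ 2 * (C 0 * C 2) * (z `^ (1 - s) * z^-1 ^+ 2))).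
  have D0 : 0 <= `|b - t| + 1 by rewrite addr_ge0.
  have D1 : b - t <= `|b - t| + 1 by rewrite (le_trans (ler_norm _))// lerDl.
  exact: (psi_density_le s1 s2' mg gK mf fK fb D0 D1 z0).
apply: (@le_trans _ _ ((`|b - t| + 1) ^+ 2 * (C 0 * C 2) * (1^-1 ^+ 1 * 2 `^ s) * pweight s 1 (0 - z))).
  rewrite -[leRHS]mulrA; apply: ler_wpM2l; first by apply: mulr_ge0; [exact: sqr_ge0|exact: mulr_ge0].
  have := pweight_tail s1 1 ltr01 (ltW z1); congr (_ <= _ * _).
  by rewrite /pweight sub0r normrN.
rewrite lerDr; apply: mulr_ge0; first exact: mulr_ge0.
by rewrite patchE; case: ifP => // _; exact: powR_ge0.
Qed.

Variables (g f : R -> R).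
Hypotheses (mg : measurable_fun [set: R] g) (gK : forall x, `|g x| <= K).
Hypotheses (mf : measurable_fun [set: R] f) (fK : forall x, `|f x| <= K).
Hypothesis fb : forall x, b < x -> f x = 0.

Let mh : measurable_fun [set: R] (fun x => f (- x)). Proof. exact: measurableT_comp. Qed.

Lemma measurable_psi_density t : measurable_fun (`]0%R, +oo[%classic : set R) (psi_density s g f t).
Proof.
apply: open_continuous_measurable_fun; first exact: interval_open.
move=> z /set_mem/=; rewrite in_itv/= andbT => z0.
have d := is_deriveM (is_derive_pot_z s1 s2' mg gK 0 t z0) (is_derive_bpot_z s1 s2' mf fK 0 t z0).
exact: is_derive_continuous (is_deriveM (is_derive1_powR (s - 1) z0) d).
Qed.

Lemma psi_cvg0 t : psi s g f t n.+1%:R^-1 @[n --> \oo] -->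
  - \int[mu]_(z in `]0, +oo[) psi_density s g f t z.
Proof.
apply: cvgN.
have e n : \int[mu]_(z in `](n.+1%:R^-1), +oo[) psi_density s g f t z =
   \int[mu]_(z in `]0, +oo[) (psi_density s g f t z * \1_(`](n.+1%:R^-1), +oo[) z).
  rewrite Rintegral_mkcond [RHS]Rintegral_mkcond; apply: eq_Rintegral => z _.
  rewrite !patchE indicE; case: ifPn => [|_]; last by rewrite mulr0; case: ifP.
  rewrite inE/= in_itv/= andbT => nz; rewrite mem_set ?mulr1//=.
  by rewrite in_itv/= andbT; apply: le_lt_trans nz; rewrite invr_ge0.
under eq_fun do rewrite e.
apply: (@dominated_Rintegral _ _ _ _ (psi_dom t)) => //.
- move=> n; apply: measurable_funM; first exact: measurable_psi_density.
  by apply: measurable_funTS; exact: measurable_indic.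
- exact: measurable_psi_density.
- move=> z; rewrite /= in_itv/= andbT => z0; apply: cvg_near_cst; near=> n.
  rewrite indicE mem_set ?mulr1//= in_itv/= andbT invf_plt ?posrE//.
  near: n.
  by apply: filterS (nbhs_infty_gtr z^-1) => n /lt_le_trans; apply; rewrite ler_nat.
- by apply: integrableS (integrable_psi_dom t).
- move=> n z; rewrite /= in_itv/= andbT => z0.
  apply: (le_trans _ (psi_density_dom t mg gK mf fK fb z0)).
  by rewrite normrM ler_piMr// indicE; case: (_ \in _); rewrite ?normr1 ?normr0.
Unshelve. all: by end_near. Qed.

Lemma bpotE (f' : R -> R) t z : measurable_fun [set: R] f' -> 0 < z ->
  bpot s f' 0 t z = \int[mu]_y (hk 0 z (y - t) * f' y).
Proof.
move=> mf' z0.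
have mm : measurable_fun [set: R] (fun y => hk 0 z (y - t) * f' y).
  apply: measurable_funM => //; apply: measurable_hk2; first exact: measurable_cst.
  by apply: measurable_funB => //; exact: measurable_cst.
rewrite -(Rintegral_opp mm); apply: eq_Rintegral => y _.
by congr (hk 0 z _ * _); ring.
Qed.

Definition Phi t := \int[mu]_(y in `]t, +oo[) (f y * \int[mu]_(x in `]-oo, t[) ((y - x) `^ (- s) * g x)).

Let measurable_powR_c (c : R) : measurable_fun [set: R] (fun x => (c - x) `^ (- s)).
Proof. exact: measurable_powR_sub. Qed.

Let integrable_inner t B : 0 < B ->
  mu.-integrable `]-oo, t[ (EFin \o (fun x => (t + B - x) `^ (- s) * g x)).
Proof.
move=> B0; have iw := integrable_scale K measurableT (integrable_pweight s1 t B0).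
have iw' : mu.-integrable `]-oo, t[ (EFin \o (fun x => K * pweight s B (t - x))) by apply: integrableS iw.
have mm : measurable_fun (`]-oo, t[%classic : set R) (fun x => (t + B - x) `^ (- s) * g x).
  by apply: measurable_funTS; apply: measurable_funM.
apply: (integrable_le _ mm iw') => // x; rewrite /= in_itv/= => xt.
rewrite normrM mulrC (ger0_norm (powR_ge0 _ _)) ler_pM ?powR_ge0//.
by rewrite /pweight gtr0_norm ?subr_gt0// [B + _]addrC addrAC.
Qed.

Let measurable_subc (t : R) : measurable_fun [set: R] (fun x => t - x).
Proof. by apply: measurable_funB => //; exact: measurable_cst. Qed.
Let measurable_csub (t : R) : measurable_fun [set: R] (fun x => x - t).
Proof. by apply: measurable_funB => //; exact: measurable_cst. Qed.

Let integrable_pot_hk t B : 0 < B ->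
  mu.-integrable `]0, +oo[ (EFin \o (fun z => z `^ (s - 1) * (hk 0 z B * pot s g 0 t z))).
Proof.
move=> B0; have i1 : mu.-integrable setT (EFin \o (fun z => C 0 * hkC 0 * pweight s B (0 - z))).
  by apply: integrable_scale => //; exact: integrable_pweight.
have i2 : mu.-integrable `]0, +oo[ (EFin \o (fun z => C 0 * hkC 0 * pweight s B (0 - z))).
  by apply: integrableS i1.
have mm : measurable_fun (`]0%R, +oo[%classic : set R) (fun z : R => z `^ (s - 1) * (hk 0 z B * pot s g 0 t z)).
  apply: measurable_funM; first by apply: measurable_funTS; exact: measurable_powR.
  apply: measurable_funM.
    by apply: measurable_funTS; apply: measurable_hk2 => //; exact: measurable_cst.
  apply: open_continuous_measurable_fun; first exact: interval_open.
  move=> z /set_mem/=; rewrite in_itv/= andbT => z0.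
  exact: is_derive_continuous (is_derive_pot_z s1 s2' mg gK 0 t z0).
apply: (integrable_le _ mm i2) => // z; rewrite /= in_itv/= andbT => z0.
have pw : pweight s B (0 - z) = pweight s B z by rewrite /pweight sub0r normrN.
have := pot_le_potC s1 s2' 0 t mg gK z0; rewrite expr0 mulr1 => h.
rewrite !normrM (ger0_norm (powR_ge0 _ _)) (ger0_norm (hk_ge0 _ _ _ _)) pw mulrA.
have w0' : 0 <= z `^ (s - 1) * hk 0 z B by rewrite mulr_ge0 ?powR_ge0 ?hk_ge0.
apply: (le_trans (ler_wpM2l w0' h)).
have pE : z `^ (s - 1) * z `^ (1 - s) = 1.
  rewrite -powRD; last by rewrite (gt_eqF z0) implybT.
  by rewrite addrC subrKA subrr powRr0.
have -> : z `^ (s - 1) * hk 0 z B * (C 0 * z `^ (1 - s)) = C 0 * hk 0 z B * (z `^ (s - 1) * z `^ (1 - s)).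
  by move: (C 0) => c; ring.
rewrite pE mulr1 -[leRHS]mulrA; apply: ler_wpM2l; first exact: C0.
exact: hk_le_swap.
Qed.

(* Fubini for the weighted product of the potential of g with the kernel
   issued from the single point y = t + B. *)
Lemma Rintegral_pot_hk t B : 0 < B ->
  \int[mu]_(z in `]0, +oo[) (z `^ (s - 1) * (hk 0 z B * pot s g 0 t z)) =
  gamma_int s * \int[mu]_(x in `]-oo, t[) ((t + B - x) `^ (- s) * g x).
Proof.
move=> B0.
pose w : R -> R := (fun z => z `^ (s - 1) * hk 0 z B) \_ `]0, +oo[.
have wE z : 0 < z -> w z = z `^ (s - 1) * hk 0 z B.
  by move=> z0; rewrite /w patchE mem_set//= in_itv/= z0.
have w0 z : z <= 0 -> w z = 0.
  move=> z0; rewrite /w patchE memNset//= in_itv/= andbT; apply/negP; by rewrite -leNgt.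
have mw : measurable_fun [set: R] w.
  apply/(measurable_restrictT _ _).1 => //; apply: measurable_funTS.
  apply: measurable_funM; first exact: measurable_powR.
  by apply: measurable_hk2 => //; exact: measurable_cst.
pose F (z x : R) := w z * (hk 0 z (t - x) * g x).
have mF : measurable_fun [set: R * R] (fun p => F p.1 p.2).
  apply: measurable_funM; first exact: (measurableT_comp mw).
  apply: measurable_funM; last exact: (measurableT_comp mg).
  by apply: measurable_hk2 => //; exact: (measurableT_comp (measurable_subc t)).
have iF z : mu.-integrable setT (EFin \o F z).
  have [z0|z0] := ltP 0 z; last first.
    by rewrite (_ : F z = cst 0) ?integrable0//; apply/funext => x; rewrite /F w0 ?mul0r.
  by apply: integrable_scale => //; exact: (integrable_pot s1 s2' mg gK).
have FE x : F ^~ x = (fun z => g x * ((fun z => z `^ (s - 1) * (hk 0 z (t - x) * hk 0 z B)) \_ `]0, +oo[) z).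
  apply/funext => z; rewrite /F patchE; case: ifPn => [|/negP] zI.
    by rewrite wE; [ring|move: zI; rewrite inE/= in_itv/= andbT].
  rewrite w0 ?mul0r ?mulr0// leNgt; apply/negP => z0; apply: zI.
  by rewrite inE/= in_itv/= z0.
have iF' x : mu.-integrable setT (EFin \o F ^~ x).
  have [A0|A0] := ltP 0 (t - x).
    by rewrite FE; apply: integrable_scale => //; apply: integrable_patch => //; exact: integrable_hk_hk.
  rewrite (_ : F ^~ x = cst 0) ?integrable0//; apply/funext => z.
  by rewrite /F (hk0 _ _ _ A0) mul0r mulr0.
have iB : mu.-integrable setT (EFin \o (fun z => C 0 * hkC 0 * pweight s B (0 - z))).
  by apply: integrable_scale => //; exact: integrable_pweight.
have FB z : \int[mu]_x `|F z x| <= C 0 * hkC 0 * pweight s B (0 - z).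
  have pw : pweight s B (0 - z) = pweight s B z by rewrite /pweight sub0r normrN.
  have [z0|z0] := ltP 0 z; last first.
    rewrite Rintegral_eq0// => [|x _]; last by rewrite /F w0// mul0r normr0.
    by apply: mulr_ge0; [apply: mulr_ge0; [exact: C0|exact: ltW (hkC_gt0 _)]|exact: powR_ge0].
  have w0' : 0 <= w z by rewrite wE// mulr_ge0 ?powR_ge0 ?hk_ge0.
  have e x : `|F z x| = w z * (hk 0 z (t - x) * `|g x|).
    by rewrite /F !normrM (ger0_norm w0') (ger0_norm (hk_ge0 _ _ _ _)).
  under eq_Rintegral => x _ do rewrite e.
  have mg' : measurable_fun [set: R] (fun x => `|g x|) by exact: measurableT_comp.
  have gK' x : `|(`|g x|)| <= K by rewrite normr_id.
  rewrite RintegralZl//; last exact: (integrable_pot s1 s2' mg' gK').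
  have := pot_le_potC s1 s2' 0 t mg' gK' z0; rewrite expr0 mulr1 => /(le_trans (ler_norm _)) h.
  apply: (le_trans (ler_wpM2l w0' h)); rewrite wE// pw.
  have pE : z `^ (s - 1) * z `^ (1 - s) = 1.
    rewrite -powRD; last by rewrite (gt_eqF z0) implybT.
    by rewrite addrC subrKA subrr powRr0.
  have -> : z `^ (s - 1) * hk 0 z B * (C 0 * z `^ (1 - s)) = C 0 * hk 0 z B * (z `^ (s - 1) * z `^ (1 - s)).
    by move: (C 0) => c; ring.
  rewrite pE mulr1 -[leRHS]mulrA; apply: ler_wpM2l; first exact: C0.
  exact: hk_le_swap.
have [fub _] := Rintegral_fubini mF iF iF' iB FB.
transitivity (\int[mu]_z \int[mu]_x F z x).
  symmetry.
  rewrite [RHS]Rintegral_mkcond; apply: eq_Rintegral => z _; rewrite patchE.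
  case: ifPn => [|/negP] zI.
    have z0 : 0 < z by move: zI; rewrite inE/= in_itv/= andbT.
    rewrite RintegralZl//; last exact: (integrable_pot s1 s2' mg gK).
    by rewrite wE// mulrA.
  rewrite Rintegral_eq0// => x _; rewrite /F w0 ?mul0r// leNgt; apply/negP => z0; apply: zI.
  by rewrite inE/= in_itv/= z0.
rewrite fub.
have Fx x : \int[mu]_z F z x = gamma_int s * ((fun x => (t + B - x) `^ (- s) * g x) \_ `]-oo, t[) x.
  rewrite patchE; case: ifPn => [|/negP] xI.
    have A0 : 0 < t - x by move: xI; rewrite inE/= in_itv/= subr_gt0.
    have -> : \int[mu]_z F z x = g x * \int[mu]_(z in `]0, +oo[) (z `^ (s - 1) * (hk 0 z (t - x) * hk 0 z B)).
      rewrite [X in _ * X]Rintegral_mkcond -RintegralZl//; last first.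
        by apply: integrable_patch => //; exact: integrable_hk_hk.
      by apply: eq_Rintegral => z _; rewrite -[LHS]/((F ^~ x) z) FE.
    rewrite (Rintegral_hk_hk s1 s2' A0 B0).
    have -> : t - x + B = t + B - x by ring.
    by move: (gamma_int s) (_ `^ _) => c p; ring.
  rewrite mulr0 Rintegral_eq0// => z _; rewrite /F hk0 ?mul0r ?mulr0// leNgt; apply/negP => A0; apply: xI.
  by rewrite inE/= in_itv/= -subr_gt0.
under eq_Rintegral => x _ do rewrite Fx.
rewrite RintegralZl//; first by rewrite [in RHS]Rintegral_mkcond.
exact: integrable_patch (integrable_inner t B0).
Qed.

(* int_0^oo z^(s-1) hk 0 z A hk 0 z B dz = Gamma(s) (A + B)^(-s). *)
Lemma Rintegral_psi_density t :
  \int[mu]_(z in `]0, +oo[) psi_density s g f t z = gamma_int s * Phi t.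
Proof.
pose w : R -> R := (fun z => z `^ (s - 1) * pot s g 0 t z) \_ `]0, +oo[.
have wE z : 0 < z -> w z = z `^ (s - 1) * pot s g 0 t z.
  by move=> z0; rewrite /w patchE mem_set//= in_itv/= z0.
have w0 z : z <= 0 -> w z = 0.
  move=> z0; rewrite /w patchE memNset//= in_itv/= andbT; apply/negP; by rewrite -leNgt.
have mw : measurable_fun [set: R] w.
  apply/(measurable_restrictT _ _).1 => //.
  apply: open_continuous_measurable_fun; first exact: interval_open.
  move=> z /set_mem/=; rewrite in_itv/= andbT => z0.
  have d := is_derive_pot_z s1 s2' mg gK 0 t z0.
  exact: is_derive_continuous (is_deriveM (is_derive1_powR (s - 1) z0) d).
pose F (z y : R) := w z * (hk 0 z (y - t) * f y).
have mF : measurable_fun [set: R * R] (fun p => F p.1 p.2).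
  apply: measurable_funM; first exact: (measurableT_comp mw).
  apply: measurable_funM; last exact: (measurableT_comp mf).
  by apply: measurable_hk2 => //; exact: (measurableT_comp (measurable_csub t)).
have i0 (f' : R -> R) z : 0 < z -> measurable_fun [set: R] f' -> (forall x, `|f' x| <= K) ->
    mu.-integrable setT (EFin \o (fun y => hk 0 z (y - t) * f' y)).
  move=> z0 mf' f'K.
  have mh' : measurable_fun [set: R] (fun x => f' (- x)) by exact: measurableT_comp.
  have := integrable_opp (integrable_pot s1 s2' mh' (fun x => f'K (- x)) 0 (- t) z0).
  congr (_.-integrable _ _); apply/funext => y /=; rewrite opprK; congr (hk 0 z _ * _)%:E; ring.
have iF z : mu.-integrable setT (EFin \o F z).
  have [z0|z0] := ltP 0 z; last first.
    by rewrite (_ : F z = cst 0) ?integrable0//; apply/funext => x; rewrite /F w0 ?mul0r.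
  by apply: integrable_scale => //; exact: i0.
have FE y : F ^~ y = (fun z => f y * ((fun z => z `^ (s - 1) * (hk 0 z (y - t) * pot s g 0 t z)) \_ `]0, +oo[) z).
  apply/funext => z; rewrite /F patchE; case: ifPn => [|/negP] zI.
    rewrite wE; last by move: zI; rewrite inE/= in_itv/= andbT.
    by move: (pot s g 0 t z) => p; ring.
  rewrite w0 ?mul0r ?mulr0// leNgt; apply/negP => z0; apply: zI.
  by rewrite inE/= in_itv/= z0.
have iF' y : mu.-integrable setT (EFin \o F ^~ y).
  have [B0|B0] := ltP 0 (y - t).
    by rewrite FE; apply: integrable_scale => //; apply: integrable_patch => //; exact: integrable_pot_hk.
  rewrite (_ : F ^~ y = cst 0) ?integrable0//; apply/funext => z.
  by rewrite /F (hk0 _ _ _ B0) mul0r mulr0.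
have FB z : \int[mu]_y `|F z y| <= psi_dom t z.
  have [z0|z0] := ltP 0 z; last first.
    rewrite Rintegral_eq0// => [|x _]; last by rewrite /F w0// mul0r normr0.
    exact: psi_dom_ge0.
  have e y : `|F z y| = `|w z| * (hk 0 z (y - t) * `|f y|).
    by rewrite /F !normrM (ger0_norm (hk_ge0 _ _ _ _)).
  under eq_Rintegral => y _ do rewrite e.
  have mf' : measurable_fun [set: R] (fun x => `|f x|) by exact: measurableT_comp.
  have fK' x : `|(`|f x|)| <= K by rewrite normr_id.
  have fb' x : b < x -> `|f x| = 0 by move=> bx; rewrite fb// normr0.
  rewrite RintegralZl//; last exact: i0.
  rewrite -bpotE//; apply: (le_trans _ (psi_density_dom t mg gK mf' fK' fb' z0)).
  rewrite /psi_density wE// mulrA [leRHS]normrM; apply: ler_wpM2l => //.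
  exact: ler_norm.
have [fub ifub] := Rintegral_fubini mF iF iF' (integrable_psi_dom t) FB.
transitivity (\int[mu]_z \int[mu]_y F z y).
  symmetry.
  rewrite [RHS]Rintegral_mkcond; apply: eq_Rintegral => z _; rewrite patchE.
  case: ifPn => [|/negP] zI.
    have z0 : 0 < z by move: zI; rewrite inE/= in_itv/= andbT.
    rewrite RintegralZl//; last exact: i0.
    by rewrite wE// -bpotE// /psi_density mulrA.
  rewrite Rintegral_eq0// => y _; rewrite /F w0 ?mul0r// leNgt; apply/negP => z0; apply: zI.
  by rewrite inE/= in_itv/= z0.
rewrite fub.
have Fy y : \int[mu]_z F z y = gamma_int s *
    ((fun y => f y * \int[mu]_(x in `]-oo, t[) ((y - x) `^ (- s) * g x)) \_ `]t, +oo[) y.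
  rewrite patchE; case: ifPn => [|/negP] yI.
    have B0 : 0 < y - t by move: yI; rewrite inE/= in_itv/= andbT subr_gt0.
    have := Rintegral_pot_hk t B0; rewrite subrKC => e.
    rewrite mulrCA -e [X in _ * X]Rintegral_mkcond -RintegralZl//; last first.
      by apply: integrable_patch => //; exact: integrable_pot_hk.
    by apply: eq_Rintegral => z _; rewrite -[LHS]/((F ^~ y) z) FE.
  rewrite mulr0 Rintegral_eq0// => z _; rewrite /F hk0 ?mul0r ?mulr0// leNgt; apply/negP => A0; apply: yI.
  by rewrite inE/= in_itv/= -subr_gt0 A0.
under eq_Rintegral => y _ do rewrite Fy.
(* Taking the factor out requires the integrand of Phi to be integrable, which is deduced from the
   second half of Fubini after division by [gamma_int s]. *)
have [g0|g0] := eqVneq (gamma_int s) 0.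
  by rewrite g0 mul0r Rintegral_eq0// => y _; rewrite mul0r.
rewrite RintegralZl//; first by rewrite -Rintegral_mkcond.
have := integrable_scale (gamma_int s)^-1 measurableT ifub.
by congr (_.-integrable _ _); apply/funext => y /=; rewrite Fy mulrA mulVf// mul1r.
Qed.

End PsiAtZero.

(** Changing the sign of U alone changes that of Psi: this is how the lower bound on Psi is obtained
    from the upper one. *)
Lemma caloric_pair_oppl {R : realType} s k (U U1 U2 V V1 V2 Psi : R -> R -> R) :
  caloric_pair s k U U1 U2 V V1 V2 Psi ->
  caloric_pair s k (fun t z => - U t z) (fun t z => - U1 t z) (fun t z => - U2 t z)
    V V1 V2 (fun t z => - Psi t z).
Proof.
move=> [k0 dU dU1 dUt cU dV dV1 dVt cV dP dPt cP]; constructor.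
- exact: k0.
all: move=> t z z0.
- exact: is_deriveN (dU t z z0).
- exact: is_deriveN (dU1 t z z0).
- by apply: (is_derive_eq (is_deriveN (dUt t z z0))); ring.
- by apply: cvgN; exact: cU.
- exact: dV.
- exact: dV1.
- exact: dVt.
- exact: cV.
- by apply: (is_derive_eq (is_deriveN (dP t z z0))); ring.
- by apply: (is_derive_eq (is_deriveN (dPt t z z0))); ring.
- by apply: cvgN; exact: cP.
Qed.

(** * The dichotomy *)

Section Dichotomy.
Context {R : realType}.
Notation mu := (@lebesgue_measure R).
Variables (s K a b c : R) (g f : R -> R).
Hypotheses (s1 : 1 < s) (s2 : s < 2) (ab : a < b).
Hypotheses (mg : measurable_fun [set: R] g) (gK : forall x, `|g x| <= K).
Hypotheses (mf : measurable_fun [set: R] f) (fK : forall x, `|f x| <= K).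
Hypotheses (ga : forall x, x < a -> g x = c) (fb : forall x, b < x -> f x = 0).
Hypothesis Phi0 : forall t, a < t < b -> Phi s g f t = 0.
Let s2' := ltW s2.
Let K0 : 0 <= K. Proof. exact: le_trans (gK 0). Qed.
Notation C n := (potC s K n).
Let C0 n : 0 <= C n. Proof. exact: potC_ge0. Qed.
Notation psi := (psi s g f).
Let s10 : 0 < s - 1. Proof. by rewrite subr_gt0. Qed.
Let s20 : 0 < 2 - s. Proof. by rewrite subr_gt0. Qed.

Let psi_cvg t : a < t < b -> psi t n.+1%:R^-1 @[n --> \oo] --> (0 : R).
Proof.
move=> tab; have := psi_cvg0 s1 s2 K0 mg gK mf fK fb (t := t).
by rewrite (Rintegral_psi_density s1 s2 K0 mg gK mf fK fb) Phi0// mulr0 oppr0.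
Qed.

Let M : R := C 0 * C 0 / (2 - s).

(** Integration of |Psi_z| <= (C 0)^2 z^(1 - s) from 0+, where Psi vanishes; this is the origin of M
    and of a rate z^(2 - s) uniform in t. The factor e treats Psi and - Psi together. *)
Let psi_near0_open (e : R) t z : `|e| <= 1 -> a < t < b -> 0 < z -> e * psi t z <= M * z `^ (2 - s).
Proof.
move=> e1 tab z0.
pose H (w : R) := M * w `^ (2 - s) - e * psi t w.
have dH (w : R) : 0 < w -> is_derive w 1 H (C 0 * C 0 * w `^ (1 - s) - e * psi_density s g f t w).
  move=> w0.
  have d1 := is_deriveZ M (is_derive1_powR (2 - s) w0).
  have d2 := is_deriveZ e (is_derive_psi_z s1 s2' mg gK mf fK fb t w0).
  apply: (is_derive_eq (is_deriveB d1 d2)); rewrite /GRing.scale/=; congr (_ - _).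
  have -> : 2 - s - 1 = 1 - s by ring.
  by rewrite mulrA /M divfK// gt_eqF.
have mono w : 0 < w -> w < z -> H w <= H z.
  move=> w0 wz; have [|v /andP[wv vz]] := @MVT_derive _ H (fun w => C 0 * C 0 * w `^ (1 - s) - e * psi_density s g f t w) w z wz.
    by move=> v /andP[wv _]; apply: dH; exact: lt_le_trans wv.
  move=> h; rewrite -subr_ge0 h; apply: mulr_ge0; last by rewrite subr_ge0 ltW.
  have v0 : 0 < v by exact: lt_trans wv.
  rewrite subr_ge0 (le_trans (ler_norm _))// normrM.
  apply: (@le_trans _ _ `|psi_density s g f t v|); first by rewrite ler_piMl.
  have := psi_density_le0 s1 s2 t mg gK mf fK v0; congr (_ <= _ * _ `^ _); ring.
have l1 : e * psi t n.+1%:R^-1 @[n --> \oo] --> (0 : R).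
  by rewrite -[X in _ --> X](mulr0 e); apply: cvgMr; exact: psi_cvg.
have Hn : \forall n \near \oo, - (e * psi t n.+1%:R^-1) <= H z.
  near=> n; have w0 : 0 < n.+1%:R^-1 :> R by rewrite invr_gt0.
  apply: (@le_trans _ _ (H n.+1%:R^-1)).
    rewrite /H lerDr; apply: mulr_ge0; last exact: powR_ge0.
    by apply: mulr_ge0; [exact: mulr_ge0|rewrite invr_ge0 ltW].
  apply: mono => //; rewrite invf_plt ?posrE//; near: n.
  by apply: filterS (nbhs_infty_gtr z^-1) => n /lt_le_trans; apply; rewrite ler_nat.
rewrite -subr_ge0 -/(H z).
have l2 : - (e * psi t n.+1%:R^-1) @[n --> \oo] --> (0 : R) by rewrite -[X in _ --> X]oppr0; exact: cvgN.
exact: (cvgr_to_le l2 Hn).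
Unshelve. all: by end_near. Qed.

(** The hypothesis on Phi concerns the open interval; the estimate reaches t = a by continuity in
    t. *)
Let psi_near0 (e : R) t z : `|e| <= 1 -> a <= t < b -> 0 < z -> e * psi t z <= M * z `^ (2 - s).
Proof.
move=> e1 /andP[]; rewrite le_eqVlt => /predU1P[<- _|at_ tb] z0; last first.
  by apply: psi_near0_open => //; rewrite at_ tb.
have cp : {for a, continuous (psi ^~ z)}.
  exact: is_derive_continuous (is_derive_psi_t s1 s2' mg gK mf fK fb a z0).
have l1 : e * psi t z @[t --> a^'+] --> e * psi a z.
  by apply: cvgMr; apply: cvg_at_right_filter; exact: cp.
apply: (cvgr_to_le l1); near=> x; apply: psi_near0_open => //.
by apply/andP; split; near: x; [exact: nbhs_right_gt|exact: nbhs_right_lt].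
Unshelve. all: by end_near. Qed.

Let psi_b t z : b <= t -> psi t z = 0.
Proof.
move=> bt; rewrite /psi Rintegral_eq0 ?oppr0// => x _.
have e : bpot s f 0 t x = 0.
  apply: Rintegral_eq0 => // y _; have [A0|A0] := leP (- t - y) 0; first by rewrite hk0// mul0r.
  rewrite fb ?mulr0//; apply: (le_lt_trans bt).
  by move: A0; rewrite subr_gt0 ltrNr.
by rewrite /psi_density e !mulr0.
Qed.

Let C02 : 0 <= (b - a) ^+ 2 * (C 0 * C 2).
Proof. by apply: mulr_ge0; [exact: sqr_ge0|exact: mulr_ge0]. Qed.

Let psi_infty t z : a <= t <= b -> 1 <= z ->
  `|psi t z| <= (b - a) ^+ 2 * (C 0 * C 2) * 2 `^ s * (2 / (s - 1)) * z^-1.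
Proof.
move=> /andP[at_ tb] z1; have z0 : 0 < z by exact: lt_le_trans z1.
have D0 : 0 <= b - a by rewrite subr_ge0 ltW.
have D1 : b - t <= b - a by rewrite lerD2l lerN2.
apply: (le_trans (psi_le_infty s1 s2' mg gK mf fK fb D0 D1 z0)).
have h : z `^ (1 - s) <= 1.
  rewrite -[leRHS](powRr0 z); apply: ler_powR => //; rewrite subr_le0; exact: ltW.
have -> : (b - a) ^+ 2 * (C 0 * C 2) * (z^-1 * 2 `^ s) * (2 * (z `^ (1 - s) / (s - 1))) =
    (b - a) ^+ 2 * (C 0 * C 2) * 2 `^ s * (2 / (s - 1)) * z^-1 * z `^ (1 - s).
  by move: ((b - a) ^+ 2 * (C 0 * C 2)) (z `^ _) (2 `^ _) (s - 1)^-1 z^-1 => x1 x2 x3 x4 x5; ring.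
rewrite ler_piMr// mulr_ge0 ?invr_ge0 ?(ltW z0)// mulr_ge0 ?divr_ge0 ?(ltW s10)//.
by rewrite mulr_ge0 ?powR_ge0.
Qed.

Let psi_decay (e' : R) : `|e'| <= 1 -> forall e, 0 < e -> exists z1 z2, [/\ 0 < z1, z1 <= z2 &
  forall t z, a <= t <= b -> 0 < z -> (z < z1) || (z2 < z) -> e' * psi t z < e].
Proof.
move=> e1 e e0.
have M0 : 0 <= M by apply: mulr_ge0; [exact: mulr_ge0|rewrite invr_ge0 ltW].
pose N := (b - a) ^+ 2 * (C 0 * C 2) * 2 `^ s * (2 / (s - 1)).
have N0 : 0 <= N.
  by apply: mulr_ge0; [apply: mulr_ge0 => //; exact: powR_ge0|rewrite divr_ge0// ltW].
pose z1 := Num.min 1 ((e / (M + 1)) `^ (2 - s)^-1).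
have M10 : 0 < M + 1 by rewrite ltr_wpDl.
have q0 : 0 < e / (M + 1) by rewrite divr_gt0.
have z10 : 0 < z1 by rewrite lt_min ltr01 powR_gt0.
exists z1, (1 + N / e); split => //.
  apply: (@le_trans _ _ 1); first by rewrite ge_min lexx.
  by rewrite lerDl divr_ge0// ltW.
move=> t z /andP[at_ tb] z0 /orP[zz|zz]; last first.
  have z1' : 1 < z by apply: le_lt_trans zz; rewrite lerDl divr_ge0// ltW.
  apply: (@le_lt_trans _ _ `|psi t z|).
    by rewrite (le_trans (ler_norm _))// normrM ler_piMl.
  have tI : a <= t <= b by rewrite at_ tb.
  apply: (le_lt_trans (psi_infty tI (ltW z1'))); rewrite -/N ltr_pdivrMr// mulrC -ltr_pdivrMr//.
  by apply: le_lt_trans zz; rewrite lerDr.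
have [tb'|bt] := ltP t b; last by rewrite psi_b// mulr0.
have tI : a <= t < b by rewrite at_ tb'.
apply: (le_lt_trans (psi_near0 e1 tI z0)).
have h : z `^ (2 - s) <= e / (M + 1).
  have -> : e / (M + 1) = ((e / (M + 1)) `^ (2 - s)^-1) `^ (2 - s).
    by rewrite -powRrM mulVf ?gt_eqF// powRr1// ltW.
  apply: ge0_ler_powR; rewrite ?nnegrE ?powR_ge0 ?(ltW z0) ?(ltW s20)//.
  by apply: (le_trans (ltW zz)); rewrite ge_min lexx orbT.
apply: (le_lt_trans (ler_wpM2l M0 h)); rewrite mulrCA gtr_pMr//.
by rewrite ltr_pdivrMr// mul1r ltrDl.
Qed.

Let cal := caloric_pair_psi s1 s2' mg gK mf fK fb.

Let mh : measurable_fun [set: R] (fun x => f (- x)). Proof. exact: measurableT_comp. Qed.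

(** The past of a contains only the constant part of the source, so U(a, .) is c times a nonnegative
    function. *)
Let U_sign z : 0 < z -> keeps_sign (pot s g 0 a) z.
Proof.
move=> z0; exists z => //.
have e z' : 0 < z' -> pot s g 0 a z' = c * \int[mu]_x hk s 0 z' (a - x).
  move=> z'0; rewrite -RintegralZl//; last exact: integrable_hk.
  apply: eq_Rintegral => x _; have [A0|A0] := leP (a - x) 0; first by rewrite hk0// mul0r mulr0.
  by rewrite ga 1?mulrC// -subr_gt0.
have I0 z' : 0 <= \int[mu]_x hk s 0 z' (a - x) by apply: Rintegral_ge0 => x _; exact: hk_ge0.
have pos z' : `|z' - z| < z -> 0 < z' by rewrite ltr_distl subrr => /andP[].
have [c0|c0] := leP 0 c; [left|right] => z' /pos z'0; rewrite e//; first exact: mulr_ge0.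
by apply: mulr_le0_ge0 => //; exact: ltW.
Qed.

Let psi0 t z : a <= t <= b -> 0 < z -> psi t z = 0.
Proof.
move=> tI z0; apply/eqP; rewrite eq_le; apply/andP; split.
  apply: (caloric_pair_le0 cal ab _ _ _ _ U_sign tI z0).
  - move=> e e0; have [|z1 [z2 [h1 h2 h3]]] := @psi_decay 1 _ e e0; first by rewrite normr1.
    by exists z1, z2; split => // t' z' ht' hz' hz; have := h3 t' z' ht' hz' hz; rewrite mul1r.
  - by move=> z' _; exact: psi_b.
  - by move=> t' z' z'0; exact: (pot_isolated s1 s2' mg gK).
  - by move=> t' z' z'0; exact: (pot_isolated s1 s2' mh (fun x => fK (- x))).
rewrite -oppr_le0; apply: (@caloric_pair_le0 _ _ _ _ _ _ _ _ _ (fun t z => - psi t z) a b (caloric_pair_oppl cal) ab _ _ _ _ _ t z tI z0).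
- move=> e e0; have [|z1 [z2 [h1 h2 h3]]] := @psi_decay (-1) _ e e0; first by rewrite normrN1.
  by exists z1, z2; split => // t' z' ht' hz' hz; have := h3 t' z' ht' hz' hz; rewrite mulN1r.
- by move=> z' _; rewrite psi_b// oppr0.
- move=> t' z' z'0; have [h|[r r0 h]] := pot_isolated s1 s2' mg gK t' z'0.
    by left => w w0; rewrite h// oppr0.
  by right; exists r => // w hw; rewrite oppr_eq0; exact: h.
- by move=> t' z' z'0; exact: (pot_isolated s1 s2' mh (fun x => fK (- x))).
- move=> z' z'0; have [r r0 [h|h]] := U_sign z'0; exists r => //.
    by right => w hw; rewrite oppr_le0; exact: h.
  by left => w hw; rewrite oppr_ge0; exact: h.
Qed.

Lemma pot_dichotomy t : a <= t <= b ->
  (forall z, 0 < z -> pot s g 0 t z = 0) \/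
  (forall z, 0 < z -> pot s (fun x => f (- x)) 0 (- t) z = 0).
Proof.
move=> tI.
have UV z : 0 < z -> pot s g 0 t z * bpot s f 0 t z = 0.
  move=> z0; have d := is_derive_psi_z s1 s2' mg gK mf fK fb t z0.
  have d0 : is_derive z 1 (psi t) 0.
    apply: (@near_eq_is_derive _ _ _ (cst 0) _ _ _ _ _ (is_derive_cst _ _ _)).
    by near=> y; rewrite psi0//; near: y; exact: lt_nbhsr.
  have /eqP := is_derive_unique d d0; rewrite mulf_eq0 gt_eqF ?powR_gt0//= => /eqP.
  exact.
have [|[r r0 Hr]] := pot_isolated s1 s2' mg gK t ltr01; first by left.
have [|[r' r'0 Hr']] := @pot_isolated _ s K _ s1 s2' mh (fun x => fK (- x)) (- t) 1 ltr01; first by right.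
(* At the nearby point 1 + h isolated zeros would leave both factors nonzero, against U V = 0. *)
pose h := Num.min r r' / 2.
have h0 : 0 < h by rewrite divr_gt0// lt_min r0.
have hr : h < r /\ h < r'.
  have m0 : 0 < Num.min r r' by rewrite lt_min r0.
  by have := half_lt m0; rewrite -/h lt_min => /andP[].
have /eqP := UV (1 + h) (addr_gt0 ltr01 h0); rewrite mulf_eq0 => /orP[|] /eqP E.
  by have := Hr (1 + h); rewrite addrAC subrr add0r gtr0_norm// h0 hr.1 E eqxx => /(_ isT).
have := Hr' (1 + h); rewrite addrAC subrr add0r gtr0_norm// h0 hr.2 => /(_ isT) /negP; case.
by apply/eqP; exact: E.
Unshelve. all: by end_near. Qed.

End Dichotomy.

(** * From vanishing potentials to vanishing sources *)

Section Conclusion.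
Context {R : realType}.
Notation mu := (@lebesgue_measure R).
Variable s : R.
Hypotheses (s1 : 1 < s) (s2 : s < 2).
Let s2' := ltW s2.

Lemma pot_opp (K : R) (g : R -> R) n t z : measurable_fun [set: R] g -> (forall x, `|g x| <= K) ->
  0 < z -> pot s (fun x => - g x) n t z = - pot s g n t z.
Proof.
move=> mg gK z0; rewrite -mulN1r -RintegralZl//; last exact: (integrable_pot s1 s2' mg gK).
by apply: eq_Rintegral => x _; rewrite mulN1r mulrN.
Qed.

(** The one-sided lemmas are applied to g and to - g. The constant c comes before the Abel integral,
    whose vanishing is known for sources equal to 0 to the left of a. *)
Lemma pot_vanish_source (K : R) (g : R -> R) t a c : measurable_fun [set: R] g -> (forall x, `|g x| <= K) ->
  (forall z, 0 < z -> pot s g 0 t z = 0) -> a < t -> (forall x, x < a -> g x = c) ->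
  {for t, continuous g} ->
  g t = 0 /\ \int[mu]_(x in `[a, t]) ((t - x) `^ (- (s - 1)) * g x) = 0.
Proof.
move=> mg gK P0 at_ gc cg.
have mg' : measurable_fun [set: R] (fun x => - g x) by exact: measurableT_comp.
have gK' x : `|- g x| <= K by rewrite normrN.
have P0' z : 0 < z -> pot s (fun x => - g x) 0 t z = 0.
  by move=> z0; rewrite (pot_opp _ _ mg gK z0) P0// oppr0.
have gc' x : x < a -> - g x = - c by move=> xa; rewrite gc.
have c0 : c = 0.
  apply: le_anti; rewrite (pot_vanish_far s1 s2 mg gK P0 at_ gc)/= -oppr_le0.
  exact: (pot_vanish_far s1 s2 mg' gK' P0' at_ gc').
split; last by apply: (pot_vanish_abel s1 s2 mg gK P0 at_); rewrite -c0.
have cg' : {for t, continuous (fun x => - g x)} by exact: cvgN.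
apply: le_anti; rewrite (pot_vanish_at s1 s2 mg gK P0 cg)/= -oppr_le0.
exact: (pot_vanish_at s1 s2 mg' gK' P0' cg').
Qed.

Lemma Rintegral_abel_opp (f : R -> R) (t b : R) (p : R) : measurable_fun [set: R] f ->
  \int[mu]_(x in `[(- b), (- t)]) ((- t - x) `^ p * f (- x)) =
  \int[mu]_(y in `[t, b]) ((y - t) `^ p * f y).
Proof.
move=> mf; rewrite Rintegral_mkcond [RHS]Rintegral_mkcond -Rintegral_opp.
  apply: eq_Rintegral => x _; rewrite !patchE.
  have -> : (- x \in (`[(- b), (- t)]%classic : set R)) = (x \in (`[t, b]%classic : set R)).
    by apply/idP/idP; rewrite !inE/= !in_itv/= !lerN2 andbC.
  by case: ifP => // _; rewrite opprK [- t + x]addrC.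
apply/(measurable_restrictT _ _).1 => //; apply: measurable_funTS; apply: measurable_funM; last exact: measurableT_comp.
apply: (measurableT_comp (measurable_powR p)).
by apply: measurable_funB => //; exact: measurable_cst.
Qed.

Theorem abel_dichotomy (K a b c : R) (g f : R -> R) : a < b ->
  measurable_fun [set: R] g -> (forall x, `|g x| <= K) ->
  measurable_fun [set: R] f -> (forall x, `|f x| <= K) ->
  (forall x, x < a -> g x = c) -> (forall x, b < x -> f x = 0) ->
  (forall t, a < t < b -> {for t, continuous g}) ->
  (forall t, a < t < b -> {for t, continuous f}) ->
  (forall t, a < t < b -> Phi s g f t = 0) ->
  forall t, a < t < b ->
  (g t = 0 /\ \int[mu]_(x in `[a, t]) ((t - x) `^ (- (s - 1)) * g x) = 0) \/
  (f t = 0 /\ \int[mu]_(y in `[t, b]) ((y - t) `^ (- (s - 1)) * f y) = 0).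
Proof.
move=> ab mg gK mf fK ga fb cg cf Phi0 t tI; have /andP[at_ tb] := tI.
have tI' : a <= t <= b by rewrite !ltW.
have mh : measurable_fun [set: R] (fun x => f (- x)) by exact: measurableT_comp.
have [P0|Q0] := pot_dichotomy s1 s2 ab mg gK mf fK ga fb Phi0 tI'; [left|right].
  exact: (pot_vanish_source mg gK P0 at_ ga (cg t tI)).
have hb x : x < - b -> f (- x) = 0 by move=> xb; rewrite fb// ltrNr.
have ch : {for (- t), continuous (fun x => f (- x))}.
  apply: (@continuous_comp _ _ _ -%R f); first exact: opp_continuous.
  by rewrite opprK; exact: cf.
have tb' : - b < - t by rewrite ltrN2.
have := pot_vanish_source mh (fun x => fK (- x)) Q0 tb' hb ch.
by rewrite opprK (Rintegral_abel_opp _ _ _ mf).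
Qed.

End Conclusion.

(** * Abel integrals and cut-off functions *)

Section IntegrableAlgebra.
Context {R : realType}.
Notation mu := (@lebesgue_measure R).

Lemma integrable_add (D : set R) (f g : R -> R) : measurable D ->
  mu.-integrable D (EFin \o f) -> mu.-integrable D (EFin \o g) ->
  mu.-integrable D (EFin \o (fun x => f x + g x)).
Proof.
move=> mD fi gi; have := @integrableD _ _ _ mu D mD _ _ fi gi.
by congr (_.-integrable _ _); exact/funext.
Qed.

Lemma integrable_sub (D : set R) (f g : R -> R) : measurable D ->
  mu.-integrable D (EFin \o f) -> mu.-integrable D (EFin \o g) ->
  mu.-integrable D (EFin \o (fun x => f x - g x)).
Proof.
move=> mD fi gi; have := @integrableB _ _ _ mu D mD _ _ fi gi.
by congr (_.-integrable _ _); exact/funext.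
Qed.

End IntegrableAlgebra.

Section Clamp.
Context {R : realType}.
Variables (a b : R).
Hypothesis ab : a < b.

(* Composing with clamp turns functions on [a, b] into continuous functions on the
   line, constant to the left of a as the potentials require. *)
Definition clamp (t : R) : R := Num.max a (Num.min b t).

Lemma clamp_itv t : a <= clamp t <= b.
Proof. by rewrite /clamp le_max lexx/= ge_max ge_min lexx (ltW ab). Qed.

Lemma clamp_id t : a <= t <= b -> clamp t = t.
Proof. by move=> /andP[at_ tb]; rewrite /clamp min_r// max_r. Qed.

Lemma clamp_left t : t <= a -> clamp t = a.
Proof. by move=> ta; rewrite /clamp min_r ?max_l// (le_trans ta)// ltW. Qed.

Lemma clamp_continuous : continuous clamp.
Proof.
move=> t; apply: (@continuous_max _ _ (cst a) (fun t => Num.min b t)); first exact: cvg_cst.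
by apply: (@continuous_min _ _ (cst b) id); [exact: cvg_cst|exact: cvg_id].
Qed.

End Clamp.

Section Continuity.
Context {R : realType}.

Lemma within_comp_continuous (T U : topologicalType) (D : set U) (g : U -> R) (c : T -> U) :
  {within D, continuous g} -> (forall x, D (c x)) -> continuous c -> continuous (g \o c).
Proof.
move=> /subspace_continuousP cg Dc cc x.
move=> A hA; have hD : nbhs (c x) (fun y => D y -> A (g y)) := cg (c x) (Dc x) A hA.
have hc : nbhs x (fun y => D (c y) -> A (g (c y))) := cc x _ hD.
have hx : nbhs x (fun y => A (g (c y))) by apply: filterS hc => y; apply; exact: Dc.
exact: hx.
Qed.

(* Partial derivatives near a point, continuous at it, give the total derivative:
   split the increment along the axes and apply the mean value theorem twice. *)
Lemma is_derive_chain (f fx fy : R -> R -> R) (x y : R -> R) (t x' y' e : R) : 0 < e ->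
  (forall v w : R, `|v - x t| < e -> `|w - y t| < e -> is_derive v 1 (f ^~ w) (fx v w)) ->
  (forall w : R, `|w - y t| < e -> is_derive w 1 (f (x t)) (fy (x t) w)) ->
  {for (x t, y t), continuous (fun p : R * R => fx p.1 p.2)} ->
  {for y t, continuous (fy (x t))} ->
  is_derive t 1 x x' -> is_derive t 1 y y' ->
  is_derive t 1 (fun t => f (x t) (y t)) (fx (x t) (y t) * x' + fy (x t) (y t) * y').
Proof.
move=> e0 dfx dfy cfx cfy dx dy.
have cx : {for t, continuous x} by exact: is_derive_continuous dx.
have cy : {for t, continuous y} by exact: is_derive_continuous dy.
have mvt (F dF : R -> R) (p q : R) : `|q - p| < e -> (forall v : R, `|v - p| < e -> is_derive v 1 F (dF v)) ->
    exists v, `|v - p| <= `|q - p| /\ F q - F p = dF v * (q - p).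
  move=> pq dF'; have [pq'|qp|->] := ltgtP p q; last by exists q; rewrite !subrr mulr0.
  - have [|v /andP[v1 v2] ->] := @MVT_derive _ F dF p q pq'.
      move=> v /andP[v1 v2]; apply: dF'; rewrite ger0_norm ?subr_ge0//.
      by apply: le_lt_trans pq; rewrite ger0_norm ?subr_ge0 ?(ltW pq')// lerD2r.
    exists v; split=> //; rewrite !gtr0_norm ?subr_gt0// lerD2r; exact: ltW.
  - have [|v /andP[v1 v2] h] := @MVT_derive _ F dF q p qp.
      move=> v /andP[v1 v2]; apply: dF'; rewrite ler0_norm ?subr_le0// opprB.
      apply: le_lt_trans pq; rewrite ltr0_norm ?subr_lt0// opprB lerD2l lerN2//.
    exists v; split; last by rewrite -opprB h -mulrN opprB.
    by rewrite !ltr0_norm ?subr_lt0// !opprB lerD2l lerN2 ltW.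
have /(_ _)/cid V h : exists p : R * R, (`|x (t + h) - x t| < e -> `|y (t + h) - y t| < e ->
    [/\ `|p.1 - x t| <= `|x (t + h) - x t|, `|p.2 - y t| <= `|y (t + h) - y t| &
     f (x (t + h)) (y (t + h)) - f (x t) (y t) = fx p.1 (y (t + h)) * (x (t + h) - x t) + fy (x t) p.2 * (y (t + h) - y t)]).
  have [hx|hx] := pselect (`|x (t + h) - x t| < e); last by exists (0, 0).
  have [hy|hy] := pselect (`|y (t + h) - y t| < e); last by exists (0, 0).
  have [v [v1 v2]] := mvt (f ^~ (y (t + h))) (fx ^~ (y (t + h))) (x t) (x (t + h)) hx (fun v hv => dfx v _ hv hy).
  have [w [w1 w2]] := mvt (f (x t)) (fy (x t)) (y t) (y (t + h)) hy (fun w hw => dfy w hw).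
  by exists (v, w) => _ _; split => //=; rewrite -v2 -w2 addrA subrK.
pose p h := sval (V h).
have shift (F : R -> R) : {for t, continuous F} -> F (t + h) @[h --> 0^'] --> F t.
  move=> cF; have h1 : (t + h) @[h --> 0^'] --> t.
    rewrite -[X in _ --> X]addr0; apply: cvgD; first exact: cvg_cst.
    exact: cvg_within.
  exact: (cvg_comp _ _ h1 cF).
have nearx : \forall h \near (0 : R)^', `|x (t + h) - x t| < e.
  by have /cvgrPdist_lt/(_ _ e0) := shift _ cx; apply: filterS => h; rewrite distrC.
have neary : \forall h \near (0 : R)^', `|y (t + h) - y t| < e.
  by have /cvgrPdist_lt/(_ _ e0) := shift _ cy; apply: filterS => h; rewrite distrC.
have cv1 : (p h).1 @[h --> 0^'] --> x t.
  apply/cvgrPdist_lt => d d0; have /cvgrPdist_lt/(_ _ d0) := shift _ cx; move=> hd.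
  near=> h; have [||h1 _ _] := svalP (V h); [by near: h|by near: h|].
  rewrite distrC (le_lt_trans h1)// distrC; near: h; exact: hd.
have cv2 : (p h).2 @[h --> 0^'] --> y t.
  apply/cvgrPdist_lt => d d0; have /cvgrPdist_lt/(_ _ d0) := shift _ cy; move=> hd.
  near=> h; have [||_ h2 _] := svalP (V h); [by near: h|by near: h|].
  rewrite distrC (le_lt_trans h2)// distrC; near: h; exact: hd.
apply: cvg_is_derive.
have lim : fx (p h).1 (y (t + h)) * (h^-1 * (x (t + h) - x t)) + fy (x t) (p h).2 * (h^-1 * (y (t + h) - y t))
    @[h --> 0^'] --> fx (x t) (y t) * x' + fy (x t) (y t) * y'.
  apply: cvgD; apply: cvgM.
  - exact: (cvg_comp (fun h => ((p h).1, y (t + h))) _ (cvg_pair cv1 (shift _ cy)) cfx).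
  - exact: is_derive_cvg.
  - exact: (cvg_comp _ _ cv2 cfy).
  - exact: is_derive_cvg.
apply: cvg_trans lim; apply: near_eq_cvg; near=> h.
have [||_ _ ->] := svalP (V h); [by near: h|by near: h|].
by rewrite [RHS]mulrDr; congr (_ + _); rewrite mulrCA.
Unshelve. all: by end_near. Qed.

End Continuity.

Section Boundedness.
Context {R : realType}.

Lemma continuous_itv_bounded (a b : R) (w : R -> R) : a < b -> continuous w ->
  exists2 M, 0 <= M & forall t, a <= t <= b -> `|w t| <= M.
Proof.
move=> ab cw; have cn : {within `[a, b], continuous (fun t => `|w t|)}.
  apply: continuous_subspaceT => t.
  by apply: (@continuous_comp _ _ _ w (fun x => `|x|)); [exact: cw|exact: norm_continuous].
have [c _ hc] := EVT_max (ltW ab) cn.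
by exists `|w c| => // t ht; apply: hc; rewrite in_itv.
Qed.

Lemma continuous_rect_bounded (s1 s2 a b : R) (w : R -> R -> R) : s1 <= s2 -> a <= b ->
  continuous (fun p : R * R => w p.1 p.2) ->
  exists2 M, 0 <= M & forall s t, s1 <= s <= s2 -> a <= t <= b -> `|w s t| <= M.
Proof.
move=> s12 ab cw; have [|s [t [_ _ H]]] := @EVT_max_rect _ (fun s t => `|w s t|) s1 s2 a b s12 ab.
  move=> s t _ _; apply: (@continuous_comp _ _ _ (fun p : R * R => w p.1 p.2) (fun x => `|x|)).
    exact: cw.
  exact: norm_continuous.
by exists `|w s t| => // s' t' hs ht; exact: H.
Qed.

End Boundedness.

Section AbelIntegral.
Context {R : realType}.
Notation mu := (@lebesgue_measure R).
Variables (a b al : R).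
Hypotheses (ab : a < b) (al0 : 0 < al) (al1 : al < 1).

Definition abel (w : R -> R) (t : R) : R := \int[mu]_(x in `[a, t]) ((t - x) `^ (- al) * w x).

Let al10 : 0 < 1 - al. Proof. by rewrite subr_gt0. Qed.

Lemma integrable_abel_gen (w : R -> R) (M c t t' : R) : measurable_fun `[c, t] w -> t <= t' ->
  (forall x, c <= x <= t -> `|w x| <= M) ->
  mu.-integrable `[c, t] (EFin \o (fun x => (t' - x) `^ (- al) * w x)).
Proof.
move=> mw tt wM.
have iA : mu.-integrable `[c, t] (EFin \o (fun x => M * (t' - x) `^ (- al))).
  apply: integrable_scale => //; apply: integrableS (integrable_abel_kernel al0 al1 c t') => //.
  by move=> x /=; rewrite !in_itv/= => /andP[-> xt]; exact: le_trans tt.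
have mm : measurable_fun `[c, t] (fun x => (t' - x) `^ (- al) * w x).
  by apply: measurable_funM => //; exact: measurable_powR_sub.
apply: (integrable_le _ mm iA) => // x; rewrite /= in_itv/= => cx.
by rewrite normrM mulrC (ger0_norm (powR_ge0 _ _)) ler_wpM2r ?powR_ge0// wM.
Qed.

Lemma abel_le (w : R -> R) (M c t : R) : measurable_fun `[c, t] w -> c <= t ->
  (forall x, c <= x <= t -> `|w x| <= M) ->
  `|\int[mu]_(x in `[c, t]) ((t - x) `^ (- al) * w x)| <= M * ((t - c) `^ (1 - al) / (1 - al)).
Proof.
move=> mw ct wM; have ii := integrable_abel_gen mw (lexx t) wM.
apply: (le_trans (le_normr_Rintegral _ ii)) => //.
rewrite -(Rintegral_abel_kernel al0 al1 ct) -RintegralZl//; last exact: integrable_abel_kernel.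
apply: le_Rintegral => //; first exact: integrable_norm.
  by apply: integrable_scale => //; exact: integrable_abel_kernel.
move=> x; rewrite /= in_itv/= => cx.
by rewrite normrM mulrC (ger0_norm (powR_ge0 _ _)) ler_wpM2r ?powR_ge0// wM.
Qed.

(** On [a, t] the difference of the kernels has a constant sign, so its absolute value integrates
    explicitly to at most (t' - t)^(1 - al) / (1 - al). The interval [t, t'] contributes the same
    amount, hence the factor 2. *)
Lemma abel_holder (w : R -> R) (M t t' : R) : measurable_fun `[a, b] w ->
  (forall x, a <= x <= b -> `|w x| <= M) -> a <= t -> t <= t' -> t' <= b ->
  `|abel w t' - abel w t| <= M * ((t' - t) `^ (1 - al) / (1 - al)) * 2.
Proof.
move=> mw wM at_ tt tb.
have M0 : 0 <= M by rewrite (le_trans (normr_ge0 (w a)))// wM// lexx ltW.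
have sub c d : a <= c -> d <= b -> `[c, d]%classic `<=` `[a, b]%classic.
  by move=> ac db x /=; rewrite !in_itv/= => /andP[cx xd]; rewrite (le_trans ac cx) (le_trans xd db).
have mw' c d : a <= c -> d <= b -> measurable_fun `[c, d] w.
  by move=> ac db; apply: measurable_funS mw => //; exact: sub.
have wM' c d x : a <= c -> d <= b -> c <= x <= d -> `|w x| <= M.
  by move=> ac db /andP[cx xd]; apply: wM; rewrite (le_trans ac cx) (le_trans xd db).
have ii : mu.-integrable `[a, t'] (EFin \o (fun x => (t' - x) `^ (- al) * w x)).
  by apply: (@integrable_abel_gen _ M) => // [|x]; [exact: mw'|exact: wM'].
have i1 : mu.-integrable `[a, t] (EFin \o (fun x => (t' - x) `^ (- al) * w x)).
  by apply: (@integrable_abel_gen _ M) => // [|x]; [apply: mw' => //; exact: le_trans tb|apply: wM' => //; exact: le_trans tb].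
have i2 : mu.-integrable `[a, t] (EFin \o (fun x => (t - x) `^ (- al) * w x)).
  by apply: (@integrable_abel_gen _ M) => // [|x]; [apply: mw' => //; exact: le_trans tb|apply: wM' => //; exact: le_trans tb].
have i3 : mu.-integrable `[t, t'] (EFin \o (fun x => (t' - x) `^ (- al) * w x)).
  apply: (@integrable_abel_gen _ M) => // [|x]; [exact: mw'|exact: wM'].
have split (h : R -> R) : mu.-integrable `[a, t'] (EFin \o h) ->
    \int[mu]_(x in `[a, t']) h x = \int[mu]_(x in `[a, t]) h x + \int[mu]_(x in `[t, t']) h x.
  move=> ih; have := @Rintegral_itvB _ h (BLeft a) (BRight t') t ih; rewrite !bnd_simp => /(_ at_ tt) e.
  rewrite -[X in _ + X]Rintegral_itv_obnd_cbnd; last first.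
    apply: integrableS ih => // x /=; rewrite !in_itv/= => /andP[tx ->]; rewrite andbT.
    by apply: (le_trans at_); exact: ltW.
  by rewrite -e addrC subrK.
rewrite /abel (split _ ii) addrAC; apply: (le_trans (ler_normD _ _)); rewrite mulr_natr mulr2n lerD//; last first.
  by apply: abel_le => // [|x]; [exact: mw'|exact: wM'].
rewrite -RintegralB//.
have iB : mu.-integrable `[a, t] (EFin \o (fun x => (t' - x) `^ (- al) * w x - (t - x) `^ (- al) * w x)).
  exact: integrable_sub.
have k1 : mu.-integrable `[a, t] (EFin \o (fun x => (t' - x) `^ (- al))).
  apply: integrableS (integrable_abel_kernel al0 al1 a t') => //.
  by move=> x /=; rewrite !in_itv/= => /andP[-> xt]; exact: le_trans tt.
have k2 := integrable_abel_kernel al0 al1 a t.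
have k12 : mu.-integrable `[a, t] (EFin \o (fun x => (t - x) `^ (- al) - (t' - x) `^ (- al))).
  exact: integrable_sub.
(* The endpoint is removed because [powR] sends 0 to 0: at x = t the kernel of t would be the
   smaller one, and the sign of the difference would be lost. *)
have iB' : mu.-integrable `[a, t[ (EFin \o (fun x => (t' - x) `^ (- al) * w x - (t - x) `^ (- al) * w x)).
  by apply: integrableS iB => // x /=; rewrite !in_itv/= => /andP[-> /ltW].
rewrite -Rintegral_itv_bndo_bndc//.
apply: (le_trans (le_normr_Rintegral _ iB')) => //.
apply: (@le_trans _ _ (\int[mu]_(x in `[a, t[) (M * ((t - x) `^ (- al) - (t' - x) `^ (- al))))).
  apply: le_Rintegral => //; first exact: integrable_norm.
    apply: integrableS (integrable_scale M (measurable_itv _) k12) => // x /=.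
    by rewrite !in_itv/= => /andP[-> /ltW].
  move=> x; rewrite /= in_itv/= => /andP[ax xt].
  rewrite -mulrBl normrM mulrC; apply: ler_pM => //.
    by apply: wM; rewrite ax/= (le_trans (ltW xt))// (le_trans tt).
  rewrite distrC ger0_norm// subr_ge0 !powRN lef_pV2 ?posrE ?powR_gt0 ?subr_gt0//; last exact: lt_le_trans tt.
  apply: ge0_ler_powR; rewrite ?nnegrE ?(ltW al0) ?subr_ge0 ?(ltW xt)//; last by rewrite lerD2r.
  by rewrite (le_trans (ltW xt)).
have k12' : mu.-integrable `[a, t[ (EFin \o (fun x => M * ((t - x) `^ (- al) - (t' - x) `^ (- al)))).
  apply: integrableS (integrable_scale M (measurable_itv _) k12) => // x /=.
  by rewrite !in_itv/= => /andP[-> /ltW].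
rewrite Rintegral_itv_bndo_bndc// RintegralZl// ler_wpM2l// RintegralB// (Rintegral_abel_kernel al0 al1 at_).
have := split _ (integrable_abel_kernel al0 al1 a t').
rewrite (Rintegral_abel_kernel al0 al1 (le_trans at_ tt)) (Rintegral_abel_kernel al0 al1 tt).
move=> e; rewrite lerBlDl -e -[leRHS]/(_ / _) ler_wpM2r ?invr_ge0 ?(ltW al10)//.
apply: ge0_ler_powR; rewrite ?nnegrE ?(ltW al10) ?subr_ge0 ?lerD2r//.
exact: le_trans tt.
Qed.

Lemma abel_continuous (w : R -> R) : continuous w -> continuous (fun t => abel w (clamp a b t)).
Proof.
move=> cw; have [M M0 wM] := continuous_itv_bounded ab cw.
have mw : measurable_fun `[a, b] w by apply: measurable_funTS; exact: continuous_measurable_fun.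
pose c := clamp a b.
have H t t' : `|abel w (c t') - abel w (c t)| <= M * (`|c t' - c t| `^ (1 - al) / (1 - al)) * 2.
  have /andP[h1 h2] := clamp_itv ab t; have /andP[h1' h2'] := clamp_itv ab t'.
  have [tt|tt] := leP (c t) (c t').
    by rewrite (@ger0_norm _ (c t' - c t)) ?subr_ge0//; exact: abel_holder.
  by rewrite distrC (@ltr0_norm _ (c t' - c t)) ?subr_lt0// opprB; apply: abel_holder => //; exact: ltW.
move=> t; apply/cvgrPdist_le => e e0.
have C0 : 0 < M * 2 / (1 - al) + 1 by rewrite ltr_wpDl// divr_ge0 ?mulr_ge0// ltW.
have d0 : 0 < (e / (M * 2 / (1 - al) + 1)) `^ (1 - al)^-1 by rewrite powR_gt0// divr_gt0.
have /cvgrPdist_lt/(_ _ d0) := @clamp_continuous _ a b t; apply: filterS => t'; rewrite -/c => hd.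
apply: (le_trans (H t' t)).
have h : `|c t - c t'| `^ (1 - al) <= e / (M * 2 / (1 - al) + 1).
  have e1 : 0 < e / (M * 2 / (1 - al) + 1) by rewrite divr_gt0.
  have -> : e / (M * 2 / (1 - al) + 1) = ((e / (M * 2 / (1 - al) + 1)) `^ (1 - al)^-1) `^ (1 - al).
    by rewrite -powRrM mulVf ?gt_eqF// powRr1// ltW.
  by apply: ge0_ler_powR; rewrite ?nnegrE ?powR_ge0 ?(ltW al10)// ltW.
have -> : M * (`|c t - c t'| `^ (1 - al) / (1 - al)) * 2 = (M * 2 / (1 - al)) * `|c t - c t'| `^ (1 - al) by ring.
have M2 : 0 <= M * 2 / (1 - al) by rewrite divr_ge0 ?mulr_ge0// ltW.
apply: (le_trans (ler_wpM2l M2 h)); rewrite mulrCA ger_pMr// ler_pdivrMr// mul1r lerDl//.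
Qed.

End AbelIntegral.

Section CutOff.
Context {R : realType}.
Variable tau : R.

(* exp(- z / (tau - t)) to the left of tau, 0 to the right; it tends to the
   indicator of ]-oo, tau[ as z tends to 0. *)
Definition cutoff (z t : R) : R := (tau - t) ^+ 2 * hk 2 0 z (tau - t).
Definition dcutoff (z t : R) : R := - (z * hk 2 0 z (tau - t)).

Let l12 : 1 < 2 :> R. Proof. by rewrite ltr1n. Qed.

Lemma cutoffE z t : t < tau -> cutoff z t = expR (- (z / (tau - t))).
Proof.
move=> tt; have A0 : 0 < tau - t by rewrite subr_gt0.
rewrite /cutoff /hk A0 mulr0n addr0 powRN -[2 in X in _ * X]/(2%:R) powR_mulrn ?(ltW A0)//.
by rewrite mulrA mulfV ?mul1r// expf_neq0// gt_eqF.
Qed.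

Lemma cutoff0 z t : tau <= t -> cutoff z t = 0.
Proof. by move=> tt; rewrite /cutoff hk0 ?mulr0// subr_le0. Qed.

Lemma dcutoff0 z t : tau <= t -> dcutoff z t = 0.
Proof. by move=> tt; rewrite /dcutoff hk0 ?mulr0 ?oppr0// subr_le0. Qed.

Lemma dcutoffE z t : t < tau -> dcutoff z t = - (z / (tau - t) ^+ 2 * expR (- (z / (tau - t)))).
Proof.
move=> tt; have A0 : 0 < tau - t by rewrite subr_gt0.
by rewrite /dcutoff /hk A0 mulr0n addr0 powRN -[2]/(2%:R) powR_mulrn ?(ltW A0)// mulrA.
Qed.

(** Written with the kernel for s = 2, the cut-off inherits differentiability at tau, where its
    formula changes. *)
Lemma is_derive_cutoff (z t : R) : 0 < z -> is_derive t 1 (cutoff z) (dcutoff z t).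
Proof.
move=> z0; pose A := tau - t.
have h1 := is_derive_affine_opp tau t.
have h2 := @is_derive1_comp _ (hk 2 0 z) (fun y => tau - y) t _ _ (is_derive_hk_A l12 (lexx _) 0 A z0) h1.
have h3 := is_deriveM (is_deriveM h1 h1) h2.
have -> : cutoff z = (fun y => tau - y) * (fun y => tau - y) * (hk 2 0 z \o (fun y => tau - y)).
  by apply/funext => y; rewrite /cutoff expr2.
apply: (is_derive_eq h3); rewrite /dcutoff !fctE/= -/A /GRing.scale/=.
have [A0|A0] := ltP 0 A; last by rewrite !hk0//; ring.
by rewrite !hkS// addr0; field; exact: lt0r_neq0.
Qed.

Lemma cutoff_continuous z : 0 < z -> continuous (cutoff z).
Proof. by move=> z0 t; exact: is_derive_continuous (is_derive_cutoff t z0). Qed.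

Lemma dcutoff_continuous z : 0 < z -> continuous (dcutoff z).
Proof.
move=> z0 t; apply: cvgN; apply: cvgM; first exact: cvg_cst.
apply: (@continuous_comp _ _ _ (fun x => tau - x) (hk 2 0 z)).
  by apply: cvgB; [exact: cvg_cst|exact: cvg_id].
exact: (continuous_hk l12 (lexx _)).
Qed.

Lemma cutoff_itv z t : 0 < z -> 0 <= cutoff z t <= 1.
Proof.
move=> z0; have [tt|tt] := ltP t tau; last by rewrite cutoff0// lexx ler01.
rewrite cutoffE// expR_ge0/= -[leRHS]expR0 ler_expR oppr_le0 divr_ge0 ?(ltW z0)//.
by rewrite subr_ge0 ltW.
Qed.

(** u e^(- u) <= 1 with u = z / (tau - t). The bound is uniform in z but just fails to be integrable
    up to tau; the estimates of the commutator to the left of tau have to distribute this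
    singularity. *)
Lemma dcutoff_le z t : 0 < z -> t < tau -> `|dcutoff z t| <= (tau - t)^-1.
Proof.
move=> z0 tt; have A0 : 0 < tau - t by rewrite subr_gt0.
have nn : 0 <= z / (tau - t) ^+ 2 * expR (- (z / (tau - t))).
  apply: mulr_ge0; last exact: expR_ge0.
  by apply: divr_ge0; [exact: ltW|exact: sqr_ge0].
rewrite dcutoffE// normrN (ger0_norm nn).
have -> : z / (tau - t) ^+ 2 * expR (- (z / (tau - t))) =
    (tau - t)^-1 * (z / (tau - t) * expR (- (z / (tau - t)))).
  by rewrite expr2 invfM; ring.
rewrite ler_piMr ?invr_ge0 ?(ltW A0)//.
rewrite expRN ler_pdivrMr ?expR_gt0// mul1r (le_trans _ (expR_ge1Dx _))//.
by rewrite lerDr.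
Qed.

Lemma cutoff_cvg t : t < tau -> cutoff n.+1%:R^-1 t @[n --> \oo] --> (1 : R).
Proof.
move=> tt; under eq_fun do rewrite cutoffE//.
have h1 : (- (n.+1%:R^-1 / (tau - t))) @[n --> \oo] --> (0 : R).
  rewrite -oppr0 -[in X in _ --> X](mul0r (tau - t)^-1); apply: cvgN; apply: cvgMl.
  exact: cvg_harmonic.
by have := cvg_comp _ _ h1 (@continuous_expR R 0); rewrite expR0.
Qed.

Lemma dcutoff_cvg t : dcutoff n.+1%:R^-1 t @[n --> \oo] --> (0 : R).
Proof.
have [tt|tt] := ltP t tau; last by under eq_fun do rewrite dcutoff0//; exact: cvg_cst.
rewrite (_ : (fun n => _) = (fun n => - (n.+1%:R^-1 / (tau - t) ^+ 2 * cutoff n.+1%:R^-1 t))); last first.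
  by apply/funext => n; rewrite dcutoffE// cutoffE.
rewrite -[X in _ --> X]oppr0 -[X in _ --> - X](mul0r (1 : R)); apply: cvgN; apply: cvgM; last exact: cutoff_cvg.
by rewrite -[X in _ --> X](mul0r ((tau - t) ^+ 2)^-1); apply: cvgMl; exact: cvg_harmonic.
Qed.

End CutOff.

Section IntegralTools.
Context {R : realType}.
Notation mu := (@lebesgue_measure R).

Lemma dominated_cvg_Rintegral (D : set R) (f_ : nat -> R -> R) (f g : R -> R) :
  measurable D -> (forall n, measurable_fun D (f_ n)) ->
  (forall x, D x -> f_ n x @[n --> \oo] --> f x) ->
  mu.-integrable D (EFin \o g) ->
  (forall n x, D x -> `|f_ n x| <= g x) ->
  \int[mu]_(x in D) f_ n x @[n --> \oo] --> \int[mu]_(x in D) f x.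
Proof.
move=> mD mf_ fl gi fg; apply: (@dominated_Rintegral _ _ _ _ g) => //.
exact: measurable_fun_cvg fl.
Qed.

Lemma Rintegral_FTC2_oo (h F : R -> R) (x y : R) : x < y ->
  (forall t : R, x < t < y -> is_derive t 1 F (h t)) ->
  {for x, continuous F} -> {for y, continuous F} ->
  (forall t, x <= t <= y -> {for t, continuous h}) ->
  \int[mu]_(t in `[x, y]) h t = F y - F x.
Proof.
move=> xy dF cx cy ch; rewrite /Rintegral (@continuous_FTC2 _ h F x y xy) -?EFinB//.
- by apply: continuous_in_subspaceT => t /set_mem/=; rewrite in_itv/=; exact: ch.
- split.
  + by move=> t; rewrite in_itv/= => ht; have [] := dF t ht.
  + by apply: cvg_at_right_filter; exact: cx.
  + by apply: cvg_at_left_filter; exact: cy.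
- by move=> t; rewrite in_itv/= => ht; rewrite derive1E; have [_ ->] := dF t ht.
Qed.

Lemma integrable_powR_shift (p c d : R) : 0 < p < 1 ->
  mu.-integrable `[c, d] (EFin \o (fun x => (x - c) `^ (- p))).
Proof.
move=> /andP[p0 p1].
have h := integrable_opp (integrable_patch (measurable_itv _) (integrable_abel_kernel p0 p1 (- d) (- c))).
have mf : measurable_fun `[c, d] (fun x : R => (x - c) `^ (- p)).
  apply: measurable_funTS; apply: (measurableT_comp (measurable_powR (- p))).
  by apply: measurable_funB => //; exact: measurable_cst.
have := @integrableS _ _ _ mu setT `[c, d]%classic _ measurableT (measurable_itv _) (@subsetT _ _) h.
apply: le_integrable => //; first exact/measurable_EFinP.
move=> x hx; rewrite /= patchE mem_set.
  by rewrite /= opprK [- c + x]addrC.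
by move: hx; rewrite /= !in_itv/= !lerN2 andbC.
Qed.

Lemma Rintegral_split (h : R -> R) (x t y : R) : mu.-integrable `[x, y] (EFin \o h) ->
  x <= t -> t <= y ->
  \int[mu]_(u in `[x, y]) h u = \int[mu]_(u in `[x, t]) h u + \int[mu]_(u in `]t, y]) h u.
Proof.
move=> ih xt ty; have := @Rintegral_itvB _ h (BLeft x) (BRight y) t ih; rewrite !bnd_simp => /(_ xt ty) e.
by rewrite -e addrC subrK.
Qed.

Lemma Rintegral_itv_oo (h : R -> R) (x y : R) : mu.-integrable `[x, y] (EFin \o h) ->
  \int[mu]_(u in `[x, y]) h u = \int[mu]_(u in `]x, y[) h u.
Proof.
move=> ih; rewrite -Rintegral_itv_bndo_bndc; last first.
  by apply: integrableS ih => // u /=; rewrite !in_itv/= => /andP[-> /ltW].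
rewrite -Rintegral_itv_obnd_cbnd//.
by apply: integrableS ih => // u /=; rewrite !in_itv/= => /andP[/ltW -> /ltW].
Qed.

(* The part of the integral contributed by the constant extension of g to the
   left of a. *)
Lemma Rintegral_powR_Ny (s y a : R) : 1 < s -> a < y ->
  \int[mu]_(x in `]-oo, a[) ((y - x) `^ (- s)) = (y - a) `^ (1 - s) / (s - 1).
Proof.
move=> s1 ay; have s10 : 0 < s - 1 by rewrite subr_gt0.
rewrite Rintegral_mkcond -Rintegral_opp; last first.
  by apply/(measurable_restrictT _ _).1 => //; exact: measurable_powR_sub.
have -> : \int[mu]_x ((fun x => (y - x) `^ (- s)) \_ `]-oo, a[) (- x) =
    \int[mu]_(x in `](- a), +oo[) ((y + x) `^ (- s)).
  rewrite [RHS]Rintegral_mkcond; apply: eq_Rintegral => x _; rewrite !patchE opprK.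
  suff -> : (- x \in (`]-oo, a[%classic : set R)) = (x \in (`](- a), +oo[%classic : set R)) by [].
  by apply/idP/idP; rewrite !inE/= !in_itv/= andbT ltrNl.
have yx x : - a <= x -> 0 < y + x by move=> ax; rewrite -ltrBlDl sub0r (lt_le_trans _ ax)// ltrN2.
have d (x : R) : - a <= x -> is_derive x 1 (fun x => - ((y + x) `^ (1 - s) / (s - 1))) ((y + x) `^ (- s)).
  move=> /yx yx0.
  have h1 : is_derive x 1 (fun x => y + x) (1 : R).
    by apply: (is_derive_eq (is_deriveD (is_derive_cst y x 1) (is_derive_id x 1))); rewrite add0r.
  have h2 := @is_derive1_comp _ (fun u => u `^ (1 - s)) (fun x => y + x) x _ _ (is_derive1_powR (1 - s) yx0) h1.
  have -> : (fun x => - ((y + x) `^ (1 - s) / (s - 1))) =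
      (- (s - 1)^-1) \*: ((fun u => u `^ (1 - s)) \o (fun x => y + x)).
    by apply/funext => u; rewrite /= [RHS]mulNr mulrC.
  apply: (is_derive_eq (is_deriveZ (- (s - 1)^-1) h2)); rewrite /GRing.scale/= mulr1.
  have -> : 1 - s - 1 = - s by ring.
  by rewrite mulrA -(opprB s 1) mulrNN mulVf ?mul1r// gt_eqF.
rewrite (Rintegral_FTC2y d).
- by rewrite opprK.
- move=> x /yx yx0; apply: (@continuous_comp _ _ _ (fun x => y + x) (fun u => u `^ (- s))).
    by apply: cvgD; [exact: cvg_cst|exact: cvg_id].
  exact: is_derive_continuous (is_derive1_powR (- s) yx0).
- have ay0 : 0 < y - a by rewrite subr_gt0.
  have i1 : mu.-integrable `](- a), +oo[ (EFin \o (fun x => pweight s (y - a) (- a - x))).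
    by apply: integrableS (integrable_pweight s1 (- a) ay0).
  have mm : measurable_fun (`](- a), +oo[%classic : set R) (fun x => (y + x) `^ (- s)).
    apply: measurable_funTS; apply: (measurableT_comp (measurable_powR (- s))).
    by apply: measurable_funD => //; exact: measurable_cst.
  apply: (integrable_le _ mm i1) => // x; rewrite /= in_itv/= andbT => ax.
  rewrite ger0_norm ?powR_ge0// /pweight ltr0_norm; last by rewrite subr_lt0.
  have -> : y - a - (- a - x) = y + x by ring.
  by [].
- rewrite -oppr0 -[in X in _ --> X](mul0r (s - 1)^-1); apply: cvgN; apply: cvgMl.
  have -> : 1 - s = - (s - 1) by ring.
  exact: powR_cvg_pinfty0.
Qed.

End IntegralTools.

(** * The commutator identity *)

Section Commutator.
Context {R : realType}.
Notation mu := (@lebesgue_measure R).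
Variables (a b al K : R) (G dG q : R -> R).
Hypotheses (ab : a < b) (al0 : 0 < al) (al1 : al < 1).
Hypotheses (cG : continuous G) (cdG : continuous dG) (cq : continuous q).
Hypothesis dGE : forall x : R, a < x < b -> is_derive x 1 G (dG x).
Hypothesis Ga : forall x, x <= a -> G x = G a.
Hypotheses (GK : forall x, a <= x <= b -> `|G x| <= K)
  (dGK : forall x, a <= x <= b -> `|dG x| <= K) (qK : forall x, a <= x <= b -> `|q x| <= K).
Notation abel := (abel a al).

Let K0 : 0 <= K. Proof. by rewrite (le_trans (normr_ge0 (G a)))// GK// lexx ltW. Qed.

(* The commutator of the fractional derivative with multiplication by chi. *)
Definition commutator (chi dchi : R -> R) (y : R) : R :=
  abel (fun x => dG x * chi x + G x * dchi x) y - chi y * abel dG y.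

Hypothesis comm0 : forall chi dchi : R -> R, continuous chi -> continuous dchi ->
  (forall x : R, a < x < b -> is_derive x 1 chi (dchi x)) ->
  \int[mu]_(y in `[a, b]) (q y * commutator chi dchi y) = 0.

Variable tau : R.
Hypotheses (atau : a < tau) (taub : tau < b).
Notation chi n := (cutoff tau n.+1%:R^-1).
Notation dchi n := (dcutoff tau n.+1%:R^-1).
Let n0 n : 0 < n.+1%:R^-1 :> R. Proof. by rewrite invr_gt0. Qed.
Let B n y := commutator (chi n) (dchi n) y.

Let cw n : continuous (fun x => dG x * chi n x + G x * dchi n x).
Proof.
move=> x; apply: cvgD; apply: cvgM.
- exact: cdG. - exact: cutoff_continuous. - exact: cG. - exact: dcutoff_continuous.
Qed.

Let measB n : measurable_fun `[a, b] (B n).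
Proof.
have h : measurable_fun `[a, b] (fun y => abel (fun x => dG x * chi n x + G x * dchi n x) (clamp a b y)
    - chi n y * abel dG (clamp a b y)).
  apply: measurable_funTS; apply: measurable_funB.
    apply: continuous_measurable_fun; apply: abel_continuous => //; exact: (@cw _).
  apply: measurable_funM; apply: continuous_measurable_fun; first exact: cutoff_continuous.
  by apply: abel_continuous.
apply: eq_measurable_fun h => y /set_mem/=; rewrite in_itv/= => hy.
by rewrite clamp_id.
Qed.

Let itv_sub y x : a <= x <= y -> y <= b -> a <= x <= b.
Proof. by move=> /andP[-> xy] /(le_trans xy). Qed.

Let mfI (w : R -> R) (y : R) : continuous w -> measurable_fun `[a, y] w.
Proof. by move=> cw'; apply: measurable_funTS; exact: continuous_measurable_fun. Qed.

Let bound_abel (w : R -> R) y : continuous w -> y <= b ->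
  mu.-integrable `[a, y] (EFin \o (fun x => (y - x) `^ (- al) * w x)).
Proof.
move=> cw' yb; have [M M0 wM] := continuous_itv_bounded ab cw'.
by apply: (@integrable_abel_gen _ al al0 al1 _ M) => // [|x hx]; [exact: mfI|apply: wM; exact: (itv_sub hx)].
Qed.

Let comm_left n y : a < y -> y < tau ->
  B n y = \int[mu]_(x in `[a, y]) ((y - x) `^ (- al) * (dG x * (chi n x - chi n y) + G x * dchi n x)).
Proof.
move=> ay yt; have yb : y <= b by exact/ltW/(lt_trans yt).
have i1 := bound_abel (@cw n) yb; have i2 := bound_abel cdG yb.
rewrite /B /commutator /abel -RintegralZl// -RintegralB//; last exact: integrable_scale.
by apply: eq_Rintegral => x _; ring.
Qed.

Let comm_left_le n y x : a <= x <= y -> y < tau ->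
  `|dG x * (chi n x - chi n y) + G x * dchi n x| <= K + K * (tau - x)^-1.
Proof.
move=> /andP[ax xy] yt; have xt : x < tau by exact: le_lt_trans yt.
have xI : a <= x <= b by rewrite ax/= ltW// (lt_trans xt).
apply: (le_trans (ler_normD _ _)); rewrite !normrM; apply: lerD; last first.
  by apply: ler_pM => //; [exact: GK|exact: dcutoff_le].
rewrite -[leRHS]mulr1; apply: ler_pM => //; first exact: dGK.
have /andP[h1 h2] := cutoff_itv tau x (n0 n); have /andP[h3 h4] := cutoff_itv tau y (n0 n).
by rewrite ler_norml; apply/andP; split; lra.
Qed.

(** To the left of tau the cut-offs tend to 1, and a constant commutes with the fractional
    derivative. *)
Let comm_left_cvg y : a < y -> y < tau -> B n y @[n --> \oo] --> (0 : R).
Proof.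
move=> ay yt; have yb : y <= b by exact/ltW/(lt_trans yt).
rewrite (_ : (fun n => B n y) = (fun n => \int[mu]_(x in `[a, y]) ((y - x) `^ (- al) * (dG x * (chi n x - chi n y) + G x * dchi n x)))); last first.
  by apply/funext => n; exact: comm_left.
have -> : (0 : R) = \int[mu]_(x in `[a, y]) (cst 0 x) by rewrite Rintegral_cst// mul0r.
apply: (@dominated_cvg_Rintegral _ _ _ _ (fun x => (K + K * (tau - y)^-1) * (y - x) `^ (- al))) => //.
- move=> n; apply: measurable_funM; first exact: measurable_powR_sub.
  apply: measurable_funD; apply: measurable_funM; try exact: mfI.
    by apply: measurable_funB => //; apply: mfI; exact: cutoff_continuous.
  by apply: mfI; exact: dcutoff_continuous.
- move=> x; rewrite /= in_itv/= => /andP[ax xy]; rewrite -[X in _ --> X](mulr0 ((y - x) `^ (- al))).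
  apply: cvgMr; rewrite -[X in _ --> X](addr0 0); apply: cvgD.
    rewrite -[X in _ --> X](mulr0 (dG x)); apply: cvgMr; rewrite -[X in _ --> X](subrr 1).
    by apply: cvgB; apply: cutoff_cvg => //; exact: le_lt_trans yt.
  by rewrite -[X in _ --> X](mulr0 (G x)); apply: cvgMr; exact: dcutoff_cvg.
- by apply: integrable_scale => //; exact: integrable_abel_kernel.
- move=> n x; rewrite /= in_itv/= => axy; have /andP[ax xy] := axy.
  rewrite normrM (ger0_norm (powR_ge0 _ _)) mulrC ler_wpM2r ?powR_ge0//.
  apply: (le_trans (comm_left_le n axy yt)); rewrite lerD2l ler_wpM2l//.
  by rewrite lef_pV2 ?posrE ?subr_gt0// ?lerD2l ?lerN2//; exact: le_lt_trans yt.
Qed.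

(** For x < y < tau, (tau - x)^(- 1) <= (tau - y)^(- (1 - ga)) (y - x)^(- ga): one part of the
    singularity goes into the Abel kernel, the other becomes an integrable function of y. The value
    is the midpoint of the admissible range 0 < ga < 1 - al. *)
Let ga : R := (1 - al) / 2.
Let ga0 : 0 < ga. Proof. by rewrite divr_gt0// subr_gt0. Qed.
Let ga1 : ga < 1. Proof. by move: al0 al1; rewrite /ga; lra. Qed.
Let alga0 : 0 < al + ga. Proof. exact: addr_gt0. Qed.
Let alga1 : al + ga < 1. Proof. by move: al0 al1; rewrite /ga; lra. Qed.

Definition commC : R := K * ((b - a) `^ (1 - al) / (1 - al)).
Definition commC' : R := K * ((b - a) `^ (1 - (al + ga)) / (1 - (al + ga))).

Let comm_left_bound n y : a < y -> y < tau -> `|B n y| <= commC + commC' * (tau - y) `^ (- (1 - ga)).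
Proof.
move=> ay yt; have yb : y <= b by exact/ltW/(lt_trans yt).
have ty0 : 0 < tau - y by rewrite subr_gt0.
have yab : y - a <= b - a by rewrite lerD2r.
have ya0 : 0 <= y - a by rewrite subr_ge0 ltW.
have mono p : 0 < 1 - p -> (y - a) `^ (1 - p) / (1 - p) <= (b - a) `^ (1 - p) / (1 - p).
  move=> p1; rewrite ler_wpM2r ?invr_ge0 ?(ltW p1)//.
  apply: ge0_ler_powR => //; rewrite ?nnegrE ?(ltW p1)//; exact: le_trans yab.
have i1 := integrable_scale K (measurable_itv _) (integrable_abel_kernel al0 al1 a y).
have i2 := integrable_scale (K * (tau - y) `^ (- (1 - ga))) (measurable_itv _) (integrable_abel_kernel alga0 alga1 a y).
have cwn : continuous (fun x => dG x * (chi n x - chi n y) + G x * dchi n x).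
  move=> x; apply: cvgD; apply: cvgM.
  - exact: cdG.
  - by apply: cvgB; [exact: cutoff_continuous|exact: cvg_cst].
  - exact: cG.
  - exact: dcutoff_continuous.
have ii := bound_abel cwn yb.
rewrite (comm_left n ay yt); apply: (le_trans (le_normr_Rintegral _ ii)) => //.
apply: (@le_trans _ _ (\int[mu]_(x in `[a, y]) (K * (y - x) `^ (- al) + K * (tau - y) `^ (- (1 - ga)) * (y - x) `^ (- (al + ga))))).
  apply: le_Rintegral => //; first exact: integrable_norm.
    exact: integrable_add.
  move=> x; rewrite /= in_itv/= => axy; have /andP[ax xy] := axy.
  rewrite normrM (ger0_norm (powR_ge0 _ _)).
  apply: (le_trans (ler_wpM2l (powR_ge0 _ _) (comm_left_le n axy yt))).
  rewrite mulrDr [_ * K]mulrC lerD2l mulrCA -[leRHS]mulrA ler_wpM2l//.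
  move: xy; rewrite le_eqVlt => /predU1P[->|xy].
    by rewrite subrr powR0 ?oppr_eq0 ?gt_eqF// mul0r mulr_ge0 ?powR_ge0.
  have yx0 : 0 < y - x by rewrite subr_gt0.
  have tx0 : 0 < tau - x by rewrite subr_gt0 (lt_trans xy).
  rewrite [- (al + ga)]opprD powRD ?(gt_eqF yx0) ?implybT// mulrCA ler_wpM2l ?powR_ge0//.
  have -> : (tau - x)^-1 = (tau - x) `^ (- (1 - ga)) * (tau - x) `^ (- ga).
    rewrite -powRD ?(gt_eqF tx0) ?implybT// -(powR_inv1 (ltW tx0)); congr (_ `^ _); ring.
  have ge_pow (x1 x2 p : R) : 0 < x1 -> x1 <= x2 -> 0 < p -> x2 `^ (- p) <= x1 `^ (- p).
    move=> x10 x12 p0; have x20 : 0 < x2 by exact: lt_le_trans x12.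
    rewrite !powRN lef_pV2 ?posrE ?powR_gt0//.
    by apply: ge0_ler_powR; rewrite ?nnegrE ?(ltW p0) ?(ltW x10) ?(ltW x20).
  apply: ler_pM; rewrite ?powR_ge0//; apply: ge_pow; rewrite ?subr_gt0//.
  - by rewrite lerD2l lerN2 ltW.
  - by rewrite lerD2r ltW.
rewrite RintegralD// !RintegralZl//; try exact: integrable_abel_kernel.
rewrite !(Rintegral_abel_kernel _ _ (ltW ay))//; apply: lerD.
  by apply: ler_wpM2l => //; apply: mono; rewrite subr_gt0.
rewrite [K * _]mulrC -mulrA mulrC /commC' ler_wpM2r ?powR_ge0// ler_wpM2l//.
by apply: mono; rewrite subr_gt0.
Qed.

Let s := 1 + al.

(** To the right of tau chi y = 0, and the integral stops at tau, away from the singularity of the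
    kernel, so integration by parts moves the derivative from G chi to the kernel. The boundary term
    at tau vanishes with chi. *)
Let comm_right n y : tau < y -> y <= b ->
  B n y = - ((y - a) `^ (- al) * (G a * chi n a)) - al * \int[mu]_(x in `[a, tau]) ((y - x) `^ (- s) * (G x * chi n x)).
Proof.
move=> ty yb; have ay : a < y by exact: lt_trans ty.
have yx x : x <= tau -> 0 < y - x by move=> xt; rewrite subr_gt0 (le_lt_trans xt).
have ctn : continuous (chi n) by exact: cutoff_continuous.
have cdtn : continuous (dchi n) by exact: dcutoff_continuous.
have cpow (p x : R) : x <= tau -> {for x, continuous (fun x => (y - x) `^ p)}.
  by move=> xt; apply: is_derive_continuous (is_derive_powR_sub p (le_lt_trans xt ty)).
have cGc x : {for x, continuous (fun x => G x * chi n x)} by apply: cvgM; [exact: cG|exact: ctn].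
rewrite /B /commutator (cutoff0 _ (ltW ty)) mul0r subr0 /abel.
have -> : \int[mu]_(x in `[a, y]) ((y - x) `^ (- al) * (dG x * chi n x + G x * dchi n x)) =
    \int[mu]_(x in `[a, tau]) ((y - x) `^ (- al) * (dG x * chi n x + G x * dchi n x)).
  rewrite (Rintegral_split (bound_abel (@cw n) yb) (ltW atau) (ltW ty)) [X in _ + X]Rintegral_eq0 ?addr0//.
  move=> x; rewrite /= in_itv/= => /andP[/ltW tx _].
  by rewrite cutoff0// dcutoff0// !mulr0 addr0 mulr0.
pose h x := (al * (y - x) `^ (- s)) * (G x * chi n x) + (y - x) `^ (- al) * (dG x * chi n x + G x * dchi n x).
have FTC : \int[mu]_(x in `[a, tau]) h x = - ((y - a) `^ (- al) * (G a * chi n a)).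
  pose H x := (y - x) `^ (- al) * (G x * chi n x).
  have -> : - ((y - a) `^ (- al) * (G a * chi n a)) = H tau - H a.
    by rewrite /H (cutoff0 _ (lexx tau)) !mulr0 sub0r.
  apply: Rintegral_FTC2_oo => //.
  - move=> x /andP[ax xt].
    have d1 := is_derive_powR_sub (- al) (lt_trans xt ty).
    have xI : a < x < b by rewrite ax (lt_trans xt).
    have d2 := is_deriveM (dGE xI) (is_derive_cutoff tau x (n0 n)).
    apply: (is_derive_eq (is_deriveM d1 d2)); rewrite /h /GRing.scale/= /s.
    have -> : - al - 1 = - (1 + al) by ring.
    by rewrite -[(G * _) x]/(G x * chi n x); ring.
  - by apply: cvgM; [exact: cpow (ltW atau)|exact: cGc].
  - by apply: cvgM; [exact: cpow|exact: cGc].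
  - move=> x /andP[ax xt]; apply: cvgD.
      by apply: cvgM; [apply: cvgM; [exact: cvg_cst|exact: cpow]|exact: cGc].
    by apply: cvgM; [exact: cpow|exact: (@cw _)].
have cont_int (F : R -> R) : (forall x, a <= x <= tau -> {for x, continuous F}) -> mu.-integrable `[a, tau] (EFin \o F).
  move=> cF; apply: continuous_compact_integrable; first exact: segment_compact.
  by apply: continuous_in_subspaceT => x /set_mem/=; rewrite in_itv/=; exact: cF.
have i1 : mu.-integrable `[a, tau] (EFin \o (fun x => (y - x) `^ (- s) * (G x * chi n x))).
  by apply: cont_int => x /andP[ax xt]; apply: cvgM; [exact: cpow|exact: cGc].
have i2 : mu.-integrable `[a, tau] (EFin \o (fun x => (y - x) `^ (- al) * (dG x * chi n x + G x * dchi n x))).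
  by apply: cont_int => x /andP[ax xt]; apply: cvgM; [exact: cpow|exact: (@cw _)].
rewrite -FTC -RintegralZl//.
have e : \int[mu]_(x in `[a, tau]) h x = \int[mu]_(x in `[a, tau]) (al * ((y - x) `^ (- s) * (G x * chi n x))) +
    \int[mu]_(x in `[a, tau]) ((y - x) `^ (- al) * (dG x * chi n x + G x * dchi n x)).
  rewrite -RintegralD//; last exact: integrable_scale.
  by apply: eq_Rintegral => x _; rewrite /h; ring.
by rewrite e addrC addKr.
Qed.

Let s1 : 1 < s. Proof. by rewrite /s ltrDl. Qed.
Let sal : s - 1 = al. Proof. by rewrite /s addrC addKr. Qed.

Let integrable_right y : tau < y ->
  mu.-integrable `]-oo, tau[ (EFin \o (fun x => (y - x) `^ (- s) * G x)).
Proof.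
move=> ty; have ty0 : 0 < y - tau by rewrite subr_gt0.
have i1 : mu.-integrable `]-oo, tau[ (EFin \o (fun x => K * pweight s (y - tau) (tau - x))).
  by apply: integrable_scale => //; apply: integrableS (integrable_pweight s1 tau ty0).
have mm : measurable_fun (`]-oo, tau[%classic : set R) (fun x => (y - x) `^ (- s) * G x).
  apply: measurable_funM; first exact: measurable_powR_sub.
  by apply: measurable_funTS; exact: continuous_measurable_fun.
apply: (integrable_le _ mm i1) => // x; rewrite /= in_itv/= => xt.
rewrite normrM mulrC (ger0_norm (powR_ge0 _ _)); apply: ler_pM; rewrite ?powR_ge0//.
  have [ax|xa] := leP a x; first by apply: GK; rewrite ax ltW// (lt_trans xt).
  by rewrite Ga ?(ltW xa)// GK// lexx ltW.
rewrite /pweight gtr0_norm ?subr_gt0//.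
by have -> : y - tau + (tau - x) = y - x by ring.
Qed.

(** The boundary term at a is al times the integral of (y - x)^(- s) G a over x < a. The constant
    extension of G therefore absorbs it, and the two terms merge into one integral over x < tau. *)
Let comm_right_cvg y : tau < y -> y <= b ->
  B n y @[n --> \oo] --> - (al * \int[mu]_(x in `]-oo, tau[) ((y - x) `^ (- s) * G x)).
Proof.
move=> ty yb; have ay : a < y by exact: lt_trans ty.
have ii := integrable_right ty.
have iat : mu.-integrable `[a, tau[ (EFin \o (fun x => (y - x) `^ (- s) * G x)).
  by apply: integrableS ii => // x /=; rewrite !in_itv/= => /andP[].
have e : \int[mu]_(x in `]-oo, tau[) ((y - x) `^ (- s) * G x) =
    (y - a) `^ (- al) / al * G a + \int[mu]_(x in `[a, tau[) ((y - x) `^ (- s) * G x).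
  have := @Rintegral_itvB _ (fun x => (y - x) `^ (- s) * G x) -oo%O (BLeft tau) a ii.
  rewrite !bnd_simp => /(_ isT atau) e1.
  have iNa : mu.-integrable `]-oo, a] (EFin \o (fun x => (y - x) `^ (- s) * G x)).
    by apply: integrableS ii => // x /=; rewrite !in_itv/= => /le_lt_trans; apply.
  have iNa' : mu.-integrable `]-oo, a[ (EFin \o (fun x => (y - x) `^ (- s) * G x)).
    by apply: integrableS iNa => // x /=; rewrite !in_itv/= => /ltW.
  have e2 : \int[mu]_(x in `]-oo, a]) ((y - x) `^ (- s) * G x) = (y - a) `^ (- al) / al * G a.
    rewrite -Rintegral_itv_bndo_bndc//.
    have -> : (y - a) `^ (- al) / al = \int[mu]_(x in `]-oo, a[) ((y - x) `^ (- s)).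
      rewrite Rintegral_powR_Ny// sal; congr (_ `^ _ / _); rewrite /s; ring.
    rewrite mulrC -RintegralZl//.
      by apply: eq_Rintegral => x /set_mem/=; rewrite in_itv/= => /ltW xa; rewrite Ga// mulrC.
    have ay0 : 0 < y - a by rewrite subr_gt0.
    have i1 : mu.-integrable `]-oo, a[ (EFin \o (fun x => pweight s (y - a) (a - x))).
      by apply: integrableS (integrable_pweight s1 a ay0).
    have mm : measurable_fun (`]-oo, a[%classic : set R) (fun x => (y - x) `^ (- s)) by exact: measurable_powR_sub.
    apply: (integrable_le _ mm i1) => // x; rewrite /= in_itv/= => xa.
    rewrite ger0_norm ?powR_ge0// /pweight gtr0_norm ?subr_gt0//.
    by have -> : y - a + (a - x) = y - x by ring.
  rewrite -e2 -Rintegral_itv_obnd_cbnd; first by rewrite -e1 addrC subrK.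
  by apply: integrableS ii => // x /=; rewrite !in_itv/= => /andP[].
rewrite e mulrDr opprD.
have -> : al * ((y - a) `^ (- al) / al * G a) = (y - a) `^ (- al) * (G a * 1).
  by field; rewrite gt_eqF.
rewrite (_ : (fun n => B n y) = (fun n => - ((y - a) `^ (- al) * (G a * chi n a))
   - al * \int[mu]_(x in `[a, tau[) ((y - x) `^ (- s) * (G x * chi n x)))); last first.
  apply/funext => n; rewrite comm_right// Rintegral_itv_bndo_bndc//.
  have mm : measurable_fun (`[a, tau[%classic : set R) (fun x => (y - x) `^ (- s) * (G x * chi n x)).
    apply: measurable_funM; first exact: measurable_powR_sub.
    apply: measurable_funTS; apply: measurable_funM; apply: continuous_measurable_fun => //.
    exact: cutoff_continuous.
  apply: (integrable_le _ mm (integrable_norm iat)) => // x _.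
  have /andP[h1 h2] := cutoff_itv tau x (n0 n).
  by rewrite mulrA normrM ler_piMr// ger0_norm.
apply: cvgB.
  apply: cvgN; apply: cvgMr; apply: cvgMr; exact: cutoff_cvg.
apply: cvgMr.
apply: (@dominated_cvg_Rintegral _ _ _ _ (fun x => `|(y - x) `^ (- s) * G x|)) => //.
- move=> n; apply: measurable_funM; first exact: measurable_powR_sub.
  apply: measurable_funTS; apply: measurable_funM; apply: continuous_measurable_fun => //.
  exact: cutoff_continuous.
- move=> x; rewrite /= in_itv/= => /andP[_ xt]; apply: cvgMr.
  by rewrite -[X in _ --> X]mulr1; apply: cvgMr; exact: cutoff_cvg.
- exact: integrable_norm.
- move=> n x _; have /andP[h1 h2] := cutoff_itv tau x (n0 n).
  by rewrite mulrA normrM ler_piMr// ger0_norm.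
Qed.

(** With G bounded by K, the boundary term and the integral add up to exactly K (y - tau)^(- al),
    since the powers of y - a cancel; this is integrable at tau because al < 1. *)
Let comm_right_bound n y : tau < y -> y <= b -> `|B n y| <= K * (y - tau) `^ (- al).
Proof.
move=> ty yb; have ay : a < y by exact: lt_trans ty.
have chi1 x : `|chi n x| <= 1 by have /andP[h1 h2] := cutoff_itv tau x (n0 n); rewrite ger0_norm.
have yx x : x <= tau -> 0 < y - x by move=> xt; rewrite subr_gt0 (le_lt_trans xt).
have cpow (p x : R) : x <= tau -> {for x, continuous (fun x => (y - x) `^ p)}.
  by move=> xt; apply: is_derive_continuous (is_derive_powR_sub p (le_lt_trans xt ty)).
have cont_int (F : R -> R) : (forall x, a <= x <= tau -> {for x, continuous F}) -> mu.-integrable `[a, tau] (EFin \o F).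
  move=> cF; apply: continuous_compact_integrable; first exact: segment_compact.
  by apply: continuous_in_subspaceT => x /set_mem/=; rewrite in_itv/=; exact: cF.
have i1 : mu.-integrable `[a, tau] (EFin \o (fun x => (y - x) `^ (- s) * (G x * chi n x))).
  apply: cont_int => x /andP[ax xt]; apply: cvgM; first exact: cpow.
  by apply: cvgM; [exact: cG|exact: cutoff_continuous].
have i2 : mu.-integrable `[a, tau] (EFin \o (fun x => (y - x) `^ (- s))).
  by apply: cont_int => x /andP[ax xt]; exact: cpow.
have GI x : a <= x <= tau -> `|G x * chi n x| <= K.
  move=> /andP[ax xt]; rewrite normrM -[leRHS]mulr1 ler_pM// GK// ax (le_trans xt)// ltW//.
have e : al * \int[mu]_(x in `[a, tau]) ((y - x) `^ (- s)) = (y - tau) `^ (- al) - (y - a) `^ (- al).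
  rewrite -RintegralZl//.
  apply: (@Rintegral_FTC2_oo _ _ (fun x => (y - x) `^ (- al))) => //.
  - move=> x /andP[ax xt]; apply: (is_derive_eq (is_derive_powR_sub (- al) (lt_trans xt ty))).
    have -> : - al - 1 = - s by rewrite /s; ring.
    by ring.
  - exact: cpow (ltW atau).
  - exact: cpow.
  - by move=> x /andP[ax xt]; apply: cvgM; [exact: cvg_cst|exact: cpow].
rewrite comm_right//.
apply: (@le_trans _ _ (K * (y - a) `^ (- al) + K * (al * \int[mu]_(x in `[a, tau]) ((y - x) `^ (- s))))).
  apply: (le_trans (ler_normB _ _)); rewrite normrN; apply: lerD.
    rewrite normrM (ger0_norm (powR_ge0 _ _)) mulrC ler_wpM2r ?powR_ge0//.
    by apply: GI; rewrite lexx ltW.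
  rewrite normrM (gtr0_norm al0) mulrCA ler_wpM2l ?(ltW al0)//.
  apply: (le_trans (le_normr_Rintegral _ i1)) => //.
  rewrite -RintegralZl//; apply: le_Rintegral => //; first exact: integrable_norm.
    exact: integrable_scale.
  move=> x; rewrite /= in_itv/= => hx.
  by rewrite normrM (ger0_norm (powR_ge0 _ _)) mulrC ler_wpM2r ?powR_ge0// GI.
by rewrite e -mulrDr addrC subrK.
Qed.

(** Dominated convergence on each side of tau, with majorants singular like (tau - y)^(- (1 - ga))
    and (y - tau)^(- al): the left part tends to 0 and the right part to - al Phi. *)
Theorem commutator_Phi : Phi s G (fun y => q y * \1_(`[a, b]) y) tau = 0.
Proof.
have mq : measurable_fun `[a, b] q by apply: measurable_funTS; exact: continuous_measurable_fun.
have mqB n : measurable_fun `[a, b] (fun y => q y * B n y) by apply: measurable_funM.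
have iL : mu.-integrable `[a, tau] (EFin \o (fun y => K * commC + K * commC' * (tau - y) `^ (- (1 - ga)))).
  apply: integrable_add => //.
    by apply: continuous_compact_integrable; [exact: segment_compact|exact: cst_continuous].
  apply: integrable_scale => //; apply: integrable_abel_kernel; last by rewrite gtrBl.
  by rewrite subr_gt0.
have iR : mu.-integrable `[tau, b] (EFin \o (fun y => K * K * (y - tau) `^ (- al))).
  by apply: integrable_scale => //; apply: integrable_powR_shift; rewrite al0.
have domL n y : `]a, tau[%classic y -> `|q y * B n y| <= K * commC + K * commC' * (tau - y) `^ (- (1 - ga)).
  rewrite /= in_itv/= => /andP[ay yt]; rewrite normrM -mulrA -mulrDr; apply: ler_pM => //.
    by apply: qK; rewrite ltW//= ltW// (lt_trans yt).
  exact: comm_left_bound.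
have domR n y : `]tau, b]%classic y -> `|q y * B n y| <= K * K * (y - tau) `^ (- al).
  rewrite /= in_itv/= => /andP[ty yb]; rewrite normrM -mulrA; apply: ler_pM => //.
    by apply: qK; rewrite yb andbT ltW// (lt_trans atau).
  exact: comm_right_bound.
have subL : `]a, tau[%classic `<=` `[a, tau]%classic.
  by move=> y /=; rewrite !in_itv/= => /andP[/ltW -> /ltW ->].
have subR : `]tau, b]%classic `<=` `[tau, b]%classic.
  by move=> y /=; rewrite !in_itv/= => /andP[/ltW -> ->].
have iL' := @integrableS _ _ _ mu _ _ _ (measurable_itv _) (measurable_itv `]a, tau[) subL iL.
have iR' := @integrableS _ _ _ mu _ _ _ (measurable_itv _) (measurable_itv `]tau, b]) subR iR.
have mL n : measurable_fun `]a, tau[ (fun y => q y * B n y).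
  apply: measurable_funS (mqB n) => // y /=; rewrite !in_itv/= => /andP[/ltW -> yt].
  by rewrite ltW// (lt_trans yt).
have mR n : measurable_fun `]tau, b] (fun y => q y * B n y).
  apply: measurable_funS (mqB n) => // y /=; rewrite !in_itv/= => /andP[ty ->].
  by rewrite andbT ltW// (lt_trans atau).
have limL : \int[mu]_(y in `]a, tau[) (q y * B n y) @[n --> \oo] --> (0 : R).
  have -> : (0 : R) = \int[mu]_(y in `]a, tau[) (cst 0 y) by rewrite Rintegral_cst// mul0r.
  apply: (@dominated_cvg_Rintegral _ _ _ _ _ _ mL _ iL' domL) => // y.
  rewrite /= in_itv/= => /andP[ay yt]; rewrite -[X in _ --> X](mulr0 (q y)); apply: cvgMr.
  exact: comm_left_cvg.
pose V y := - (al * \int[mu]_(x in `]-oo, tau[) ((y - x) `^ (- s) * G x)).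
have limR : \int[mu]_(y in `]tau, b]) (q y * B n y) @[n --> \oo] --> \int[mu]_(y in `]tau, b]) (q y * V y).
  apply: (@dominated_cvg_Rintegral _ _ _ _ _ _ mR _ iR' domR) => // y.
  rewrite /= in_itv/= => /andP[ty yb]; apply: cvgMr; exact: comm_right_cvg.
have sum0 n : \int[mu]_(y in `]a, tau[) (q y * B n y) + \int[mu]_(y in `]tau, b]) (q y * B n y) = 0.
  have iLn : mu.-integrable `]a, tau[ (EFin \o (fun y => q y * B n y)).
    exact: (integrable_le _ (mL n) iL' (domL n)).
  have cwb := abel_continuous ab al0 al1 (@cw n); have cdb := abel_continuous ab al0 al1 cdG.
  have iab : mu.-integrable `[a, b] (EFin \o (fun y => q y * B n y)).
    have h : mu.-integrable `[a, b] (EFin \o (fun y => q y * (abel (fun x => dG x * chi n x + G x * dchi n x) (clamp a b y)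
        - chi n y * abel dG (clamp a b y)))).
      apply: continuous_compact_integrable; first exact: segment_compact.
      apply: continuous_subspaceT => y; apply: cvgM; first exact: cq.
      by apply: cvgB; [exact: cwb|apply: cvgM; [exact: cutoff_continuous|exact: cdb]].
    apply: (@eq_integrable _ _ _ mu _ (measurable_itv _) _ _ _ h) => y /set_mem/=; rewrite in_itv/= => hy.
    by rewrite clamp_id.
  have -> : 0 = \int[mu]_(y in `[a, b]) (q y * B n y).
    apply/esym/comm0; [exact: cutoff_continuous|exact: dcutoff_continuous|].
    by move=> x _; exact: is_derive_cutoff.
  rewrite (Rintegral_split iab (ltW atau) (ltW taub)) Rintegral_itv_oo//.
  by apply: integrableS iab => // y /=; rewrite !in_itv/= => /andP[-> yt]; rewrite (le_trans yt)// ltW.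
have lim0 : (cst 0 : nat -> R) n @[n --> \oo] --> \int[mu]_(y in `]tau, b]) (q y * V y).
  rewrite -[X in _ --> X]add0r (_ : cst 0 = fun n => \int[mu]_(y in `]a, tau[) (q y * B n y) +
      \int[mu]_(y in `]tau, b]) (q y * B n y)); last by apply/funext => n; rewrite sum0.
  exact: cvgD.
move: lim0 => /(cvg_unique (@norm_hausdorff _ R^o) (cvg_cst 0)) /esym e0.
have eV : \int[mu]_(y in `]tau, b]) (q y * V y) = - al * Phi s G (fun y => q y * \1_(`[a, b]) y) tau.
  have mP : measurable_fun `]tau, b] (fun y => q y * V y).
    apply: measurable_fun_cvg mR _ => y; rewrite /= in_itv/= => /andP[ty yb].
    by apply: cvgMr; exact: comm_right_cvg.
  have iV : mu.-integrable `]tau, b] (EFin \o (fun y => q y * V y)).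
    apply: (integrable_le _ mP iR') => // y hy.
    have hy' := hy; move: hy'; rewrite /= in_itv/= => /andP[ty yb].
    have l1 : `|q y * B n y| @[n --> \oo] --> `|q y * V y|.
      by apply: cvg_norm; apply: cvgMr; exact: comm_right_cvg.
    by apply: (cvgr_to_le l1); apply: nearW => n; exact: domR.
  have iV' := integrable_scale (- al)^-1 (measurable_itv _) iV.
  have eF : \int[mu]_(y in `]tau, b]) (q y * V y) = \int[mu]_(y in `]tau, b]) (- al * ((- al)^-1 * (q y * V y))).
    by apply: eq_Rintegral => y _; rewrite mulrA mulfV ?mul1r// oppr_eq0 gt_eqF.
  rewrite eF RintegralZl//; congr (_ * _).
  rewrite /Phi Rintegral_mkcond [RHS]Rintegral_mkcond; apply: eq_Rintegral => y _.
  rewrite !patchE indicE; case: ifPn => [|/negP] yI.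
    move: yI; rewrite inE/= in_itv/= => /andP[ty yb].
    rewrite mem_set ?mem_set//=; last 2 first.
    - by rewrite in_itv/= yb andbT ltW// (lt_trans atau).
    - by rewrite in_itv/= ty.
    by rewrite mulr1 /V; field; rewrite gt_eqF.
  case: ifPn => // ty; rewrite memNset ?mulr0 ?mul0r// => /=; rewrite in_itv/= => /andP[_ yb].
  by apply: yI; move: ty; rewrite !inE/= !in_itv/= andbT => ->.
by move/eqP: e0; rewrite eV mulf_eq0 oppr_eq0 (gt_eqF al0)/= => /eqP.
Qed.

End Commutator.

(** * Parameter integrals and regularity data *)

Section Pairing.
Context {T U V W : topologicalType}.

Lemma continuous_pair (f : T -> U) (g : T -> V) : continuous f -> continuous g -> continuous (fun x => (f x, g x)).
Proof. by move=> cf cg x; exact: (cvg_pair (cf x) (cg x)). Qed.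

Lemma continuous_comp_pair (h : U * V -> W) (f : T -> U) (g : T -> V) : continuous h ->
  continuous f -> continuous g -> continuous (fun x => h (f x, g x)).
Proof.
move=> ch cf cg x; apply: (@continuous_comp _ _ _ (fun x => (f x, g x)) h); last exact: ch.
exact: continuous_pair.
Qed.

End Pairing.

Section OneDim.
Context {R : realType}.
Notation mu := (@lebesgue_measure R).

Lemma continuous_itv_integrable (a b : R) (f : R -> R) : continuous f -> mu.-integrable `[a, b] (EFin \o f).
Proof.
move=> cf; apply: continuous_compact_integrable; first exact: segment_compact.
exact: continuous_subspaceT.
Qed.

Lemma is_derive_eq_itv (a b t d : R) (f g : R -> R) : a < t < b ->
  (forall x, a < x < b -> f x = g x) -> is_derive t 1 f d -> is_derive t 1 g d.
Proof.
move=> /andP[at_ tb] fg; apply: near_eq_is_derive.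
near=> x; apply: fg; apply/andP; split; near: x; [exact: lt_nbhsr|exact: lt_nbhsl].
Unshelve. all: by end_near. Qed.

Lemma is_derive_Rintegral_upper (a t : R) (f : R -> R) : continuous f -> a < t ->
  is_derive t 1 (fun x => \int[mu]_(y in `[a, x]) f y) (f t).
Proof.
move=> cf at_; have t1 : t < t + 1 by rewrite ltrDl.
have [d1 d2] := @continuous_FTC1 R f (BLeft a) t (t + 1) t1 (continuous_itv_integrable _ _ cf) at_ (cf t).
by apply: DeriveDef; [exact: d1|rewrite -derive1E; exact: d2].
Qed.

(** Differentiation in the upper limit; it converts invariance over subintervals into a pointwise
    equality of Lagrangians. *)
Lemma eq_continuous_Rintegral (a b t : R) (f g : R -> R) : continuous f -> continuous g ->
  (forall tb, a <= tb -> tb <= b -> \int[mu]_(y in `[a, tb]) f y = \int[mu]_(y in `[a, tb]) g y) ->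
  a < t < b -> f t = g t.
Proof.
move=> cf cg fg atb; have /andP[at_ tb] := atb.
have d1 := is_derive_Rintegral_upper cf at_; have d2 := is_derive_Rintegral_upper cg at_.
have d3 : is_derive t 1 (fun x => \int[mu]_(y in `[a, x]) g y) (f t).
  by apply: (is_derive_eq_itv atb _ d1) => x /andP[ax xb]; apply: fg; exact: ltW.
by rewrite -(@derive_val _ _ _ _ _ _ _ d3) (@derive_val _ _ _ _ _ _ _ d2).
Qed.

(** The factor [p] is merely integrable so that it can be the Abel kernel; the majorant comes from
    the bound of [dw] on a compact rectangle around s. *)
Lemma is_derive_Rintegral_weight (a b s : R) (p : R -> R) (w dw : R -> R -> R) : a <= b ->
  mu.-integrable `[a, b] (EFin \o p) ->
  (forall s, continuous (w s)) -> continuous (fun z : R * R => dw z.1 z.2) ->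
  (forall s y : R, a <= y <= b -> is_derive s 1 (w ^~ y) (dw s y)) ->
  is_derive s 1 (fun s => \int[mu]_(y in `[a, b]) (p y * w s y)) (\int[mu]_(y in `[a, b]) (p y * dw s y)).
Proof.
move=> ab ip cw cdw dwE; have mp : measurable_fun `[a, b] p.
  by have /measurable_int/measurable_EFinP := ip.
have s12 : s - 1 <= s + 1 by rewrite lerBlDr -addrA lerDl.
have [M M0 dwM] := continuous_rect_bounded s12 ab cdw.
have ipn := integrable_norm ip.
apply: (@is_derive_Rintegral _ (fun s y => p y * w s y) (fun s y => p y * dw s y) _ s 1 (fun y => M * `|p y|)) => //.
- move=> x _.
  have mm : measurable_fun `[a, b] (fun y => p y * w x y).
    by apply: measurable_funM => //; apply: measurable_funTS; exact: continuous_measurable_fun.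
  have [|y _ Hy] := @EVT_max R (fun y => `|w x y|) a b ab.
    by apply: continuous_subspaceT => y; apply: cvg_norm; exact: cw.
  apply: (integrable_le _ mm (integrable_scale `|w x y| _ ipn)) => // z zD.
  rewrite normrM mulrC ler_wpM2r//; exact: Hy.
- move=> x y _; rewrite /= in_itv/= => yab.
  apply: (is_derive_eq (is_deriveZ (p y) (dwE x y yab))); exact: erefl.
- exact: integrable_scale.
- move=> x y xs; rewrite /= in_itv/= => yab; rewrite normrM mulrC ler_wpM2r// dwM//.
  by move: xs; rewrite ltr_norml => /andP[h1 h2]; apply/andP; split; lra.
Qed.

(* Symmetry of the mixed derivatives, with differentiability of q in the second
   variable as part of the conclusion: differentiate f s y - f s x = int p s. *)
Lemma is_derive_mixed (a b s t : R) (f p q m : R -> R -> R) :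
  (forall s y : R, is_derive s 1 (f ^~ y) (q s y)) ->
  (forall s y : R, a < y < b -> is_derive y 1 (f s) (p s y)) ->
  (forall s y : R, is_derive s 1 (p ^~ y) (m s y)) ->
  (forall s, continuous (f s)) -> (forall s, continuous (p s)) -> continuous (fun z : R * R => m z.1 z.2) ->
  a < t < b -> is_derive t 1 (q s) (m s t).
Proof.
move=> fq fp pm cf cp cm /andP[at_ tb].
pose x := (a + t) / 2; have ax : a < x by rewrite /x; lra.
have xt : x < t by rewrite /x; lra.
have E s' y : x < y < b -> f s' y - f s' x = \int[mu]_(z in `[x, y]) (1 * p s' z).
  move=> /andP[xy yb]; apply/esym.
  have -> : \int[mu]_(z in `[x, y]) (1 * p s' z) = \int[mu]_(z in `[x, y]) p s' z.
    by apply: eq_Rintegral => z _; rewrite mul1r.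
  apply: Rintegral_FTC2_oo => //.
  - by move=> z /andP[xz zy]; apply: fp; rewrite (lt_trans ax)//= (lt_trans zy).
  - exact: cf.
  - exact: cf.
  - by move=> z _; exact: cp.
have E2 y : x < y < b -> q s y = q s x + \int[mu]_(z in `[x, y]) m s z.
  move=> xyb; have /andP[xy yb] := xyb.
  have i1 : mu.-integrable `[x, y] (EFin \o (fun=> 1 : R)) by apply: continuous_itv_integrable => ?; exact: cvg_cst.
  have d1 := @is_derive_Rintegral_weight x y s (fun=> 1) p m (ltW xy) i1 cp cm (fun s y _ => pm s y).
  have d2 := is_deriveB (fq s y) (fq s x).
  have e : f ^~ y - f ^~ x = (fun s' => \int[mu]_(z in `[x, y]) (1 * p s' z)).
    by apply/funext => s'; rewrite -E.
  rewrite e in d2; apply/eqP; rewrite addrC -subr_eq; apply/eqP.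
  rewrite -(@derive_val _ _ _ _ _ _ _ d2) (@derive_val _ _ _ _ _ _ _ d1).
  by apply: eq_Rintegral => z _; rewrite mul1r.
have xtb : x < t < b by rewrite xt.
have cms : continuous (m s).
  exact: (continuous_comp_pair cm (fun=> cvg_cst _) (fun=> cvg_id)).
have d : is_derive t 1 (cst (q s x) + (fun y => \int[mu]_(z in `[x, y]) m s z)) (0 + m s t).
  by apply: is_deriveD; exact: is_derive_Rintegral_upper.
rewrite add0r in d; apply: (is_derive_eq_itv xtb _ d) => y yI.
by rewrite (E2 _ yI).
Qed.

Lemma is_derive_lipschitz (a b K : R) (f df : R -> R) : {within `[a, b], continuous f} ->
  (forall x : R, a < x < b -> is_derive x 1 f (df x)) -> (forall x, a < x < b -> `|df x| <= K) ->
  forall x y, a <= x -> x <= y -> y <= b -> `|f y - f x| <= K * (y - x).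
Proof.
move=> cf fd dfK x y ax; rewrite le_eqVlt => /predU1P[-> _|xy yb]; first by rewrite !subrr normr0 mulr0.
have sub z : x < z < y -> a < z < b by move=> /andP[h1 h2]; rewrite (le_lt_trans ax)//= (lt_le_trans h2).
have cf' : {within `[x, y], continuous f}.
  apply: continuous_subspaceW cf => z /=; rewrite !in_itv/= => /andP[h1 h2].
  by rewrite (le_trans ax)//= (le_trans h2).
have [|c cI ->] := @MVT R f df x y xy _ cf'.
  by move=> z; rewrite in_itv/= => /sub; exact: fd.
rewrite normrM (gtr0_norm (_ : 0 < y - x)) ?subr_gt0// ler_wpM2r ?subr_ge0 ?(ltW xy)//.
by apply: dfK; apply: sub; move: cI; rewrite in_itv.
Qed.

Lemma lipschitz_abs_continuous (a b K : R) (w : R -> R) : 0 <= K ->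
  (forall x y, a <= x -> x <= y -> y <= b -> `|w y - w x| <= K * (y - x)) -> abs_continuous a b w.
Proof.
move=> K0 wK e e0; have K1 : 0 < K + 1 by rewrite ltr_wpDl.
exists (e / (K + 1)); first exact: divr_gt0.
move=> n x y xy _; rewrite ltr_pdivlMr// mulrC => h; apply: le_lt_trans h.
rewrite mulr_sumr; apply: ler_sum => i _; have [h1 h2 h3] := xy i.
apply: (le_trans (wK _ _ h1 h2 h3)); rewrite ler_wpM2r ?subr_ge0// lerDl//.
Qed.

(** A derivative within D is an ordinary one when the line through p in the direction e stays in D
    near p; k is f along that line. *)
Lemma is_derive_of_in (V : normedModType R) (D : set V) (f : V -> R) (p e : V) (l x : R) (k : R -> R) :
  (forall y, k y = f (p + (y - x) *: e)) -> (\forall h \near (0 : R), D (p + h *: e)) ->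
  is_derive_in D f p e l -> is_derive x 1 k l.
Proof.
move=> kE nD fl; have h : h^-1 *: (k (h *: (1 : R^o) + x) - k x) @[h --> (0 : R)^'] --> l.
  have fl' : h^-1 * (f (p + h *: e) - f p) @[h --> (0 : R)^'] --> l.
    move=> A /fl hA; have nD' : (0 : R)^' (fun h => D (p + h *: e)) by exact: nbhs_dnbhs.
    by apply: filterS2 nD' hA => h' Ph; apply.
  apply: cvg_trans fl'; apply: near_eq_cvg; near=> h.
  rewrite !kE subrr scale0r addr0; congr (_ * (f (p + _ *: e) - _)).
  by rewrite /GRing.scale/= mulr1 addrK.
have hc : cvg (h^-1 *: (k (h *: (1 : R^o) + x) - k x) @[h --> (0 : R)^']) by apply/cvg_ex; exists l.
by apply: DeriveDef; [exact: hc|exact: (cvg_lim (@norm_hausdorff _ _) h)].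
Unshelve. all: by end_near. Qed.

End OneDim.

Section Regularity.
Context {R : realType}.

Lemma within_comp_continuous_at (T U W : topologicalType) (D : set U) (g : U -> W) (c : T -> U) (x : T) :
  {within D, continuous g} -> {for x, continuous c} -> (\forall y \near x, D (c y)) ->
  {for x, continuous (g \o c)}.
Proof.
move=> /subspace_continuousP cg cc Dc A hA; have Dx : D (c x) := nbhs_singleton Dc.
have hD : nbhs (c x) (fun y => D y -> A (g y)) := cg (c x) Dx A hA.
have hc : nbhs x (fun y => D (c y) -> A (g (c y))) := cc _ hD.
by apply: filterS2 Dc hc => y Dy; apply.
Qed.

Notation V := (R^o * R^o * R^o)%type.

Lemma is_derive_partial1 (D2 D3 : set R) (f : V -> R) (x y t l : R) : D2 y -> D3 t ->
  @is_derive_in R V (setT `*` D2 `*` D3) f (x, y, t) (1, 0, 0) l ->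
  is_derive x 1 (fun x' => f (x', y, t)) l.
Proof.
move=> Dy Dt; apply: is_derive_of_in => [x'|].
  by congr (f (_, _, _)); rewrite /= /GRing.scale/= ?mulr0 ?addr0// mulr1 addrC subrK.
near=> h; split; [split|] => //=; rewrite /GRing.scale/= mulr0 addr0//.
Unshelve. all: by end_near.
Qed.

Lemma is_derive_partial2 (D1 D2 D3 : set R) (f : V -> R) (x y t l : R) : D1 x -> open D2 -> D2 y -> D3 t ->
  @is_derive_in R V (D1 `*` D2 `*` D3) f (x, y, t) (0, 1, 0) l ->
  is_derive y 1 (fun y' => f (x, y', t)) l.
Proof.
move=> Dx oD Dy Dt; apply: is_derive_of_in => [y'|].
  by congr (f (_, _, _)); rewrite /= /GRing.scale/= ?mulr0 ?addr0// mulr1 addrC subrK.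
have cy : y + h @[h --> (0 : R)] --> y by rewrite -[X in _ --> X]addr0; apply: cvgD; [exact: cvg_cst|exact: cvg_id].
have Dn : \forall h \near (0 : R), D2 (y + h) by apply: cy; exact: open_nbhs_nbhs.
apply: filterS Dn => h Dh; split; [split|] => /=; rewrite /GRing.scale/= ?mulr0 ?addr0 ?mulr1//.
Qed.

Lemma is_derive_partial3 (D1 D2 D3 : set R) (f : V -> R) (x y t l : R) : D1 x -> D2 y -> nbhs t D3 ->
  @is_derive_in R V (D1 `*` D2 `*` D3) f (x, y, t) (0, 0, 1) l ->
  is_derive t 1 (fun t' => f (x, y, t')) l.
Proof.
move=> Dx Dy Dt; apply: is_derive_of_in => [t'|].
  by congr (f (_, _, _)); rewrite /= /GRing.scale/= ?mulr0 ?addr0// mulr1 addrC subrK.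
have ct : t + h @[h --> (0 : R)] --> t by rewrite -[X in _ --> X]addr0; apply: cvgD; [exact: cvg_cst|exact: cvg_id].
have Dn : \forall h \near (0 : R), D3 (t + h) by exact: ct.
apply: filterS Dn => h Dh; split; [split|] => /=; rewrite /GRing.scale/= ?mulr0 ?addr0 ?mulr1//.
Qed.

Lemma continuous_triple (T : topologicalType) (X Y Z : T -> R) (x : T) :
  {for x, continuous X} -> {for x, continuous Y} -> {for x, continuous Z} ->
  {for x, continuous (fun x => (X x, Y x, Z x) : V)}.
Proof. by move=> cX cY cZ; exact: (cvg_pair (cvg_pair cX cY) cZ). Qed.

Lemma nbhs_itv (a b t : R) : a < t < b -> nbhs t `[a, b]%classic.
Proof.
move=> /andP[at_ tb]; near=> x => /=; rewrite in_itv/=; apply/andP; split; apply/ltW; near: x.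
  exact: lt_nbhsr.
exact: lt_nbhsl.
Unshelve. all: by end_near. Qed.

(** Continuity is known only over [a, b] in the last variable, so it is packaged for compositions
    whose last component stays in [a, b]. The source space is arbitrary because both the line and
    the plane occur later. *)
Lemma lagrangian_partials (a b : R) (L : R -> R -> R -> R) : a < b -> class_C3var 1 setT setT `[a, b] L ->
  exists Lx Ly : R -> R -> R -> R,
  [/\ forall (x y t : R), a <= t <= b -> is_derive x 1 (fun x => L x y t) (Lx x y t),
      forall (x y t : R), a <= t <= b -> is_derive y 1 (fun y => L x y t) (Ly x y t) &
      forall (T : topologicalType) (X Y Z : T -> R), (forall x, a <= Z x <= b) ->
        continuous X -> continuous Y -> continuous Z ->
      [/\ continuous (fun x => L (X x) (Y x) (Z x)), continuous (fun x => Lx (X x) (Y x) (Z x)) &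
          continuous (fun x => Ly (X x) (Y x) (Z x))]].
Proof.
move=> ab [cL dL].
have [|gx [gxE [cgx _]]] := dL (1, 0, 0); first by rewrite !inE eqxx.
have [|gy [gyE [cgy _]]] := dL (0, 1, 0); first by rewrite !inE eqxx orbT.
exists (fun x y t => gx (x, y, t)), (fun x y t => gy (x, y, t)); split.
- by move=> x y t tab; apply: is_derive_partial1 (gxE _ _) => //; rewrite /= in_itv.
- move=> x y t tab; apply: is_derive_partial2 (gyE _ _) => //=; rewrite ?in_itv//; exact: openT.
- move=> T X Y Z Zab cX cY cZ.
  have cc : continuous (fun x => (X x, Y x, Z x) : V).
    by move=> x; apply: continuous_triple; [exact: cX|exact: cY|exact: cZ].
  have cD x : (setT `*` setT `*` `[a, b]) ((X x, Y x, Z x) : V) by split => //=; rewrite in_itv; exact: Zab.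
  split; [exact: (@within_comp_continuous _ _ _ _ _ _ cL cD cc)|exact: (@within_comp_continuous _ _ _ _ _ _ cgx cD cc)|].
  exact: (@within_comp_continuous _ _ _ _ _ _ cgy cD cc).
Qed.

Lemma C2_curve_derivative (a b : R) (S : set R) (u : R -> R) : a < b -> C2_curve a b S u ->
  exists u1 : R -> R, [/\ forall t : R, a < t < b -> is_derive t 1 u (u1 t),
    continuous (u \o clamp a b) & continuous (u1 \o clamp a b)].
Proof.
move=> ab [[cu du] _]; have [|u1 [u1E [cu1 _]]] := du 1; first by rewrite inE eqxx.
have cI x : `[a, b]%classic (clamp a b x) by rewrite /= in_itv; exact: clamp_itv.
exists u1; split.
- move=> t tab; apply: (is_derive_of_in _ _ (u1E t _)).
  + by move=> y; rewrite /GRing.scale/= mulr1 addrC subrK.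
  + have ct : t + h *: (1 : R^o) @[h --> (0 : R)] --> t.
      rewrite -[X in _ --> X]addr0; apply: cvgD; first exact: cvg_cst.
      by rewrite -[X in _ --> X](scale0r (1 : R^o)); apply: cvgZr_tmp; exact: cvg_id.
    by apply: ct; exact: nbhs_itv.
  + by rewrite /= in_itv/=; move: tab => /andP[/ltW -> /ltW ->].
- by apply: (within_comp_continuous cu cI); exact: clamp_continuous.
- by apply: (within_comp_continuous cu1 cI); exact: clamp_continuous.
Qed.

(** N is the orbit of u with the factor e^(sigma t) absorbed, Ns its derivative in s, dN its
    derivative in t, and M the derivative of dN in s; composition with [clamp] makes them continuous
    on the plane. Only the order x or t, then s, is extracted from the regularity of the flow; that
    M is also the time derivative of Ns is left to [is_derive_mixed]. *)
Lemma flow_partials (a b sigma : R) (S : set R) (xi : R -> R -> R -> R) (u : R -> R) : a < b -> open S ->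
  class_C3var 2 setT S `[a, b] xi -> C2_curve a b S u ->
  exists N Ns dN M : R -> R -> R,
  [/\ forall s t, N s t = expR (sigma * clamp a b t) * xi s (u (clamp a b t)) (clamp a b t),
      [/\ continuous (fun p : R * R => N p.1 p.2), continuous (fun p : R * R => Ns p.1 p.2),
      continuous (fun p : R * R => dN p.1 p.2) & continuous (fun p : R * R => M p.1 p.2)],
      forall s t : R, is_derive s 1 (N ^~ t) (Ns s t) /\ is_derive s 1 (dN ^~ t) (M s t),
      forall s t : R, a < t < b -> is_derive t 1 (N s) (dN s t) &
      forall s t, Ns s t = Ns s (clamp a b t)].
Proof.
move=> ab oS [cxi dxi] hu; have uS := hu.2; have [u1 [u1E cu cu1]] := C2_curve_derivative ab hu.
have [|g1 [g1E [cg1 _]]] := dxi (1, 0, 0); first by rewrite !inE eqxx.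
have [|g2 [g2E [cg2 dg2]]] := dxi (0, 1, 0); first by rewrite !inE eqxx orbT.
have [|g3 [g3E [cg3 dg3]]] := dxi (0, 0, 1); first by rewrite !inE eqxx !orbT.
have [|g21 [g21E [cg21 _]]] := dg2 (1, 0, 0); first by rewrite !inE eqxx.
have [|g31 [g31E [cg31 _]]] := dg3 (1, 0, 0); first by rewrite !inE eqxx.
set c := clamp a b; have cab t : a <= c t <= b by exact: clamp_itv.
have cI t : `[a, b]%classic (c t) by rewrite /= in_itv; exact: cab.
have cc : continuous c by exact: clamp_continuous.
pose P (s t : R) : V := (s, u (c t), c t).
have PD s t : (setT `*` S `*` `[a, b]) (P s t) by split; [split => //; exact: uS|exact: cI].
have c2 (w : R -> R) : continuous w -> continuous (fun p : R * R => w p.2).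
  by move=> cw p; apply: (@continuous_comp _ _ _ snd w); [exact: cvg_snd|exact: cw].
have cP : continuous (fun p : R * R => P p.1 p.2).
  by move=> p; apply: continuous_triple; [exact: cvg_fst|exact: (c2 _ cu)|exact: (c2 _ cc)].
have cF (g : V -> R) : {within setT `*` S `*` `[a, b], continuous g} -> continuous (fun p : R * R => g (P p.1 p.2)).
  by move=> cg; apply: (within_comp_continuous cg _ cP) => p; exact: PD.
have ce : continuous (fun p : R * R => expR (sigma * c p.2)).
  apply: (c2 (fun t => expR (sigma * c t))) => t; apply: (@continuous_comp _ _ _ (fun t => sigma * c t) expR); last exact: continuous_expR.
  by apply: cvgMr; exact: cc.
have cu1' : continuous (fun p : R * R => u1 (c p.2)) by exact: (c2 _ cu1).
exists (fun s t => expR (sigma * c t) * xi s (u (c t)) (c t)), (fun s t => expR (sigma * c t) * g1 (P s t)),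
  (fun s t => expR (sigma * c t) * (sigma * xi s (u (c t)) (c t) + g2 (P s t) * u1 (c t) + g3 (P s t))),
  (fun s t => expR (sigma * c t) * (sigma * g1 (P s t) + g21 (P s t) * u1 (c t) + g31 (P s t))).
have cS (g h k : V -> R) : {within setT `*` S `*` `[a, b], continuous g} ->
    {within setT `*` S `*` `[a, b], continuous h} -> {within setT `*` S `*` `[a, b], continuous k} ->
  continuous (fun p : R * R => expR (sigma * c p.2) * (sigma * g (P p.1 p.2) + h (P p.1 p.2) * u1 (c p.2) + k (P p.1 p.2))).
  move=> cg ch ck p; apply: cvgM; first exact: ce.
  apply: cvgD; last exact: cF.
  by apply: cvgD; [apply: cvgMr; exact: cF|apply: cvgM; [exact: cF|exact: cu1']].
have d1 (s t : R) : is_derive s 1 (fun s => xi s (u (c t)) (c t)) (g1 (P s t)).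
  by apply: (is_derive_partial1 _ _ (g1E (P s t) (PD s t))); [exact: uS|exact: cI].
split; first by [].
- split.
  + by move=> p; apply: cvgM; [exact: ce|exact: (cF _ cxi)].
  + by move=> p; apply: cvgM; [exact: ce|exact: (cF _ cg1)].
  + exact: (@cS _ _ _ cxi cg2 cg3).
  + exact: (@cS _ _ _ cg1 cg21 cg31).
- move=> s t; split; first exact: (is_deriveZ (expR (sigma * c t)) (d1 s t)).
  have d2 : is_derive s 1 (fun s => g2 (P s t)) (g21 (P s t)).
    by apply: (is_derive_partial1 _ _ (g21E (P s t) (PD s t))); [exact: uS|exact: cI].
  have d3 : is_derive s 1 (fun s => g3 (P s t)) (g31 (P s t)).
    by apply: (is_derive_partial1 _ _ (g31E (P s t) (PD s t))); [exact: uS|exact: cI].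
  have e1 := is_deriveD (is_deriveD (is_deriveZ sigma (d1 s t)) (is_deriveZ (u1 (c t)) d2)) d3.
  have := is_deriveZ (expR (sigma * c t)) e1.
  rewrite (_ : _ \*: _ = (fun s => expR (sigma * c t) * (sigma * xi s (u (c t)) (c t) + g2 (P s t) * u1 (c t) + g3 (P s t)))).
    by move=> h; apply: (is_derive_eq h); rewrite /GRing.scale/= [g21 _ * _]mulrC.
  by apply/funext => s'; rewrite /GRing.scale/= [g2 _ * _]mulrC.
- move=> s t tab.
  pose h y := expR (sigma * y) * xi s (u y) y.
  have tI : a <= t <= b by move: tab => /andP[/ltW -> /ltW ->].
  have ct : c t = t by exact: clamp_id.
  rewrite ct /P; rewrite -!/(P _ _).
  have Sut : S (u t) by exact: uS.
  have [e /= e0 Se] : \forall v \near u t, S v by exact: open_nbhs_nbhs.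
  have /andP[at_ tb] := tab.
  (* Values within d of u t lie in the open set S and times within d of t in ]a, b[, so that
     derivatives within the domain are ordinary ones. *)
  pose d := Num.min e (Num.min (t - a) (b - t)).
  have d0 : 0 < d by rewrite !lt_min e0 !subr_gt0 at_.
  have dS v : `|v - u t| < d -> S v by move=> h'; apply: Se => /=; rewrite distrC (lt_le_trans h')// ge_min lexx.
  have dI w : `|w - t| < d -> a < w < b.
    rewrite !lt_min => /andP[_ /andP[]]; rewrite !ltr_norml => /andP[h1 _] /andP[_ h2].
    by move: h1 h2; rewrite opprB !ltrD2r => ->.
  have dI' w : `|w - t| < d -> `[a, b]%classic w.
    by move=> /dI /andP[/ltW h1 /ltW h2]; rewrite /= in_itv/= h1.
  have D : is_derive t 1 (fun y => xi s (u y) y) (g2 (s, u t, t) * u1 t + g3 (s, u t, t) * 1).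
    apply: (@is_derive_chain _ (xi s) (fun v w => g2 (s, v, w)) (fun v w => g3 (s, v, w)) u id t (u1 t) 1 d d0).
    - move=> v w hv hw; apply: (is_derive_partial2 _ oS (dS v hv) (dI' w hw) (g2E (s, v, w) _)) => //.
      by split; [split => //; exact: dS|exact: dI'].
    - move=> w hw; apply: (is_derive_partial3 _ Sut _ (g3E (s, u t, w) _)) => //; first exact/nbhs_itv/dI.
      by split; [split|exact: dI'].
    - apply: (@within_comp_continuous_at _ _ _ _ g2 (fun p : R * R => (s, p.1, p.2) : V) _ cg2).
        by apply: continuous_triple; [exact: cvg_cst|exact: cvg_fst|exact: cvg_snd].
      have n1 : \forall p \near (u t, t), S p.1 by apply: (@cvg_fst _ _ (nbhs (u t)) (nbhs t)); exact: open_nbhs_nbhs.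
      have n2 : \forall p \near (u t, t), `[a, b]%classic p.2 by apply: (@cvg_snd _ _ (nbhs (u t)) (nbhs t)); exact: nbhs_itv.
      by apply: filterS2 n1 n2 => p h1 h2; split.
    - apply: (@within_comp_continuous_at _ _ _ _ g3 (fun w : R => (s, u t, w) : V) _ cg3).
        by apply: continuous_triple; [exact: cvg_cst|exact: cvg_cst|exact: cvg_id].
      by apply: filterS (nbhs_itv tab) => w hw; split.
    - exact: u1E.
  have de : is_derive t 1 (fun y => expR (sigma * y)) (sigma * expR (sigma * t)).
    have dl : is_derive t 1 (fun y : R => sigma * y) sigma.
      by apply: (is_derive_eq (is_deriveZ sigma (is_derive_id t 1))); rewrite /GRing.scale/= mulr1.
    by apply: (is_derive_eq (is_derive1_comp (is_derive_expR _) dl)); rewrite mulrC.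
  apply: (@is_derive_eq_itv _ a b t _ h) => //.
    by move=> y /andP[/ltW ya /ltW yb]; rewrite /h /c clamp_id// ya.
  by apply: (is_derive_eq (is_deriveM de D)); rewrite /P ct /GRing.scale/=; ring.
- by move=> s t; rewrite /P /c (clamp_id (clamp_itv ab t)).
Qed.

End Regularity.

(** * Euler-Lagrange equation and invariance *)

Section Noether.
Context {R : realType}.
Notation mu := (@lebesgue_measure R).
Variables (a b al sigma : R) (L Lx Ly : R -> R -> R -> R).
Hypotheses (ab : a < b) (al0 : 0 < al) (al1 : al < 1).
Notation c := (clamp a b).
Notation abel := (abel a al).
Notation Dt := (tempered_caputo a al sigma).

Let cab t : a <= c t <= b. Proof. exact: clamp_itv. Qed.
Let cc : continuous c. Proof. exact: clamp_continuous. Qed.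
Let cE t : a < t < b -> c t = t.
Proof. by move=> /andP[/ltW h1 /ltW h2]; rewrite clamp_id// h1. Qed.

Let ce (k : R) : continuous (fun t => expR (k * c t)).
Proof.
move=> t; apply: (@continuous_comp _ _ _ (fun t => k * c t) expR); last exact: continuous_expR.
by apply: cvgMr; exact: cc.
Qed.

(** The endpoints have measure zero, so [derive1] is evaluated only inside ]a, b[, where the
    two-sided derivative is available. *)
Lemma tempered_caputoE (v w : R -> R) (t : R) : continuous w ->
  (forall x : R, a < x < b -> is_derive x 1 (fun x => expR (sigma * x) * v x) (w x)) -> a <= t <= b ->
  Dt v t = expR (- (sigma * t)) / Gamma (1 - al) * abel w t.
Proof.
move=> cw vw /andP[at_ tb]; rewrite /tempered_caputo; congr (_ * _); rewrite /abel /Rintegral; congr fine.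
have mw : measurable_fun `]a, t[ (fun x => (t - x) `^ (- al) * w x).
  by apply: measurable_funM; [exact: measurable_powR_sub|apply: measurable_funTS; exact: continuous_measurable_fun].
have eq_in : {in `]a, t[%classic, (fun x => (t - x) `^ (- al) * w x) =1
    (fun x => (t - x) `^ (- al) * derive1 (fun x => expR (sigma * x) * v x) x)}.
  move=> x /set_mem/=; rewrite in_itv/= => /andP[ax xt]; congr (_ * _).
  have xI : a < x < b by rewrite ax (lt_le_trans xt).
  by rewrite derive1E (@derive_val _ _ _ _ _ _ _ (vw x xI)).
apply: eq_integral_itv_bounded => //.
- exact: eq_measurable_fun mw.
- by move=> x xI; rewrite -eq_in// inE.
Qed.

(* Junk value: if Gamma (1 - al) were 0, cK and the tempered operators would all be 0,
   so no case distinction is needed. *)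
Definition cK (t : R) : R := expR (- sigma * c t) / Gamma (1 - al).

Let ccK : continuous cK.
Proof. by move=> t; apply: cvgMl; exact: ce. Qed.

Hypothesis LxE : forall x y t : R, a <= t <= b -> is_derive x 1 (fun x => L x y t) (Lx x y t).
Hypothesis LyE : forall x y t : R, a <= t <= b -> is_derive y 1 (fun y => L x y t) (Ly x y t).
Hypothesis Lc : forall (T : topologicalType) (X Y Z : T -> R), (forall x, a <= Z x <= b) ->
  continuous X -> continuous Y -> continuous Z ->
  [/\ continuous (fun x => L (X x) (Y x) (Z x)), continuous (fun x => Lx (X x) (Y x) (Z x)) &
      continuous (fun x => Ly (X x) (Y x) (Z x))].

Let L_chain (X Y : R -> R) (h t X' Y' : R) : is_derive h 1 X X' -> is_derive h 1 Y Y' ->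
  is_derive h 1 (fun h => L (X h) (Y h) (c t)) (Lx (X h) (Y h) (c t) * X' + Ly (X h) (Y h) (c t) * Y').
Proof.
move=> dX dY; apply: (@is_derive_chain _ (fun v w => L v w (c t)) (fun v w => Lx v w (c t))
  (fun v w => Ly v w (c t)) X Y h X' Y' 1) => //.
- by move=> v w _ _; exact: LxE.
- by move=> w _; exact: LyE.
- have [//|_ h2 _] := @Lc (R * R)%type fst snd (fun=> c t) (fun=> cab t) (fun=> cvg_fst) (fun=> cvg_snd).
    by move=> ?; exact: cvg_cst.
  exact: h2.
- have [| |//|_ _ h2] := @Lc R (fun=> X h) id (fun=> c t) (fun=> cab t).
  + by move=> ?; exact: cvg_cst.
  + by move=> ?; exact: cvg_id.
  + by move=> ?; exact: cvg_cst.
  exact: h2.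
Qed.

Variables (S : set R) (xi : R -> R -> R -> R) (u : R -> R) (N Ns dN M : R -> R -> R).
Hypothesis uS : forall t, a <= t <= b -> S (u t).
Hypothesis NE : forall s t, N s t = expR (sigma * c t) * xi s (u (c t)) (c t).
Hypotheses (cN : continuous (fun p : R * R => N p.1 p.2)) (cNs : continuous (fun p : R * R => Ns p.1 p.2))
  (cdN : continuous (fun p : R * R => dN p.1 p.2)) (cM : continuous (fun p : R * R => M p.1 p.2)).
Hypothesis NsE : forall s t : R, is_derive s 1 (N ^~ t) (Ns s t).
Hypothesis ME : forall s t : R, is_derive s 1 (dN ^~ t) (M s t).
Hypothesis dNE : forall s t : R, a < t < b -> is_derive t 1 (N s) (dN s t).
Hypothesis Nsc : forall s t, Ns s t = Ns s (c t).
Hypothesis xi0 : forall x t, S x -> a <= t <= b -> xi 0 x t = x.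

Let slice (F : R -> R -> R) : continuous (fun p : R * R => F p.1 p.2) -> forall s, continuous (F s).
Proof. by move=> cF s; exact: (continuous_comp_pair cF (fun=> cvg_cst _) (fun=> cvg_id)). Qed.

Definition curve (s t : R) : R := expR (- sigma * c t) * N s t.
Definition velocity (s t : R) : R := cK t * abel (dN s) (c t).

Lemma curveE s t : curve s t = xi s (u (c t)) (c t).
Proof. by rewrite /curve NE mulrA -expRD mulNr addNr expR0 mul1r. Qed.

Lemma curve0 t : curve 0 t = u (c t).
Proof. by rewrite curveE xi0//; exact: uS. Qed.

Let ccurve s : continuous (curve s).
Proof. by move=> t; apply: cvgM; [exact: ce|exact: slice]. Qed.

Let cabel (w : R -> R) : continuous w -> continuous (fun t => abel w (c t)).
Proof. exact: abel_continuous. Qed.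

Let cvelocity s : continuous (velocity s).
Proof. by move=> t; apply: cvgM; [exact: ccK|apply: cabel; exact: slice]. Qed.

Let cKE t : a <= t <= b -> expR (- (sigma * t)) / Gamma (1 - al) = cK t.
Proof. by move=> tI; rewrite /cK clamp_id// mulNr. Qed.

Lemma lagr_flow s t : a <= t <= b ->
  lagr a al sigma L (fun t => xi s (u t) t) t = L (curve s t) (velocity s t) (c t).
Proof.
move=> tI; rewrite /lagr curveE /velocity clamp_id//; congr (L _ _ _).
rewrite -cKE//; apply: tempered_caputoE => //; first exact: slice.
move=> x xI; apply: (is_derive_eq_itv xI _ (dNE s xI)) => y yI.
by rewrite NE cE.
Qed.

Let caputo_pert (W W' : R -> R) h t : continuous W' ->
  (forall x : R, a < x < b -> is_derive x 1 W (W' x)) -> a <= t <= b ->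
  Dt (fun t => u t + h * (expR (- sigma * t) * W t)) t = velocity 0 t + h * (cK t * abel W' t).
Proof.
move=> cW' WE tI; have /andP[at_ tb] := tI.
have cd : continuous (fun x => dN 0 x + h * W' x).
  by move=> x; apply: cvgD; [exact: slice|apply: cvgMr; exact: cW'].
have cint (w : R -> R) : continuous w -> mu.-integrable `[a, t] (EFin \o (fun x => (t - x) `^ (- al) * w x)).
  move=> cw; have [K K0 wK] := continuous_itv_bounded ab cw.
  apply: (@integrable_abel_gen _ al al0 al1 _ K) => //.
    by apply: measurable_funTS; exact: continuous_measurable_fun.
  by move=> x /andP[ax xt]; rewrite wK// ax (le_trans xt).
transitivity (cK t * abel (fun x => dN 0 x + h * W' x) t).
  rewrite -cKE//; apply: tempered_caputoE => // x xI.
  have d : is_derive x 1 (N 0 + h \*: W) (dN 0 x + h *: W' x).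
    by apply: is_deriveD; [exact: dNE|apply: is_deriveZ; exact: WE].
  apply: (is_derive_eq_itv xI _ d) => y yI.
  have yI' : a <= y <= b by move: yI => /andP[/ltW -> /ltW ->].
  rewrite mulrDr mulrCA [expR _ * (_ * _)]mulrA -expRD mulNr addrN expR0 mul1r.
  by rewrite -[LHS]/(N 0 y + h * W y) NE cE// xi0//; exact: uS.
rewrite /velocity clamp_id// mulrCA -mulrDr; congr (_ * _).
rewrite /abel -RintegralZl//; last exact: cint.
have i1 := cint _ (slice cdN (s := 0)).
have i2 := integrable_scale h (measurable_itv _) (cint _ cW').
rewrite -RintegralD//.
by apply: eq_Rintegral => x _; rewrite mulrDr mulrCA.
Qed.

Definition Lxu t := Lx (curve 0 t) (velocity 0 t) (c t).
Definition Lyu t := Ly (curve 0 t) (velocity 0 t) (c t).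

Let cLu : continuous Lxu /\ continuous Lyu.
Proof. by have [_ h1 h2] := @Lc R (curve 0) (velocity 0) c cab (@ccurve 0) (@cvelocity 0) cc. Qed.

Lemma curve_unperturbed t : a <= t <= b -> curve 0 t = u t /\ Dt u t = velocity 0 t.
Proof.
move=> tI; rewrite curve0 clamp_id//; split => //.
have -> : u = fun t => u t + 0 * (expR (- sigma * t) * 0) by apply/funext => x; rewrite mul0r addr0.
have c0 : continuous ((fun=> 0) : R -> R) by exact: cst_continuous.
have d0 (x : R) : a < x < b -> is_derive x 1 (fun=> 0) (0 : R) by move=> _; exact: is_derive_cst.
have := @caputo_pert (fun=> 0) (fun=> 0) 0 t c0 d0 tI; rewrite [X in _ = _ + X]mul0r addr0; exact.
Qed.

Lemma lagr_dyE t : a <= t <= b -> lagr_dy a al sigma L u t = Lyu t.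
Proof.
move=> tI; have [e1 e2] := curve_unperturbed tI; rewrite /lagr_dy /Lyu e1 e2 clamp_id//.
by rewrite derive1E (@derive_val _ _ _ _ _ _ _ (LyE _ _ tI)).
Qed.

Lemma generatorE t : a <= t <= b -> generator xi u t = expR (- sigma * t) * Ns 0 t.
Proof.
move=> tI; rewrite /generator derive1E.
have d := is_deriveZ (expR (- sigma * t)) (NsE 0 t).
have e : (fun s => xi s (u t) t) = expR (- sigma * t) \*: N ^~ t.
  by apply/funext => s; rewrite -[RHS]/(expR (- sigma * t) * N s t) NE clamp_id// mulrA -expRD mulNr addNr expR0 mul1r.
by rewrite e (@derive_val _ _ _ _ _ _ _ d).
Qed.

(** [weak_extremal] speaks only of differentials that exist, so existence comes from differentiation
    under the integral. The variation e^(- sigma t) W has tempered derivative [cK] times the Abel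
    integral of W'; it is Lipschitz, hence absolutely continuous, and the perturbed Lagrangians are
    continuous on [a, b], so it is admissible. *)
Lemma euler_lagrange (W W' : R -> R) : weak_extremal a b al sigma L u ->
  continuous W -> continuous W' -> (forall x : R, a < x < b -> is_derive x 1 W (W' x)) ->
  \int[mu]_(t in `[a, b]) (Lxu t * (expR (- sigma * c t) * W t) + Lyu t * (cK t * abel W' (c t))) = 0.
Proof.
move=> hu cW cW' WE; pose v t := expR (- sigma * t) * W t.
pose v' t := expR (- sigma * c t) * W t; pose Q t := cK t * abel W' (c t).
have cv' : continuous v' by move=> t; apply: cvgM; [exact: ce|exact: cW].
have cQ : continuous Q by move=> t; apply: cvgM; [exact: ccK|exact: cabel].
pose X h t := curve 0 t + h * v' t; pose Y h t := velocity 0 t + h * Q t.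
pose F h t := L (X h t) (Y h t) (c t).
pose dF h t := Lx (X h t) (Y h t) (c t) * v' t + Ly (X h t) (Y h t) (c t) * Q t.
have c2 (w : R -> R) : continuous w -> continuous (fun p : R * R => w p.2).
  by move=> cw p; apply: (@continuous_comp _ _ _ snd w); [exact: cvg_snd|exact: cw].
have cXY (w w' : R -> R) : continuous w -> continuous w' -> continuous (fun p : R * R => w p.2 + p.1 * w' p.2).
  by move=> cw cw' p; apply: cvgD; [exact: (c2 _ cw)|apply: cvgM; [exact: cvg_fst|exact: (c2 _ cw')]].
have [cF cFx cFy] := @Lc (R * R)%type (fun p => X p.1 p.2) (fun p => Y p.1 p.2) (fun p => c p.2)
  (fun p => cab _) (cXY _ _ (@ccurve 0) cv') (cXY _ _ (@cvelocity 0) cQ) (c2 _ cc).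
have cdF : continuous (fun p : R * R => dF p.1 p.2).
  move=> p; apply: cvgD; apply: cvgM; [exact: cFx|exact: (c2 _ cv')|exact: cFy|exact: (c2 _ cQ)].
have lin (p q h : R) : is_derive h 1 (fun h => p + h * q) q.
  have d := is_deriveD (is_derive_cst p h 1) (is_deriveZ q (is_derive_id h (1 : R))).
  rewrite (_ : (fun h => p + h * q) = cst p + q \*: id).
    by apply: (is_derive_eq d); rewrite add0r /GRing.scale/= mulr1.
  by apply/funext => x; rewrite -[RHS]/(p + q * x) mulrC.
have FE (h t : R) : is_derive h 1 (F ^~ t) (dF h t) by apply: L_chain; exact: lin.
have lagrE h t : a <= t <= b -> lagr a al sigma L (fun t => u t + h * v t) t = F h t.
  move=> tI; rewrite /lagr (caputo_pert _ cW' WE)// /F /X /Y /v /v' /Q curve0 clamp_id//.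
have fin h : action_finite a b al sigma L (fun t => u t + h * v t).
  apply: (@eq_integrable _ _ _ mu _ (measurable_itv _) (EFin \o F h)) => [t /set_mem/=|].
    by rewrite in_itv/= => tI; rewrite lagrE.
  by apply: continuous_itv_integrable; exact: slice.
have actE h : action a b al sigma L (fun t => u t + h * v t) = \int[mu]_(t in `[a, b]) (1 * F h t).
  by apply: eq_Rintegral => t /set_mem/=; rewrite in_itv/= => tI; rewrite lagrE// mul1r.
have i1 : mu.-integrable `[a, b] (EFin \o (fun=> 1 : R)) by apply: continuous_itv_integrable => ?; exact: cvg_cst.
have d := @is_derive_Rintegral_weight _ a b 0 (fun=> 1) F dF (ltW ab) i1 (slice cF) cdF (fun s y _ => FE s y).
have adm : admissible_variation a b al sigma L u v.
  split; last by near=> h; exact: fin.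
  have cdv : continuous (fun t => - sigma * expR (- sigma * c t) * W t + expR (- sigma * c t) * W' t).
    move=> t; apply: cvgD; apply: cvgM; [apply: cvgMr; exact: ce|exact: cW|exact: ce|exact: cW'].
  have [K K0 vK] := continuous_itv_bounded ab cdv.
  apply: (lipschitz_abs_continuous K0).
  apply: (@is_derive_lipschitz _ a b K v (fun t => - sigma * expR (- sigma * c t) * W t + expR (- sigma * c t) * W' t)).
  - apply: continuous_subspaceT => t; apply: cvgM; last exact: cW.
    apply: (@continuous_comp _ _ _ (fun t => - sigma * t) expR); last exact: continuous_expR.
    by apply: cvgMr; exact: cvg_id.
  - move=> x xI; rewrite cE//.
    have dl : is_derive x 1 (fun y : R => - sigma * y) (- sigma).
      by apply: (is_derive_eq (is_deriveZ (- sigma) (is_derive_id x 1))); rewrite /GRing.scale/= mulr1.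
    have de := is_derive1_comp (is_derive_expR (- sigma * x)) dl.
    by apply: (is_derive_eq (is_deriveM de (WE x xI))); rewrite /GRing.scale/=; ring.
  - by move=> x /andP[/ltW h1 /ltW h2]; apply: vK; rewrite h1.
rewrite (_ : \int[mu]_(t in _) _ = \int[mu]_(t in `[a, b]) (1 * dF 0 t)); last first.
  by apply: eq_Rintegral => t _; rewrite mul1r /dF /X /Y !mul0r !addr0.
apply: (hu v _ adm); rewrite /is_gateaux.
have u0 : u = fun t => u t + 0 * v t by apply/funext => t; rewrite mul0r addr0.
have dd : h^-1 *: (\int[mu]_(y in `[a, b]) (1 * F (h *: (1 : R^o) + 0) y) - \int[mu]_(y in `[a, b]) (1 * F 0 y))
    @[h --> (0 : R)^'] --> \int[mu]_(y in `[a, b]) (1 * dF 0 y).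
  have [dv <-] := d; exact: dv.
apply: cvg_trans dd; apply: near_eq_cvg; near=> h.
have a0 := etrans (congr1 (action a b al sigma L) u0) (actE 0).
by rewrite actE a0 [RHS]mulrC addr0 /GRing.scale/= mulr1.
Unshelve. all: by end_near. Qed.

(** The Lagrangian along the transported curve has the same integral over [a, tb] for every s, hence
    does not depend on s at any interior time; the identity is its derivative at s = 0. *)
Lemma invariance_identity t : a < t < b -> C2_curve a b S u -> weak_extremal a b al sigma L u ->
  invariant_action a b al sigma L S xi ->
  Lxu t * (expR (- sigma * c t) * Ns 0 t) + Lyu t * (cK t * abel (M 0) (c t)) = 0.
Proof.
move=> tI hu wu inv; pose H s t := L (curve s t) (velocity s t) (c t).
have cH s : continuous (H s) by have [] := @Lc R (curve s) (velocity s) c cab (@ccurve s) (@cvelocity s) cc.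
have He s : H s t = H 0 t.
  apply: (eq_continuous_Rintegral (cH s) (cH 0) _ tI) => tb atb tbb.
  transitivity (\int[mu]_(y in `[a, tb]) lagr a al sigma L u y).
    rewrite (inv u hu wu s a tb (lexx a) atb tbb).
    apply: eq_Rintegral => y /set_mem/=; rewrite in_itv/= => /andP[ay yb].
    by rewrite lagr_flow// ay (le_trans yb).
  apply: eq_Rintegral => y /set_mem/=; rewrite in_itv/= => /andP[ay yb].
  have yI : a <= y <= b by rewrite ay (le_trans yb).
  by have [e1 e2] := curve_unperturbed yI; rewrite /lagr /H e1 e2 clamp_id.
have dX : is_derive (0 : R) 1 (curve ^~ t) (expR (- sigma * c t) * Ns 0 t).
  exact: (is_deriveZ (expR (- sigma * c t)) (NsE 0 t)).
have dA : is_derive (0 : R) 1 (fun s => abel (dN s) (c t)) (abel (M 0) (c t)).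
  have /andP[ac _] := cab t.
  exact: (@is_derive_Rintegral_weight _ a (c t) 0 _ dN M ac (integrable_abel_kernel al0 al1 a (c t))
    (slice cdN) cM (fun s y _ => ME s y)).
have dY : is_derive (0 : R) 1 (velocity ^~ t) (cK t * abel (M 0) (c t)) by exact: (is_deriveZ (cK t) dA).
have d1 := L_chain t dX dY.
have d2 : is_derive (0 : R) 1 (fun s => L (curve s t) (velocity s t) (c t)) 0.
  rewrite (_ : (fun s => _) = cst (H 0 t)); last by apply/funext => s; exact: He.
  exact: is_derive_cst.
by rewrite -[LHS](@derive_val _ _ _ _ _ _ _ d1) (@derive_val _ _ _ _ _ _ _ d2).
Qed.

(* The exponential factors are split so that all kernels become pure powers:
   e^(sigma t) times the generator is Ns 0 t, and momentum absorbs dL/dy. *)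
Definition momentum t := cK t * Lyu t.

Let cmomentum : continuous momentum.
Proof. by move=> y; apply: cvgM; [exact: ccK|exact: cLu.2]. Qed.

Lemma noether_leftE t : a < t < b ->
  noether_left a al sigma L xi u t = momentum t * \int[mu]_(x in `[a, t]) ((t - x) `^ (- al) * Ns 0 x).
Proof.
move=> tI; have /andP[at_ tb] := tI; have tI' : a <= t <= b by rewrite !ltW.
have cG : continuous (Ns 0) by exact: slice.
have [K K0 wK] := continuous_itv_bounded ab cG.
rewrite /noether_left /tempered_int_left lagr_dyE// /momentum /cK clamp_id//.
have -> : 1 - al - 1 = - al by ring.
have -> : \int[mu]_(x in `[a, t]) ((t - x) `^ (- al) * expR (- (sigma * (t - x))) * generator xi u x) =
    expR (- sigma * t) * \int[mu]_(x in `[a, t]) ((t - x) `^ (- al) * Ns 0 x).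
  rewrite -RintegralZl//; last first.
    apply: (@integrable_abel_gen _ al al0 al1 _ K) => //.
      by apply: measurable_funTS; exact: continuous_measurable_fun.
    by move=> x /andP[ax xt]; rewrite wK// ax (le_trans xt)// ltW.
  apply: eq_Rintegral => x /set_mem/=; rewrite in_itv/= => /andP[ax xt].
  rewrite generatorE ?ax ?(le_trans xt (ltW tb))//.
  have -> : expR (- sigma * t) = expR (- (sigma * (t - x))) * expR (- sigma * x).
    by rewrite -expRD; congr expR; ring.
  by ring.
by move: (Gamma _)^-1 (\int[mu]_(x in _) _) => g I; ring.
Qed.

Lemma noether_rightE t : a < t < b ->
  noether_right a b al sigma L xi u t = Ns 0 t * \int[mu]_(y in `[t, b]) ((y - t) `^ (- al) * momentum y).
Proof.
move=> tI; have /andP[at_ tb] := tI; have tI' : a <= t <= b by rewrite !ltW.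
rewrite /noether_right /tempered_int_right generatorE//.
have -> : 1 - al - 1 = - al by ring.
have iK (w : R -> R) : continuous w -> mu.-integrable `[t, b] (EFin \o (fun y => (y - t) `^ (- al) * w y)).
  move=> cw; have [K K0 wK] := continuous_itv_bounded ab cw.
  have ii : mu.-integrable `[t, b] (EFin \o (fun y => K * (y - t) `^ (- al))).
    by apply: integrable_scale => //; apply: integrable_powR_shift; rewrite al0.
  have mm : measurable_fun `[t, b] (fun y => (y - t) `^ (- al) * w y).
    apply: measurable_funM; last by apply: measurable_funTS; exact: continuous_measurable_fun.
    by apply: (measurableT_comp (measurable_powR _)); exact: measurable_funB.
  apply: (integrable_le _ mm ii) => // y; rewrite /= in_itv/= => /andP[ty yb].
  rewrite normrM (ger0_norm (powR_ge0 _ _)) mulrC ler_wpM2r ?powR_ge0//.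
  by rewrite wK// yb andbT (le_trans _ ty)// ltW.
have im := iK _ cmomentum.
have <- : expR (sigma * t) * \int[mu]_(y in `[t, b]) ((y - t) `^ (- al) * momentum y) = (Gamma (1 - al))^-1 *
    \int[mu]_(y in `[t, b]) ((y - t) `^ (- al) * expR (- (sigma * (y - t))) * lagr_dy a al sigma L u y).
  have il : mu.-integrable `[t, b] (EFin \o (fun y => (y - t) `^ (- al) * expR (- (sigma * (y - t))) * lagr_dy a al sigma L u y)).
    have ct : continuous (fun y => expR (- (sigma * (y - t))) * Lyu y).
      move=> y; apply: cvgM; last exact: cLu.2.
      apply: (@continuous_comp _ _ _ (fun y => - (sigma * (y - t))) expR); last exact: continuous_expR.
      by apply: cvgN; apply: cvgMr; apply: cvgB; [exact: cvg_id|exact: cvg_cst].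
    apply: (@eq_integrable _ _ _ mu _ (measurable_itv _) _ _ _ (iK _ ct)) => y /set_mem/=; rewrite in_itv/= => /andP[ty yb].
    by rewrite mulrA lagr_dyE// yb andbT (le_trans _ ty)// ltW.
  rewrite -RintegralZl// -RintegralZl//; apply: eq_Rintegral => y /set_mem/=; rewrite in_itv/= => /andP[ty yb].
  have yI : a <= y <= b by rewrite yb andbT (le_trans _ ty)// ltW.
  rewrite lagr_dyE// /momentum /cK clamp_id//.
  have -> : expR (- (sigma * (y - t))) = expR (sigma * t) * expR (- sigma * y).
    by rewrite -expRD; congr expR; ring.
  by move: (Gamma _)^-1 => g; ring.
by rewrite mulrACA -expRD mulNr addNr expR0 mul1r.
Qed.

(** The Euler-Lagrange identity for W = G chi, minus chi times the pointwise invariance identity,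
    eliminates L_x and leaves the commutator paired with the momentum. This is the input of the
    dichotomy. *)
Theorem noether_products_vanish t : a < t < b -> C2_curve a b S u -> weak_extremal a b al sigma L u ->
  invariant_action a b al sigma L S xi ->
  momentum t * \int[mu]_(x in `[a, t]) ((t - x) `^ (- al) * Ns 0 x) = 0 /\
  Ns 0 t * \int[mu]_(y in `[t, b]) ((y - t) `^ (- al) * momentum y) = 0.
Proof.
move=> tI hu wu inv; pose G := Ns 0; pose dG := M 0.
have cG : continuous G := slice cNs (s:=0); have cdG : continuous dG := slice cM (s:=0).
have cq : continuous momentum by move=> y; apply: cvgM; [exact: ccK|exact: cLu.2].
have dGE (x : R) : a < x < b -> is_derive x 1 G (dG x).
  by move=> xI; exact: (@is_derive_mixed _ a b 0 x N dN Ns M NsE dNE ME (@slice _ cN) (@slice _ cdN) cM xI).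
have [K1 K10 GK1] := continuous_itv_bounded ab cG; have [K2 K20 GK2] := continuous_itv_bounded ab cdG.
have [K3 K30 GK3] := continuous_itv_bounded ab cq; pose K := K1 + K2 + K3.
have GK x : a <= x <= b -> `|G x| <= K by move=> /GK1; rewrite /K => h; lra.
have dGK x : a <= x <= b -> `|dG x| <= K by move=> /GK2; rewrite /K => h; lra.
have qK x : a <= x <= b -> `|momentum x| <= K by move=> /GK3; rewrite /K => h; lra.
have lab : a <= a <= b by rewrite lexx ltW.
have comm0 chi dchi : continuous chi -> continuous dchi ->
    (forall x : R, a < x < b -> is_derive x 1 chi (dchi x)) ->
    \int[mu]_(y in `[a, b]) (momentum y * commutator a al G dG chi dchi y) = 0.
  move=> cchi cdchi chiE.
  have cW : continuous (fun x => G x * chi x) by move=> x; apply: cvgM; [exact: cG|exact: cchi].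
  have cW' : continuous (fun x => dG x * chi x + G x * dchi x).
    by move=> x; apply: cvgD; apply: cvgM; [exact: cdG|exact: cchi|exact: cG|exact: cdchi].
  rewrite -[RHS](euler_lagrange wu cW cW') => [|x xI]; last first.
    by apply: (is_derive_eq (is_deriveM (dGE x xI) (chiE x xI))); rewrite /GRing.scale/=; ring.
  congr fine; apply: eq_integral_itv_bounded.
  - apply: measurable_funM; first by apply: measurable_funTS; exact: continuous_measurable_fun.
    apply: (@eq_measurable_fun _ _ _ _ _ (fun y => abel (fun x => dG x * chi x + G x * dchi x) (c y)
        - chi y * abel dG (c y))).
      by move=> y /set_mem/=; rewrite in_itv/= => yI; rewrite /commutator cE.
    apply: measurable_funTS; apply: continuous_measurable_fun => y; apply: cvgB; first exact: cabel.
    by apply: cvgM; [exact: cchi|exact: cabel].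
  - apply: measurable_funTS; apply: continuous_measurable_fun => y; apply: cvgD; apply: cvgM.
    + exact: cLu.1.
    + by apply: cvgM; [exact: ce|exact: cW].
    + exact: cLu.2.
    + by apply: cvgM; [exact: ccK|exact: cabel].
  - move=> y yI; have yI' : a < y < b by move: yI; rewrite in_itv.
    have e := invariance_identity yI' hu wu inv.
    have e' : Lxu y * (expR (- sigma * c y) * G y) = - (Lyu y * (cK y * abel dG (c y))).
      by apply/eqP; rewrite -addr_eq0; apply/eqP.
    rewrite [_ * (G y * chi y)]mulrA [Lxu y * _]mulrA e' /commutator /momentum cE//.
    by ring.
(* The momentum is cut off outside [a, b], while G is already constant to the left of a through
   [clamp]. *)
pose f y := momentum y * \1_(`[a, b]%classic : set R) y.
have fE y : a <= y <= b -> f y = momentum y by move=> yI; rewrite /f indicE mem_set ?mulr1//= in_itv.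
have f0 y : ~~ (a <= y <= b) -> f y = 0.
  by move=> yI; rewrite /f indicE memNset ?mulr0//= in_itv/=; exact/negP.
have Ga x : x <= a -> G x = G a by move=> xa; rewrite /G Nsc clamp_left.
have Phi0 (x : R) : a < x < b -> Phi (1 + al) G f x = 0.
  move=> /andP[ax xb]; exact: (commutator_Phi ab al0 al1 cG cdG cq dGE Ga GK dGK qK comm0 ax xb).
have s1 : 1 < 1 + al by rewrite ltrDl.
have s2 : 1 + al < 2 by rewrite -[X in _ < X]/(1 + 1) ltrD2l.
have fK x : `|f x| <= K.
  have [xI|xI] := boolP (a <= x <= b); first by rewrite fE// qK.
  by rewrite f0// normr0 (le_trans _ (GK a lab)).
have mf : measurable_fun [set: R] f.
  by apply: measurable_funM; [exact: continuous_measurable_fun|exact: measurable_indic].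
have cf x : a < x < b -> {for x, continuous f}.
  move=> xI; have near_f : \forall y \near x, momentum y = f y.
    by apply: filterS (nbhs_itv xI) => y /=; rewrite in_itv/= => yI; rewrite fE.
  have xI' : a <= x <= b by move: xI => /andP[/ltW -> /ltW ->].
  by rewrite /prop_for /continuous_at fE//; apply: cvg_trans (cq x); exact: near_eq_cvg.
have GKT x : `|G x| <= K by rewrite /G Nsc; apply: GK; exact: cab.
have fb x : b < x -> f x = 0 by move=> bx; rewrite f0// negb_and -!ltNge bx orbT.
have cGI x : a < x < b -> {for x, continuous G} by move=> _; exact: cG.
have := abel_dichotomy s1 s2 ab (continuous_measurable_fun cG) GKT mf fK (fun x xa => Ga x (ltW xa)) fb cGI cf Phi0 tI.
rewrite (_ : 1 + al - 1 = al); last by ring.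
have tI' : a <= t <= b by move: tI => /andP[/ltW -> /ltW ->].
(* Whichever source vanishes at t, it does so together with its own Abel integral, so each of the
   two products contains a zero factor. *)
case.
- by rewrite -/G => -[-> ->]; rewrite mulr0 mul0r.
- rewrite fE// => -[-> e]; rewrite mul0r; split => //; rewrite (_ : \int[mu]_(y in `[t, b]) _ = 0) ?mulr0// -[RHS]e.
  apply: eq_Rintegral => y /set_mem/=; rewrite in_itv/= => /andP[ty yb].
  by rewrite fE// yb andbT (le_trans _ ty)//; case/andP: tI'.
Qed.

End Noether.

(** * Vanishing of both terms and the conservation law *)

Lemma noether_factors_vanish (R : realType) (a b alpha sigma : R)
  (L : R -> R -> R -> R) (S' : set R) (xi : R -> R -> R -> R) (u : R -> R) :
  a < b -> 0 < alpha -> alpha < 1 -> class_C3var 1 setT setT `[a, b] L -> open S' ->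
  one_param_group a b S' xi -> invariant_action a b alpha sigma L S' xi ->
  C2_curve a b S' u -> weak_extremal a b alpha sigma L u ->
  forall t, a < t < b -> noether_left a alpha sigma L xi u t = 0 /\ noether_right a b alpha sigma L xi u t = 0.
Proof.
move=> hab al0 al1 hL hS [xiC _ _ xi0 _] inv hu wu t tI.
have [Lx [Ly [LxE LyE Lc]]] := lagrangian_partials hab hL.
have [N [Ns [dN [M [NE [cN cNs cdN cM] dE dNE Nsc]]]]] := flow_partials sigma hab hS xiC hu.
have NsE (s y : R) : is_derive s 1 (fun s => N s y) (Ns s y) := (dE s y).1.
have ME (s y : R) : is_derive s 1 (fun s => dN s y) (M s y) := (dE s y).2.
have [v1 v2] := noether_products_vanish hab al0 al1 LxE LyE Lc hu.2 NE cN cNs cdN cM NsE ME dNE Nsc xi0 tI hu wu inv.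
split.
  exact: (etrans (noether_leftE hab al0 al1 LyE hu.2 NE cNs cdN NsE dNE xi0 tI) v1).
exact: (etrans (noether_rightE hab al0 al1 LyE Lc hu.2 NE cN cdN NsE dNE xi0 tI) v2).
Qed.

Unset Implicit Arguments.

Theorem theorem4p10 (R : realType) (a b alpha sigma : R)
  (L : R -> R -> R -> R) (S' X' : set R) (xi : R -> R -> R -> R)
  (hab : a < b) (halpha : 2^-1 < alpha < 1) (hsigma : 0 < sigma)
  (hL : class_C3var 1 setT setT `[a, b] L)
  (hS : open S')
  (hX : open X') (hXab : X' `<=` `[a, b])
  (hxi : one_param_group a b S' xi)
  (hinv : invariant_action a b alpha sigma L S' xi) :
  forall u : R -> R, C2_curve a b S' u -> weak_extremal a b alpha sigma L u ->
  [/\ cvg (noether_left a alpha sigma L xi u t @[t --> b^'-]),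
      cvg (noether_right a b alpha sigma L xi u t @[t --> a^'+])
    & forall t : R, X' t ->
        noether a b alpha sigma L xi u t =
          lim (noether_left a alpha sigma L xi u t @[t --> b^'-])
          - lim (noether_right a b alpha sigma L xi u t @[t --> a^'+])
        /\ is_derive t 1 (noether a b alpha sigma L xi u) 0].
Proof.
move=> u hu wu; have /andP[al12 al1] := halpha.
have al0 : 0 < alpha by rewrite (lt_trans _ al12)// invr_gt0.
have Z t (tI : a < t < b) := noether_factors_vanish hab al0 al1 hL hS hxi hinv hu wu tI.
have l1 : noether_left a alpha sigma L xi u t @[t --> b^'-] --> (0 : R).
  apply: (@cvg_trans _ ((cst 0 : R -> R) t @[t --> b^'-])); last exact: cvg_cst.
  apply: near_eq_cvg; near=> t; have tI : a < t < b by apply/andP; split => //; near: t; exact: nbhs_left_gt.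
  exact: esym (Z t tI).1.
have l2 : noether_right a b alpha sigma L xi u t @[t --> a^'+] --> (0 : R).
  apply: (@cvg_trans _ ((cst 0 : R -> R) t @[t --> a^'+])); last exact: cvg_cst.
  apply: near_eq_cvg; near=> t; have tI : a < t < b by apply/andP; split => //; near: t; exact: nbhs_right_lt.
  exact: esym (Z t tI).2.
split; [exact: cvgP l1|exact: cvgP l2|move=> t tX].
(* X' is open in the line and contained in [a, b], so it misses both endpoints. *)
have tI : a < t < b.
  have [e /= e0 eX] : nbhs t X' by exact: open_nbhs_nbhs.
  have h1 : X' (t - e / 2) by apply: eX => /=; rewrite opprB addrC subrK gtr0_norm ?divr_gt0// ltr_pdivrMr// ltr_pMr// ltrDl.
  have h2 : X' (t + e / 2).
    by apply: eX => /=; rewrite opprD addrA subrr add0r normrN gtr0_norm ?divr_gt0// ltr_pdivrMr// ltr_pMr// ltrDl.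
  have := hXab _ h1; have := hXab _ h2; rewrite /= !in_itv/= => /andP[_ hb] /andP[ha _].
  have e2 : 0 < e / 2 by rewrite divr_gt0.
  by rewrite (le_lt_trans ha) ?ltrBlDr ?ltrDl//= (lt_le_trans _ hb)// ltrDl.
have no0 x : a < x < b -> noether a b alpha sigma L xi u x = 0.
  by move=> /Z[z1 z2]; rewrite /noether z1 z2 addr0.
split.
  by rewrite no0// (cvg_lim (@norm_hausdorff _ _) l1) (cvg_lim (@norm_hausdorff _ _) l2) subr0.
(* The quantity agrees with the zero function on the whole of ]a, b[, hence near t, and not merely
   at t. *)
apply: (@is_derive_eq_itv _ a b t 0 (cst 0)) => // x xI; exact: esym (no0 x xI).
Unshelve. all: by end_near. Qed.
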